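(* Let $\Omega'\subseteq\mathbb{R}^{n'}$, $\Omega\subseteq\mathbb{R}^n$ be open, $m\in\mathbb{R}$, $\rho\in(0,1]$, $\delta\in[0,1)$, and let $\phi\in\widetilde{\Phi}_{\rm sc}(\Omega';\Omega\times\mathbb{R}^p)$ be a slow scale generalized phase function in the variables of $\Omega\times\mathbb{R}^p$. (i) If $a\in\widetilde{\mathcal{S}}^m_{\rho,\delta,\rm rg}(\Omega'\times\Omega\times\mathbb{R}^p)$ is a regular generalized symbol, then the corresponding generalized Fourier integral operator $$A:u\mapsto\int_{\Omega\times\mathbb{R}^p}e^{i\phi(x,y,\xi)}a(x,y,\xi)u(y)\,dy\,\frac{d\xi}{(2\pi)^p}$$ maps $\mathcal{G}^\infty_c(\Omega)$ continuously into $\mathcal{G}^\infty(\Omega')$. (ii) If $a\in\widetilde{\mathcal{S}}^{-\infty}_{\rm rg}(\Omega'\times\Omega\times\mathbb{R}^p)$, then $A$ maps $\mathcal{G}_c(\Omega)$ continuously into $\mathcal{G}^\infty(\Omega')$.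
   Context: **Nets.** All nets are indexed by $\varepsilon\in(0,1]$; $O(\cdot)$ is meant as $\varepsilon\to0$. A slow scale net is a net $(r_\varepsilon)_\varepsilon$ in $\mathbb{C}$ such that $\forall q\ge0\,\exists c_q>0\,\forall\varepsilon\in(0,1]:\ |r_\varepsilon|^q\le c_q\varepsilon^{-1}$. A net $(u_\varepsilon)_\varepsilon$ in $\mathbb{C}$ is strictly nonzero (resp. slow scale-strictly nonzero) if there are $r>0$ (resp. a slow scale net $(s_\varepsilon)_\varepsilon$) and $\eta\in(0,1]$ with $|u_\varepsilon|\ge\varepsilon^r$ (resp. $|u_\varepsilon|\ge1/s_\varepsilon$) for all $\varepsilon\in(0,\eta]$. For a locally convex space $E$ with seminorms $(p_i)_{i\in I}$: $\mathcal{M}_E$ is the set of nets in $E$ with $\forall i\,\exists N\in\mathbb{N}:\ p_i(u_\varepsilon)=O(\varepsilon^{-N})$; $\mathcal{M}^{\rm sc}_E$ the set of nets with $\forall i\,\exists$ slow scale net $(\omega_\varepsilon)$: $p_i(u_\varepsilon)=O(\omega_\varepsilon)$; $\mathcal{N}_E$ the set of nets with $\forall i\,\forall q\in\mathbb{N}:\ p_i(u_\varepsilon)=O(\varepsilon^q)$; $\mathcal{G}_E=\mathcal{M}_E/\mathcal{N}_E$. $\widetilde{\mathbb{C}}=\mathcal{G}_{\mathbb{C}}$. **Colombeau algebras and topologies.** $\mathcal{G}(\Omega)=\mathcal{G}_E$ for $E=C^\infty(\Omega)$ with seminorms $p_{K,i}(f)=\sup_{x\in K,|\alpha|\le i}|\partial^\alpha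 f(x)|$, $K\Subset\Omega$. $\mathcal{G}_c(\Omega)$: elements of compact support. $\mathcal{G}(\Omega')$ is regarded as a subset of $\mathcal{G}_{C^0(\Omega')}$ (the natural map is injective). $\mathcal{G}^\infty(\Omega)$: elements $u\in\mathcal{G}(\Omega)$ having a representative with $\forall K\Subset\Omega\,\exists N\in\mathbb{N}\,\forall\alpha\in\mathbb{N}^n:\ \sup_K|\partial^\alpha u_\varepsilon|=O(\varepsilon^{-N})$. $\mathcal{G}^\infty_c(\Omega)=\mathcal{G}^\infty(\Omega)\cap\mathcal{G}_c(\Omega)$. $\mathcal{G}^\infty(\Omega')$ carries the topology of the ultra-pseudo-seminorms $\mathcal{P}_{\mathcal{G}^\infty(K)}(u)=e^{-\mathrm{v}(u)}$, $\mathrm{v}(u)=\sup\{b\in\mathbb{R}:\forall\alpha\ \sup_K|\partial^\alpha u_\varepsilon|=O(\varepsilon^b)\}$, $K\Subset\Omega'$. For $K\Subset\Omega$ let $K'\Subset\Omega$ be any compact set containing $K$ in its interior, and compute the following on representatives supported in $K'$: $\mathcal{G}_K(\Omega)=\{u\in\mathcal{G}_c(\Omega):\operatorname{supp}u\subseteq K\}$ has the ultra-pseudo-seminorms $e^{-\mathrm{v}_{n}(u)}$, $\mathrm{v}_n(u)=\sup\{b:p_{K',n}(u_\varepsilon)=O(\varepsilon^b)\}$, $n\in\mathbb{N}$; $\mathcal{G}^\infty_K(\Omega)=\{u\in\mathcal{G}^\infty(\Omega):\operatorname{supp}u\subseteq K\}$ has the ultra-pseudo-norm $e^{-\mathrm{v}^\infty_K(u)}$,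 $\mathrm{v}^\infty_K(u)=\sup\{b:\forall n\ p_{K',n}(u_\varepsilon)=O(\varepsilon^b)\}$. $\mathcal{G}_c(\Omega)$ and $\mathcal{G}^\infty_c(\Omega)$ carry the strict inductive limit topologies (as locally convex topological $\widetilde{\mathbb{C}}$-modules) of the $\mathcal{G}_{K_n}(\Omega)$, resp. $\mathcal{G}^\infty_{K_n}(\Omega)$, for an exhausting sequence of compacts $K_n$; a $\widetilde{\mathbb{C}}$-linear map out of them into a locally convex topological $\widetilde{\mathbb{C}}$-module is continuous iff its restriction to each $\mathcal{G}_K(\Omega)$, resp. $\mathcal{G}_K^\infty(\Omega)$, is continuous. **Symbols.** For an open set $X$ (here $X=\Omega'\times\Omega$, $z=(x,y)$), $S^m_{\rho,\delta}(X\times\mathbb{R}^p)$ is Hörmander's symbol space with seminorms $|a|^{(m)}_{\rho,\delta,K,j}=\sup_{z\in K,\xi\in\mathbb{R}^p,|\alpha+\beta|\le j}\langle\xi\rangle^{-m+\rho|\alpha|-\delta|\beta|}|\partial_\xi^\alpha\partial_z^\beta a(z,\xi)|$; $\widetilde{\mathcal{S}}^m_{\rho,\delta}=\mathcal{G}_{S^m_{\rho,\delta}}$. $\widetilde{\mathcal{S}}^m_{\rho,\delta,\rm rg}(X\times\mathbb{R}^p)$: those $a\in\widetilde{\mathcal{S}}^m_{\rho,\delta}(X\times\mathbb{R}^p)$ such that for every $K\Subset X$ there are a representative $(a_\varepsilon)$ and $N\in\mathbb{N}$ with $|a_\varepsilon|^{(m)}_{\rho,\delta,K,j}=O(\varepsilon^{-N})$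 for all $j$. $\widetilde{\mathcal{S}}^{-\infty}(X\times\mathbb{R}^p)=\mathcal{G}_{S^{-\infty}(X\times\mathbb{R}^p)}$, where $S^{-\infty}=\bigcap_mS^m_{1,0}$ with seminorms $|\cdot|^{(m)}_{1,0,K,j}$ for all $m\in\mathbb{R}$, $K$, $j$; $\widetilde{\mathcal{S}}^{-\infty}_{\rm rg}$: those $a\in\widetilde{\mathcal{S}}^{-\infty}$ such that for every $K\Subset X$ there are a representative and $N\in\mathbb{N}$ with $|a_\varepsilon|^{(m)}_{1,0,K,j}=O(\varepsilon^{-N})$ for all $m\in\mathbb{R}$, $j\in\mathbb{N}$. $S^1_{\rm hg}(X\times\mathbb{R}^p\setminus0)$: smooth functions on $X\times(\mathbb{R}^p\setminus0)$ positively homogeneous of degree $1$ in $\xi$, with seminorms $\sup_{z\in K,\xi\ne0}|\xi|^{-1+|\alpha|}|\partial^\alpha_\xi\partial^\beta_z a(z,\xi)|$. **Generalized phase functions.** A phase function on $\Omega\times\mathbb{R}^p$ is a real-valued function, smooth on $\Omega\times(\mathbb{R}^p\setminus0)$, positively homogeneous of degree $1$ in $\xi$, with $\nabla_{y,\xi}\phi(y,\xi)\ne0$ for all $y\in\Omega$, $\xi\ne0$. $\mathcal{M}_\Phi(\Omega';\Omega\times\mathbb{R}^p)$ is the set of nets $(\phi_\varepsilon)_\varepsilon$ of continuous functions on $\Omega'\times\Omega\times\mathbb{R}^p$, smooth on $\Omega'\times\Omega\times(\mathbb{R}^p\setminus0)$, such that $\phi_\varepsilon(x,\cdot,\cdot)$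 is a phase function for all $x,\varepsilon$, and: (i) $(\phi_\varepsilon)\in\mathcal{M}_{S^1_{\rm hg}(\Omega'\times\Omega\times\mathbb{R}^p\setminus0)}$; (ii) for all $K'\Subset\Omega'$, $K\Subset\Omega$ the net $\big(\inf_{x\in K',y\in K,\xi\neq0}|\nabla_{y,\xi}\phi_\varepsilon(x,y,\xi/|\xi|)|^2\big)_\varepsilon$ is strictly nonzero. $\widetilde\Phi(\Omega';\Omega\times\mathbb{R}^p)$ is the quotient by $(\phi_\varepsilon)\sim(\omega_\varepsilon)\iff(\phi_\varepsilon-\omega_\varepsilon)\in\mathcal{N}_{S^1_{\rm hg}(\Omega'\times\Omega\times\mathbb{R}^p\setminus0)}$. $\widetilde\Phi_{\rm sc}(\Omega';\Omega\times\mathbb{R}^p)$ consists of those $\phi\in\widetilde\Phi(\Omega';\Omega\times\mathbb{R}^p)$ with a representative in $\mathcal{M}^{\rm sc}_{S^1_{\rm hg}(\Omega'\times\Omega\times\mathbb{R}^p\setminus0)}$ for which the nets in (ii) are all slow scale-strictly nonzero. **Oscillatory integral.** Fix $\chi\in C_c^\infty(\mathbb{R}^p)$ with $\chi=1$ for $|\xi|<1/4$, $\chi=0$ for $|\xi|>1/2$; set $\varphi_{\phi_\varepsilon}(x,y,\xi)=|\nabla_{y,\xi}\phi_\varepsilon(x,y,\xi/|\xi|)|^{-2}$, $a_{j,\varepsilon}=i(1-\chi)\varphi_{\phi_\varepsilon}\partial_{\xi_j}\phi_\varepsilon$, $b_{k,\varepsilon}=i(1-\chi)|\xi|^{-2}\varphi_{\phi_\varepsilon}\partial_{y_k}\phi_\varepsilon$,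 $c_\varepsilon=\chi+\sum_j\partial_{\xi_j}a_{j,\varepsilon}+\sum_k\partial_{y_k}b_{k,\varepsilon}$, $L_{\phi_\varepsilon}=\sum_{j=1}^p a_{j,\varepsilon}\partial_{\xi_j}+\sum_{k=1}^nb_{k,\varepsilon}\partial_{y_k}+c_\varepsilon$ (so ${}^tL_{\phi_\varepsilon}e^{i\phi_\varepsilon}=e^{i\phi_\varepsilon}$). With $s=\min\{\rho,1-\delta\}$ and any $h\in\mathbb{N}$ with $m-hs+1<-p$, $Au\in\mathcal{G}_{C^0(\Omega')}$ is the class of $$\Big(\int_{\Omega\times\mathbb{R}^p}e^{i\phi_\varepsilon(x,y,\xi)}L^h_{\phi_\varepsilon}\big(a_\varepsilon(x,y,\xi)u_\varepsilon(y)\big)\,dy\,\frac{d\xi}{(2\pi)^p}\Big)_\varepsilon,$$ with all $u_\varepsilon$ supported in a common compact set; it is independent of the choices and belongs to $\mathcal{G}(\Omega')$. An $a\in\widetilde{\mathcal{S}}^{-\infty}$ is viewed as a symbol of any order $m$; in that case the integral converges absolutely and one may take $h=0$. *)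

(* Defs.v *)
From HB Require Import structures.
From mathcomp Require Import all_boot all_order all_algebra.
From mathcomp Require Import complex.
From mathcomp Require Import all_classical all_reals all_analysis.

Set Implicit Arguments.
Unset Strict Implicit.
Unset Printing Implicit Defensive.

Import Order.TTheory GRing.Theory Num.Theory.
Import numFieldNormedType.Exports.

Local Open Scope classical_set_scope.
Local Open Scope complex_scope.
Local Open Scope ring_scope.

(* The library has no Lebesgue measure on R^n: it is built on
   [n.-tuple (measurableTypeR R)] by iterated products. *)
Section lebesgue_cons.
Context (R : realType) (n : nat).
Variable mu : {sigma_finite_measure set (n.-tuple (measurableTypeR R)) -> \bar R}.
Local Notation T := (measurableTypeR R).

Definition tcons (w : T * n.-tuple T) : n.+1.-tuple T := [tuple of w.1 :: w.2].

Let measurable_tcons : measurable_fun [set: T * n.-tuple T] tcons.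
Proof. exact: measurable_cons. Qed.

Definition lebesgue_cons : set (n.+1.-tuple T) -> \bar R :=
  pushforward (@lebesgue_measure R \x mu)%E tcons.

Let lebesgue_cons0 : lebesgue_cons set0 = 0%E.
Proof. by rewrite /lebesgue_cons /pushforward preimage_set0 measure0. Qed.

Let lebesgue_cons_ge0 A : (0 <= lebesgue_cons A)%E.
Proof. exact: measure_ge0. Qed.

Let lebesgue_cons_sigma_additive : semi_sigma_additive lebesgue_cons.
Proof.
move=> F mF tF mUF; rewrite /lebesgue_cons /pushforward preimage_bigcup.
apply: measure_semi_sigma_additive.
- by move=> k; rewrite -[X in measurable X]setTI; exact: measurable_tcons.
- apply/trivIsetP => /= i j _ _ ij; rewrite -preimage_setI.
  by move/trivIsetP : tF => /(_ _ _ _ _ ij) ->//; rewrite preimage_set0.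
- by rewrite -preimage_bigcup -[X in measurable X]setTI; exact: measurable_tcons.
Qed.

HB.instance Definition _ := isMeasure.Build _ _ _ lebesgue_cons
  lebesgue_cons0 lebesgue_cons_ge0 lebesgue_cons_sigma_additive.

Let lebesgue_cons_sigma_finite : sigma_finite setT lebesgue_cons.
Proof.
have /sigma_finiteP[F [TF ndF Foo]] := sigma_finiteT (@lebesgue_measure R).
have /sigma_finiteP[G [TG ndG Goo]] := sigma_finiteT mu.
pose split (t : n.+1.-tuple T) : T * n.-tuple T :=
  (tnth t ord0, [tuple of behead t]).
have msplit : measurable_fun [set: n.+1.-tuple T] split.
  apply/measurable_fun_pairP; split;
    [exact: measurable_tnth | exact: measurable_behead].
have splitK w : split (tcons w) = w.
  by case: w => a t; congr pair; exact: val_inj.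
exists (fun k => split @^-1` (F k `*` G k)).
  rewrite -preimage_bigcup; apply/esym/seteqP; split => // t _.
  have : [set: T] (split t).1 by []; have : [set: n.-tuple T] (split t).2 by [].
  rewrite TF TG => -[j _ Gj] [i _ Fi]; exists (maxn i j) => //; split.
  - by apply: subsetPset (ndF _ _ (leq_maxl i j)) _ Fi.
  - by apply: subsetPset (ndG _ _ (leq_maxr i j)) _ Gj.
move=> k; have [mF Fk] := Foo k; have [mG Gk] := Goo k; split.
  by rewrite -[X in measurable X]setTI; apply: msplit => //; exact: measurableX.
rewrite /lebesgue_cons /pushforward.
have -> : tcons @^-1` (split @^-1` (F k `*` G k)) = F k `*` G k.
  by apply/seteqP; split => w; rewrite /preimage /mkset splitK.
by rewrite product_measure1E// lte_mul_pinfty// ge0_fin_numE.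
Qed.

HB.instance Definition _ := Measure_isSigmaFinite.Build _ _ _ lebesgue_cons
  lebesgue_cons_sigma_finite.
End lebesgue_cons.

Fixpoint lebesgue_tuple (R : realType) (n : nat) :
    {sigma_finite_measure set (n.-tuple (measurableTypeR R)) -> \bar R} :=
  match n return {sigma_finite_measure set (n.-tuple (measurableTypeR R)) -> \bar R} with
  | 0%N => dirac [tuple]
  | k.+1 => lebesgue_cons (lebesgue_tuple R k)
  end.

(* Functions on an open subset of R^d are total functions on ['rV[R]_d] whose
   values off that subset are ignored: nets differing only there have a
   negligible difference.  [R[i]] is not a normed module over [R] in the library,
   so derivatives and continuity are taken on real and imaginary parts. *)

Section calculus.
Context {R : realType}.
Local Notation normc := (@Normc.normc R).

(* The norm of ['rV[R]_d] in the library is the maximum norm. *)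
Definition enorm d (v : 'rV[R]_d) : R := Num.sqrt (\sum_i v 0 i ^+ 2).

Definition japanese d (v : 'rV[R]_d) : R := Num.sqrt (1 + enorm v ^+ 2).

Definition row_of_tuple d (t : d.-tuple (measurableTypeR R)) : 'rV[R]_d :=
  \row_i (tnth t i : R).

Definition rpderiv d (i : 'I_d) (f : 'rV[R]_d -> R) : 'rV[R]_d -> R :=
  fun x => 'D_(delta_mx 0 i) f x.

Definition pderiv d (i : 'I_d) (f : 'rV[R]_d -> R[i]) : 'rV[R]_d -> R[i] :=
  fun x => rpderiv i (fun y => complex.Re (f y)) x
        +i* rpderiv i (fun y => complex.Im (f y)) x.

Definition pderivs d (s : seq 'I_d) (f : 'rV[R]_d -> R[i]) : 'rV[R]_d -> R[i] :=
  foldr (@pderiv d) f s.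

Definition mlen d (al : 'I_d -> nat) : nat := (\sum_i al i)%N.

Definition mderiv d (al : 'I_d -> nat) (f : 'rV[R]_d -> R[i]) :=
  pderivs (flatten [seq nseq (al i) i | i <- enum 'I_d]) f.

Definition mpair d p (be : 'I_d -> nat) (al : 'I_p -> nat) : 'I_(d + p) -> nat :=
  fun i => match fintype.split i with inl k => be k | inr k => al k end.

Definition continuous_on d (A : set 'rV[R]_d) (f : 'rV[R]_d -> R[i]) : Prop :=
  forall x, A x -> {for x, continuous (fun y => complex.Re (f y))} /\
                   {for x, continuous (fun y => complex.Im (f y))}.

Definition smooth_on d (A : set 'rV[R]_d) (f : 'rV[R]_d -> R[i]) : Prop :=
  forall s : seq 'I_d, continuous_on A (pderivs s f) /\
    forall (i : 'I_d) x, A x ->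
      derivable (fun y => complex.Re (pderivs s f y)) x (delta_mx 0 i) /\
      derivable (fun y => complex.Im (pderivs s f y)) x (delta_mx 0 i).

Definition compact_in d (K A : set 'rV[R]_d) : Prop := compact K /\ K `<=` A.

End calculus.

Section nets.
Context {R : realType}.
Local Notation normc := (@Normc.normc R).

Definition bigO_eps (f : R -> \bar R) (g : R -> R) : Prop :=
  exists C : R, \forall e \near 0^'+, (f e <= (C * g e)%:E)%E.

Definition slow_scale (r : R -> R[i]) : Prop :=
  forall q : R, 0 <= q -> exists c : R, 0 < c /\
    forall e : R, 0 < e <= 1 -> normc (r e) `^ q <= c * e^-1.

(* The next two are used for nets of infima, which are [+oo] over an empty
   set; the slow scale net is taken positive so that its inverse is a genuine
   one. *)
Definition strictly_nonzero (u : R -> \bar R) : Prop :=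
  exists r : R, 0 < r /\ exists eta : R, 0 < eta <= 1 /\
    forall e : R, 0 < e <= eta -> ((e `^ r)%:E <= u e)%E.

Definition sc_strictly_nonzero (u : R -> \bar R) : Prop :=
  exists s : R -> R, (forall e, 0 < s e) /\ slow_scale (fun e => (s e)%:C) /\
    exists eta : R, 0 < eta <= 1 /\
    forall e : R, 0 < e <= eta -> (((s e)^-1)%:E <= u e)%E.

(* A locally convex space given as a subspace [lc_set] of an ambient module
   with its set of seminorms; the seminorms may be infinite off [lc_set]. *)
Record lcspace := LCSpace {
  lc_ambient : lmodType R[i];
  lc_set : set lc_ambient;
  lc_semi : set (lc_ambient -> \bar R) }.

Definition exp_neg (v : \bar R) : \bar R := expeR (- v)%E.

Section colombeau_space.
Variable E : lcspace.
Local Notation net := (R -> lc_ambient E).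

Definition net_in (u : net) : Prop :=
  forall e : R, 0 < e <= 1 -> lc_set (u e).

Definition moderate_net (u : net) : Prop := net_in u /\
  forall q, lc_semi q ->
    exists N : nat, bigO_eps (fun e => q (u e)) (fun e => e ^- N).

Definition sc_moderate_net (u : net) : Prop := net_in u /\
  forall q, lc_semi q -> exists w : R -> R[i], slow_scale w /\
    bigO_eps (fun e => q (u e)) (fun e => normc (w e)).

Definition negligible_net (u : net) : Prop := net_in u /\
  forall q, lc_semi q ->
    forall k : nat, bigO_eps (fun e => q (u e)) (fun e => e ^+ k).

Definition gclass (u : net) : set net :=
  [set v | moderate_net v /\ negligible_net (v - u)].

(* Elements of G_E are equivalence classes, i.e. sets of nets. *)
Definition GE : set (set net) := [set U | exists2 u, moderate_net u & U = gclass u].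

Definition gzero : set net := gclass 0.

Definition gadd (U V : set net) : set net :=
  [set w | moderate_net w /\ exists u v, [/\ U u, V v & negligible_net (w - (u + v))]].

Definition gsub (U V : set net) : set net :=
  [set w | moderate_net w /\ exists u v, [/\ U u, V v & negligible_net (w - (u - v))]].

Definition gscale (L : set (R -> R[i])) (U : set net) : set net :=
  [set w | moderate_net w /\ exists l u,
    [/\ L l, U u & negligible_net (w - (fun e => l e *: u e))]].

(* [exp_neg (valuation U P)] is e^(-v), v being the supremum of the b for which
   some representative satisfies [P b]. *)
Definition valuation (U : set net) (P : R -> net -> Prop) : \bar R :=
  ereal_sup [set b%:E | b in [set b | exists2 u, U u & P b u]].

(* The natural map G_F -> G_E, U being an element of G_F for some F with the same
   ambient module and continuously included in E. *)
Definition gmap (U : set net) : set net :=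
  [set v | moderate_net v /\ exists2 u, U u & negligible_net (v - u)].

End colombeau_space.
Arguments GE : clear implicits.
Arguments gzero : clear implicits.
Arguments gmap : clear implicits.

Definition Cspace : lcspace :=
  @LCSpace R[i] setT [set fun z : R[i] => (normc z)%:E].

Definition Ctilde : set (set (R -> R[i])) := GE Cspace.

Definition Ctilde_abs (L : set (R -> R[i])) : \bar R :=
  exp_neg (@valuation Cspace L
    (fun b l => bigO_eps (fun e => (normc (l e))%:E) (fun e => e `^ b))).

Section topology.
Variable E : lcspace.
Local Notation cls := (set (R -> lc_ambient E)).

(* Neighbourhoods of U in the subset D of G_E for the topology defined by the
   family P. *)
Definition ups_nbhs (D : set cls) (P : set (cls -> \bar R)) (U : cls) :
    set_system cls :=
  [set W | exists F : set (cls -> \bar R), [/\ finite_set F, F `<=` P &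
     exists2 eta : R, 0 < eta & forall V, D V ->
       (forall Q, F Q -> (Q (gsub V U) < eta%:E)%E) -> W V]].

Definition ultra_pseudo_seminorm (D : set cls) (Q : cls -> \bar R) : Prop :=
  [/\ forall U, D U -> (0 <= Q U < +oo)%E,
      Q (gzero E) = 0%E,
      forall L U, Ctilde L -> D U -> (Q (gscale L U) <= Ctilde_abs L * Q U)%E &
      forall U V, D U -> D V -> (Q (gadd U V) <= maxe (Q U) (Q V))%E].

(* The inductive limit topology on D of subspaces [DK k] with topologies given
   by [PK k] is the finest locally convex module topology for which the
   inclusions are continuous; it is given by all the ultra-pseudo-seminorms on D
   which are continuous on each [DK k]. *)
Definition inductive_limit (D : set cls) (I : Type) (J : set I)
    (DK : I -> set cls) (PK : I -> set (cls -> \bar R)) : set (cls -> \bar R) :=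
  [set Q | ultra_pseudo_seminorm D Q /\
     forall k, J k -> forall U, DK k U ->
       Q @ ups_nbhs (DK k) (PK k) U --> Q U].

End topology.

Definition continuous_map (E F : lcspace)
    (D : set (set (R -> lc_ambient E))) (P : set (set (R -> lc_ambient E) -> \bar R))
    (D' : set (set (R -> lc_ambient F))) (P' : set (set (R -> lc_ambient F) -> \bar R))
    (B : set (R -> lc_ambient E) -> set (R -> lc_ambient F)) : Prop :=
  forall U, D U -> B @ ups_nbhs D P U `=>` ups_nbhs D' P' (B U).

End nets.
Arguments lcspace : clear implicits.
Arguments GE {R} E _.
Arguments gzero {R} E _.
Arguments gmap {R} E U _.

Section colombeau_algebras.
Context {R : realType} {d : nat}.
Local Notation normc := (@Normc.normc R).
Implicit Types (Om K : set 'rV[R]_d) (f : 'rV[R]_d -> R[i]).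
Local Notation net := (R -> 'rV[R]_d -> R[i]).

Definition sup_norm K f : \bar R :=
  ereal_sup [set (normc (f x))%:E | x in K].

Definition Ck_norm K (i : nat) f : \bar R :=
  ereal_sup [set r | exists x (al : 'I_d -> nat),
    [/\ K x, (mlen al <= i)%N & r = (normc (mderiv al f x))%:E]].

Definition Cinf Om : lcspace R :=
  @LCSpace R ('rV[R]_d -> R[i]) (smooth_on Om)
    [set q | exists K i, compact_in K Om /\ q = Ck_norm K i].

Definition C0 Om : lcspace R :=
  @LCSpace R ('rV[R]_d -> R[i]) (continuous_on Om)
    [set q | exists K, compact_in K Om /\ q = sup_norm K].

Definition G Om : set (set net) := GE (Cinf Om).

Definition G_to_C0 Om (U : set net) : set net :=
  gmap (C0 Om) U.

Definition gsupp Om (U : set net) : set 'rV[R]_d :=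
  [set x | Om x /\ ~ exists V, [/\ open V, V `<=` Om, V x &
     exists2 u, U u & @negligible_net R (Cinf V) u]].

Definition Gc Om : set (set net) := [set U | G Om U /\ compact (gsupp Om U)].

Definition Ginf Om : set (set net) :=
  [set U | G Om U /\ exists2 u, U u & forall K, compact_in K Om ->
     exists N : nat, forall al : 'I_d -> nat,
       bigO_eps (fun e => sup_norm K (mderiv al (u e))) (fun e => e ^- N)].

Definition Gcinf Om : set (set net) := Ginf Om `&` Gc Om.

Definition Ginf_seminorm Om K (U : set net) : \bar R :=
  exp_neg (@valuation R (Cinf Om) U (fun b u => forall al : 'I_d -> nat,
    bigO_eps (fun e => sup_norm K (mderiv al (u e))) (fun e => e `^ b))).

Definition Ginf_top Om : set (set net -> \bar R) :=
  [set Q | exists2 K, compact_in K Om & Q = Ginf_seminorm Om K].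

Definition supported Om K (u : net) : Prop :=
  forall e x, 0 < e <= 1 -> Om x -> ~ K x -> u e x = 0.

Definition GK Om K : set (set net) := [set U | Gc Om U /\ gsupp Om U `<=` K].

Definition GKinf Om K : set (set net) :=
  [set U | Ginf Om U /\ gsupp Om U `<=` K].

(* The larger compact set K' is arbitrary, the valuation does not depend on
   it. *)
Definition GK_seminorm Om K (n : nat) (U : set net) : \bar R :=
  exp_neg (@valuation R (Cinf Om) U (fun b u => exists K',
    [/\ compact_in K' Om, K `<=` K'°, supported Om K' u &
     bigO_eps (fun e => Ck_norm K' n (u e)) (fun e => e `^ b)])).

Definition GKinf_norm Om K (U : set net) : \bar R :=
  exp_neg (@valuation R (Cinf Om) U (fun b u => exists K',
    [/\ compact_in K' Om, K `<=` K'°, supported Om K' u & forall n,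
     bigO_eps (fun e => Ck_norm K' n (u e)) (fun e => e `^ b)])).

(* All compact subsets are used; an exhausting sequence is cofinal in them. *)
Definition Gc_top Om : set (set net -> \bar R) :=
  @inductive_limit R (Cinf Om) (Gc Om) _ [set K | compact_in K Om]
    (GK Om) (fun K => range (GK_seminorm Om K)).

Definition Gcinf_top Om : set (set net -> \bar R) :=
  @inductive_limit R (Cinf Om) (Gcinf Om) _ [set K | compact_in K Om]
    (GKinf Om) (fun K => [set GKinf_norm Om K]).

End colombeau_algebras.

(* A function of (z, xi) is a function on ['rV[R]_(d + p)], evaluated at
   [row_mx z xi]. *)

Section symbols.
Context {R : realType} {d p : nat}.
Local Notation normc := (@Normc.normc R).
Implicit Types (X K : set 'rV[R]_d) (a : 'rV[R]_(d + p) -> R[i]).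
Local Notation net := (R -> 'rV[R]_(d + p) -> R[i]).

Definition symb_norm (m rho delta : R) K (j : nat) a : \bar R :=
  ereal_sup [set r | exists z xi (be : 'I_d -> nat) (al : 'I_p -> nat),
    [/\ K z, (mlen al + mlen be <= j)%N &
     r = (japanese xi `^ (- m + rho * (mlen al)%:R - delta * (mlen be)%:R)
          * normc (mderiv (mpair be al) a (row_mx z xi)))%:E]].

Definition symbol_set X (m rho delta : R) : set ('rV[R]_(d + p) -> R[i]) :=
  [set a | smooth_on [set w | X (lsubmx w)] a /\
     forall K j, compact_in K X -> (symb_norm m rho delta K j a < +oo)%E].

Definition symbol_space X (m rho delta : R) : lcspace R :=
  @LCSpace R ('rV[R]_(d + p) -> R[i]) (symbol_set X m rho delta)
    [set q | exists K j, compact_in K X /\ q = symb_norm m rho delta K j].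

Definition smoothing_space X : lcspace R :=
  @LCSpace R ('rV[R]_(d + p) -> R[i]) [set a | forall m, symbol_set X m 1 0 a]
    [set q | exists m K j, compact_in K X /\ q = symb_norm m 1 0 K j].

Definition regular_symbol X (m rho delta : R) : set (set net) :=
  [set A | GE (symbol_space X m rho delta) A /\
     forall K, compact_in K X -> exists2 a, A a & exists N : nat, forall j,
       bigO_eps (fun e => symb_norm m rho delta K j (a e)) (fun e => e ^- N)].

Definition regular_smoothing X : set (set net) :=
  [set A | GE (smoothing_space X) A /\
     forall K, compact_in K X -> exists2 a, A a & exists N : nat,
       forall (m : R) j,
       bigO_eps (fun e => symb_norm m 1 0 K j (a e)) (fun e => e ^- N)].

Definition smoothing_to_symbol X (m rho delta : R) (A : set net) : set net :=
  gmap (symbol_space X m rho delta) A.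

Definition hg_norm K (al : 'I_p -> nat) (be : 'I_d -> nat) a : \bar R :=
  ereal_sup [set r | exists z xi, [/\ K z, xi != 0 &
    r = (enorm xi `^ (-1 + (mlen al)%:R)
         * normc (mderiv (mpair be al) a (row_mx z xi)))%:E]].

Definition S1hg X : lcspace R :=
  @LCSpace R ('rV[R]_(d + p) -> R[i])
    [set a | smooth_on [set w | X (lsubmx w) /\ rsubmx w != 0] a /\
       forall z xi (t : R), X z -> xi != 0 -> 0 < t ->
         a (row_mx z (t *: xi)) = t%:C * a (row_mx z xi)]
    [set q | exists K al be, compact_in K X /\ q = hg_norm K al be].

End symbols.

(* The variables (x, y, xi) are the blocks of [row_mx (row_mx x y) xi]. *)

Section fio.
Context {R : realType} {n' n p : nat}.
Local Notation vec := 'rV[R]_(n' + n + p).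
Implicit Types (f : vec -> R).

Definition prod_set (Om' : set 'rV[R]_n') (Om : set 'rV[R]_n) : set 'rV[R]_(n' + n) :=
  [set z | Om' (lsubmx z) /\ Om (rsubmx z)].

Definition pt (x : 'rV[R]_n') (y : 'rV[R]_n) (xi : 'rV[R]_p) : vec :=
  row_mx (row_mx x y) xi.

Definition ypart (w : vec) : 'rV[R]_n := rsubmx (lsubmx w).
Definition xipart (w : vec) : 'rV[R]_p := rsubmx w.

Definition iy (k : 'I_n) : 'I_(n' + n + p) := lshift p (rshift n' k).
Definition ixi (j : 'I_p) : 'I_(n' + n + p) := rshift (n' + n) j.

Definition phase_function (Om : set 'rV[R]_n) (g : 'rV[R]_(n + p) -> R) : Prop :=
  [/\ smooth_on [set v | Om (lsubmx v) /\ rsubmx v != 0] (fun v => (g v)%:C),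
      forall y xi (t : R), Om y -> 0 < t ->
        g (row_mx y (t *: xi)) = t * g (row_mx y xi) &
      forall y xi, Om y -> xi != 0 ->
        exists i, rpderiv i g (row_mx y xi) != 0].

Definition gradsq f (w : vec) : R :=
  \sum_k (rpderiv (iy k) f w) ^+ 2 + \sum_j (rpderiv (ixi j) f w) ^+ 2.

Definition normalize_xi (w : vec) : vec :=
  row_mx (lsubmx w) ((enorm (xipart w))^-1 *: xipart w).

Definition inf_gradsq (K' : set 'rV[R]_n') (K : set 'rV[R]_n) f : \bar R :=
  ereal_inf [set r | exists x y xi, [/\ K' x, K y, xi != 0 &
    r = (gradsq f (normalize_xi (pt x y xi)))%:E]].

Definition complex_net (ph : R -> vec -> R) : R -> vec -> R[i] :=
  fun e w => (ph e w)%:C.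

Definition M_Phi Om' Om (ph : R -> vec -> R) : Prop :=
  [/\ forall e, 0 < e <= 1 ->
        [/\ forall w, prod_set Om' Om (lsubmx w) -> {for w, continuous (ph e)},
            smooth_on [set w | prod_set Om' Om (lsubmx w) /\ xipart w != 0]
              (complex_net ph e) &
            forall x, Om' x -> phase_function Om
              (fun v => ph e (pt x (lsubmx v) (rsubmx v)))],
      moderate_net (E := S1hg (prod_set Om' Om)) (complex_net ph) &
      forall K' K, compact_in K' Om' -> compact_in K Om ->
        strictly_nonzero (fun e => inf_gradsq K' K (ph e))].

Definition Phi_class Om' Om (ph : R -> vec -> R) : set (R -> vec -> R) :=
  [set om | M_Phi Om' Om om /\
     negligible_net (E := S1hg (prod_set Om' Om)) (complex_net (ph - om))].

Definition Phi_tilde Om' Om : set (set (R -> vec -> R)) :=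
  [set phi | exists2 ph, M_Phi Om' Om ph & phi = Phi_class Om' Om ph].

Definition Phi_sc Om' Om : set (set (R -> vec -> R)) :=
  [set phi | Phi_tilde Om' Om phi /\ exists2 ph, phi ph &
     sc_moderate_net (E := S1hg (prod_set Om' Om)) (complex_net ph) /\
     forall K' K, compact_in K' Om' -> compact_in K Om ->
       sc_strictly_nonzero (fun e => inf_gradsq K' K (ph e))].

Definition cutoff (chi : 'rV[R]_p -> R[i]) : Prop :=
  [/\ smooth_on setT chi,
      forall xi, enorm xi < 4^-1 -> chi xi = 1 &
      forall xi, 2^-1 < enorm xi -> chi xi = 0].

Section operator_L.
Variables (chi : 'rV[R]_p -> R[i]) (f : vec -> R).

Definition varphi (w : vec) : R := (gradsq f (normalize_xi w))^-1.

Definition acoef (j : 'I_p) (w : vec) : R[i] :=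
  (0 +i* 1) * (1 - chi (xipart w)) * (varphi w * rpderiv (ixi j) f w)%:C.

Definition bcoef (k : 'I_n) (w : vec) : R[i] :=
  (0 +i* 1) * (1 - chi (xipart w)) *
  (enorm (xipart w) ^- 2 * varphi w * rpderiv (iy k) f w)%:C.

Definition ccoef (w : vec) : R[i] :=
  chi (xipart w) + \sum_j pderiv (ixi j) (acoef j) w
                 + \sum_k pderiv (iy k) (bcoef k) w.

Definition Lop (F : vec -> R[i]) : vec -> R[i] := fun w =>
  \sum_j acoef j w * pderiv (ixi j) F w + \sum_k bcoef k w * pderiv (iy k) F w
  + ccoef w * F w.

End operator_L.

Definition cis (t : R) : R[i] := cos t +i* sin t.

Definition oscillatory_net Om (chi : 'rV[R]_p -> R[i]) (h : nat)
    (ph : R -> vec -> R) (a : R -> vec -> R[i]) (u : R -> 'rV[R]_n -> R[i]) :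
    R -> 'rV[R]_n' -> R[i] := fun e x =>
  let integrand (t : n.-tuple (measurableTypeR R) * p.-tuple (measurableTypeR R)) :=
    let w := pt x (row_of_tuple t.1) (row_of_tuple t.2) in
    cis (ph e w)
    * iter h (Lop chi (ph e)) (fun w => a e w * u e (ypart w)) w in
  let mu := (lebesgue_tuple R n \x lebesgue_tuple R p)%E in
  let D := [set t | Om (row_of_tuple t.1)] in
  ((2 * pi) ^- p)%:C *
  (Rintegral mu D (fun t => complex.Re (integrand t))
   +i* Rintegral mu D (fun t => complex.Im (integrand t))).

(* The class of the oscillatory integral: all moderate nets equivalent to it for
   some choice of representatives and of h.  Since the choices do not matter,
   this is an element of G_(C^0(Om')), i.e. a single equivalence class. *)
Definition FIO Om' Om (chi : 'rV[R]_p -> R[i]) (m rho delta : R)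
    (phi : set (R -> vec -> R)) (A : set (R -> vec -> R[i]))
    (U : set (R -> 'rV[R]_n -> R[i])) : set (R -> 'rV[R]_n' -> R[i]) :=
  [set v | moderate_net (E := C0 Om') v /\ exists ph a u (h : nat),
    [/\ phi ph, A a, U u /\ (exists2 K, compact_in K Om & supported Om K u),
        m - h%:R * Num.min rho (1 - delta) + 1 < - p%:R &
        negligible_net (E := C0 Om') (v - oscillatory_net Om chi h ph a u)]].

(* T, with values in G_(C^0(Om')), maps D continuously into G^oo(Om'), seen as a
   subset of G_(C^0(Om')). *)
Definition maps_continuously_into_Ginf Om' Om
    (D : set (set (R -> 'rV[R]_n -> R[i])))
    (P : set (set (R -> 'rV[R]_n -> R[i]) -> \bar R))
    (T : set (R -> 'rV[R]_n -> R[i]) -> set (R -> 'rV[R]_n' -> R[i])) : Prop :=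
  exists B : set (R -> 'rV[R]_n -> R[i]) -> set (R -> 'rV[R]_n' -> R[i]),
    (forall U, D U -> Ginf Om' (B U) /\ T U = G_to_C0 Om' (B U)) /\
    @continuous_map R (Cinf Om) (Cinf Om') D P (Ginf Om') (Ginf_top Om') B.

End fio.

(* Main.v *)
(** Since tL e^(i phi) = e^(i phi), the integrals of e^(i phi) L F and e^(i phi) F
    agree as soon as F has order < -p, so A u may be computed with any large power
    h of L.  For a slow scale phase the coefficients of L and all derivatives of phi
    are O(e^(-eta)) for every eta > 0, so L lowers the order of a symbol by
    min(rho, 1 - delta) without losing any power of e; an x-derivative of e^(i phi)
    raises the order by 1, likewise at no cost in e.  Raising h together with the
    number s of x-derivatives, d_x^s (A u) is on a compact set O(e^(b - N - eta)) for
    every s and every eta > 0, where -N is the exponent of the regular symbol a on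
    the relevant compact set and b one valid for all derivatives of u.  This single
    N gives both regularity and continuity.  If a is smoothing then h = 0 already
    works, no derivative falls on u, and b need only bound sup |u|.

    A representative of u supported in a fixed compact set is obtained by a cutoff;
    other representatives of phi, a, u and other powers h change A u by a negligible
    net only, because e^(i phi) - e^(i phi') is bounded by 2 |phi - phi'| and
    differences of symbols are negligible in every symbol seminorm. *)

(* A phase is smooth only for xi <> 0, and this shapes the estimates. For |xi| >= 1/4 homogeneous
   functions are symbols of type (1, 0). For |xi| < 1/4 the factor 1 - chi kills the coefficients of
   L, so L is the identity there and no derivative of the phase in y or xi is met. The x-derivatives
   of e^(i phi) do reach xi = 0, but those of phi keep degree 1 and stay bounded, and phi itself
   vanishes on xi = 0. Slow scale nets are encoded by estimates O(e^b') for all b' < b: a slow scale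
   factor then has exponent 0, and exponents add under products. Bounds and independence of
   representatives are proved together, by carrying pairs of nets with negligible difference through
   each construction. A fixed e is the case of a constant net, so the same calculus justifies the
   integrations by parts. For continuity, each seminorm of the target is pulled back to the source
   and shown to be one of those that define the inductive limit topology. It is there that the loss
   N has to be uniform over all u supported in one compact set. *)
Require Import Defs.
From HB Require Import structures.
From mathcomp Require Import all_boot all_order all_algebra.
From mathcomp Require Import complex.
From mathcomp Require Import all_classical all_reals all_analysis.
From mathcomp Require Import measurable_realfun ring lra.
Set Implicit Arguments.
Unset Strict Implicit.
Unset Printing Implicit Defensive.
Import Order.TTheory GRing.Theory Num.Theory.
Import numFieldNormedType.Exports.
Local Open Scope classical_set_scope.
Local Open Scope complex_scope.
Local Open Scope ring_scope.

(** * Complex-valued functions and directional derivatives *)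

Section normc.
Context {R : realType}.
Implicit Types (a b : R) (z w : R[i]).
Local Notation normc := (@Normc.normc R).

Lemma normc_ge0 z : 0 <= normc z.
Proof. by case: z => a b /=; exact: sqrtr_ge0. Qed.

Lemma normc_real a : normc a%:C = `|a|.
Proof. by rewrite /= expr0n /= addr0 sqrtr_sqr. Qed.

Lemma normc_i : normc (0 +i* 1) = 1.
Proof. by rewrite /= expr0n /= expr1n add0r sqrtr1. Qed.

Lemma normc_cis a : normc (cis a) = 1.
Proof. by rewrite /= cos2Dsin2 sqrtr1. Qed.

Lemma normc_Re z : `|complex.Re z| <= normc z.
Proof. by case: z => a b /=; rewrite -sqrtr_sqr ler_wsqrtr// lerDl sqr_ge0. Qed.

Lemma normc_Im z : `|complex.Im z| <= normc z.
Proof. by case: z => a b /=; rewrite -sqrtr_sqr ler_wsqrtr// lerDr sqr_ge0. Qed.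

Lemma normc_le_ReIm z : normc z <= `|complex.Re z| + `|complex.Im z|.
Proof.
rewrite [z in normc z]complexE (le_trans (le_normcD _ _))// lerD//.
  by rewrite normc_real.
by rewrite Normc.normcM normc_real normc_i mul1r.
Qed.

Lemma cReD z w : complex.Re (z + w) = complex.Re z + complex.Re w.
Proof. by case: z w => [? ?] []. Qed.
Lemma cImD z w : complex.Im (z + w) = complex.Im z + complex.Im w.
Proof. by case: z w => [? ?] []. Qed.
Lemma cReM z w : complex.Re (z * w) =
  complex.Re z * complex.Re w - complex.Im z * complex.Im w.
Proof. by case: z w => [? ?] []. Qed.
Lemma cImM z w : complex.Im (z * w) =
  complex.Re z * complex.Im w + complex.Im z * complex.Re w.
Proof. by case: z w => [? ?] []. Qed.
Lemma cReN z : complex.Re (- z) = - complex.Re z. Proof. by case: z. Qed.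
Lemma cImN z : complex.Im (- z) = - complex.Im z. Proof. by case: z. Qed.

Lemma complexP z w :
  complex.Re z = complex.Re w -> complex.Im z = complex.Im w -> z = w.
Proof. by case: z w => [? ?] [? ?] /= -> ->. Qed.
End normc.

Section complex_derivative.
Context {R : realType} {V : normedModType R}.
Implicit Types (f g : V -> R[i]) (x v : V) (l m : R[i]).

(** Existence and value of the derivative in one predicate, so that each rule of calculus yields
    differentiability and the formula at once. *)
Definition cder f x v l : Prop :=
  is_derive x v (fun y => complex.Re (f y)) (complex.Re l) /\
  is_derive x v (fun y => complex.Im (f y)) (complex.Im l).

(** Difference quotients only see the line through [x], so agreement there suffices. This matters
    for domains such as the slice xi = 0, which contain no neighbourhood of [x]. *)
Lemma is_derive_line (h k : V -> R) x v (l : R) :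
  (\forall t \near 0, h (t *: v + x) = k (t *: v + x)) ->
  is_derive x v h l -> is_derive x v k l.
Proof.
move=> hk [+ <-] => dh.
have hk0 : h x = k x by have /nbhs_singleton := hk; rewrite scale0r add0r.
have E : \forall t \near 0^',
    t^-1 *: (h (t *: v + x) - h x) = t^-1 *: (k (t *: v + x) - k x).
  apply: cvg_within.
  by apply: filterS hk => t ->; rewrite hk0.
have dk : derivable k x v.
  move/cvg_ex : dh => [/= b hb]; apply/cvg_ex; exists b => /=.
  exact/(cvg_trans _ hb)/near_eq_cvg.
apply: DeriveDef => //.
rewrite /derive; congr (lim _); rewrite eqEsubset; split; apply/near_eq_cvg => //.
by apply: filterS E => t ->.
Qed.

Lemma cder_line f g x v l :
  (\forall t \near 0, f (t *: v + x) = g (t *: v + x)) ->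
  cder f x v l -> cder g x v l.
Proof.
move=> fg [fR fI]; split; [apply: is_derive_line fR|apply: is_derive_line fI].
  by apply: filterS fg => t ->.
by apply: filterS fg => t ->.
Qed.

Lemma near_line x v (P : set V) : nbhs x P -> \forall t \near (0 : R), P (t *: v + x).
Proof.
move=> Px.
have : (fun t : R => t *: v + x) t @[t --> (0 : R)] --> x.
  rewrite -[X in _ --> X]add0r -[X in X + _](scale0r v).
  by apply: cvgD; [exact: cvgZr_tmp|exact: cvg_cst].
exact.
Qed.

Lemma cder_near f g x v l :
  (\near x, f x = g x) -> cder f x v l -> cder g x v l.
Proof.
move=> fg; apply: cder_line.
exact: (@near_line x v (fun y => f y = g y)).
Qed.

Lemma cder_cst l0 x v : cder (fun=> l0) x v 0.
Proof. by split; exact: is_derive_cst. Qed.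

Lemma cderD f g x v l m :
  cder f x v l -> cder g x v m -> cder (fun y => f y + g y) x v (l + m).
Proof.
move=> [fR fI] [gR gI]; split.
  under eq_fun do rewrite cReD.
  by rewrite cReD; exact: is_deriveD.
under eq_fun do rewrite cImD.
by rewrite cImD; exact: is_deriveD.
Qed.

Lemma cderN f x v l : cder f x v l -> cder (fun y => - f y) x v (- l).
Proof.
move=> [fR fI]; split.
  by under eq_fun do rewrite cReN; rewrite cReN; exact: is_deriveN.
by under eq_fun do rewrite cImN; rewrite cImN; exact: is_deriveN.
Qed.

Lemma cderB f g x v l m :
  cder f x v l -> cder g x v m -> cder (fun y => f y - g y) x v (l - m).
Proof. by move=> hf hg; apply: cderD => //; exact: cderN. Qed.

Lemma cderM f g x v l m : cder f x v l -> cder g x v m ->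
  cder (fun y => f y * g y) x v (l * g x + f x * m).
Proof.
move=> [fR fI] [gR gI]; split.
  under eq_fun do rewrite cReM.
  apply: (is_derive_eq (is_deriveB (is_deriveM fR gR) (is_deriveM fI gI))).
  by rewrite cReD !cReM /GRing.scale /=; ring.
under eq_fun do rewrite cImM.
apply: (is_derive_eq (is_deriveD (is_deriveM fR gI) (is_deriveM fI gR))).
by rewrite cImD !cImM /GRing.scale /=; ring.
Qed.

Lemma cder_real (h : V -> R) x v (l : R) :
  is_derive x v h l -> cder (fun y => (h y)%:C) x v l%:C.
Proof. by split => //=; exact: is_derive_cst. Qed.

Lemma cder_realV (h : V -> R) x v (l : R) : h x != 0 -> is_derive x v h l ->
  cder (fun y => (h y)^-1%:C) x v (- l * (h x)^-1 * (h x)^-1)%:C.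
Proof.
move=> hx [dh <-]; apply: cder_real; apply: DeriveDef; first exact: derivableV.
by rewrite deriveV// /GRing.scale /= -exprVn; ring.
Qed.

Lemma is_derive1P (f : V -> R) x v (l : R) :
  is_derive x v f l <-> is_derive (0 : R) (1 : R) (fun t : R => f (t *: v + x)) l.
Proof.
have D1 : 'D_v f x = 'D_1 (fun t : R => f (t *: v + x)) 0.
  rewrite /derive; set g1 := fun h => h^-1 *: _; set g2 := fun h => h^-1 *: _.
  suff -> : g1 = g2 by [].
  by apply/funext => t; rewrite /g1 /g2 /= addr0 scale0r add0r [_%:A]mulr1.
split=> -[df <-].
  exact: (DeriveDef ((derivable1P _ _ _).1 df) (esym D1)).
exact: (DeriveDef ((derivable1P _ _ _).2 df) D1).
Qed.

Lemma is_derive_comp1 (k : R -> R) (h : V -> R) x v (l m : R) :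
  is_derive x v h l -> is_derive (h x) 1 k m ->
  is_derive x v (fun y => k (h y)) (m * l).
Proof.
move=> /is_derive1P[dh <-] [dk <-]; apply/is_derive1P.
set H := fun t : R => h (t *: v + x) in dh *.
have hx : H 0 = h x by rewrite /H scale0r add0r.
rewrite -hx in dk *.
apply: DeriveDef.
  apply/derivable1_diffP; apply: (@differentiable_comp _ _ _ _ H k).
    exact/derivable1_diffP.
  exact/derivable1_diffP.
rewrite -!derive1E; exact: (@derive1_comp _ H k 0 dh dk).
Qed.

Lemma cder_cis (h : V -> R) x v (l : R) : is_derive x v h l ->
  cder (fun y => cis (h y)) x v ((0 +i* 1) * l%:C * cis (h x)).
Proof.
move=> dh; split => /=.
  apply: (is_derive_eq (is_derive_comp1 dh (is_derive_cos _))).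
  by ring.
apply: (is_derive_eq (is_derive_comp1 dh (is_derive_sin _))).
by ring.
Qed.
End complex_derivative.

Section affine_derivative.
Context {R : realType} {V W : normedModType R}.

Lemma is_derive_affine (f : W -> R) (g : V -> W) (a v : V) (v' : W) l :
  (forall h : R, g (h *: v + a) = h *: v' + g a) ->
  is_derive (g a) v' f l -> is_derive a v (fun x => f (g x)) l.
Proof.
move=> gE [df <-]; apply: DeriveDef.
  move/cvg_ex : df => [/= b hb]; apply/cvg_ex; exists b => /=.
  by under eq_fun do rewrite gE.
rewrite /derive; set g1 := fun h => h^-1 *: _; set g2 := fun h => h^-1 *: _.
suff -> : g1 = g2 by [].
by apply/funext => h; rewrite /g1 /g2 /= gE.
Qed.

Lemma cder_affine (f : W -> R[i]) (g : V -> W) (a v : V) (v' : W) l :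
  (forall h : R, g (h *: v + a) = h *: v' + g a) ->
  cder f (g a) v' l -> cder (fun x => f (g x)) a v l.
Proof.
move=> gE [fR fI]; split.
  exact: (is_derive_affine (f := fun y => complex.Re (f y)) gE).
exact: (is_derive_affine (f := fun y => complex.Im (f y)) gE).
Qed.

Lemma cder0 (f : V -> R[i]) a : cder f a 0 0.
Proof. by split; exact: is_derive0. Qed.

Lemma is_derive_scale (f : V -> R) (a v : V) (t l : R) :
  is_derive a v f l -> is_derive a (t *: v) f (t * l).
Proof.
move=> /is_derive1P df; apply/is_derive1P.
have := @is_derive_comp1 R R (fun s => f (s *: v + a)) (fun s => s * t) 0 1 t l.
rewrite mul0r mulrC => H.
under eq_fun do rewrite scalerA.
apply: H => //.
apply: (is_derive_eq (is_deriveM (is_derive_id _ _) (is_derive_cst _ _ _))).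
by rewrite scaler0 add0r [_%:A]mulr1.
Qed.
End affine_derivative.

Section partial_derivatives.
Context {R : realType} {d : nat}.
Implicit Types (f g : 'rV[R]_d -> R[i]) (x : 'rV[R]_d) (i : 'I_d).

Definition pdiff i f x : Prop := cder f x (delta_mx 0 i) (pderiv i f x).

Lemma cder_pderiv i f x l : cder f x (delta_mx 0 i) l -> pderiv i f x = l.
Proof.
by move=> [fR fI]; case: l fR fI => a b /= [_ aE] [_ bE]; rewrite /pderiv /rpderiv aE bE.
Qed.

Lemma cder_pdiff i f x l : cder f x (delta_mx 0 i) l -> pdiff i f x.
Proof. by move=> fl; rewrite /pdiff (cder_pderiv fl). Qed.

Lemma pdiffP i f x : pdiff i f x <->
  derivable (fun y => complex.Re (f y)) x (delta_mx 0 i) /\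
  derivable (fun y => complex.Im (f y)) x (delta_mx 0 i).
Proof.
split=> [[[dR _] [dI _]] //|[dR dI]].
by split; exact: derivableP.
Qed.
End partial_derivatives.

(** * Symbol estimates for nets of functions *)

Section epsilon_near.
Context {R : realType}.

Lemma near0r01 : \forall e \near (0 : R)^'+, 0 < e <= 1.
Proof.
near=> e; apply/andP; split; first by near: e; exact: nbhs_right_gt.
by near: e; exact: nbhs_right_le.
Unshelve. all: end_near. Qed.

Lemma near0r_lt (c : R) : 0 < c -> \forall e \near (0 : R)^'+, e < c.
Proof. by move=> c0; near=> e; near: e; exact: nbhs_right_lt.
Unshelve. all: end_near. Qed.

Lemma powR_ge1 (e b : R) : 0 < e <= 1 -> b <= 0 -> 1 <= e `^ b.
Proof.
by move=> e01 b0; rewrite -[leLHS](powRr0 e); apply: ger_powR.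
Qed.

Lemma powR_gtD (x b c : R) : 0 < x -> x `^ (b + c) = x `^ b * x `^ c.
Proof. by move=> x0; rewrite powRD// (gt_eqF x0) implybT. Qed.

Lemma near0r_ex (P : R -> Prop) :
  (\forall e \near (0 : R)^'+, P e) -> exists e, 0 < e <= 1 /\ P e.
Proof.
move=> H; have : \forall e \near (0 : R)^'+, 0 < e <= 1 /\ P e.
  by apply: filterS2 near0r01 H.
by move=> /filter_ex.
Qed.
End epsilon_near.

(* [S J A G om sh k b mu F]: the net [F] is [k] times differentiable on [A] in
   the directions of [J], and on [G] each of its derivatives along
   [i_1, .., i_l] is [O(e^b' om^(mu + sh i_1 + .. + sh i_l))] for all [b' < b].
   Slow scale nets are those which are [O(e^b')] for all [b' < 0]. *)
Section symbol_nets.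
Context {R : realType} {d : nat}.
Local Notation normc := (@Normc.normc R).
Local Notation net := (R -> 'rV[R]_d -> R[i]).

Definition bnd (G : set 'rV[R]_d) (om : 'rV[R]_d -> R) (b mu : R) (F : net) :=
  forall b', b' < b -> exists2 C, 0 <= C & \forall e \near 0^'+, forall w, G w ->
    normc (F e w) <= C * e `^ b' * om w `^ mu.

Definition net_pdiff (A : set 'rV[R]_d) (i : 'I_d) (F : net) :=
  forall e w, 0 < e <= 1 -> A w -> pdiff i (F e) w.

Definition net_pderiv (i : 'I_d) (F : net) : net := fun e => pderiv i (F e).

Fixpoint S (J : pred 'I_d) (A G : set 'rV[R]_d) (om : 'rV[R]_d -> R)
    (sh : 'I_d -> R) (k : nat) (b mu : R) (F : net) : Prop :=
  bnd G om b mu F /\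
  match k with
  | 0%N => True
  | k'.+1 => forall i, J i ->
      net_pdiff A i F /\ S J A G om sh k' b (mu + sh i) (net_pderiv i F)
  end.

(** Weaker than openness, because one domain, the slice xi = 0, is open only in the directions of x.
    It is enough to replace a net by an equal one under a derivative. *)
Definition line_open (J : pred 'I_d) (A : set 'rV[R]_d) :=
  forall w i, A w -> J i -> \forall t \near (0 : R), A (t *: delta_mx 0 i + w).

Lemma open_line_open J A : open A -> line_open J A.
Proof.
move=> oA w i Aw _; apply: (@near_line _ _ w (delta_mx 0 i) A).
exact: open_nbhs_nbhs.
Qed.

Lemma bndS J A G om sh k b mu F : S J A G om sh k b mu F -> bnd G om b mu F.
Proof. by case: k => [|k] []. Qed.

Section fixed_domain.
Variables (J : pred 'I_d) (A G : set 'rV[R]_d) (om : 'rV[R]_d -> R).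
Variable sh : 'I_d -> R.
Hypotheses (loA : line_open J A) (GA : G `<=` A) (om1 : forall w, G w -> 1 <= om w).
Local Notation bnd := (bnd G om).
Local Notation S := (S J A G om sh).
Implicit Types F : net.

Lemma bnd_ext b mu F F' :
  (forall e w, 0 < e <= 1 -> A w -> F e w = F' e w) -> bnd b mu F -> bnd b mu F'.
Proof.
move=> FF' bF b' /bF[C C0 H]; exists C => //.
near=> e => w Gw; rewrite -FF'; [|by near: e; exact: near0r01|exact: GA].
by move: w Gw; near: e.
Unshelve. all: end_near. Qed.

Lemma cder_net_ext F F' i l e w : J i -> 0 < e <= 1 -> A w ->
  (forall e w, 0 < e <= 1 -> A w -> F e w = F' e w) ->
  cder (F e) w (delta_mx 0 i) l -> cder (F' e) w (delta_mx 0 i) l.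
Proof.
move=> Ji e01 Aw FF'; apply: cder_line.
by apply: filterS (loA Aw Ji) => t At; exact: FF'.
Qed.

Lemma S_ext k b mu F F' :
  (forall e w, 0 < e <= 1 -> A w -> F e w = F' e w) -> S k b mu F -> S k b mu F'.
Proof.
elim: k b mu F F' => [|k IH] b mu F F' FF' /= [bF SF].
  by split => //; exact: bnd_ext bF.
split; first exact: bnd_ext bF.
move=> i Ji; have [dF SkF] := SF _ Ji.
have cF e w : 0 < e <= 1 -> A w ->
    cder (F' e) w (delta_mx 0 i) (pderiv i (F e) w).
  by move=> e01 Aw; apply: (cder_net_ext Ji) FF' _ => //; exact: dF.
split; first by move=> e w e01 Aw; exact: cder_pdiff (cF _ _ e01 Aw).
apply: IH SkF => e w e01 Aw; rewrite /net_pderiv.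
by rewrite (cder_pderiv (cF _ _ e01 Aw)).
Qed.

Lemma bnd_le b mu b1 mu1 F : b1 <= b -> mu <= mu1 -> bnd b mu F -> bnd b1 mu1 F.
Proof.
move=> b1b mumu1 bF b' b'b1; have [|C C0 H] := bF b'; first exact: lt_le_trans b1b.
exists C => //; apply: filterS H => e H w Gw; apply: le_trans (H w Gw) _.
apply: ler_wpM2l; first by rewrite mulr_ge0// powR_ge0.
by rewrite ler_powR// om1.
Qed.

Lemma S_le k b mu k1 b1 mu1 F : (k1 <= k)%N -> b1 <= b -> mu <= mu1 ->
  S k b mu F -> S k1 b1 mu1 F.
Proof.
elim: k k1 mu mu1 F => [|k IH] [|k1] mu mu1 F //= k1k b1b mumu1 [bF SF].
- by split => //; exact: bnd_le bF.
- by split => //; exact: bnd_le bF.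
split; first exact: bnd_le bF.
move=> i /SF[dF SkF]; split => //.
by apply: IH SkF => //; rewrite lerD2r.
Qed.

Lemma bndD b mu F F' : bnd b mu F -> bnd b mu F' ->
  bnd b mu (fun e w => F e w + F' e w).
Proof.
move=> bF bF' b' b'b; have [C C0 H] := bF _ b'b; have [C' C'0 H'] := bF' _ b'b.
exists (C + C'); first exact: addr_ge0.
apply: filterS2 H H' => e H H' w Gw; apply: le_trans (le_normcD _ _) _.
by rewrite !mulrDl lerD// ?H// H'.
Qed.

Lemma SD k b mu F F' : S k b mu F -> S k b mu F' ->
  S k b mu (fun e w => F e w + F' e w).
Proof.
elim: k mu F F' => [|k IH] mu F F' /= [bF SF] [bF' SF']; split => //; try exact: bndD.
move=> i Ji; have [dF SkF] := SF _ Ji; have [dF' SkF'] := SF' _ Ji.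
have cFF' e w : 0 < e <= 1 -> A w ->
    cder (fun w => F e w + F' e w) w (delta_mx 0 i) (pderiv i (F e) w + pderiv i (F' e) w).
  by move=> e01 Aw; apply: cderD; [exact: dF|exact: dF'].
split; first by move=> e w e01 Aw; exact: cder_pdiff (cFF' _ _ e01 Aw).
apply: S_ext (IH _ _ _ SkF SkF') => e w e01 Aw.
by rewrite /net_pderiv (cder_pderiv (cFF' _ _ e01 Aw)).
Qed.

Lemma bndM b mu b1 mu1 F F' : bnd b mu F -> bnd b1 mu1 F' ->
  bnd (b + b1) (mu + mu1) (fun e w => F e w * F' e w).
Proof.
move=> bF bF' b' b'b.
(* The slack [b + b1 - b'] is shared equally between the two factors. *)
pose c := b - (b + b1 - b') / 2; pose c1 := b1 - (b + b1 - b') / 2.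
have b'E : b' = c + c1 by rewrite /c /c1; lra.
have [|C C0 H] := bF c; first by rewrite /c; lra.
have [|C' C'0 H'] := bF' c1; first by rewrite /c1; lra.
exists (C * C'); first exact: mulr_ge0.
apply: filterS3 near0r01 H H' => e /andP[e0 _] H H' w Gw.
rewrite Normc.normcM.
have w0 : 0 < om w by rewrite (lt_le_trans _ (om1 Gw)).
rewrite b'E powR_gtD// powR_gtD//.
set p1 := e `^ _; set p2 := e `^ _.
have -> : C * C' * (p1 * p2) * (om w `^ mu * om w `^ mu1) =
  (C * p1 * om w `^ mu) * (C' * p2 * om w `^ mu1) by ring.
apply: ler_pM; [exact: normc_ge0|exact: normc_ge0| |].
  exact: H.
exact: H'.
Qed.

Lemma SM k b mu b1 mu1 F F' : S k b mu F -> S k b1 mu1 F' ->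
  S k (b + b1) (mu + mu1) (fun e w => F e w * F' e w).
Proof.
elim: k mu mu1 F F' => [|k IH] mu mu1 F F' /= SF0 SF0'; have [bF SF] := SF0;
  have [bF' SF'] := SF0'; split => //; try exact: bndM.
move=> i Ji; have [dF SkF] := SF _ Ji; have [dF' SkF'] := SF' _ Ji.
have cFF' e w : 0 < e <= 1 -> A w -> cder (fun w => F e w * F' e w) w (delta_mx 0 i)
    (pderiv i (F e) w * F' e w + F e w * pderiv i (F' e) w).
  by move=> e01 Aw; apply: cderM; [exact: dF|exact: dF'].
split; first by move=> e w e01 Aw; exact: cder_pdiff (cFF' _ _ e01 Aw).
apply: (@S_ext _ _ _ (fun e w =>
    pderiv i (F e) w * F' e w + F e w * pderiv i (F' e) w)).
  by move=> e w e01 Aw; rewrite /net_pderiv (cder_pderiv (cFF' _ _ e01 Aw)).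
apply: SD.
  rewrite addrAC; apply: IH SkF _.
  exact: (@S_le k.+1 _ _ _ _ _ _ (leqnSn k) (lexx _) (lexx _) SF0').
rewrite -addrA; apply: IH SkF'.
exact: (@S_le k.+1 _ _ _ _ _ _ (leqnSn k) (lexx _) (lexx _) SF0).
Qed.

Lemma bnd_cst b mu (c : R[i]) : b <= 0 -> 0 <= mu -> bnd b mu (fun _ _ => c).
Proof.
move=> b0 mu0 b' b'b; exists (normc c); first exact: normc_ge0.
near=> e => w Gw; rewrite -[leLHS]mulr1 -[leLHS]mulr1 ler_pM//.
- by rewrite mulr1 normc_ge0.
- rewrite ler_wpM2l ?normc_ge0// powR_ge1//; last lra.
  by near: e; exact: near0r01.
by rewrite -[leLHS](powRr0 (om w)) ler_powR// om1.
Unshelve. all: end_near. Qed.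

Lemma bnd0 b mu F : (forall e w, 0 < e <= 1 -> G w -> F e w = 0) -> bnd b mu F.
Proof.
move=> F0 b' _; exists 0 => //; near=> e => w Gw; rewrite F0//.
  by rewrite Normc.normc0 !mul0r.
by near: e; exact: near0r01.
Unshelve. all: end_near. Qed.

Lemma S0 k b mu F : (forall e w, 0 < e <= 1 -> A w -> F e w = 0) -> S k b mu F.
Proof.
move=> F0; apply: (@S_ext _ _ _ (fun _ _ => 0)) => [e w e01 Aw|].
  by rewrite F0.
elim: k mu {F F0} => [|k IH] mu /=; split => //; try exact: bnd0.
move=> i Ji; split.
  by move=> e w _ _; exact: cder_pdiff (cder_cst _ _ _).
apply: S_ext (IH _) => e w _ _.
by rewrite /net_pderiv (cder_pderiv (cder_cst _ _ _)).
Qed.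

Lemma S_cst k b mu (c : R[i]) : b <= 0 -> 0 <= mu -> S k b mu (fun _ _ => c).
Proof.
move=> b0 mu0; case: k => [|k] /=; split => //; try exact: bnd_cst.
move=> i Ji; split.
  by move=> e w _ _; exact: cder_pdiff (cder_cst _ _ _).
by apply: S0 => e w _ _; rewrite /net_pderiv (cder_pderiv (cder_cst _ _ _)).
Qed.

Lemma S_scale k b mu c F : S k b mu F -> S k b mu (fun e w => c * F e w).
Proof.
move=> SF; rewrite -[b]add0r -[mu]add0r; apply: SM => //.
exact: S_cst.
Qed.

Lemma SN k b mu F : S k b mu F -> S k b mu (fun e w => - F e w).
Proof.
move=> SF; apply: S_ext (S_scale (-1) SF) => e w _ _.
by rewrite mulN1r.
Qed.

Lemma SB k b mu F F' : S k b mu F -> S k b mu F' ->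
  S k b mu (fun e w => F e w - F' e w).
Proof. by move=> SF SF'; apply: SD => //; exact: SN. Qed.

Lemma S_sum (I : Type) (r : seq I) k b mu (F : I -> net) :
  (forall j, S k b mu (F j)) -> S k b mu (fun e w => \sum_(j <- r) F j e w).
Proof.
move=> SF; elim: r => [|j r IH].
  by apply: S0 => e w _ _; rewrite big_nil.
apply: (@S_ext _ _ _ (fun e w => F j e w + \sum_(j <- r) F j e w)).
  by move=> e w _ _; rewrite big_cons.
exact: SD.
Qed.

(** Since d(1/g) = - dg (1/g) (1/g), the estimates of order [k.+1] follow from those of order [k] by
    products. Only the bound of 1/g itself, a lower bound of [g], has to be supplied. *)
Lemma S_realV k mu (g : R -> 'rV[R]_d -> R) :
  (forall e w, 0 < e <= 1 -> A w -> g e w != 0) ->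
  S k 0 mu (fun e w => (g e w)%:C) -> bnd 0 (- mu) (fun e w => (g e w)^-1%:C) ->
  S k 0 (- mu) (fun e w => (g e w)^-1%:C).
Proof.
move=> g0; elim: k => [|k IH] Sg bg; first by split.
have Sk : S k 0 (- mu) (fun e w => (g e w)^-1%:C).
  by apply: IH => //; exact: (@S_le k.+1 _ _ _ _ _ _ (leqnSn k) (lexx _) (lexx _) Sg).
case: Sg => _ Sg; split => // i Ji; have [dg Skg] := Sg _ Ji.
have cg e w : 0 < e <= 1 -> A w -> cder (fun w => (g e w)^-1%:C) w (delta_mx 0 i)
    (- pderiv i (fun w => (g e w)%:C) w * (g e w)^-1%:C * (g e w)^-1%:C).
  move=> e01 Aw; have [dR dI] := dg _ _ e01 Aw.
  have -> : pderiv i (fun w => (g e w)%:C) w = (rpderiv i (g e) w)%:C.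
    rewrite /pderiv /=; congr (_ +i* _).
    by rewrite /rpderiv; exact: derive_cst.
  rewrite -rmorphN -!rmorphM; apply: cder_realV; first exact: g0.
split; first by move=> e w e01 Aw; exact: cder_pdiff (cg _ _ e01 Aw).
apply: (@S_ext _ _ _ (fun e w =>
    - pderiv i (fun w => (g e w)%:C) w * (g e w)^-1%:C * (g e w)^-1%:C)).
  by move=> e w e01 Aw; rewrite /net_pderiv (cder_pderiv (cg _ _ e01 Aw)).
have -> : - mu + sh i = (mu + sh i) - mu - mu by ring.
have -> : (0 : R) = 0 + 0 + 0 by rewrite !addr0.
by apply: (SM (SM (SN Skg) Sk) Sk).
Qed.

(** The bound of order zero is |e^(ig)| = 1, and d e^(ig) = i dg e^(ig). So estimates are asked of
    the derivatives of [g] alone, and [g] may be unbounded. *)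
Lemma S_cis k (g : R -> 'rV[R]_d -> R) :
  (forall i, J i -> net_pdiff A i (fun e w => (g e w)%:C) /\
    S k 0 (sh i) (net_pderiv i (fun e w => (g e w)%:C))) ->
  S k.+1 0 0 (fun e w => cis (g e w)).
Proof.
have b0 : bnd 0 0 (fun e w => cis (g e w)).
  move=> b' b'0; exists 1 => //; near=> e => w Gw.
  rewrite normc_cis mul1r powRr0 mulr1 powR_ge1//; last exact: ltW.
  by near: e; exact: near0r01.
have step k' : S k' 0 0 (fun e w => cis (g e w)) ->
    (forall i, J i -> net_pdiff A i (fun e w => (g e w)%:C) /\
      S k' 0 (sh i) (net_pderiv i (fun e w => (g e w)%:C))) ->
    S k'.+1 0 0 (fun e w => cis (g e w)).
  move=> Sc Sg; split => // i Ji; have [dg Skg] := Sg _ Ji.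
  have cg e w : 0 < e <= 1 -> A w -> cder (fun w => cis (g e w)) w (delta_mx 0 i)
      ((0 +i* 1) * pderiv i (fun w => (g e w)%:C) w * cis (g e w)).
    move=> e01 Aw; have [dR dI] := dg _ _ e01 Aw.
    have -> : pderiv i (fun w => (g e w)%:C) w = (rpderiv i (g e) w)%:C.
      rewrite /pderiv /=; congr (_ +i* _).
      by rewrite /rpderiv; exact: derive_cst.
    exact: cder_cis dR.
  split; first by move=> e w e01 Aw; exact: cder_pdiff (cg _ _ e01 Aw).
  apply: (@S_ext _ _ _ (fun e w =>
      ((0 +i* 1) * pderiv i (fun w => (g e w)%:C) w * cis (g e w)))).
    by move=> e w e01 Aw; rewrite /net_pderiv (cder_pderiv (cg _ _ e01 Aw)).
  by have := SM (S_scale (0 +i* 1) Skg) Sc; rewrite add0r addr0 add0r.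
elim: k => [|k IH] Sg; first by apply: step => //; split.
apply: step => //; apply: IH => i /Sg[dg Skg].
split => //; exact: (@S_le k.+1 _ _ _ _ _ _ (leqnSn k) (lexx _) (lexx _) Skg).
Unshelve. all: end_near. Qed.

End fixed_domain.
End symbol_nets.
Arguments S0 {R d J A G om sh} loA GA [k b mu F] _.
Arguments S_cst {R d J A G om sh} loA GA om1 [k b mu] c _ _.

(** * Mean value theorem and symmetry of second derivatives *)

Section mean_value.
Context {R : realType} {V : normedModType R}.

Lemma mvt0 (F DF : R -> R) (r : R) : 0 < r ->
  (forall s : R, s \in `[0, r] -> is_derive s (1 : R) F (DF s)) ->
  exists2 c : R, 0 <= c <= r & F r - F 0 = r * DF c.
Proof.
move=> r0 dl; have M := @MVT R F DF 0 r r0.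
have dl' (s : R) : s \in `]0, r[%R -> is_derive s 1 F (DF s).
  by move=> s0r; apply: dl; exact: (subset_itv_oo_cc s0r).
have [|c c0r E] := M dl'.
  by apply: derivable_within_continuous => s s0r; have [] := dl s s0r.
exists c; last by rewrite E subr0 mulrC.
by have := subset_itv_oo_cc c0r; rewrite in_itv.
Qed.

Lemma is_derive_on_line (f : V -> R) (y v : V) (s : R) :
  derivable f (s *: v + y) v ->
  is_derive s (1 : R) (fun t : R => f (t *: v + y)) ('D_v f (s *: v + y)).
Proof.
move=> df; apply: (@is_derive_affine _ _ _ f (fun t : R => t *: v + y) s 1 v).
  by move=> h; rewrite [h *: 1]mulr1 scalerDl addrA.
exact: derivableP.
Qed.

Lemma mvt_line (f : V -> R) (y v : V) (r : R) : 0 < r ->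
  (forall s : R, 0 <= s <= r -> derivable f (s *: v + y) v) ->
  exists2 c : R, 0 <= c <= r & f (r *: v + y) - f y = r * 'D_v f (c *: v + y).
Proof.
move=> r0 df.
have dl (s : R) : s \in `[0, r] -> is_derive s (1 : R) (fun t : R => f (t *: v + y)) ('D_v f (s *: v + y)).
  by rewrite in_itv /= => s0r; apply: is_derive_on_line; exact: df.
have [c c0r E] := mvt0 r0 dl.
exists c => //; apply: etrans E.
by rewrite scale0r add0r.
Qed.

Lemma mvt_line_le (f : V -> R) (y v : V) (r M : R) :
  (forall s : R, `|s| <= `|r| -> derivable f (s *: v + y) v /\ `|'D_v f (s *: v + y)| <= M) ->
  `|f (r *: v + y) - f y| <= M * `|r|.
Proof.
move=> df; have [r0|r0|->] := ltgtP r 0; last first.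
- by rewrite scale0r add0r subrr normr0 mulr0.
- have [|c c0r ->] := @mvt_line f y v r r0.
    by move=> s /andP[s0 sr]; apply: (df s _).1; rewrite !ger0_norm// ltW.
  rewrite normrM mulrC ler_wpM2r//; apply: (df c _).2.
  by case/andP: c0r => c0 cr; rewrite !ger0_norm// ltW.
have Nr0 : 0 < - r by rewrite oppr_gt0.
have [|c c0r] := @mvt_line f (r *: v + y) v (- r) Nr0.
  move=> s /andP[s0 sr]; rewrite addrA -scalerDl; apply: (df (s + r) _).1.
  by rewrite !ler0_norm ?(ltW r0)//; lra.
rewrite addrA -scalerDl addNr scale0r add0r distrC => ->.
rewrite normrM normrN mulrC ler_wpM2r// addrA -scalerDl; apply: (df (c + r) _).2.
by case/andP: c0r => c0 cr; rewrite !ler0_norm ?(ltW r0)//; lra.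
Qed.

(** The mean value theorem is applied twice: in the direction [v] to the increment of [f] along
    [r *: w], then in the direction [w] to the derivative of [f] along [v]. *)
Lemma mvt_square (f : V -> R) (x v w : V) (r : R) : 0 < r ->
  (forall s t : R, 0 <= s <= r -> 0 <= t <= r ->
     derivable f (s *: v + (t *: w + x)) v /\
     derivable (fun y => 'D_v f y) (s *: v + (t *: w + x)) w) ->
  exists s t : R, [/\ 0 <= s <= r, 0 <= t <= r &
    f (r *: v + (r *: w + x)) - f (r *: v + x) - f (r *: w + x) + f x
    = r * (r * 'D_w (fun y => 'D_v f y) (s *: v + (t *: w + x)))].
Proof.
move=> r0 H.
have r0r : 0 <= r <= r by rewrite lexx ltW.
have Z0r : 0 <= (0 : R) <= r by rewrite lexx ltW.
pose g y := f (r *: w + y) - f y.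
have dg1 s : 0 <= s <= r -> is_derive (s *: v + x) v (fun y => f (r *: w + y))
    ('D_v f (r *: w + (s *: v + x))).
  move=> s0r; apply: (@is_derive_affine _ _ _ f (fun y => r *: w + y) _ v v).
    by move=> h; rewrite addrCA.
  by apply: derivableP; rewrite addrCA; exact: (H s r s0r r0r).1.
have dg2 s : 0 <= s <= r -> is_derive (s *: v + x) v f ('D_v f (s *: v + x)).
  move=> s0r; apply: derivableP.
  by have := (H s 0 s0r Z0r).1; rewrite scale0r add0r.
have dg s : 0 <= s <= r -> is_derive (s *: v + x) v g
    ('D_v f (r *: w + (s *: v + x)) - 'D_v f (s *: v + x)).
  by move=> s0r; apply: is_deriveB; [exact: dg1|exact: dg2].
have [|s s0r gE] := @mvt_line g x v r r0.
  by move=> s s0r; exact: @ex_derive (dg s s0r).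
have [|t t0r hE] := @mvt_line (fun y => 'D_v f y) (s *: v + x) w r r0.
  by move=> t t0r; rewrite addrCA; exact: (H s t s0r t0r).2.
have dgE : 'D_v g (s *: v + x) =
  'D_v f (r *: w + (s *: v + x)) - 'D_v f (s *: v + x) by have [_] := dg s s0r.
exists s, t; split => //.
transitivity (r * 'D_v g (s *: v + x)).
  by rewrite -gE /g (addrCA (r *: v)); ring.
by rewrite dgE hE (addrCA (s *: v)).
Qed.

Let eq4 (a b c e u v : R) : a - b - c + e = u -> a - c - b + e = v -> u = v.
Proof. by move=> <- <-; ring. Qed.

Let tri2 (a b z e : R) : `|a - z| < e / 2 -> `|b - z| < e / 2 -> `|a - b| <= e.
Proof.
move=> az bz; rewrite (_ : a - b = (a - z) - (b - z)); last by ring.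
by rewrite (le_trans (ler_normB _ _))//; lra.
Qed.

(** The second difference over a small parallelogram is symmetric in [v] and [w], and by
    [mvt_square] it is r^2 times either mixed derivative at some nearby point. Continuity lets the
    parallelogram shrink to [x]. *)
Lemma schwarz (f : V -> R) (x v w : V) :
  (\forall y \near x, [/\ derivable f y v, derivable f y w,
     derivable (fun y => 'D_v f y) y w & derivable (fun y => 'D_w f y) y v]) ->
  {for x, continuous (fun y => 'D_w (fun y => 'D_v f y) y)} ->
  {for x, continuous (fun y => 'D_v (fun y => 'D_w f y) y)} ->
  'D_w (fun y => 'D_v f y) x = 'D_v (fun y => 'D_w f y) x.
Proof.
move=> H c1 c2; apply/eqP; rewrite -subr_eq0 -normr_le0; apply/ler_addgt0Pl => e e0.
rewrite addr0.
have e20 : 0 < e / 2 by rewrite divr_gt0.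
have /nbhs_ballP[r r0 rH] : \forall y \near x, [/\ [/\ derivable f y v, derivable f y w,
     derivable (fun y => 'D_v f y) y w & derivable (fun y => 'D_w f y) y v],
    `|'D_w (fun y => 'D_v f y) x - 'D_w (fun y => 'D_v f y) y| < e / 2 &
    `|'D_v (fun y => 'D_w f y) x - 'D_v (fun y => 'D_w f y) y| < e / 2].
  move/cvgrPdist_lt : c1 => /(_ _ e20) c1.
  move/cvgrPdist_lt : c2 => /(_ _ e20) c2.
  apply: filterS3 H c1 c2 => y hy h1 h2.
  by split; [exact: hy|exact: h1|exact: h2].
(* The parallelogram stays in the ball of radius [r], because |s v + t w| <= q (|v| + |w|) < r. The
   summand 1 keeps [N] positive. *)
pose N := `|v| + `|w| + 1.
have N0 : 0 < N by rewrite ltr_wpDl// addr_ge0.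
pose q := r / N / 2.
have q0 : 0 < q by rewrite !divr_gt0.
have inb s t : 0 <= s <= q -> 0 <= t <= q -> ball x r (s *: v + (t *: w + x)).
  move=> /andP[s0 sq] /andP[t0 tq]; rewrite -ball_normE /ball_ /=.
  rewrite distrC addrA addrK (le_lt_trans (ler_normD _ _))// !normrZ !ger0_norm//.
  apply: (@le_lt_trans _ _ (q * N)); last first.
    by rewrite /q mulrAC divfK ?gt_eqF// ltr_pdivrMr// ltr_pMr// ltr1n.
  rewrite /N !mulrDr -[leLHS]addr0; apply: lerD; last by rewrite mulr_ge0// ltW.
  by apply: lerD; apply: ler_wpM2r.
have [|s [t [s0 t0 E1]]] := @mvt_square f x v w q q0.
  move=> s t s0 t0; have [[h1 _ h3 _] _ _] := rH _ (inb s t s0 t0).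
  exact: conj h1 h3.
have [|t' [s' [t'0 s'0 E2]]] := @mvt_square f x w v q q0.
  move=> s1 t1 s10 t10; rewrite addrCA.
  have [[_ h2 _ h4] _ _] := rH _ (inb t1 s1 t10 s10).
  exact: conj h2 h4.
have [_ b1 _] := rH _ (inb s t s0 t0); have [_ _ b2] := rH _ (inb s' t' s'0 t'0).
rewrite (addrCA (t' *: w)) (addrCA (q *: w)) in E2.
have E := mulfI (lt0r_neq0 q0) (mulfI (lt0r_neq0 q0) (eq4 E1 E2)).
rewrite E in b1; exact: tri2 b1 b2.
Qed.
End mean_value.

Section bounded_partials.
Context {R : realType} {d : nat}.
Implicit Types (f : 'rV[R]_d -> R) (x y : 'rV[R]_d).

Lemma coord_le_norm x i : `|x 0 i| <= `|x|.
Proof.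
rewrite [leRHS]/Num.norm /= mx_normrE; apply/bigmax_geP; right => /=.
by exists (0, i).
Qed.

Lemma norm_le_coord x (M : R) : 0 <= M -> (forall i, `|x 0 i| <= M) -> `|x| <= M.
Proof.
move=> M0 H; rewrite [leLHS]/Num.norm /= mx_normrE; apply/bigmax_leP; split => //.
by move=> [i j] _ /=; rewrite ord1.
Qed.

Lemma norm_lt_coord x (M : R) : 0 < M -> (forall i, `|x 0 i| < M) -> `|x| < M.
Proof.
move=> M0 H; rewrite [ltLHS]/Num.norm /= mx_normrE; apply/bigmax_ltP; split => //.
by move=> [i j] _ /=; rewrite ord1.
Qed.

Lemma bounded_partials_lipschitz f x (r M : R) : 0 < r ->
  (forall i y, `|y - x| < r -> derivable f y (delta_mx 0 i) /\
     `|rpderiv i f y| <= M) ->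
  forall y, `|y - x| < r -> `|f y - f x| <= d%:R * M * `|y - x|.
Proof.
move=> r0 H y yx.
(* A path from [x] to [y] that changes one coordinate at a time. In the maximum norm all its
   segments stay within distance |y - x| of [x]. *)
pose z (k : nat) : 'rV[R]_d := \row_j (if (j < k)%N then y 0 j else x 0 j).
have z0 : z 0%N = x by apply/rowP => j; rewrite !mxE.
have zd : z d = y by apply/rowP => j; rewrite !mxE ltn_ord.
have zS (k : 'I_d) : z k.+1 = (y 0 k - x 0 k) *: delta_mx 0 k + z k.
  apply/rowP => j; rewrite !mxE eqxx /= ltnS leq_eqVlt (inj_eq val_inj).
  have [->|jk] := eqVneq j k; first by rewrite ltnn /= mulr1 subrK.
  by rewrite /= mulr0 add0r.
have step (k : 'I_d) : `|f (z k.+1) - f (z k)| <= M * `|y - x|.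
  have M0 : 0 <= M.
    have xx : `|x - x| < r by rewrite subrr normr0.
    by apply: le_trans (H k x xx).2.
  rewrite zS; apply: (@le_trans _ _ (M * `|y 0 k - x 0 k|)); last first.
    by apply: ler_wpM2l => //; have := coord_le_norm (y - x) k; rewrite !mxE; apply.
  apply: mvt_line_le => s syx; apply: H.
  apply: le_lt_trans yx; apply: norm_le_coord => // j.
  rewrite !mxE eqxx /=; have yxj := coord_le_norm (y - x) j; rewrite !mxE in yxj.
  have [->|jk] := eqVneq j k; last first.
    by rewrite mulr0 add0r; case: ifP => // _; rewrite subrr normr0.
  rewrite ltnn mulr1 addrK (le_trans syx)//.
  by have := coord_le_norm (y - x) k; rewrite !mxE.
have H2 (k : nat) : (k <= d)%N -> `|f (z k) - f x| <= k%:R * (M * `|y - x|).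
  elim: k => [|k IH] kd; first by rewrite z0 subrr normr0 mul0r.
  have -> : f (z k.+1) - f x = (f (z k) - f x) + (f (z k.+1) - f (z k)) by ring.
  apply: le_trans (ler_normD _ _) _.
  rewrite -natr1 mulrDl mul1r; apply: lerD; first by apply: IH; exact: ltnW.
  exact: (step (Ordinal kd)).
by have := H2 d (leqnn d); rewrite zd mulrA.
Qed.

(** The usual source of the continuity that [smooth_on] demands: a bound on the derivatives of one
    order more, which [S] and dominated integrals both provide. *)
Lemma bounded_partials_continuous f x (r M : R) : 0 < r ->
  (forall i y, `|y - x| < r -> derivable f y (delta_mx 0 i) /\
     `|rpderiv i f y| <= M) -> {for x, continuous f}.
Proof.
move=> r0 H; have L := bounded_partials_lipschitz r0 H.
apply: (@cvgrPdist_lt _ _ _ (nbhs x) _ f (f x)).2 => e e0.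
pose q := Num.min r (e / (`|d%:R * M| + 1)).
have q0 : 0 < q by rewrite lt_min r0 divr_gt0// ltr_wpDl.
apply/nbhs_ballP; exists q => // y; rewrite -ball_normE /ball_ /= distrC => yx.
have := yx; rewrite lt_min => /andP[yxr yxe].
rewrite distrC; apply: le_lt_trans (L y yxr) _.
apply: (@le_lt_trans _ _ ((`|d%:R * M| + 1) * `|y - x|)).
  by apply: ler_wpM2r => //; rewrite (le_trans (ler_norm _))// lerDl.
by rewrite mulrC -ltr_pdivlMr// ltr_wpDl.
Qed.
End bounded_partials.

Section iterated_derivatives.
Context {R : realType} {d : nat}.
Implicit Types (f g : 'rV[R]_d -> R[i]) (x : 'rV[R]_d) (i j : 'I_d) (s : seq 'I_d).

Lemma pderivs_rcons s i f : pderivs (rcons s i) f = pderivs s (pderiv i f).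
Proof. by rewrite /pderivs foldr_rcons. Qed.

Lemma pderivs_cat s1 s2 f : pderivs (s1 ++ s2) f = pderivs s1 (pderivs s2 f).
Proof. by rewrite /pderivs foldr_cat. Qed.

Lemma pderiv_near i f g x : (\near x, f x = g x) -> pderiv i f x = pderiv i g x.
Proof.
move=> fg; rewrite /pderiv /rpderiv.
rewrite (near_eq_derive (g := fun y => complex.Re (g y))); last first.
  by apply: filterS fg => y ->.
rewrite (near_eq_derive (f := fun y => complex.Im (f y)) (g := fun y => complex.Im (g y)))//.
by apply: filterS fg => y ->.
Qed.

Lemma pderivs_ext A s f g : open A -> (forall x, A x -> f x = g x) ->
  forall x, A x -> pderivs s f x = pderivs s g x.
Proof.
move=> oA fg; elim: s => [|i s IH] //= x Ax; apply: pderiv_near.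
by apply: filterS (open_nbhs_nbhs (conj oA Ax)) => y Ay; exact: IH.
Qed.

Lemma smooth_on_pderivs A s f : smooth_on A f -> smooth_on A (pderivs s f).
Proof. by move=> sf s'; have := sf (s' ++ s); rewrite pderivs_cat. Qed.

Lemma smooth_onS A B f : A `<=` B -> smooth_on B f -> smooth_on A f.
Proof.
move=> AB sf s; have [cf df] := sf s; split=> [x Ax|i x Ax].
  exact/cf/AB.
exact/df/AB.
Qed.

Lemma near_eq_continuous (h k : 'rV[R]_d -> R) x :
  (\near x, h x = k x) -> {for x, continuous h} -> {for x, continuous k}.
Proof.
move=> hk ch; rewrite /prop_for /continuous_at -(nbhs_singleton hk).
exact: (cvg_trans (near_eq_cvg hk) ch).
Qed.

Lemma smooth_on_ext A f g : open A -> (forall x, A x -> f x = g x) ->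
  smooth_on A f -> smooth_on A g.
Proof.
move=> oA fg sf s; have [cf df] := sf s.
have E := pderivs_ext s oA fg.
have nE x : A x -> \near x, pderivs s f x = pderivs s g x.
  by move=> Ax; apply: filterS (open_nbhs_nbhs (conj oA Ax)) => y; exact: E.
split=> [x Ax|i x Ax].
  have [cR cI] := cf x Ax; split.
    by apply: near_eq_continuous cR; apply: filterS (nE x Ax) => y ->.
  by apply: near_eq_continuous cI; apply: filterS (nE x Ax) => y ->.
have [dR dI] := df i x Ax; split.
  by apply: near_eq_derivable dR; apply: filterS (nE x Ax) => y ->.
by apply: near_eq_derivable dI; apply: filterS (nE x Ax) => y ->.
Qed.

Lemma smooth_on_pdiff A f s i x : smooth_on A f -> A x -> pdiff i (pderivs s f) x.
Proof. by move=> sf Ax; apply/pdiffP; exact: (sf s).2. Qed.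

Lemma pderivC A i j f x : open A -> smooth_on A f -> A x ->
  pderiv i (pderiv j f) x = pderiv j (pderiv i f) x.
Proof.
move=> oA sf Ax.
have nA := open_nbhs_nbhs (conj oA Ax).
have H (c : R[i] -> R) : (c = @complex.Re R \/ c = @complex.Im R) ->
    'D_(delta_mx 0 i) (fun y => 'D_(delta_mx 0 j) (fun y => c (f y)) y) x =
    'D_(delta_mx 0 j) (fun y => 'D_(delta_mx 0 i) (fun y => c (f y)) y) x.
  move=> cE; apply: schwarz.
  - apply: filterS nA => y Ay.
    have [_ d0] := sf [::]; have [_ dj] := sf [:: j]; have [_ di] := sf [:: i].
    have [d0jR d0jI] := d0 j y Ay; have [d0iR d0iI] := d0 i y Ay.
    have [djR djI] := dj i y Ay; have [diR diI] := di j y Ay.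
    case: cE => ->; split; [exact: d0jR|exact: d0iR|exact: djR|exact: diR|
      exact: d0jI|exact: d0iI|exact: djI|exact: diI].
  - have [c0 _] := sf [:: i; j]; have [cR cI] := c0 x Ax.
    by case: cE => ->; [exact: cR|exact: cI].
  have [c0 _] := sf [:: j; i]; have [cR cI] := c0 x Ax.
  by case: cE => ->; [exact: cR|exact: cI].
apply: complexP => /=.
  exact: (H (@complex.Re R) (or_introl erefl)).
exact: (H (@complex.Im R) (or_intror erefl)).
Qed.

Lemma pderivs_comm A i s f x : open A -> smooth_on A f -> A x ->
  pderivs s (pderiv i f) x = pderiv i (pderivs s f) x.
Proof.
move=> oA sf; elim: s x => [|j s IH] //= x Ax.
transitivity (pderiv j (pderiv i (pderivs s f)) x); last first.
  exact: (pderivC _ _ oA (smooth_on_pderivs s sf) Ax).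
apply: pderiv_near; apply: filterS (open_nbhs_nbhs (conj oA Ax)) => y Ay.
exact: IH.
Qed.

Lemma pderivs_perm A s s' f x : open A -> smooth_on A f -> A x -> perm_eq s s' ->
  pderivs s f x = pderivs s' f x.
Proof.
move=> oA sf; elim: s s' x => [|i s IH] s' x Ax.
  by move=> /perm_size /=; case: s'.
move=> ss'; have is' : i \in s' by rewrite -(perm_mem ss') mem_head.
case/splitPr : is' ss' => p1 p2 ss'.
have {}ss' : perm_eq s (p1 ++ p2).
  by move: ss'; rewrite perm_sym perm_catC /= perm_cons perm_catC perm_sym.
rewrite pderivs_cat.
transitivity (pderiv i (pderivs p1 (pderivs p2 f)) x); last first.
  by apply/esym; exact: (pderivs_comm _ _ oA (smooth_on_pderivs p2 sf) Ax).
rewrite -pderivs_cat.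
apply: pderiv_near; apply: filterS (open_nbhs_nbhs (conj oA Ax)) => y Ay.
exact: IH.
Qed.

Lemma perm_count s :
  perm_eq s (flatten [seq nseq (count_mem i s) i | i <- enum 'I_d]).
Proof.
apply/allP => x _ /=; rewrite count_flatten -map_comp sumnE big_map big_enum /=.
rewrite (bigD1 x)//= big1 ?addn0; last first.
  by move=> i ix; rewrite count_nseq /= (negbTE ix) mul0n.
by rewrite count_nseq /= eqxx mul1n.
Qed.

Lemma mlen_count s : mlen (fun i => count_mem i s) = size s.
Proof.
rewrite /mlen; elim: s => [|j s IH] /=; first by rewrite big1.
rewrite big_split /= IH (bigD1 j)//= eqxx big1 ?addn0// => i ij.
by rewrite eq_sym (negbTE ij).
Qed.

(** Seminorms are indexed by multi-indices, while inductions run over words of directions. For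
    smooth functions the two agree, as derivatives commute. *)
Lemma pderivs_mderiv A s f x : open A -> smooth_on A f -> A x ->
  pderivs s f x = mderiv (fun i => count_mem i s) f x.
Proof. by move=> oA sf Ax; apply: pderivs_perm sf Ax (perm_count s). Qed.

Lemma mderiv_pderivs (al : 'I_d -> nat) f : exists2 s,
  mderiv al f = pderivs s f & size s = mlen al.
Proof.
exists (flatten [seq nseq (al i) i | i <- enum 'I_d]) => //.
rewrite size_flatten /shape -map_comp sumnE big_map big_enum /=.
by apply: eq_bigr => i _; rewrite size_nseq.
Qed.
End iterated_derivatives.

Section symbol_net_derivatives.
Context {R : realType} {d : nat}.
Local Notation normc := (@Normc.normc R).
Local Notation net := (R -> 'rV[R]_d -> R[i]).
Implicit Types (J : pred 'I_d) (A G : set 'rV[R]_d) (om : 'rV[R]_d -> R)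
  (sh : 'I_d -> R) (F : net).

(** Induction runs from the right end of the word, since its last letter is the derivative applied
    first, the one that [S] peels off. *)
Lemma S_pderivs J A G om sh k b mu F s : S J A G om sh k b mu F ->
  all J s -> (size s <= k)%N ->
  bnd G om b (mu + \sum_(i <- s) sh i) (fun e => pderivs s (F e)) /\
  forall i, J i -> (size s < k)%N -> net_pdiff A i (fun e => pderivs s (F e)).
Proof.
elim/last_ind: s k mu F => [|s j IH] k mu F SF.
  move=> _ _; rewrite big_nil addr0; split; first exact: bndS SF.
  by move=> i Ji; case: k SF => // k [_ SF] _; exact: (SF i Ji).1.
rewrite all_rcons => /andP[Jj Js]; rewrite size_rcons.
case: k SF => // k [_ /(_ j Jj)[_ SF]]; rewrite ltnS => sk.
have [bs ds] := IH _ _ _ SF Js sk; split.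
  have -> : (fun e => pderivs (rcons s j) (F e)) =
      (fun e => pderivs s (net_pderiv j F e)).
    by apply/funext => e; rewrite pderivs_rcons.
  by rewrite big_rcons /= [_ + sh j]addrC addrA.
move=> i Ji; rewrite ltnS => /(ds i Ji).
by move=> H e w e01 Aw; rewrite pderivs_rcons; exact: H.
Qed.

Lemma S_of_pderivs J A G om sh k b mu F :
  (forall s, all J s -> (size s <= k)%N ->
    bnd G om b (mu + \sum_(i <- s) sh i) (fun e => pderivs s (F e))) ->
  (forall s i, all J s -> J i -> (size s < k)%N ->
     net_pdiff A i (fun e => pderivs s (F e))) ->
  S J A G om sh k b mu F.
Proof.
elim: k mu F => [|k IH] mu F bF dF.
  by split => //; have := bF [::] erefl (leqnn _); rewrite big_nil addr0.
split; first by have := bF [::] erefl (leq0n _); rewrite big_nil addr0.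
move=> i Ji; split; first exact: dF [::] i erefl Ji (ltn0Sn _).
apply: IH => [s Js sk|s j Js Jj sk].
  have := bF (rcons s i); rewrite all_rcons Ji Js size_rcons ltnS => /(_ erefl sk).
  have -> : (fun e => pderivs (rcons s i) (F e)) =
      (fun e => pderivs s (net_pderiv i F e)).
    by apply/funext => e; rewrite pderivs_rcons.
  have -> // : mu + \sum_(j <- rcons s i) sh j = mu + sh i + \sum_(j <- s) sh j.
  by rewrite big_rcons /=; ring.
have := dF (rcons s i) j; rewrite all_rcons Ji Js size_rcons ltnS => /(_ erefl Jj sk).
by move=> H e w e01 Aw; have := H e w e01 Aw; rewrite pderivs_rcons.
Qed.

Lemma S_sub J J' A A' G G' om sh k b mu F :
  (forall i, J' i -> J i) -> A' `<=` A -> G' `<=` G ->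
  S J A G om sh k b mu F -> S J' A' G' om sh k b mu F.
Proof.
move=> JJ AA GG; elim: k mu F => [|k IH] mu F [bF SF]; split => //.
- move=> b' /bF[C C0 H]; exists C => //.
  by apply: filterS H => e H w /GG; exact: H.
- move=> b' /bF[C C0 H]; exists C => //.
  by apply: filterS H => e H w /GG; exact: H.
move=> i /JJ/SF[dF SkF]; split; last exact: IH.
by move=> e w e01 /AA; exact: dF.
Qed.

Lemma bnd_union G G' om b mu F :
  bnd G om b mu F -> bnd G' om b mu F -> bnd (G `|` G') om b mu F.
Proof.
move=> bF bF' b' b'b; have [C C0 H] := bF _ b'b; have [C' C'0 H'] := bF' _ b'b.
exists (C + C'); first exact: addr_ge0.
apply: filterS2 H H' => e H H' w Gw.
have ge0 c : 0 <= c -> 0 <= c * e `^ b' * om w `^ mu.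
  by move=> c0; rewrite !mulr_ge0// powR_ge0.
rewrite !mulrDl; case: Gw => Gw.
  by apply: ler_wpDr; [exact: ge0|exact: H].
by apply: ler_wpDl; [exact: ge0|exact: H'].
Qed.

Lemma S_union J A A' G G' om sh k b mu F :
  S J A G om sh k b mu F -> S J A' G' om sh k b mu F ->
  S J (A `|` A') (G `|` G') om sh k b mu F.
Proof.
elim: k mu F => [|k IH] mu F [bF SF] [bF' SF']; split => //; try exact: bnd_union.
move=> i Ji; have [dF SkF] := SF i Ji; have [dF' SkF'] := SF' i Ji.
split; last exact: IH.
by move=> e w e01 [Aw|Aw]; [exact: dF|exact: dF'].
Qed.

Lemma S_sh J A G om sh sh' k b mu F : (forall w, G w -> 1 <= om w) ->
  (forall i, J i -> sh i <= sh' i) ->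
  S J A G om sh k b mu F -> S J A G om sh' k b mu F.
Proof.
move=> om1 shh' SF.
have shs s : all J s -> \sum_(i <- s) sh i <= \sum_(i <- s) sh' i.
  elim: s => [|j s IH] /=; first by rewrite !big_nil.
  by move=> /andP[Jj Js]; rewrite !big_cons lerD ?IH// shh'.
apply: S_of_pderivs => [s Js sk|s i Js Ji sk].
  have [bs _] := S_pderivs SF Js sk.
  by apply: bnd_le bs => //; rewrite lerD2l shs.
by have [_ ds] := S_pderivs SF Js (ltnW sk); exact: ds.
Qed.

(** Existence of the derivatives is part of [S]; their continuity follows from the bounds of one
    order more, on a ball where the weight [om] lies between two constants. *)
Lemma S_smooth A f : open A ->
  (forall k x, A x -> exists r om sh mu M, [/\ 0 < r,
     forall w, `|w - x| < r -> A w /\ 1 <= om w <= M &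
     S predT A [set w | `|w - x| < r] om sh k 0 mu (fun _ => f)]) ->
  smooth_on A f.
Proof.
move=> oA H s.
have ds i x : A x -> pdiff i (pderivs s f) x.
  move=> Ax; have [r [om [sh [mu [M [r0 omM Sf]]]]]] := H (size s).+1 x Ax.
  have [_ ds] := S_pderivs Sf (all_predT s) (leqnSn _).
  by apply: (ds i erefl (ltnSn _) 1); rewrite // ltr01 lexx.
split; last by move=> i x Ax; apply/pdiffP; exact: ds.
move=> x Ax; have [r [om [sh [mu [M [r0 omM Sf]]]]]] := H (size s).+1 x Ax.
have M1 : 1 <= M.
  have xx : `|x - x| < r by rewrite subrr normr0.
  by have [_ /andP[w1 wM]] := omM x xx; exact: le_trans wM.
have bd i : exists B, forall y, `|y - x| < r -> normc (pderiv i (pderivs s f) y) <= B.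
  have [+ _] := S_pderivs (s := i :: s) Sf (all_predT _) (leqnn _).
  (* The net does not depend on e, so a single value of e turns the estimate into a genuine bound;
     -1 stands for any exponent below 0. *)
  move=> /(_ (-1)); rewrite oppr_lt0 => /(_ ltr01)[C cC0 H1].
  have [e [e01 He]] := near0r_ex H1.
  exists (C * e `^ (-1) * M `^ `|mu + \sum_(j <- i :: s) sh j|) => y yx.
  have [_ /andP[w1 wM]] := omM y yx.
  apply: le_trans (He y yx) _; apply: ler_wpM2l; first by rewrite mulr_ge0// powR_ge0.
  apply: (@le_trans _ _ (om y `^ `|mu + \sum_(j <- i :: s) sh j|)).
    by rewrite ler_powR// ler_norm.
  by apply: ge0_ler_powR => //; rewrite nnegrE; lra.
have {bd}[B bd] : exists B, forall i y, `|y - x| < r ->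
    normc (pderiv i (pderivs s f) y) <= B.
  have /choice[B HB] := bd; exists (\sum_i `|B i|) => i y yx.
  apply: le_trans (HB i y yx) _; rewrite (bigD1 i)//=.
  by rewrite (le_trans (ler_norm _))// lerDl sumr_ge0.
split.
  apply: (bounded_partials_continuous (M := B) r0) => i y yx.
  have [Ay _] := omM y yx; have /pdiffP[dR _] := ds i y Ay; split => //.
  exact: le_trans (normc_Re (pderiv i (pderivs s f) y)) (bd i y yx).
apply: (bounded_partials_continuous (M := B) r0) => i y yx.
have [Ay _] := omM y yx; have /pdiffP[_ dI] := ds i y Ay; split => //.
exact: le_trans (normc_Im (pderiv i (pderivs s f) y)) (bd i y yx).
Qed.
End symbol_net_derivatives.

Section coordinate_projection.
Context {R : realType} {d d' : nat}.
Variables (pi : 'rV[R]_d -> 'rV[R]_d') (sg : 'I_d -> option 'I_d').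
Hypothesis piE : forall i (h : R) w, pi (h *: delta_mx 0 i + w) =
  if sg i is Some j then h *: delta_mx 0 j + pi w else pi w.

(** When coordinate [i] moves, the projected point either moves along the coordinate given by [sg i]
    or, for [None], not at all. *)
Lemma pderiv_proj i (f : 'rV[R]_d' -> R[i]) w : pderiv i (fun w => f (pi w)) w =
  if sg i is Some j then pderiv j f (pi w) else 0.
Proof.
have D (h : 'rV[R]_d' -> R) : 'D_(delta_mx 0 i) (fun w => h (pi w)) w =
    'D_(if sg i is Some j then delta_mx 0 j else 0) h (pi w).
  rewrite /derive; set g1 := fun h => h^-1 *: _; set g2 := fun h => h^-1 *: _.
  suff -> : g1 = g2 by [].
  apply/funext => t; rewrite /g1 /g2 /= piE; case: (sg i) => //.
  by rewrite scaler0 add0r.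
rewrite /pderiv /rpderiv (D (fun y => complex.Re (f y))) (D (fun y => complex.Im (f y))).
by case: (sg i) => //; rewrite !derive0.
Qed.

Lemma pdiff_proj i (f : 'rV[R]_d' -> R[i]) w :
  (if sg i is Some j then pdiff j f (pi w) else True) ->
  pdiff i (fun w => f (pi w)) w.
Proof.
have pE h : pi (h *: delta_mx 0 i + w) =
    h *: (if sg i is Some j then delta_mx 0 j else 0) + pi w.
  by rewrite piE; case: (sg i) => //; rewrite scaler0 add0r.
case E : (sg i) => [j|] H; rewrite E in pE; apply: cder_pdiff.
  exact: (cder_affine pE H).
exact: (cder_affine pE (cder0 f _)).
Qed.

Lemma pderivs_proj s (f : 'rV[R]_d' -> R[i]) w : pderivs s (fun w => f (pi w)) w =
  if all (fun i => sg i != None) s then pderivs (pmap sg s) f (pi w) else 0.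
Proof.
elim: s w => [|i s IH] //= w.
have -> : pderivs s (fun w => f (pi w)) = (fun w =>
    if all (fun i => sg i != None) s then pderivs (pmap sg s) f (pi w) else 0).
  by apply/funext => w'; exact: IH.
case: (all (fun i => sg i != None) s); last by rewrite andbF (cder_pderiv (cder_cst _ _ _)).
by rewrite (pderiv_proj i (pderivs (pmap sg s) f)); case: (sg i).
Qed.
End coordinate_projection.

(** * Integration on tuples *)

Section measurability.
Context {R : realType} {d : nat} {dT : measure_display} {T : measurableType dT}.
Variable tau : T -> 'rV[R]_d.
Hypothesis mtau : forall i, measurable_fun setT (fun t => tau t 0 i).

(** An open set is a countable union of cubes with rational centre and size, and the preimage of a
    cube only involves the coordinates, whose measurability is known. *)
Lemma measurable_preimage_open (U : set 'rV[R]_d) : open U -> measurable (tau @^-1` U).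
Proof.
move=> oU.
pose box (q : 'rV[rat]_d * nat) : set 'rV[R]_d :=
  [set v | forall i, `|v 0 i - ratr (q.1 0 i)| < q.2.+1%:R^-1].
have -> : tau @^-1` U = \bigcup_(q : 'rV[rat]_d * nat)
    (if pselect (box q `<=` U) then tau @^-1` box q else set0).
  apply/seteqP; split => [t Ut|t [q _]]; last first.
    by case: pselect => // qU; exact: qU.
  have /nbhs_ballP[r /= r0 rU] := open_nbhs_nbhs (conj oU Ut).
  (* A cube of this size that contains the point lies in its ball of radius [r], as the diameter is
     below [r]. *)
  have [k kr] : exists k : nat, k.+1%:R^-1 < r / 2.
    have r20 : 0 < r / 2 by rewrite divr_gt0.
    have [k _ /(_ k (leqnn k))] := near_infty_natSinv_lt (PosNum r20).
    by exists k.
  have k0 : 0 < k.+1%:R^-1 :> R by rewrite invr_gt0.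
  have H i : exists q : rat, `|tau t 0 i - ratr q| < k.+1%:R^-1.
    move: (k.+1%:R^-1) k0 {kr} => c k0.
    have /rat_in_itvoo[q] : tau t 0 i - c < tau t 0 i + c by lra.
    by rewrite in_itv /= => /andP[q1 q2]; exists q; rewrite ltr_norml; apply/andP; split; lra.
  have /choice[q Hq] := H.
  have tq : box (\row_i q i, k) (tau t) by move=> i /=; rewrite mxE.
  exists (\row_i q i, k) => //; case: pselect => //= nqU; exfalso; apply: nqU => v vq.
  apply: rU; rewrite -ball_normE /ball_ /=; apply: norm_lt_coord => // i.
  rewrite !mxE; have h1 := vq i; have h2 := tq i; rewrite /= mxE in h1 h2.
  rewrite (_ : _ - _ = (tau t 0 i - ratr (q i)) - (v 0 i - ratr (q i))); last by ring.
  move: (k.+1%:R^-1) h1 h2 kr => c h1 h2 kr.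
  by apply: le_lt_trans (ler_normB _ _) _; lra.
apply: countable_bigcupT_measurable => // q; case: pselect => //= _.
have -> : tau @^-1` box q =
    \bigcap_(i in [set: 'I_d]) [set t | `|tau t 0 i - ratr (q.1 0 i)| < q.2.+1%:R^-1].
  by apply/seteqP; split => [t H i _|t H i]; [exact: H|exact: H].
apply: fin_bigcap_measurable => // i _.
have m1 : measurable_fun setT (fun t => `|tau t 0 i - ratr (q.1 0 i)| : R).
  by apply: measurableT_comp => //; apply: measurable_funB => //; exact: mtau.
have := m1 measurableT _ (measurable_itv `]-oo, (q.2.+1%:R^-1 : R)[).
by rewrite setTI; congr measurable; apply/seteqP; split => t; rewrite /= in_itv.
Qed.

Lemma measurable_continuous_comp (U : set 'rV[R]_d) (f : 'rV[R]_d -> R) :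
  open U -> (forall v, U v -> {for v, continuous f}) ->
  measurable_fun (tau @^-1` U) (fun t => f (tau t)).
Proof.
move=> oU cf; apply: (measurability _ (RGenOpens.measurableE R)).
move=> _ [_ [a [b ->] <-]].
have -> : tau @^-1` U `&` (fun t => f (tau t)) @^-1` `]a, b[ =
    tau @^-1` (U `&` f @^-1` `]a, b[) by [].
apply: measurable_preimage_open; rewrite openE => v [Uv fv].
apply: filterI; first exact: open_nbhs_nbhs.
by apply: (cf v Uv); apply: open_nbhs_nbhs; split => //; exact: interval_open.
Qed.
End measurability.

Section weights.
Context {R : realType}.
Local Notation lebesgue := (@lebesgue_measure R).

Definition weight1 (c t : R) : R := (1 + `|t|) `^ (- c).

Lemma weight1_ge0 c t : 0 <= weight1 c t.
Proof. exact: powR_ge0. Qed.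

Lemma continuous_weight1 c : continuous (weight1 c).
Proof.
move=> t; rewrite /weight1.
have H : {for 1 + `|t|, continuous (fun a : R => a `^ (- c))}.
  apply/differentiable_continuous/derivable1_diffP.
  by apply: derivable_powR; rewrite in_itv /= andbT (lt_le_trans ltr01)// lerDl.
apply: (@continuous_comp _ _ _ (fun t : R => 1 + `|t|) (fun a : R => a `^ (- c))) => //.
by apply: continuousD; [exact: cst_continuous|exact: norm_continuous].
Qed.

Lemma measurable_weight1 c : measurable_fun setT (weight1 c).
Proof. by apply: continuous_measurable_fun; exact: continuous_weight1. Qed.

Lemma integral_weight1_pos c : 1 < c ->
  (\int[lebesgue]_(t in `[(0 : R)%R, +oo[) (weight1 c t)%:E < +oo)%E.
Proof.
move=> c1.
(* The primitive of (1 + t)^(-c) that tends to 0 at infinity, as c > 1. *)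
pose F (t : R) := - ((1 + t) `^ (1 - c) * (c - 1)^-1).
have dF (t : R) : 0 <= t -> is_derive t (1 : R) F ((1 + t) `^ (- c)).
  move=> t0; have t10 : 0 < 1 + t by lra.
  have H : is_derive t (1 : R) (fun t : R => 1 + t) 1.
    by apply: (is_derive_eq (is_deriveD (is_derive_cst _ _ _) (is_derive_id _ _))); rewrite add0r.
  have H2 := is_derive_comp1 H (is_derive1_powR (1 - c) t10).
  apply: (is_derive_eq (is_deriveN (is_deriveM H2 (is_derive_cst (c - 1)^-1 _ _)))).
  rewrite scaler0 add0r mulr1 [_ *: _]mulrC.
  have -> : 1 - c - 1 = - c by ring.
  have c10 : c - 1 != 0 by lra.
  by rewrite -opprB mulrC mulrA mulrN mulVf// mulN1r opprK.
rewrite (@ge0_continuous_FTC2y _ _ F 0 0) ?ltry//.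
- by move=> x _; exact: weight1_ge0.
- by apply: continuous_subspaceT; exact: continuous_weight1.
- have -> : 0 = - (0 * (c - 1)^-1) :> R by rewrite mul0r oppr0.
  apply: cvgN; apply: cvgMl.
  have -> : (fun x => (1 + x) `^ (1 - c)) = (fun x => ((1 + x) `^ (c - 1))^-1) :> (R -> R).
    by apply/funext => x; rewrite -powRN opprB.
  apply/cvgrPdist_lt => e e0.
  near=> x; rewrite sub0r normrN ger0_norm ?invr_ge0 ?powR_ge0//.
  rewrite invf_plt ?posrE//; last by rewrite powR_gt0// ltr_pwDl//; near: x; exact: nbhs_pinfty_ge.
  rewrite -[ltLHS]powRr1 ?invr_ge0 ?(ltW e0)// -[X in _ `^ X < _](@divff _ (c - 1)); last by lra.
  rewrite mulrC powRrM; apply: gt0_ltr_powR; rewrite ?nnegrE ?powR_ge0 ?subr_gt0//.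
    by rewrite addr_ge0//; near: x; exact: nbhs_pinfty_ge.
  apply: (@lt_trans _ _ x); last by rewrite ltrDr.
  by near: x; exact: nbhs_pinfty_gt.
- by move=> x x0; have [] := dF x (ltW x0).
- apply: cvg_at_right_filter.
  by have [/derivable1_diffP/differentiable_continuous] := dF 0 (lexx _).
- move=> x; rewrite in_itv /= andbT => x0; rewrite derive1E.
  have [_ ->] := dF x (ltW x0).
  by rewrite /weight1 gtr0_norm.
Unshelve. all: end_near. Qed.

Lemma integral_weight1 c : 1 < c -> (\int[lebesgue]_t (weight1 c t)%:E < +oo)%E.
Proof.
move=> c1; have Hp := integral_weight1_pos c1.
have mw (D : set R) : measurable_fun D (fun t => (weight1 c t)%:E).
  by apply/measurable_EFinP; apply: measurable_funTS; exact: measurable_weight1.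
have -> : [set: R] = `]-oo, 0%R] `|` `]0%R, +oo[ :> set R.
  by apply/seteqP; split => x // _; have [x0|x0] := leP x 0; [left|right]; rewrite /= in_itv /= ?x0.
rewrite ge0_integral_setU//=; last 3 first.
- exact: mw.
- by move=> t _; rewrite lee_fin weight1_ge0.
- apply/disj_setPS => x /= []; rewrite !in_itv /= andbT => h1 h2; lra.
apply: lte_add_pinfty; last first.
  apply: le_lt_trans Hp; apply: ge0_subset_integral => //.
  - exact: mw.
  - by move=> t _; rewrite lee_fin weight1_ge0.
  - by move=> x; rewrite /= !in_itv /= !andbT => /ltW.
have -> : (0 : R) = - 0 by rewrite oppr0.
rewrite (@ge0_integration_by_substitutionNy _ (weight1 c) 0).
- suff -> : weight1 c \o -%R = weight1 c by [].
  by apply/funext => t; rewrite /weight1 /= normrN.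
- by apply: continuous_subspaceT; exact: continuous_weight1.
- by move=> t _; exact: weight1_ge0.
Qed.
End weights.

Section tuple_measure.
Context {R : realType}.
Local Notation lebesgue := (@lebesgue_measure R).
Local Notation T := (measurableTypeR R).

Lemma measurable_tcons n : measurable_fun [set: T * n.-tuple T] (@tcons R n).
Proof. exact: measurable_cons. Qed.

Lemma ge0_integral_lebesgue_tupleS n (f : n.+1.-tuple T -> \bar R) :
  measurable_fun setT f -> (forall t, 0 <= f t)%E ->
  (\int[lebesgue_tuple R n.+1]_t f t =
   \int[lebesgue]_a \int[lebesgue_tuple R n]_t f (tcons (a, t)))%E.
Proof.
move=> mf f0.
have -> : (\int[lebesgue_tuple R n.+1]_t f t =
    \int[lebesgue \x lebesgue_tuple R n]_w f (tcons w))%E.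
  have := @ge0_integral_pushforward _ _ _ _ R (@tcons R n) (@measurable_tcons n)
    (lebesgue \x lebesgue_tuple R n)%E setT f measurableT mf (fun t _ => f0 t).
  by rewrite preimage_setT => <-.
rewrite fubini_tonelli1//.
exact: measurableT_comp mf (@measurable_tcons n).
Qed.

Lemma measurable_prod_tuple n (g : nat -> R -> R) :
  (forall i, measurable_fun setT (g i)) ->
  measurable_fun setT (fun t : n.-tuple T => \prod_(i < n) g i (tnth t i)).
Proof.
move=> mg; apply: measurable_prod => i _.
exact: measurableT_comp (mg i) (measurable_tnth i).
Qed.

(** By Tonelli the integral factors along the recursive construction of the measure, into the first
    coordinate and the tail with [g] shifted by one index. *)
Lemma integral_prod_tuple n (g : nat -> R -> R) :
  (forall i, measurable_fun setT (g i)) -> (forall i t, 0 <= g i t) ->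
  (forall i, \int[lebesgue]_t (g i t)%:E < +oo)%E ->
  (\int[lebesgue_tuple R n]_t (\prod_(i < n) g i (tnth t i))%:E < +oo)%E.
Proof.
elim: n g => [|n IH] g mg g0 gi.
  rewrite (eq_integral (fun=> 1%E)) => [|t _]; last by rewrite big_ord0.
  by rewrite integral_cst// mul1e /= diracE ltry.
rewrite ge0_integral_lebesgue_tupleS; last 2 first.
- by apply/measurable_EFinP; exact: measurable_prod_tuple.
- by move=> t; rewrite lee_fin prodr_ge0.
pose I := (\int[lebesgue_tuple R n]_t (\prod_(i < n) g i.+1 (tnth t i))%:E)%E.
have I0 : (0 <= I)%E by apply: integral_ge0 => t _; rewrite lee_fin prodr_ge0.
have Ioo : (I < +oo)%E by exact: (IH (fun i => g i.+1)).
have Ifin : I \is a fin_num by rewrite ge0_fin_numE.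
rewrite (eq_integral (fun a : T => (fine I)%:E * (g 0%N a)%:E)%E); last first.
  move=> a _; rewrite fineK//.
  rewrite (eq_integral (fun t : n.-tuple T =>
      (g 0%N a)%:E * (\prod_(i < n) g i.+1 (tnth t i))%:E)%E); last first.
    move=> t _; rewrite big_ord_recl EFinM; congr (_%:E * _%:E)%E.
    by apply: eq_bigr => i _; rewrite tnthS.
  have mp : measurable_fun setT (fun t : n.-tuple T =>
      (\prod_(i < n) g i.+1 (tnth t i))%:E).
    by apply/measurable_EFinP; exact: (@measurable_prod_tuple n (fun i => g i.+1)).
  have p0 (t : n.-tuple T) : setT t -> (0 <= (\prod_(i < n) g i.+1 (tnth t i))%:E)%E.
    by move=> _; rewrite lee_fin prodr_ge0.
  by rewrite (ge0_integralZl_EFin _ measurableT p0 mp (g0 0%N a)) muleC.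
have m0 : measurable_fun setT (fun a : T => (g 0%N a)%:E).
  by apply/measurable_EFinP; exact: (mg 0%N).
have p0 (a : T) : setT a -> (0 <= (g 0%N a)%:E)%E by move=> _; rewrite lee_fin.
rewrite (ge0_integralZl_EFin _ measurableT p0 m0 (fine_ge0 I0)).
by apply: lte_mul_pinfty; rewrite ?lee_fin ?fine_ge0.
Qed.
End tuple_measure.

Section measure_preserving.
Context {R : realType}.

Definition mpres d (T : measurableType d) (mu : set T -> \bar R) (psi : T -> T) :=
  measurable_fun setT psi /\ forall A, measurable A -> mu (psi @^-1` A) = mu A.

Lemma mpres_ge0_integral d (T : measurableType d) (mu : {measure set T -> \bar R})
    psi (f : T -> \bar R) : mpres mu psi ->
  measurable_fun setT f -> (forall t, 0 <= f t)%E ->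
  (\int[mu]_t f (psi t) = \int[mu]_t f t)%E.
Proof.
move=> [mpsi pmu] mf f0.
have := @ge0_integral_pushforward _ _ _ _ R psi mpsi mu setT f measurableT mf
  (fun t _ => f0 t).
rewrite preimage_setT => <-; apply: eq_measure_integral => A mA _.
exact: (pmu A mA).
Qed.

Lemma mpres_Rintegral d (T : measurableType d) (mu : {measure set T -> \bar R})
    psi (f : T -> R) : mpres mu psi -> measurable_fun setT f ->
  Rintegral mu setT (fun t => f (psi t)) = Rintegral mu setT f.
Proof.
move=> pmu mf; congr fine; have [mpsi _] := pmu.
have mF : measurable_fun setT (EFin \o f) by exact/measurable_EFinP.
have fpos t : (0 <= (EFin \o f)^\+ t)%E by [].
have fneg t : (0 <= (EFin \o f)^\- t)%E by [].
rewrite [LHS]integralE [RHS]integralE; congr (_ - _)%E.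
  apply: eq_trans (mpres_ge0_integral pmu (measurable_funepos mF) fpos).
  apply: eq_integral => t _.
  by have /(congr1 (@^~ t)) := funepos_comp (EFin \o f) psi.
apply: eq_trans (mpres_ge0_integral pmu (measurable_funeneg mF) fneg).
apply: eq_integral => t _.
by have /(congr1 (@^~ t)) := funeneg_comp (EFin \o f) psi.
Qed.

Lemma mpres_pair1 d1 d2 (T1 : measurableType d1) (T2 : measurableType d2)
    (m1 : {sigma_finite_measure set T1 -> \bar R})
    (m2 : {sigma_finite_measure set T2 -> \bar R}) psi :
  mpres m1 psi -> mpres (m1 \x m2)%E (fun z => (psi z.1, z.2)).
Proof.
move=> pm; have [mpsi _] := pm; split.
  apply/measurable_fun_pairP; split; last exact: measurable_snd.
  exact: measurableT_comp mpsi measurable_fst.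
move=> A mA; rewrite /product_measure1.
by rewrite -(mpres_ge0_integral pm (measurable_fun_xsection m2 mA)).
Qed.

Lemma mpres_pair2 d1 d2 (T1 : measurableType d1) (T2 : measurableType d2)
    (m1 : {sigma_finite_measure set T1 -> \bar R})
    (m2 : {sigma_finite_measure set T2 -> \bar R}) psi :
  mpres m2 psi -> mpres (m1 \x m2)%E (fun z => (z.1, psi z.2)).
Proof.
move=> pm; have [mpsi pm2] := pm; split.
  apply/measurable_fun_pairP; split; first exact: measurable_fst.
  exact: measurableT_comp mpsi measurable_snd.
move=> A mA; rewrite /product_measure1; apply: eq_integral => x _ /=.
have mx : measurable (xsection A x) by exact: measurable_xsection.
by rewrite -(pm2 _ mx).
Qed.

(** Lebesgue measure is determined by its values on the intervals ]a, b], and translation maps these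
    to intervals of the same length. *)
Lemma mpres_shift (s : R) :
  mpres (@lebesgue_measure R) (fun t : measurableTypeR R => t + s).
Proof.
have ms : @measurable_fun _ _ (measurableTypeR R) (measurableTypeR R) setT
    (fun t => t + s).
  apply: (@measurable_funD _ _ R setT (fun t => t) (fun=> s)) => //.
split => // A mA; apply/esym.
pose phi : {mfun measurableTypeR R >-> measurableTypeR R} :=
  HB.pack (fun t : measurableTypeR R => t + s) (isMeasurableFun.Build _ _ _ _ _ ms).
apply: (@lebesgue_measure_unique R (pushforward (@lebesgue_measure R) phi)) => //.
move=> _ [[a b] _ <-] /=; rewrite /pushforward.
have -> : phi @^-1` `]a, b] = `](a - s), (b - s)]%classic.
  by apply/seteqP; split => x /=; rewrite !in_itv /= ltrBlDr lerBrDr.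
rewrite !lebesgue_measure_itv /= !lte_fin ltrD2r; case: ifP => // _.
by rewrite -!EFinB; congr EFin; ring.
Qed.
End measure_preserving.

Section tuple_shift.
Context {R : realType}.
Local Notation T := (measurableTypeR R).

Definition tshift n (i : nat) (s : R) (t : n.-tuple T) : n.-tuple T :=
  [tuple (if j == i :> nat then tnth t j + s else tnth t j) | j < n].

Lemma tshift_tcons0 n (s : R) (w : T * n.-tuple T) :
  tshift 0 s (tcons w) = tcons (w.1 + s, w.2).
Proof.
apply/eq_from_tnth => j; rewrite tnth_mktuple.
by case: (unliftP ord0 j) => [k ->|->] /=; rewrite ?tnthS ?tnth0.
Qed.

Lemma tshift_tconsS n i (s : R) (w : T * n.-tuple T) :
  tshift i.+1 s (tcons w) = tcons (w.1, tshift i s w.2).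
Proof.
apply/eq_from_tnth => j; rewrite tnth_mktuple.
case: (unliftP ord0 j) => [k ->|->] /=; rewrite ?tnthS ?tnth0//.
by rewrite tnth_mktuple /bump /= add1n eqSS.
Qed.

Lemma measurable_tshift n i (s : R) : measurable_fun setT (@tshift n i s).
Proof.
apply/measurable_fun_tnthP => j.
have -> : (@tnth n T ^~ j) \o (@tshift n i s) =
    if j == i :> nat then (fun t => tnth t j + s) else (fun t => tnth t j).
  by apply/funext => t /=; rewrite tnth_mktuple; case: ifP.
case: ifP => _; last exact: measurable_tnth.
apply: (@measurable_funD _ _ R setT (fun t => tnth t j) (fun=> s)) => //.
exact: measurable_tnth.
Qed.

(** A shift of coordinate 0 acts on the first factor of the product measure, any other one on the
    tail, where the induction hypothesis applies. *)
Lemma mpres_tshift n i (s : R) : mpres (lebesgue_tuple R n) (@tshift n i s).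
Proof.
elim: n i => [|n IH] i; first split; first exact: measurable_tshift.
  have -> : @tshift 0 i s = id.
    apply/funext => t; apply: eq_from_tnth => j.
    by have := ltn_ord j; rewrite ltn0.
  by [].
split; first exact: measurable_tshift.
move=> A mA; rewrite /= /lebesgue_cons /pushforward.
have mA' : measurable (@tcons R n @^-1` A).
  by rewrite -[_ @^-1` _]setTI; exact: measurable_tcons.
case: i => [|i].
  have [_ E] := mpres_pair1 (lebesgue_tuple R n) (mpres_shift s).
  apply: etrans (E _ mA'); congr product_measure1.
  by apply/funext => w; rewrite /preimage /mkset tshift_tcons0.
have [_ E] := mpres_pair2 (@lebesgue_measure R) (IH i).
apply: etrans (E _ mA'); congr product_measure1.
by apply/funext => w; rewrite /preimage /mkset tshift_tconsS.
Qed.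
End tuple_shift.

Section integral_of_derivative.
Context {R : realType} {d : measure_display} {T : measurableType d}.
Variable mu : {measure set T -> \bar R}.

(* Differentiating the constant function [s |-> int G o psi_s]. *)
Lemma integral_flow_derivative (psi : R -> T -> T) (G DG M : T -> R) :
  (forall s, mpres mu (psi s)) -> (forall t, psi 0 t = t) ->
  measurable_fun setT G -> (forall t, 0 <= M t) ->
  mu.-integrable setT (EFin \o M) ->
  (forall (s : R) t, `|s| < 1 -> [/\ `|G (psi s t)| <= M t, `|DG (psi s t)| <= M t &
     is_derive s (1 : R) (fun s => G (psi s t)) (DG (psi s t))]) ->
  Rintegral mu setT DG = 0.
Proof.
move=> pmu psi0 mG M0 iM H.
pose f s t := G (psi s t).
have I1 (s : R) : `]-1, 1[%classic s -> `|s| < 1.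
  by rewrite /= in_itv /= ltr_norml.
have intf s : `]-1, 1[%classic s -> mu.-integrable setT (EFin \o f s).
  move=> /I1 s1; apply: (le_integrable measurableT _ _ iM) => /=.
    by apply/measurable_EFinP; apply: measurableT_comp => //; have [] := pmu s.
  by move=> t _; rewrite lee_fin (ger0_norm (M0 t)); have [] := H s t s1.
have df s t : `]-1, 1[%classic s -> setT t -> derivable (f ^~ t) s 1.
  by move=> /I1 s1 _; have [_ _ []] := H s t s1.
have dfE s t : `|s| < 1 -> partial1of2 f s t = DG (psi s t).
  by move=> s1; rewrite partial1of2E; have [_ _ [_ <-]] := H s t s1.
have G_ub s t : `]-1, 1[%classic s -> setT t -> `|partial1of2 f s t| <= M t.
  by move=> /I1 s1 _; rewrite dfE//; have [] := H s t s1.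
have Ia : `]-1, 1[%classic (0 : R) by rewrite /= in_itv /= ltrN10 ltr01.
have := differentiation_under_integral measurableT Ia intf df M0 iM G_ub.
have -> : (fun s => Rintegral mu setT (fun t => f s t)) = (fun=> Rintegral mu setT G).
  by apply/funext => s; exact: (mpres_Rintegral (pmu s) mG).
rewrite derive1_cst => E; apply: etrans (esym E).
apply: eq_Rintegral => t _ /=; rewrite dfE ?psi0//.
by rewrite normr0 ltr01.
Qed.
End integral_of_derivative.

Section product_integrability.
Context {R : realType} {d1 d2 : measure_display}.
Context {T1 : measurableType d1} {T2 : measurableType d2}.
Variables (m1 : {sigma_finite_measure set T1 -> \bar R})
  (m2 : {sigma_finite_measure set T2 -> \bar R}).

Lemma integrable_tensor (f1 : T1 -> R) (f2 : T2 -> R) :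
  measurable_fun setT f1 -> measurable_fun setT f2 ->
  (forall x, 0 <= f1 x) -> (forall y, 0 <= f2 y) ->
  (\int[m1]_x (f1 x)%:E < +oo)%E -> (\int[m2]_x (f2 x)%:E < +oo)%E ->
  (m1 \x m2)%E.-integrable setT (fun z => (f1 z.1 * f2 z.2)%:E).
Proof.
move=> mf1 mf2 f10 f20 i1 i2.
have mF : measurable_fun setT (fun z : T1 * T2 => (f1 z.1 * f2 z.2)%:E).
  apply/measurable_EFinP; apply: measurable_funM.
    exact: measurableT_comp mf1 measurable_fst.
  exact: measurableT_comp mf2 measurable_snd.
apply/integrableP; split => //.
rewrite (eq_integral (fun z : T1 * T2 => (f1 z.1 * f2 z.2)%:E)); last first.
  by move=> z _; rewrite gee0_abs// lee_fin mulr_ge0.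
rewrite fubini_tonelli1//; last by move=> z; rewrite lee_fin mulr_ge0.
pose I := (\int[m2]_x (f2 x)%:E)%E.
have I0 : (0 <= I)%E by apply: integral_ge0 => t _; rewrite lee_fin.
have Ifin : I \is a fin_num by rewrite ge0_fin_numE.
have m2' : measurable_fun setT (fun y => (f2 y)%:E) by apply/measurable_EFinP.
have m1' : measurable_fun setT (fun y => (f1 y)%:E) by apply/measurable_EFinP.
have p2 y : setT y -> (0 <= (f2 y)%:E)%E by move=> _; rewrite lee_fin.
have p1 y : setT y -> (0 <= (f1 y)%:E)%E by move=> _; rewrite lee_fin.
rewrite (eq_integral (fun x : T1 => (fine I)%:E * (f1 x)%:E)%E); last first.
  move=> x _; rewrite fineK// /fubini_F /=.
  under eq_integral do rewrite EFinM.
  by rewrite (ge0_integralZl_EFin _ measurableT p2 m2' (f10 x)) muleC.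
rewrite (ge0_integralZl_EFin _ measurableT p1 m1' (fine_ge0 I0)).
by apply: lte_mul_pinfty; rewrite ?lee_fin ?fine_ge0.
Qed.
End product_integrability.

Section phase_space_integrability.
Context {R : realType} {n p : nat}.
Local Notation T := (measurableTypeR R).
Local Notation vec d := ('rV[R]_d).

Definition phase_measure : set (n.-tuple T * p.-tuple T) -> \bar R :=
  (lebesgue_tuple R n \x lebesgue_tuple R p)%E.

HB.instance Definition _ := Measure.on phase_measure.

(** The common dominating function: a symbol of order [mu] whose y ranges over a bounded set is at
    most a constant times it. *)
Definition box_weight (r mu : R) (t : n.-tuple T * p.-tuple T) : R :=
  ((`|row_of_tuple t.1| <= r)%R)%:R * japanese (row_of_tuple t.2) `^ mu.

Lemma box_weight_ge0 r mu t : 0 <= box_weight r mu t.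
Proof. by rewrite /box_weight mulr_ge0// powR_ge0. Qed.

Lemma enorm_ge0 d (v : vec d) : 0 <= enorm v.
Proof. exact: sqrtr_ge0. Qed.

Lemma sqr_enorm d (v : vec d) : enorm v ^+ 2 = \sum_i v 0 i ^+ 2.
Proof. by rewrite sqr_sqrtr// sumr_ge0// => i _; exact: sqr_ge0. Qed.

Lemma japanese_ge1 d (v : vec d) : 1 <= japanese v.
Proof.
by rewrite -[leLHS]sqrtr1; apply: ler_wsqrtr; rewrite lerDl; exact: sqr_ge0.
Qed.

Lemma japanese_gt0 d (v : vec d) : 0 < japanese v.
Proof. exact: lt_le_trans ltr01 (japanese_ge1 v). Qed.

Lemma sqr_japanese d (v : vec d) : japanese v ^+ 2 = 1 + \sum_i v 0 i ^+ 2.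
Proof.
by rewrite -sqr_enorm sqr_sqrtr//; apply: addr_ge0 => //; exact: sqr_ge0.
Qed.

Lemma coord_le_enorm d (v : vec d) i : `|v 0 i| <= enorm v.
Proof.
rewrite -(@ler_pXn2r _ 2)// ?nnegrE ?enorm_ge0// sqr_enorm real_normK ?num_real//.
by rewrite (bigD1 i)//= lerDl sumr_ge0// => j _; exact: sqr_ge0.
Qed.

Lemma enorm_le_japanese d (v : vec d) : enorm v <= japanese v.
Proof.
rewrite -(@ler_pXn2r _ 2)// ?nnegrE ?enorm_ge0 ?(ltW (japanese_gt0 v))//.
by rewrite sqr_japanese sqr_enorm lerDr.
Qed.

Lemma measurable_row_of_tuple d (i : 'I_d) :
  measurable_fun setT (fun t : d.-tuple T => row_of_tuple t 0 i).
Proof.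
by under eq_fun do rewrite mxE; exact: measurable_tnth.
Qed.

Lemma continuous_coord d (i : 'I_d) : continuous (fun v : vec d => v 0 i).
Proof. exact: coord_continuous. Qed.

Lemma continuous_sum_sqr d : continuous (fun v : vec d => \sum_i v 0 i ^+ 2).
Proof.
apply: continuous_big => //; first exact: add_continuous.
move=> i _ w.
apply: (@continuous_comp _ _ _ (fun v : vec d => v 0 i) (fun x : R => x ^+ 2)).
  exact: continuous_coord.
exact: exprn_continuous.
Qed.

Lemma continuous_enorm d : continuous (@enorm R d).
Proof.
move=> v; apply: (@continuous_comp _ _ _ (fun v : vec d => \sum_i v 0 i ^+ 2) Num.sqrt).
  exact: continuous_sum_sqr.
exact: sqrt_continuous.
Qed.

Lemma continuous_japanese d : continuous (@japanese R d).
Proof.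
move=> v.
apply: (@continuous_comp _ _ _ (fun v : vec d => 1 + enorm v ^+ 2) Num.sqrt).
  apply: continuousD; first exact: cst_continuous.
  apply: (@continuous_comp _ _ _ (@enorm R d) (fun x : R => x ^+ 2)).
    exact: continuous_enorm.
  exact: exprn_continuous.
exact: sqrt_continuous.
Qed.

Lemma measurable_box_weight r mu : measurable_fun setT (box_weight r mu).
Proof.
apply: measurable_funM.
  have mn : measurable_fun setT
      (fun t : n.-tuple T * p.-tuple T => `|row_of_tuple t.1|).
    have := @measurable_continuous_comp R n _ (n.-tuple T * p.-tuple T)%type
      (fun t => row_of_tuple t.1) _ setT (fun v => `|v|) openT
      (fun v _ => @norm_continuous _ _ v).
    rewrite preimage_setT; apply => i.
    exact: measurableT_comp (measurable_row_of_tuple i) measurable_fst.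
  have mi : measurable_fun setT (fun x : R => ((x <= r)%R)%:R : R).
    have -> : (fun x : R => ((x <= r)%R)%:R : R) = \1_(`]-oo, r]%classic : set R).
      by apply/funext => x; rewrite indicE mem_setE in_itv.
    exact: measurable_indic.
  exact: measurableT_comp mi mn.
apply: measurableT_comp (measurable_powR mu) _.
have := @measurable_continuous_comp R p _ (n.-tuple T * p.-tuple T)%type
  (fun t => row_of_tuple t.2) _ setT (@japanese R p) openT
  (fun v _ => @continuous_japanese p v).
rewrite preimage_setT; apply => i.
exact: measurableT_comp (measurable_row_of_tuple i) measurable_snd.
Qed.

(** From 1 + |xi_i| <= 2 <xi> each factor (1 + |xi_i|)^(-c) is at least (2 <xi>)^(-c). The
    comparison reduces integrability in p variables to one variable. *)
Lemma japanese_le_prod (c : R) (t : p.-tuple T) : 0 <= c ->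
  japanese (row_of_tuple t) `^ (- c * p%:R) <=
  2 `^ (c * p%:R) * \prod_(i < p) weight1 c (tnth t i).
Proof.
move=> c0; set q := japanese _.
have q1 : 1 <= q by exact: japanese_ge1.
have q0 : 0 < q by exact: japanese_gt0.
have -> : q `^ (- c * p%:R) = 2 `^ (c * p%:R) * \prod_(i < p) (2 * q) `^ (- c).
  rewrite prodr_const card_ord -powR_mulrn ?powR_ge0// -powRrM powRM ?(ltW q0)//.
  by rewrite mulrA -powR_gtD// mulNr subrr powRr0 mul1r.
rewrite ler_wpM2l ?powR_ge0//; apply: ler_prod => i _; rewrite powR_ge0 /=.
rewrite /weight1 !powRN lef_pV2 ?posrE ?powR_gt0 ?mulr_gt0 ?ltr_pwDl//.
apply: ge0_ler_powR; rewrite ?nnegrE ?addr_ge0 ?mulr_ge0 ?(ltW q0)//.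
have := coord_le_enorm (row_of_tuple t) i; rewrite mxE => h.
have := enorm_le_japanese (row_of_tuple t); rewrite -/q => h2.
by rewrite mulr_natl mulr2n lerD// (le_trans h).
Qed.

Lemma integrable_box_weight (r mu : R) : mu < - p%:R ->
  phase_measure.-integrable setT (EFin \o box_weight r mu).
Proof.
move=> mup.
(* The decay <xi>^mu is spread evenly over the [p] coordinates, each of which gets an exponent above
   1. For p = 0 the product is empty and 2 is an arbitrary choice. *)
pose c := if p == 0%N then 2 else - mu / p%:R.
have c1 : 1 < c.
  rewrite /c; case: ifPn => [_|]; first by rewrite ltr1n.
  by rewrite -lt0n => p0; rewrite ltr_pdivlMr ?ltr0n// mul1r ltrNr.
pose g (i : nat) (x : R) : R := ((`|x| <= r)%R)%:R.
pose f1 (t : n.-tuple T) : R := \prod_(i < n) g i (tnth t i).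
pose f2 (t : p.-tuple T) : R := \prod_(i < p) weight1 c (tnth t i).
have f10 t : 0 <= f1 t by apply: prodr_ge0 => i _; exact: ler0n.
have f20 t : 0 <= f2 t by apply: prodr_ge0 => i _; exact: weight1_ge0.
have mg i : measurable_fun setT (g i).
  have -> : g i = \1_(`[- r, r]%classic : set R).
    by apply/funext => x; rewrite indicE mem_setE in_itv /= -ler_norml.
  exact: measurable_indic.
have gi i : (\int[lebesgue_measure]_t (g i t)%:E < +oo)%E.
  have -> : g i = \1_(`[- r, r]%classic : set R).
    by apply/funext => x; rewrite indicE mem_setE in_itv /= -ler_norml.
  have : (@lebesgue_measure R (`[(- r)%R, r]%classic : set R) < +oo)%E.
    by rewrite lebesgue_measure_itv; case: ifP => _; rewrite ?ltry// -EFinD ltry.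
  by rewrite integral_indic//; rewrite setIT.
have H t : box_weight r mu t <= 2 `^ (c * p%:R) * (f1 t.1 * f2 t.2).
  rewrite mulrCA; apply: ler_pM; [exact: ler0n|exact: powR_ge0| |].
    case: (boolP (`|row_of_tuple t.1| <= r)) => [yr|_]; last exact: f10.
    rewrite /f1 big1// => i _; rewrite /g; suff -> : `|tnth t.1 i| <= r by [].
    by apply: le_trans yr; have := coord_le_norm (row_of_tuple t.1) i; rewrite mxE.
  apply: le_trans (japanese_le_prod t.2 (ltW (lt_trans ltr01 c1))).
  apply: ler_powR; first exact: japanese_ge1.
  rewrite /c; case: ifPn => [/eqP p0|p0].
    by apply: le_trans (ltW mup) _; rewrite p0 mulr0 oppr0.
  by rewrite -[- (_ / _)]mulNr opprK divfK// pnatr_eq0.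
have If : phase_measure.-integrable setT
    (fun t => (2 `^ (c * p%:R))%:E * (f1 t.1 * f2 t.2)%:E)%E.
  apply: integrableZl => //; apply: integrable_tensor => //.
  - exact: (@measurable_prod_tuple R n g).
  - exact: (@measurable_prod_tuple R p (fun=> weight1 c) (fun=> @measurable_weight1 R c)).
  - by apply: (@integral_prod_tuple R n g) => // i t; exact: ler0n.
  - apply: (@integral_prod_tuple R p (fun=> weight1 c)) => i.
    + exact: measurable_weight1.
    + by move=> t; exact: weight1_ge0.
    + exact: integral_weight1.
apply: (le_integrable measurableT _ _ If) => /=.
  by apply/measurable_EFinP; exact: measurable_box_weight.
move=> t _; rewrite lee_fin (ger0_norm (box_weight_ge0 _ _ _)).
by apply: le_trans (H t) _; exact: ler_norm.
Qed.
End phase_space_integrability.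

(** * Growth of nets *)

Section growth.
Context {R : realType}.
Local Notation normc := (@Normc.normc R).
Implicit Types (f g : R -> \bar R) (b c : R).

(** The scalar counterpart of [bnd]: an estimate for every exponent below [b], so that constants and
    slow scale factors leave [b] unchanged. *)
Definition growth b f := forall b', b' < b -> exists2 C, 0 <= C &
  \forall e \near 0^'+, (f e <= (C * e `^ b')%:E)%E.

Lemma growth_le b c f g : c <= b -> (\forall e \near 0^'+, (g e <= f e)%E) ->
  growth b f -> growth c g.
Proof.
move=> cb gf fb b' b'c; have [|C C0 H] := fb b'; first exact: lt_le_trans cb.
by exists C => //; apply: filterS2 gf H => e; exact: le_trans.
Qed.

Lemma powR_expn (e : R) k : 0 < e -> e ^+ k = e `^ k%:R.
Proof. by move=> e0; rewrite powR_mulrn// ltW. Qed.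

Lemma powR_expnN (e : R) k : 0 < e -> e ^- k = e `^ (- k%:R).
Proof. by move=> e0; rewrite powR_invn// ltW. Qed.

Lemma bigO_growth b f (g : R -> R) : (forall e, 0 < e <= 1 -> g e = e `^ b) ->
  bigO_eps f g -> growth b f.
Proof.
move=> gE [C H] b' b'b; exists `|C| => //.
apply: filterS2 near0r01 H => e e01 H; apply: le_trans H _.
rewrite gE// lee_fin; apply: (@le_trans _ _ (`|C| * e `^ b)).
  by rewrite ler_wpM2r ?powR_ge0 ?ler_norm.
rewrite ler_wpM2l//; apply: ger_powR => //; exact: ltW.
Qed.

Lemma bigO_powR_growth b f : bigO_eps f (fun e => e `^ b) -> growth b f.
Proof. exact: bigO_growth. Qed.

Lemma bigO_expN_growth N f : bigO_eps f (fun e => e ^- N) -> growth (- N%:R) f.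
Proof. by apply: bigO_growth => e /andP[e0 _]; rewrite powR_expnN. Qed.

Lemma negligible_growth f b :
  (forall k : nat, bigO_eps f (fun e => e ^+ k)) -> growth b f.
Proof.
move=> H; pose k := (Num.truncn `|b|).+1.
have bk : b <= k%:R by rewrite (le_trans (ler_norm _))// ltW// truncnS_gt.
apply: (@growth_le k%:R _ f) => //; first by apply: nearW.
apply: (@bigO_growth _ _ (fun e => e ^+ k)) (H k) => e /andP[e0 _].
exact: powR_expn.
Qed.

Lemma growth_bigO b b' f : growth b f -> b' < b -> bigO_eps f (fun e => e `^ b').
Proof. by move=> fb /fb[C C0 H]; exists C. Qed.

Lemma growth_negligible f : (forall b, growth b f) ->
  forall k : nat, bigO_eps f (fun e => e ^+ k).
Proof.
move=> H k; have [C H'] : bigO_eps f (fun e => e `^ k%:R).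
  by apply: (@growth_bigO (k%:R + 1)) => //; rewrite ltrDl.
by exists C; apply: filterS2 near0r01 H' => e /andP[e0 _]; rewrite powR_expn.
Qed.

Lemma growth_moderate b f : growth b f -> forall N : nat, - b < N%:R ->
  bigO_eps f (fun e => e ^- N).
Proof.
move=> H N bN.
have [C H'] : bigO_eps f (fun e => e `^ (- N%:R)).
  by apply: growth_bigO H _; rewrite ltrNl.
by exists C; apply: filterS2 near0r01 H' => e /andP[e0 _]; rewrite powR_expnN.
Qed.

Lemma growth_moderate_ex b f : growth b f -> exists N : nat,
  bigO_eps f (fun e => e ^- N).
Proof.
move=> H; exists (Num.truncn `|b|).+1; apply: (growth_moderate H).
by rewrite (le_lt_trans (ler_norm _))// normrN truncnS_gt.
Qed.

(** Given b' < 0, the slow scale condition with q = -1/b' reads |w|^q <= c / e, and its power of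
    exponent 1/q = -b' is |w| <= c^(-b') e^b'. *)
Lemma slow_scale_growth f (w : R -> R[i]) : slow_scale w ->
  bigO_eps f (fun e => normc (w e)) -> growth 0 f.
Proof.
move=> sw [C H] b' b'0.
have q0 : 0 < - b'^-1 by rewrite oppr_gt0 invr_lt0.
have [c [c0 Hc]] := sw _ (ltW q0).
exists (`|C| * c `^ (- b')); first by rewrite mulr_ge0// powR_ge0.
apply: filterS2 near0r01 H => e e01 H; apply: le_trans H _; rewrite lee_fin.
have e0 : 0 < e by case/andP: e01.
apply: (@le_trans _ _ (`|C| * normc (w e))).
  by rewrite ler_wpM2r ?normc_ge0 ?ler_norm.
rewrite -mulrA ler_wpM2l//.
have -> : c `^ (- b') * e `^ b' = (c * e^-1) `^ (- b').
  rewrite powRM ?invr_ge0 ?(ltW c0) ?(ltW e0)//; congr (_ * _).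
  by rewrite -powR_inv1 ?(ltW e0)// -powRrM mulN1r opprK.
have -> : normc (w e) = (normc (w e) `^ (- b'^-1)) `^ (- b').
  rewrite -powRrM mulrNN mulVf ?lt_eqF// powRr1//; exact: normc_ge0.
apply: ge0_ler_powR; rewrite ?nnegrE ?powR_ge0 ?oppr_ge0 ?(ltW b'0)//.
  by rewrite mulr_ge0 ?invr_ge0 ?(ltW c0) ?(ltW e0).
exact: Hc.
Qed.

Lemma growthD b f g h : (forall e, (h e <= f e + g e)%E) ->
  growth b f -> growth b g -> growth b h.
Proof.
move=> hfg fb gb b' b'b; have [C C0 H] := fb _ b'b; have [D D0 H'] := gb _ b'b.
exists (C + D); first exact: addr_ge0.
apply: filterS2 H H' => e H H'; apply: le_trans (hfg e) _.
by rewrite mulrDl EFinD leeD.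
Qed.
End growth.

(** * Symbols and homogeneous functions as nets with estimates *)

Section submatrix_topology.
Context {R : realType}.

Lemma row_mx_addZ d p (t : R) (u u' : 'rV[R]_d) (v v' : 'rV[R]_p) :
  t *: row_mx u v + row_mx u' v' = row_mx (t *: u + u') (t *: v + v').
Proof. by rewrite scale_row_mx add_row_mx. Qed.

Lemma delta_lshift d p (i : 'I_d) :
  delta_mx 0 (lshift p i) = row_mx (delta_mx 0 i) 0 :> 'rV[R]_(d + p).
Proof.
apply/rowP => j; case: (fintype.splitP j) => k jk.
  by rewrite (_ : j = lshift p k) ?row_mxEl ?mxE ?(inj_eq (@lshift_inj _ _))//; exact: val_inj.
rewrite (_ : j = rshift d k) ?row_mxEr ?mxE; last exact: val_inj.
by rewrite eq_rlshift andbF.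
Qed.

Lemma delta_rshift d p (i : 'I_p) :
  delta_mx 0 (rshift d i) = row_mx 0 (delta_mx 0 i) :> 'rV[R]_(d + p).
Proof.
apply/rowP => j; case: (fintype.splitP j) => k jk.
  rewrite (_ : j = lshift p k) ?row_mxEl ?mxE; last exact: val_inj.
  by rewrite eq_lrshift andbF.
by rewrite (_ : j = rshift d k) ?row_mxEr ?mxE ?(inj_eq (@rshift_inj _ _))//; exact: val_inj.
Qed.

Lemma lsubmx_addZ d p (t : R) (u v : 'rV[R]_(d + p)) :
  lsubmx (t *: u + v) = t *: lsubmx u + lsubmx v.
Proof. by apply/rowP => j; rewrite !mxE. Qed.

Lemma rsubmx_addZ d p (t : R) (u v : 'rV[R]_(d + p)) :
  rsubmx (t *: u + v) = t *: rsubmx u + rsubmx v.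
Proof. by apply/rowP => j; rewrite !mxE. Qed.

Lemma continuous_lsubmx d p : continuous (@lsubmx R 1 d p : 'rV[R]_(d + p) -> 'rV[R]_d).
Proof.
move=> v; apply/differentiable_continuous; exact: differentiable_lsubmx.
Qed.

Lemma continuous_rsubmx d p : continuous (@rsubmx R 1 d p : 'rV[R]_(d + p) -> 'rV[R]_p).
Proof.
move=> v; apply/differentiable_continuous; exact: differentiable_rsubmx.
Qed.

Lemma open_lsubmx d p (X : set 'rV[R]_d) : open X ->
  open [set w : 'rV[R]_(d + p) | X (lsubmx w)].
Proof.
by move=> oX; have /continuousP H := @continuous_lsubmx d p; exact: H.
Qed.

Lemma open_rsubmx d p (X : set 'rV[R]_p) : open X ->
  open [set w : 'rV[R]_(d + p) | X (rsubmx w)].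
Proof.
by move=> oX; have /continuousP H := @continuous_rsubmx d p; exact: H.
Qed.
End submatrix_topology.

Section symbol_seminorms.
Context {R : realType} {d p : nat}.
Local Notation normc := (@Normc.normc R).
Local Notation net := (R -> 'rV[R]_(d + p) -> R[i]).
Implicit Types (X K : set 'rV[R]_d) (a : net) (s : seq 'I_(d + p)).

(** The change of order under one derivative of a symbol of type (rho, delta). *)
Definition shf (rho delta : R) (i : 'I_(d + p)) : R :=
  match fintype.split i with inl _ => delta | inr _ => - rho end.

Definition omega (w : 'rV[R]_(d + p)) : R := japanese (rsubmx w).

Definition over X : set 'rV[R]_(d + p) := [set w | X (lsubmx w)].

Definition over_ne0 X : set 'rV[R]_(d + p) := [set w | X (lsubmx w) /\ rsubmx w != 0].

Definition zcount s (l : 'I_d) := count_mem (lshift p l) s.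
Definition xicount s (l : 'I_p) := count_mem (rshift d l) s.

Lemma mpair_count s : mpair (zcount s) (xicount s) =1 (fun i => count_mem i s).
Proof.
move=> i; rewrite /mpair; case: (fintype.splitP i) => k ik.
  by rewrite /zcount (_ : i = lshift p k)//; exact: val_inj.
by rewrite /xicount (_ : i = rshift d k)//; exact: val_inj.
Qed.

Lemma pderivs_mpair A s (f : 'rV[R]_(d + p) -> R[i]) w : open A -> smooth_on A f -> A w ->
  pderivs s f w = mderiv (mpair (zcount s) (xicount s)) f w.
Proof.
move=> oA sf Aw; rewrite (pderivs_mderiv s oA sf Aw) /mderiv.
by congr (pderivs (flatten _) f w); apply: eq_map => i; rewrite mpair_count.
Qed.

Lemma mlen_zxicount s : (mlen (xicount s) + mlen (zcount s))%N = size s.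
Proof.
rewrite -[RHS]mlen_count /mlen big_split_ord /= addnC; congr (_ + _)%N.
Qed.

Lemma sum_shf rho delta s : \sum_(i <- s) shf rho delta i =
  delta * (mlen (zcount s))%:R - rho * (mlen (xicount s))%:R.
Proof.
elim: s => [|i s IH].
  by rewrite big_nil /mlen !big1// !mulr0 subr0.
have E1 (m : nat) (k : 'I_m) (F : 'I_m -> nat) :
    (\sum_l ((k == l) + F l) = 1 + \sum_l F l)%N.
  rewrite big_split /= (bigD1 k)//= eqxx big1 ?addn0// => l.
  by rewrite eq_sym => /negbTE ->.
rewrite big_cons IH /shf; case: (fintype.splitP i) => k ik.
  have -> : i = lshift p k by exact: val_inj.
  have -> : mlen (zcount (lshift p k :: s)) = (1 + mlen (zcount s))%N.
    by rewrite -(E1 _ k); apply: eq_bigr => l _; rewrite /zcount /= eq_lshift.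
  have -> : mlen (xicount (lshift p k :: s)) = mlen (xicount s).
    by apply: eq_bigr => l _; rewrite /xicount /= eq_lrshift.
  by rewrite natrD; ring.
have -> : i = rshift d k by exact: val_inj.
have -> : mlen (xicount (rshift d k :: s)) = (1 + mlen (xicount s))%N.
  by rewrite -(E1 _ k); apply: eq_bigr => l _; rewrite /xicount /= eq_rshift.
have -> : mlen (zcount (rshift d k :: s)) = mlen (zcount s).
  by apply: eq_bigr => l _; rewrite /zcount /= eq_rlshift.
by rewrite natrD; ring.
Qed.

Lemma omega_ge1 w : 1 <= omega w.
Proof. exact: japanese_ge1. Qed.

Lemma omega_gt0 w : 0 < omega w.
Proof. exact: japanese_gt0. Qed.

Lemma open_over X : open X -> open (over X).
Proof. exact: open_lsubmx. Qed.

Lemma open_ne0 : open [set xi : 'rV[R]_p | xi != 0].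
Proof.
have -> : [set xi : 'rV[R]_p | xi != 0] = (fun xi : 'rV[R]_p => `|xi|) @^-1` [set r | 0 < r].
  by apply/seteqP; split => x; rewrite /= normr_gt0.
have /continuousP H := @norm_continuous R 'rV[R]_p.
by apply: H; exact: open_gt.
Qed.

Lemma open_over_ne0 X : open X -> open (over_ne0 X).
Proof.
by move=> oX; apply: openI; [exact: open_lsubmx|exact: (open_rsubmx open_ne0)].
Qed.

(** By [sum_shf] the weight in [symb_norm] is the inverse of [omega] to the order reached after the
    derivatives; smoothness lets words be replaced by multi-indices. *)
Lemma S_symbol X K m rho delta k b a : open X -> K `<=` X ->
  (forall e, 0 < e <= 1 -> smooth_on (over X) (a e)) ->
  growth b (fun e => symb_norm m rho delta K k (a e)) ->
  S predT (over X) (over K) omega (shf rho delta) k b m a.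
Proof.
move=> oX KX sa Ha; apply: S_of_pderivs => [s _ sk|s i _ _ sk e w e01 Aw]; last first.
  exact: (smooth_on_pdiff _ _ (sa e e01)).
move=> b' b'b; have [C C0 H] := Ha b' b'b; exists C => //.
apply: filterS2 near0r01 H => e e01 H w Kw.
have Aw : over X w by exact: KX.
rewrite (pderivs_mpair s (open_over oX) (sa e e01) Aw).
rewrite sum_shf; set al := xicount s; set be := zcount s.
have := le_trans (ereal_sup_ubound _) H.
move=> /(_ (japanese (rsubmx w) `^ (- m + rho * (mlen al)%:R - delta * (mlen be)%:R)
          * normc (mderiv (mpair be al) (a e) (row_mx (lsubmx w) (rsubmx w))))%:E).
rewrite hsubmxK lee_fin => /(_ _)h.
rewrite mulrC -ler_pdivrMl ?powR_gt0 ?omega_gt0// -powRN.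
apply: le_trans (h _); last first.
  exists (lsubmx w), (rsubmx w), be, al; rewrite hsubmxK; split => //.
  by rewrite mlen_zxicount.
by rewrite /omega le_eqVlt; apply/orP; left; apply/eqP; congr (_ `^ _ * _); ring.
Qed.
End symbol_seminorms.

Section homogeneous_nets.
Context {R : realType} {d p : nat}.
Local Notation normc := (@Normc.normc R).
Local Notation net := (R -> 'rV[R]_(d + p) -> R[i]).
Implicit Types (X K : set 'rV[R]_d) (a : net) (s : seq 'I_(d + p)).

(** The radius 1/4 is that of [cutoff]: below it 1 - chi vanishes, above it |xi| and <xi> are
    comparable, so that homogeneous functions are symbols. *)
Definition over_big K : set 'rV[R]_(d + p) :=
  [set w | K (lsubmx w) /\ 4^-1 <= enorm (rsubmx w)].

Definition over_small K : set 'rV[R]_(d + p) :=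
  [set w | K (lsubmx w) /\ enorm (rsubmx w) < 4^-1].

Definition xiord s : nat := mlen (xicount s).

Definition hgbnd K b a := forall s b', b' < b -> exists2 C, 0 <= C &
  \forall e \near 0^'+, forall w, K (lsubmx w) -> rsubmx w != 0 ->
    normc (pderivs s (a e) w) <= C * e `^ b' * enorm (rsubmx w) `^ (1 - (xiord s)%:R).

Definition zdir (i : 'I_(d + p)) : bool :=
  if fintype.split i is inl _ then true else false.

Lemma enorm_gt0 q (v : 'rV[R]_q) : v != 0 -> 0 < enorm v.
Proof.
move=> v0; rewrite lt_neqAle enorm_ge0 andbT eq_sym.
apply: contra v0 => /eqP ev; apply/eqP/rowP => i; rewrite mxE.
by apply/eqP; rewrite -normr_le0 -ev coord_le_enorm.
Qed.

Lemma enorm0 q : enorm (0 : 'rV[R]_q) = 0.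
Proof. by rewrite /enorm big1 ?sqrtr0// => i _; rewrite mxE expr0n. Qed.

Lemma enormZ q (t : R) (v : 'rV[R]_q) : enorm (t *: v) = `|t| * enorm v.
Proof.
rewrite /enorm -sqrtr_sqr -sqrtrM ?sqr_ge0// mulr_sumr; congr (Num.sqrt _).
by apply: eq_bigr => i _; rewrite mxE exprMn.
Qed.

Lemma over_big_ne0 K : over_big K `<=` over_ne0 K.
Proof.
move=> w [Kw xw]; split => //; apply/negP => /eqP w0; move: xw.
by rewrite w0 enorm0 leNgt invr_gt0 ltr0n.
Qed.

(** For r >= 1/4 one has 24 r^2 >= 3/2, hence 1 + r^2 <= 25 r^2. *)
Lemma japanese_le_enorm (v : 'rV[R]_p) : 4^-1 <= enorm v -> japanese v <= 5 * enorm v.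
Proof.
move=> v4; rewrite -(@ler_pXn2r _ 2)// ?nnegrE ?(ltW (japanese_gt0 v)) ?mulr_ge0 ?enorm_ge0//.
rewrite sqr_japanese -sqr_enorm exprMn.
have : 4^-1 ^+ 2 <= enorm v ^+ 2.
  by rewrite ler_pXn2r// ?nnegrE ?enorm_ge0// invr_ge0.
by move: (enorm v ^+ 2) => x; lra.
Qed.

(** For r >= 0 this comes from |v| <= <v>, for r < 0 from <v> <= 5 |v|. *)
Lemma enorm_powR_le (v : 'rV[R]_p) (r : R) : 4^-1 <= enorm v ->
  enorm v `^ r <= 5 `^ `|r| * japanese v `^ r.
Proof.
move=> v4; have v0 : 0 < enorm v by apply: lt_le_trans v4; rewrite invr_gt0.
have [r0|r0] := leP 0 r.
  rewrite ger0_norm// -[leLHS]mul1r; apply: ler_pM; rewrite ?powR_ge0//.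
    by rewrite -[leLHS](powRr0 5); apply: ler_powR => //; lra.
  by apply: ge0_ler_powR; rewrite ?nnegrE ?enorm_ge0 ?(ltW (japanese_gt0 v)) ?enorm_le_japanese.
rewrite ltr0_norm// -{1 3}(opprK r); have q0 : 0 <= - r by rewrite oppr_ge0 ltW.
move: (- r) q0 => q q0; rewrite !powRN ler_pdivlMr ?powR_gt0 ?japanese_gt0// mulrC.
rewrite ler_pdivrMr ?powR_gt0// -powRM ?(ltW v0)//.
apply: ge0_ler_powR; rewrite ?nnegrE ?(ltW (japanese_gt0 _)) ?mulr_ge0 ?(ltW v0)//.
exact: japanese_le_enorm.
Qed.

Lemma S_hg X K k b a : open X -> K `<=` X ->
  (forall e, 0 < e <= 1 -> smooth_on (over_ne0 X) (a e)) -> hgbnd K b a ->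
  S predT (over_ne0 X) (over_big K) omega (shf 1 0) k b 1 a.
Proof.
move=> oX KX sa Ha; apply: S_of_pderivs => [s _ sk|s i _ _ sk e w e01 Aw]; last first.
  exact: (smooth_on_pdiff _ _ (sa e e01)).
move=> b' b'b; have [C C0 H] := Ha s b' b'b.
exists (C * 5 `^ `|1 - (xiord s)%:R|); first by rewrite mulr_ge0// powR_ge0.
apply: filterS H => e H w [Kw xw].
have [_ w0] := over_big_ne0 (conj Kw xw).
apply: le_trans (H w Kw w0) _.
rewrite (_ : C * _ * _ * _ = C * e `^ b' * (5 `^ `|1 - (xiord s)%:R| *
  omega w `^ (1 + \sum_(i <- s) shf 1 0 i))); last by ring.
apply: ler_wpM2l; first by rewrite mulr_ge0// powR_ge0.
rewrite sum_shf mul0r mul1r sub0r; exact: enorm_powR_le.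
Qed.

(** Derivatives in z keep the degree of homogeneity 1, so no negative power of |xi| arises and |xi|
    <= <xi> gives a bound up to xi = 0. *)
Lemma S_hg_zdir X K k b a : open X -> K `<=` X ->
  (forall e, 0 < e <= 1 -> smooth_on (over_ne0 X) (a e)) -> hgbnd K b a ->
  S zdir (over_ne0 X) (over_ne0 K) omega (fun=> 0) k b 1 a.
Proof.
move=> oX KX sa Ha; apply: S_of_pderivs => [s zs sk|s i _ _ sk e w e01 Aw]; last first.
  exact: (smooth_on_pdiff _ _ (sa e e01)).
have xs0 : xiord s = 0%N.
  rewrite /xiord /mlen big1// => l _; apply/eqP; rewrite -leqn0 leqNgt -has_count has_pred1.
  apply/negP => ls; move/allP : zs => /(_ _ ls); rewrite /zdir.
  case: fintype.splitP => // k' /= E; have := ltn_ord k'; rewrite -E.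
  by rewrite ltnNge leq_addr.
move=> b' b'b; have [C C0 H] := Ha s b' b'b; exists C => //.
apply: filterS H => e H w [Kw w0]; apply: le_trans (H w Kw w0) _.
rewrite xs0 subr0 big1_seq// addr0; apply: ler_wpM2l; first by rewrite mulr_ge0// powR_ge0.
by apply: ge0_ler_powR; rewrite ?nnegrE ?enorm_ge0 ?(ltW (japanese_gt0 _)) ?enorm_le_japanese.
Qed.

Lemma hg_norm_hgbnd X K b a : open X -> K `<=` X ->
  (forall e, 0 < e <= 1 -> smooth_on (over_ne0 X) (a e)) ->
  (forall al be, growth b (fun e => hg_norm K al be (a e))) -> hgbnd K b a.
Proof.
move=> oX KX sa Ha s b' b'b; have [C C0 H] := Ha (xicount s) (zcount s) b' b'b.
exists C => //; apply: filterS2 near0r01 H => e e01 H w Kw w0.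
have Aw : over_ne0 X w by split => //; exact: KX.
rewrite (pderivs_mpair s (open_over_ne0 oX) (sa e e01) Aw).
have := le_trans (ereal_sup_ubound _) H.
move=> /(_ (enorm (rsubmx w) `^ (-1 + (xiord s)%:R)
  * normc (mderiv (mpair (zcount s) (xicount s)) (a e)
      (row_mx (lsubmx w) (rsubmx w))))%:E).
rewrite hsubmxK lee_fin => /(_ _)h.
rewrite mulrC -ler_pdivrMl ?powR_gt0 ?enorm_gt0// -powRN.
have -> : - (1 - (xiord s)%:R) = -1 + (xiord s)%:R :> R by ring.
by apply: h; exists (lsubmx w), (rsubmx w); rewrite hsubmxK; split.
Qed.

Definition homogeneous X (r : R) (f : 'rV[R]_(d + p) -> R[i]) :=
  forall z xi (t : R), X z -> xi != 0 -> 0 < t ->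
    f (row_mx z (t *: xi)) = (t `^ r)%:C * f (row_mx z xi).

Lemma homogeneous_pderiv X r f i : open X -> smooth_on (over_ne0 X) f ->
  homogeneous X r f ->
  homogeneous X (r - (~~ zdir i)%:R) (pderiv i f).
Proof.
move=> oX sf hf z xi t Xz xi0 t0.
have Aw : over_ne0 X (row_mx z xi) by rewrite /over_ne0 /= row_mxKl row_mxKr.
have txi0 : t *: xi != 0 by rewrite scaler_eq0 negb_or gt_eqF.
have Atw : over_ne0 X (row_mx z (t *: xi)) by rewrite /over_ne0 /= row_mxKl row_mxKr.
pose g (w : 'rV[R]_(d + p)) := row_mx (lsubmx w) (t *: rsubmx w).
have gE : g (row_mx z xi) = row_mx z (t *: xi) by rewrite /g row_mxKl row_mxKr.
have df w : over_ne0 X w -> cder f w (delta_mx 0 i) (pderiv i f w).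
  exact: (smooth_on_pdiff [::] i sf).
have c1 : cder (fun w => f (g w)) (row_mx z xi) (delta_mx 0 i)
    ((t `^ r)%:C * pderiv i f (row_mx z xi)).
  apply: (cder_near (f := fun w => (t `^ r)%:C * f w)).
    apply: filterS (open_nbhs_nbhs (conj (open_over_ne0 oX) Aw)) => w [Xw w0].
    by rewrite /g hf// hsubmxK.
  have := cderM (cder_cst (t `^ r)%:C _ _) (df _ Aw).
  by rewrite mul0r add0r.
have cderZ (c : R) w v l : cder f w v l -> cder f w (c *: v) (c%:C * l).
  move=> [fR fI]; split.
    have -> : complex.Re (c%:C * l) = c * complex.Re l.
      by rewrite cReM /= mul0r subr0.
    exact: is_derive_scale fR.
  have -> : complex.Im (c%:C * l) = c * complex.Im l.
    by rewrite cImM /= mul0r addr0.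
  exact: is_derive_scale fI.
rewrite /zdir; case: (fintype.splitP i) => k ik /=.
  rewrite subr0; have iE : i = lshift p k by exact: val_inj.
  have c2 : cder (fun w => f (g w)) (row_mx z xi) (delta_mx 0 i)
      (pderiv i f (row_mx z (t *: xi))).
    rewrite -gE; apply: (cder_affine (v' := delta_mx 0 i)); last by rewrite gE; exact: df.
    move=> h; rewrite iE delta_lshift /g !scale_row_mx !add_row_mx.
    by rewrite !row_mxKl !row_mxKr !scaler0 !add0r.
  by rewrite -(cder_pderiv c2) (cder_pderiv c1).
have iE : i = rshift d k by exact: val_inj.
have c2 : cder (fun w => f (g w)) (row_mx z xi) (delta_mx 0 i)
    (t%:C * pderiv i f (row_mx z (t *: xi))).
  rewrite -gE; apply: (cder_affine (v' := t *: delta_mx 0 i)); last first.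
    by rewrite gE; apply: cderZ; exact: df.
  move=> h; rewrite iE delta_rshift /g !scale_row_mx !add_row_mx.
  by rewrite !row_mxKl !row_mxKr !scaler0 !add0r scalerDr !scalerA mulrC.
have tC0 : t%:C != 0 :> R[i] by rewrite eq_complex /= gt_eqF.
apply: (mulfI tC0); rewrite -(cder_pderiv c2) (cder_pderiv c1) mulrA -rmorphM.
congr (_%:C * _); rewrite -[X in X * _](powRr1 (ltW t0)) -powR_gtD//; congr (_ `^ _).
by ring.
Qed.

Lemma homogeneous_pderivs X r f s : open X -> smooth_on (over_ne0 X) f ->
  homogeneous X r f -> homogeneous X (r - (xiord s)%:R) (pderivs s f).
Proof.
move=> oX sf hf; elim: s => [|i s IH].
  by rewrite /xiord /mlen big1// subr0.
have -> : r - (xiord (i :: s))%:R = r - (xiord s)%:R - (~~ zdir i)%:R.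
  rewrite -addrA -opprD -natrD; congr (_ - _%:R).
  have E1 := sum_shf (1 : R) 0 (i :: s); have E2 := sum_shf (1 : R) 0 s.
  rewrite big_cons E2 !mul0r !sub0r !mul1r /shf in E1.
  apply/eqP; rewrite -(eqr_nat R) natrD /xiord /zdir; apply/eqP.
  by move: E1; case: fintype.split => _ /= E1; lra.
exact: homogeneous_pderiv (smooth_on_pderivs _ sf) IH.
Qed.

Lemma compact_sphere_bound X K (g : 'rV[R]_(d + p) -> R) : compact_in K X ->
  (forall w, over_ne0 X w -> {for w, continuous g}) ->
  exists2 C, 0 <= C & forall w, K (lsubmx w) -> enorm (rsubmx w) = 1 -> `|g w| <= C.
Proof.
move=> [cK KX] cg.
pose Q : set 'rV[R]_(d + p) := [set w | K (lsubmx w) /\ enorm (rsubmx w) = 1].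
have [Q0|/set0P Q0] := eqVneq Q set0.
  exists 0 => // w Kw w1; have : Q w by []. 
  by rewrite Q0.
have cQ : compact Q.
  apply: bounded_closed_compact.
    have [M [Mr MK]] := compact_bounded cK.
    exists (`|M| + 1); split => // c Mc w [Kw w1].
    have M0 : 0 <= `|M| + 1 by rewrite addr_ge0.
    apply: norm_le_coord => [|i]; first by rewrite (le_trans M0)// ltW.
    rewrite -(hsubmxK w) mxE; case: fintype.split => k.
      apply: le_trans (coord_le_norm _ _) _; apply: (MK c) => //.
      by rewrite (le_lt_trans (ler_norm _))// (lt_trans _ Mc)// ltrDl.
    apply: le_trans (coord_le_enorm _ _) _; rewrite w1.
    by rewrite (le_trans _ (ltW Mc))// lerDr.
  have clK : closed K by apply: compact_closed => //; exact: norm_hausdorff.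
  apply: closedI.
    have /continuous_closedP H := @continuous_lsubmx R d p; exact: H.
  have ce : continuous (fun w : 'rV[R]_(d + p) => enorm (rsubmx w)).
    move=> w; apply: (@continuous_comp _ _ _ (fun w => rsubmx w) (@enorm R p)).
      exact: continuous_rsubmx.
    exact: continuous_enorm.
  have /continuous_closedP H := ce.
  exact: (H [set 1] (@closed_eq R 1)).
have cgQ : {within Q, continuous (fun w => `|g w|)}.
  apply: continuous_in_subspaceT => w; rewrite inE => -[Kw w1].
  apply: (@continuous_comp _ _ _ g (fun x : R => `|x|)); last exact: norm_continuous.
  apply: cg; split; first exact: KX.
  by apply/negP => /eqP w0; move: w1; rewrite w0 enorm0 => /esym/eqP; rewrite oner_eq0.
have [c _ Hc] := EVT_max_rV Q0 cQ cgQ.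
by exists `|g c| => // w Kw w1; apply: Hc; rewrite inE.
Qed.

(** Each derivative is homogeneous, so its bound on the compact product of [K] with the unit sphere
    propagates by scaling. This brings a phase at one fixed e under the estimates for nets. *)
Lemma homogeneous_hgbnd X K (f : 'rV[R]_(d + p) -> R[i]) : open X -> compact_in K X ->
  smooth_on (over_ne0 X) f -> homogeneous X 1 f -> hgbnd K 0 (fun=> f).
Proof.
move=> oX cK sf hf s b' b'0.
have [cs _] := sf s.
have [C1 C10 H1] := compact_sphere_bound cK (fun w Aw => (cs w Aw).1).
have [C2 C20 H2] := compact_sphere_bound cK (fun w Aw => (cs w Aw).2).
exists (C1 + C2); first exact: addr_ge0.
apply: filterS near0r01 => e e01 w Kw w0.
have r0 := enorm_gt0 w0; set r := enorm (rsubmx w).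
pose w' := row_mx (lsubmx w) (r^-1 *: rsubmx w).
have w'1 : enorm (rsubmx w') = 1.
  by rewrite row_mxKr enormZ ger0_norm ?invr_ge0 ?(ltW r0)// mulVf// gt_eqF.
have K' : K (lsubmx w') by rewrite row_mxKl.
have w'0 : rsubmx w' != 0.
  by apply/negP => /eqP E; move: w'1; rewrite E enorm0 => /esym/eqP; rewrite oner_eq0.
have -> : w = row_mx (lsubmx w') (r *: rsubmx w').
  by rewrite row_mxKl row_mxKr scalerA divff ?gt_eqF// scale1r hsubmxK.
have hs := homogeneous_pderivs s oX sf hf.
rewrite hs//; last by apply: cK.2.
rewrite hsubmxK Normc.normcM normc_real ger0_norm ?powR_ge0// mulrC.
rewrite ler_wpM2r ?powR_ge0//.
apply: (@le_trans _ _ ((C1 + C2) * 1)); last first.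
  by rewrite ler_wpM2l ?addr_ge0// powR_ge1// ltW.
by rewrite mulr1 (le_trans (normc_le_ReIm _))// lerD ?H1 ?H2.
Qed.
End homogeneous_nets.

(** * Pairs of nets with negligible difference *)

Section symbol_net_pairs.
Context {R : realType} {d : nat}.
Local Notation net := (R -> 'rV[R]_d -> R[i]).
Variables (J : pred 'I_d) (A G : set 'rV[R]_d) (om : 'rV[R]_d -> R).
Variable sh : 'I_d -> R.

(** Two representatives carried together, with a common estimate and a difference that is negligible
    at the same order [mu]. Each construction then yields its bounds and its independence of
    representatives at once. *)
Definition SP k b mu (F F' : net) : Prop :=
  [/\ S J A G om sh k b mu F, S J A G om sh k b mu F' &
      forall c, S J A G om sh k c mu (fun e w => F e w - F' e w)].

Hypotheses (loA : line_open J A) (GA : G `<=` A) (om1 : forall w, G w -> 1 <= om w).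
Implicit Types F : net.
Local Notation Sext := (S_ext loA GA).

Lemma SP_ext k b mu F F' H H' :
  (forall e w, 0 < e <= 1 -> A w -> F e w = H e w) ->
  (forall e w, 0 < e <= 1 -> A w -> F' e w = H' e w) ->
  SP k b mu F F' -> SP k b mu H H'.
Proof.
move=> FH FH' [SF SF' SD]; split; [exact: Sext FH SF|exact: Sext FH' SF'|move=> c].
by apply: Sext (SD c) => e w e01 Aw; rewrite FH ?FH'.
Qed.

Lemma SP_diag k b mu F : S J A G om sh k b mu F -> SP k b mu F F.
Proof.
move=> SF; split => // c; apply: (S0 loA GA) => e w _ _; exact: subrr.
Qed.

Lemma SP_le k b mu k1 b1 mu1 F F' : (k1 <= k)%N -> b1 <= b -> mu <= mu1 ->
  SP k b mu F F' -> SP k1 b1 mu1 F F'.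
Proof.
move=> kk bb mm [SF SF' SD]; split; [exact: (S_le om1 kk bb mm)|exact: (S_le om1 kk bb mm)|].
by move=> c; apply: (S_le om1 kk (lexx c) mm).
Qed.

Lemma SPD k b mu F F' H H' : SP k b mu F F' -> SP k b mu H H' ->
  SP k b mu (fun e w => F e w + H e w) (fun e w => F' e w + H' e w).
Proof.
move=> [SF SF' dF] [SH SH' dH]; split; [exact: (SD loA GA)|exact: (SD loA GA)|move=> c].
apply: Sext (SD loA GA (dF c) (dH c)) => e w _ _; ring.
Qed.

Lemma SPM k b mu b1 mu1 F F' H H' : SP k b mu F F' -> SP k b1 mu1 H H' ->
  SP k (b + b1) (mu + mu1) (fun e w => F e w * H e w) (fun e w => F' e w * H' e w).
Proof.
move=> [SF SF' dF] [SH SH' dH]; split; [exact: (SM loA GA om1)|exact: (SM loA GA om1)|move=> c].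
(* FH - F'H' = (F - F')H + F'(H - H'). To reach the exponent [c], each difference is taken small
   enough to make up for the other factor. *)
have S1 := SM loA GA om1 (dF (c - b1)) SH.
have S2 := SM loA GA om1 SF' (dH (c - b)).
rewrite subrK in S1; rewrite addrC subrK in S2.
apply: Sext (SD loA GA S1 S2) => e w _ _; ring.
Qed.

Lemma SP_scale k b mu (c : R[i]) F F' : SP k b mu F F' ->
  SP k b mu (fun e w => c * F e w) (fun e w => c * F' e w).
Proof.
move=> SF; rewrite -[b]add0r -[mu]add0r; apply: SPM => //.
by apply: SP_diag; exact: (S_cst loA GA om1).
Qed.

Lemma SP_sum (I : Type) (r : seq I) k b mu (F F' : I -> net) :
  (forall j, SP k b mu (F j) (F' j)) ->
  SP k b mu (fun e w => \sum_(j <- r) F j e w) (fun e w => \sum_(j <- r) F' j e w).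
Proof.
move=> SF; elim: r => [|j r IH].
  apply: (@SP_ext _ _ _ (fun _ _ => 0) (fun _ _ => 0)); [| |apply: SP_diag].
  - by move=> e w _ _; rewrite big_nil.
  - by move=> e w _ _; rewrite big_nil.
  - by apply: (S0 loA GA).
apply: SP_ext (SPD (SF j) IH) => e w _ _; by rewrite big_cons.
Qed.

Lemma SP_pderiv k b mu F F' i : J i -> SP k.+1 b mu F F' ->
  SP k b (mu + sh i) (net_pderiv i F) (net_pderiv i F').
Proof.
move=> Ji [SF SF' SD]; have [dF SkF] := SF.2 i Ji; have [dF' SkF'] := SF'.2 i Ji.
split => // c; have [_ SkD] := (SD c).2 i Ji.
apply: Sext SkD => e w e01 Aw; rewrite /net_pderiv.
exact: (cder_pderiv (cderB (dF _ _ e01 Aw) (dF' _ _ e01 Aw))).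
Qed.

(** The difference is 1/g - 1/g' = -(g - g')/(g g'), and both reciprocals satisfy estimates by
    [S_realV]. *)
Lemma SP_realV k mu (g g' : R -> 'rV[R]_d -> R) :
  (forall e w, 0 < e <= 1 -> A w -> g e w != 0) ->
  (forall e w, 0 < e <= 1 -> A w -> g' e w != 0) ->
  bnd G om 0 (- mu) (fun e w => (g e w)^-1%:C) ->
  bnd G om 0 (- mu) (fun e w => (g' e w)^-1%:C) ->
  SP k 0 mu (fun e w => (g e w)%:C) (fun e w => (g' e w)%:C) ->
  SP k 0 (- mu) (fun e w => (g e w)^-1%:C) (fun e w => (g' e w)^-1%:C).
Proof.
move=> g0 g'0 bg bg' [Sg Sg' SD].
have SV := S_realV loA GA om1 g0 Sg bg; have SV' := S_realV loA GA om1 g'0 Sg' bg'.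
split => // c.
have := SM loA GA om1 (SM loA GA om1 (SN loA GA om1 (SD c)) SV) SV'.
rewrite !addr0 subrr add0r => H; apply: Sext H => e w e01 Aw.
rewrite -!rmorphB -rmorphN -!rmorphM; congr _%:C.
by field; rewrite g0// g'0.
Qed.
End symbol_net_pairs.

Section symbol_net_pairs_domains.
Context {R : realType} {d : nat}.
Local Notation net := (R -> 'rV[R]_d -> R[i]).
Implicit Types (J : pred 'I_d) (A G : set 'rV[R]_d) (om : 'rV[R]_d -> R)
  (sh : 'I_d -> R) (F : net).

Lemma SP_sub J J' A A' G G' om sh k b mu F F' :
  (forall i, J' i -> J i) -> A' `<=` A -> G' `<=` G ->
  SP J A G om sh k b mu F F' -> SP J' A' G' om sh k b mu F F'.
Proof.
move=> JJ AA GG [SF SF' SD]; split => [||c].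
- exact: (S_sub JJ AA GG SF).
- exact: (S_sub JJ AA GG SF').
- exact: (S_sub JJ AA GG (SD c)).
Qed.

Lemma SP_union J A A' G G' om sh k b mu F F' :
  SP J A G om sh k b mu F F' -> SP J A' G' om sh k b mu F F' ->
  SP J (A `|` A') (G `|` G') om sh k b mu F F'.
Proof.
move=> [S1 S2 S3] [T1 T2 T3]; split => [||c].
- exact: S_union.
- exact: S_union.
- exact: (S_union (S3 c) (T3 c)).
Qed.

Lemma SP_sh J A G om sh sh' k b mu F F' : (forall w, G w -> 1 <= om w) ->
  (forall i, J i -> sh i <= sh' i) ->
  SP J A G om sh k b mu F F' -> SP J A G om sh' k b mu F F'.
Proof.
move=> om1 ss [S1 S2 S3]; split => [||c].
- exact: (S_sh om1 ss S1).
- exact: (S_sh om1 ss S2).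
- exact: (S_sh om1 ss (S3 c)).
Qed.
End symbol_net_pairs_domains.

Section pulled_back_symbols.
Context {R : realType} {d p : nat}.
Local Notation normc := (@Normc.normc R).
Local Notation vec := 'rV[R]_(d + p).
Implicit Types (X K : set 'rV[R]_d).

Lemma line_open_over X : open X -> line_open predT (@over R d p X).
Proof. by move=> oX; apply: open_line_open; exact: open_over. Qed.

Lemma line_open_over_ne0 X : open X -> line_open predT (@over_ne0 R d p X).
Proof. by move=> oX; apply: open_line_open; exact: open_over_ne0. Qed.

Lemma open_over_small X : open X -> open (@over_small R d p X).
Proof.
move=> oX; apply: openI; first exact: open_lsubmx.
apply: (@open_rsubmx _ _ _ [set xi : 'rV[R]_p | enorm xi < 4^-1]).
have /continuousP H := @continuous_enorm R p.
exact: (H [set r | r < 4^-1] (@open_lt R 4^-1)).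
Qed.

Lemma pderiv_real q (i : 'I_q) (f : 'rV[R]_q -> R) w :
  pderiv i (fun w => (f w)%:C) w = (rpderiv i f w)%:C.
Proof. by rewrite /pderiv /=; congr (_ +i* _); rewrite /rpderiv; exact: derive_cst. Qed.

Lemma xi_proj i (h : R) (w : vec) : rsubmx (h *: delta_mx 0 i + w) =
  if (if fintype.split i is inr j then Some j else None) is Some j
  then h *: delta_mx 0 j + rsubmx w else rsubmx w.
Proof.
rewrite rsubmx_addZ; case: (fintype.splitP i) => k ik.
  rewrite (_ : i = lshift p k); last exact: val_inj.
  by rewrite delta_lshift row_mxKr scaler0 add0r.
rewrite (_ : i = rshift d k); last exact: val_inj.
by rewrite delta_rshift row_mxKr.
Qed.

Lemma cutoff_bounded (chi : 'rV[R]_p -> R[i]) s : cutoff chi ->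
  exists2 C, 0 <= C & forall xi, normc (pderivs s chi xi) <= C /\
    (1 < enorm xi -> pderivs s chi xi = 0).
Proof.
move=> [sc _ chi0].
have out xi : 2^-1 < enorm xi -> pderivs s chi xi = 0.
  move=> x2; have o2 : open [set xi : 'rV[R]_p | 2^-1 < enorm xi].
    have /continuousP H := @continuous_enorm R p.
    exact: (H [set r | 2^-1 < r] (@open_gt R 2^-1)).
  rewrite (pderivs_ext (g := fun=> 0) s o2)//.
  elim: s {x2} xi => [|i s IH] xi //=.
  have -> : pderivs s (fun=> 0) = (fun=> 0 : R[i]) :> ('rV[R]_p -> R[i]) by exact/funext.
  exact: cder_pderiv (cder_cst _ _ _).
pose Q : set 'rV[R]_p := [set xi | enorm xi <= 1].
have Q0 : Q !=set0 by exists 0; rewrite /Q /= enorm0.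
have cQ : compact Q.
  apply: bounded_closed_compact.
    exists 1; split => // c c1 xi xQ; apply: norm_le_coord => [|i].
      by rewrite ltW// (lt_trans ltr01).
    by apply: le_trans (coord_le_enorm _ _) _; apply: le_trans xQ (ltW c1).
  have /continuous_closedP H := @continuous_enorm R p.
  exact: (H [set r | r <= 1] (@closed_le R 1)).
have [cs _] := sc s.
have cR : {within Q, continuous (fun w => `|complex.Re (pderivs s chi w)|)}.
  apply: continuous_subspaceT => w.
  apply: (@continuous_comp _ _ _ (fun w => complex.Re (pderivs s chi w)) (fun x : R => `|x|)).
    exact: (cs w I).1.
  exact: norm_continuous.
have cI : {within Q, continuous (fun w => `|complex.Im (pderivs s chi w)|)}.
  apply: continuous_subspaceT => w.
  apply: (@continuous_comp _ _ _ (fun w => complex.Im (pderivs s chi w)) (fun x : R => `|x|)).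
    exact: (cs w I).2.
  exact: norm_continuous.
have [c1 _ H1] := EVT_max_rV Q0 cQ cR; have [c2 _ H2] := EVT_max_rV Q0 cQ cI.
exists (`|complex.Re (pderivs s chi c1)| + `|complex.Im (pderivs s chi c2)|) => //.
move=> xi; split; last first.
  by move=> x1; apply: out; apply: lt_trans x1; rewrite invf_lt1// ltr1n.
have [x1|x1] := leP (enorm xi) 1.
  by rewrite (le_trans (normc_le_ReIm _))// lerD ?H1 ?H2// inE.
by rewrite out ?Normc.normc0 ?addr_ge0// (lt_trans _ x1)// invf_lt1// ltr1n.
Qed.

(** All derivatives of [chi] are bounded and supported where |xi| <= 1, hence where 1 <= <xi> <= 2.
    There all powers of <xi> are comparable, so the order [mu] is arbitrary. *)
Lemma S_cutoff X K (chi : 'rV[R]_p -> R[i]) rho delta k mu : cutoff chi ->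
  S predT (over X) (over K) omega (shf rho delta) k 0 mu
    (fun _ (w : vec) => chi (rsubmx w)).
Proof.
move=> hc; have [sc _ _] := hc.
apply: S_of_pderivs => [s _ sk b' b'0|s i _ _ sk e w e01 Aw]; last first.
  have -> : pderivs s (fun w : vec => chi (rsubmx w)) = (fun w =>
      if all (fun i => (if fintype.split i is inr j then Some j else None) != None) s
      then pderivs (pmap (fun i => if fintype.split i is inr j then Some j else None) s)
        chi (rsubmx w) else 0).
    by apply/funext => w'; exact: (pderivs_proj (sg := fun i => if fintype.split i is inr j then Some j else None) xi_proj).
  case: (all _ s); last exact: cder_pdiff (cder_cst _ _ _).
  apply: (pdiff_proj xi_proj); case: fintype.split => // j.
  exact: (smooth_on_pdiff _ j sc).
set sg := fun i : 'I_(d + p) => if fintype.split i is inr j then Some j else None.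
have [C C0 HC] := cutoff_bounded (pmap sg s) hc.
pose nu := mu + \sum_(i <- s) shf rho delta i.
exists (C * 2 `^ `|nu|); first by rewrite mulr_ge0// powR_ge0.
apply: filterS near0r01 => e e01 w Kw.
rewrite (pderivs_proj (sg := sg) xi_proj).
have e1 : 1 <= e `^ b' by rewrite powR_ge1// ltW.
have RHS0 : 0 <= C * 2 `^ `|nu| * e `^ b' * omega w `^ nu.
  by rewrite !mulr_ge0// powR_ge0.
case: ifP => _; last by rewrite Normc.normc0.
have [x1|x1] := leP (enorm (rsubmx w)) 1; last first.
  by have [_ ->//] := HC (rsubmx w); rewrite Normc.normc0.
apply: (@le_trans _ _ (C * 1 * 1)); first by rewrite !mulr1; exact: (HC _).1.
rewrite -/nu -mulrA -mulrA -mulrA ler_wpM2l// mulrCA; apply: ler_pM => //.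
have w2 : omega w <= 2.
  rewrite -(@ler_pXn2r _ 2)// ?nnegrE ?(ltW (omega_gt0 w))// sqr_japanese -sqr_enorm.
  have : enorm (rsubmx w) ^+ 2 <= 1 by rewrite exprn_ile1// enorm_ge0.
  by move: (_ ^+ 2) => x; lra.
have [n0|n0] := leP 0 nu.
  rewrite ger0_norm// -[leLHS]mulr1 ler_pM//.
    by rewrite -[leLHS](powRr0 2); apply: ler_powR => //; rewrite ler1n.
  by rewrite -[leLHS](powRr0 (omega w)); apply: ler_powR => //; exact: omega_ge1.
rewrite ltr0_norm// -{2}(opprK nu); have q0 : 0 <= - nu by rewrite oppr_ge0 ltW.
move: (- nu) q0 => q q0; rewrite powRN ler_pdivlMr ?powR_gt0 ?omega_gt0// mul1r.
by apply: ge0_ler_powR; rewrite ?nnegrE ?(ltW (omega_gt0 w)).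
Qed.

(** The coordinates of xi are the building blocks of the symbol |xi|^2 and, through it, of |xi|^(-2)
    in L. *)
Lemma S_xi_coord X K k j :
  S predT (over X) (over K) omega (shf 1 0) k 0 1
    (fun _ (w : vec) => (w 0 (rshift d j))%:C).
Proof.
have cd i w : cder (fun w : vec => (w 0 (rshift d j))%:C) w (delta_mx 0 i)
    ((rshift d j == i)%:R : R)%:C.
  apply: cder_real; apply/is_derive1P.
  have -> : (fun t : R => (t *: delta_mx 0 i + w) 0 (rshift d j)) =
      (fun t : R => t * (rshift d j == i)%:R + w 0 (rshift d j)).
    by apply/funext => t; rewrite !mxE eqxx.
  apply: (is_derive_eq (is_deriveD (is_deriveM (is_derive_id _ _)
    (is_derive_cst _ _ _)) (is_derive_cst _ _ _))).
  by rewrite scaler0 add0r addr0 [_%:A]mulr1.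
have b1 : bnd (over K) omega 0 1 (fun _ (w : vec) => (w 0 (rshift d j))%:C).
  move=> b' b'0; exists 1 => //; apply: filterS near0r01 => e e01 w Kw.
  rewrite normc_real mul1r powRr1 ?(ltW (omega_gt0 w))//.
  apply: (@le_trans _ _ (1 * omega w)).
    rewrite mul1r; apply: le_trans (enorm_le_japanese _).
    by have := coord_le_enorm (rsubmx w) j; rewrite mxE.
  by rewrite ler_wpM2r ?(ltW (omega_gt0 w))// powR_ge1// ltW.
case: k => [|k]; split => // i _; split.
  by move=> e w _ _; exact: cder_pdiff (cd _ _).
have -> : net_pderiv i (fun _ (w : vec) => (w 0 (rshift d j))%:C) =
    (fun _ _ => ((rshift d j == i)%:R : R)%:C).
  by apply/funext => e; apply/funext => w; exact: cder_pderiv (cd _ _).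
move: k => k.
have Sc mu0 := @S_cst R (d + p) predT setT (over K) omega (shf 1 0)
  (open_line_open openT) (fun _ _ => I) (fun w _ => omega_ge1 w) k 0 mu0
  ((rshift d j == i)%:R : R)%:C (lexx _).
apply: (S_sub _ _ _ (Sc _ _)) => //.
by rewrite /shf; case: fintype.split => _ /=; rewrite ?addr0// subrr.
Qed.
End pulled_back_symbols.

(** * Phase functions and the operator L *)

Section phase_functions.
Context {R : realType} {n' n p : nat}.
Local Notation normc := (@Normc.normc R).
Local Notation vec := 'rV[R]_(n' + n + p).
Variables (Om' : set 'rV[R]_n') (Om : set 'rV[R]_n).
Hypotheses (oOm' : open Om') (oOm : open Om).
Local Notation X := (prod_set Om' Om).

Definition phase_at (f : vec -> R) : Prop :=
  [/\ forall w, X (lsubmx w) -> {for w, continuous f},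
      smooth_on (over_ne0 X) (fun w => (f w)%:C) &
      forall x, Om' x -> phase_function Om
        (fun v => f (pt x (lsubmx v) (rsubmx v)))].

Lemma open_prod_set : open X.
Proof. by apply: openI; [exact: open_lsubmx|exact: open_rsubmx]. Qed.

Lemma derive_affineE (V W : normedModType R) (f : W -> R) (g : V -> W) (a v : V) (v' : W) :
  (forall h : R, g (h *: v + a) = h *: v' + g a) ->
  'D_v (fun x => f (g x)) a = 'D_v' f (g a).
Proof.
move=> gE; rewrite /derive; set g1 := fun h => h^-1 *: _; set g2 := fun h => h^-1 *: _.
suff -> : g1 = g2 by [].
by apply/funext => h; rewrite /g1 /g2 /= gE.
Qed.

Section one_phase.
Variable f : vec -> R.
Hypothesis hf : phase_at f.

Lemma phase_homogeneous : homogeneous X 1 (fun w => (f w)%:C).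
Proof.
move=> z xi t [z1 z2] xi0 t0; have [_ _ /(_ _ z1)[_ h _]] := hf.
have := h (rsubmx z) xi t z2 t0; rewrite !row_mxKl !row_mxKr /pt hsubmxK => ->.
by rewrite powRr1 ?(ltW t0)// rmorphM.
Qed.

(** Homogeneity with t = 2 at xi = 0 gives f = 2 f. *)
Lemma phase0 w : X (lsubmx w) -> rsubmx w = 0 -> f w = 0.
Proof.
move=> [z1 z2] xi0; have [_ _ /(_ _ z1)[_ h _]] := hf.
have := h (rsubmx (lsubmx w)) (rsubmx w) 2 z2; rewrite !row_mxKl !row_mxKr /pt !hsubmxK.
rewrite xi0 scaler0 -[X in row_mx _ X]xi0 hsubmxK => /(_ _)E.
have : f w = 2 * f w by apply: E.
by move=> ?; lra.
Qed.

Lemma phase_pdiff i w : over_ne0 X w -> pdiff i (fun w => (f w)%:C) w.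
Proof. by have [_ sf _] := hf; exact: (smooth_on_pdiff [::] i sf). Qed.

Lemma phase_rpderiv_hom i w (t : R) : over_ne0 X w -> 0 < t ->
  rpderiv i f (row_mx (lsubmx w) (t *: rsubmx w)) =
  t `^ (1 - (~~ zdir i)%:R) * rpderiv i f w.
Proof.
move=> [Xw w0] t0; have [_ sf _] := hf.
have := homogeneous_pderiv i open_prod_set sf phase_homogeneous Xw w0 t0.
by rewrite hsubmxK !pderiv_real -rmorphM => /complexI.
Qed.

Lemma zdir_iy k : zdir (iy k : 'I_(n' + n + p)) = true.
Proof. by rewrite /zdir /iy (unsplitK (inl (rshift n' k)) : fintype.split (lshift p _) = _). Qed.

Lemma zdir_ixi j : zdir (ixi j : 'I_(n' + n + p)) = false.
Proof. by rewrite /zdir /ixi (unsplitK (inr j) : fintype.split (rshift (n' + n) _) = _). Qed.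

(** The y-derivatives have degree 1 and the xi-derivatives degree 0. Undoing the normalization
    expresses [varphi] through derivatives at [w] itself, to which the symbol calculus applies. *)
Lemma gradsq_normalize w : over_ne0 X w -> gradsq f (normalize_xi w) =
  enorm (rsubmx w) ^- 2 * (\sum_k rpderiv (iy k) f w ^+ 2) +
  \sum_j rpderiv (ixi j) f w ^+ 2.
Proof.
move=> Aw; have [Xw w0] := Aw; have r0 := enorm_gt0 w0.
rewrite /gradsq /normalize_xi /xipart; congr (_ + _).
  rewrite mulr_sumr; apply: eq_bigr => k _.
  rewrite phase_rpderiv_hom// ?invr_gt0// zdir_iy subr0 powRr1 ?invr_ge0 ?(ltW r0)//.
  by rewrite exprMn exprVn.
apply: eq_bigr => j _; rewrite phase_rpderiv_hom// ?invr_gt0// zdir_ixi.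
by rewrite subrr powRr0 mul1r.
Qed.

(** A vanishing sum of squares would make every partial derivative in (y, xi) zero at a point with
    xi <> 0, which the definition of a phase function excludes. *)
Lemma gradsq_normalize_neq0 w : over_ne0 X w -> gradsq f (normalize_xi w) != 0.
Proof.
move=> [[z1 z2] w0]; have r0 := enorm_gt0 w0.
have [_ _ /(_ _ z1)[_ _ h]] := hf.
have xi0 : (enorm (rsubmx w))^-1 *: rsubmx w != 0.
  by rewrite scaler_eq0 negb_or invr_eq0 gt_eqF.
have [ i ] := h _ _ z2 xi0.
set x := lsubmx (lsubmx w); set y := rsubmx (lsubmx w); set xi := _ *: _.
set g := fun v => _.
have pE : normalize_xi w = pt x y xi by rewrite /normalize_xi /pt hsubmxK.
have gE i' : (forall (t : R) v, pt x (lsubmx (t *: delta_mx 0 i + v)) (rsubmx (t *: delta_mx 0 i + v)) =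
     t *: delta_mx 0 i' + pt x (lsubmx v) (rsubmx v)) ->
    rpderiv i g (row_mx y xi) = rpderiv i' f (normalize_xi w).
  move=> H; rewrite /rpderiv /g pE.
  rewrite (@derive_affineE _ _ f (fun v => pt x (lsubmx v) (rsubmx v)) _ _ (delta_mx 0 i')).
    by rewrite row_mxKl row_mxKr.
  by move=> t; exact: H.
have gsq0 : gradsq f (normalize_xi w) = 0 -> forall i', (exists k, i' = iy k) \/ (exists j, i' = ixi j) ->
    rpderiv i' f (normalize_xi w) = 0.
  move=> /eqP; rewrite /gradsq paddr_eq0; last 2 first.
  - by apply: sumr_ge0 => k _; exact: sqr_ge0.
  - by apply: sumr_ge0 => k _; exact: sqr_ge0.
  rewrite !psumr_eq0; try by move=> k _; exact: sqr_ge0.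
  move=> /andP[/allP h1 /allP h2] i' [[k ->]|[k ->]].
    by have := h1 k (mem_index_enum _); rewrite sqrf_eq0 => /eqP.
  by have := h2 k (mem_index_enum _); rewrite sqrf_eq0 => /eqP.
apply: contra => /eqP /gsq0 H.
case: (fintype.splitP i) => k ik.
  have iE : i = lshift p k by exact: val_inj.
  rewrite (gE (iy k)) ?H//; first by left; exists k.
  move=> t v; rewrite iE /iy !delta_lshift delta_rshift /pt !lsubmx_addZ !rsubmx_addZ.
  by rewrite !row_mxKl !row_mxKr !scale_row_mx !add_row_mx !scaler0 !add0r.
have iE : i = rshift n k by exact: val_inj.
rewrite (gE (ixi k)) ?H//; first by right; exists k.
move=> t v; rewrite iE /ixi !delta_rshift /pt !lsubmx_addZ !rsubmx_addZ.
by rewrite !row_mxKl !row_mxKr !scale_row_mx !add_row_mx !scaler0 !add0r.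
Qed.

Lemma varphiE w : over_ne0 X w -> varphi f w =
  (enorm (rsubmx w) ^- 2 * (\sum_k rpderiv (iy k) f w ^+ 2) +
   \sum_j rpderiv (ixi j) f w ^+ 2)^-1.
Proof. by move=> Aw; rewrite /varphi gradsq_normalize. Qed.
End one_phase.

Variable chi : 'rV[R]_p -> R[i].
Hypothesis hchi : cutoff chi.

Lemma acoef_small (f : vec -> R) j w : enorm (rsubmx w) < 4^-1 -> acoef chi f j w = 0.
Proof.
by move=> w4; have [_ c1 _] := hchi; rewrite /acoef /xipart c1// subrr mulr0 mul0r.
Qed.

Lemma bcoef_small (f : vec -> R) k w : enorm (rsubmx w) < 4^-1 -> bcoef chi f k w = 0.
Proof.
by move=> w4; have [_ c1 _] := hchi; rewrite /bcoef /xipart c1// subrr mulr0 mul0r.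
Qed.

(** What the estimates use of two representatives of a slow scale phase over [K]. The exponents 0
    stand for slow scale growth, and the last clause for slow scale lower bounds of the
    gradients. *)
Definition phase_pair (K : set 'rV[R]_(n' + n)) (ph ph' : R -> vec -> R) : Prop :=
  [/\ forall e, 0 < e <= 1 -> [/\ phase_at (ph e), phase_at (ph' e) &
        smooth_on (over_ne0 X) (fun w => (ph e w)%:C - (ph' e w)%:C)],
      hgbnd K 0 (complex_net ph) /\ hgbnd K 0 (complex_net ph'),
      forall c, hgbnd K c (fun e w => (ph e w)%:C - (ph' e w)%:C) &
      bnd (over_big K) omega 0 0 (fun e w => (varphi (ph e) w)%:C) /\
      bnd (over_big K) omega 0 0 (fun e w => (varphi (ph' e) w)%:C)].

Section coefficients.
Variables (K : set 'rV[R]_(n' + n)) (ph ph' : R -> vec -> R).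
Hypotheses (KX : K `<=` X) (hp : phase_pair K ph ph').
Let oX := open_prod_set.
Local Notation A := (@over_ne0 R (n' + n) p X).
Local Notation G := (@over_big R (n' + n) p K).
Local Notation SPb := (SP predT A G omega (shf 1 0)).

Let loA : line_open predT A := line_open_over_ne0 oX.
Let GA : G `<=` A.
Proof. by move=> w /over_big_ne0[Kw w0]; split => //; exact: KX. Qed.
Let om1 (w : vec) : G w -> 1 <= omega w. Proof. by move=> _; exact: omega_ge1. Qed.

Let ph_at e : 0 < e <= 1 -> phase_at (ph e). Proof. by have [H _ _ _] := hp => /H[]. Qed.
Let ph'_at e : 0 < e <= 1 -> phase_at (ph' e). Proof. by have [H _ _ _] := hp => /H[]. Qed.

Lemma SP_phase k : SPb k 0 1 (complex_net ph) (complex_net ph').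
Proof.
have [H [h1 h2] h3 _] := hp; split => [||c].
- by apply: (S_hg k oX KX _ h1) => e /ph_at[].
- by apply: (S_hg k oX KX _ h2) => e /ph'_at[].
by apply: (S_hg k oX KX _ (h3 c)) => e /H[].
Qed.

Lemma SP_phase_zdir k : SP zdir A (over_ne0 K) omega (fun=> 0) k 0 1
  (complex_net ph) (complex_net ph').
Proof.
have [H [h1 h2] h3 _] := hp; split => [||c].
- by apply: (S_hg_zdir k oX KX _ h1) => e /ph_at[].
- by apply: (S_hg_zdir k oX KX _ h2) => e /ph'_at[].
by apply: (S_hg_zdir k oX KX _ (h3 c)) => e /H[].
Qed.

Lemma shf_iy (rho delta : R) k : shf rho delta (iy k : 'I_(n' + n + p)) = delta.
Proof. by rewrite /shf /iy (unsplitK (inl (rshift n' k)) : fintype.split (lshift p _) = _). Qed.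

Lemma shf_ixi (rho delta : R) j : shf rho delta (ixi j : 'I_(n' + n + p)) = - rho.
Proof. by rewrite /shf /ixi (unsplitK (inr j) : fintype.split (rshift (n' + n) _) = _). Qed.

Let rp (i : 'I_(n' + n + p)) (q : R -> vec -> R) : R -> vec -> R[i] :=
  fun e w => (rpderiv i (q e) w)%:C.

Lemma SP_rpderiv_iy k l : SPb l 0 1 (rp (iy k) ph) (rp (iy k) ph').
Proof.
have := SP_pderiv loA GA (i := iy k) erefl (SP_phase l.+1).
rewrite shf_iy addr0; apply: (SP_ext loA GA) => e w _ _.
  exact: pderiv_real.
exact: pderiv_real.
Qed.

Lemma SP_rpderiv_ixi j l : SPb l 0 0 (rp (ixi j) ph) (rp (ixi j) ph').
Proof.
have := SP_pderiv loA GA (i := ixi j) erefl (SP_phase l.+1).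
rewrite shf_ixi subrr; apply: (SP_ext loA GA) => e w _ _.
  exact: pderiv_real.
exact: pderiv_real.
Qed.

(** |xi|^2 is a sum of squares of symbols of order 1, and where |xi| >= 1/4 its reciprocal is at
    most a constant times <xi>^(-2). *)
Lemma S_enorm_inv2 k : S predT A G omega (shf 1 0) k 0 (-2)
  (fun _ w => (enorm (rsubmx w) ^- 2)%:C).
Proof.
have S2 : S predT A G omega (shf 1 0) k 0 2 (fun _ (w : vec) => (enorm (rsubmx w) ^+ 2)%:C).
  apply: (@S_ext _ _ _ _ _ _ _ loA GA _ _ _
      (fun _ w => \sum_j (w 0 (rshift (n' + n) j))%:C * (w 0 (rshift (n' + n) j))%:C)).
    move=> e w _ _; rewrite sqr_enorm rmorph_sum; apply: eq_bigr => j _.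
    by rewrite -rmorphM -expr2 mxE.
  apply: (S_sum loA GA) => j.
  have Sj := S_xi_coord X K k j.
  have Sj' : S predT A G omega (shf 1 0) k 0 1 (fun _ w => (w 0 (rshift (n' + n) j))%:C).
    by apply: (S_sub _ _ _ Sj) => // w [].
  have := SM loA GA om1 Sj' Sj'; rewrite addr0.
  by have -> : 1 + 1 = 2 :> R by [].
apply: (S_realV loA GA om1 _ S2).
  by move=> e w _ [_ w0]; rewrite expf_eq0 /= gt_eqF// enorm_gt0.
move=> b' b'0; exists (5 `^ `| -2|); first exact: powR_ge0.
apply: filterS near0r01 => e e01 w [Kw w4].
rewrite normc_real ger0_norm ?invr_ge0 ?exprn_ge0 ?enorm_ge0//.
rewrite -powR_invn ?enorm_ge0// mulrAC; apply: le_trans (enorm_powR_le _ w4) _.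
rewrite -[leLHS]mulr1 ler_wpM2l ?mulr_ge0 ?powR_ge0//.
by rewrite powR_ge1// ltW.
Qed.

(** [varphi] is the reciprocal of a symbol of order 0 that is bounded below up to slow scale
    factors, so it is again a symbol of order 0. *)
Lemma SP_varphi k : SPb k 0 0 (fun e w => (varphi (ph e) w)%:C)
  (fun e w => (varphi (ph' e) w)%:C).
Proof.
have [_ _ _ [l1 l2]] := hp; rewrite -[X in SP _ _ _ _ _ _ _ X]oppr0.
apply: (SP_realV loA GA om1).
- by move=> e w e01; apply: gradsq_normalize_neq0; exact: ph_at.
- by move=> e w e01; apply: gradsq_normalize_neq0; exact: ph'_at.
- rewrite oppr0; exact: l1.
- rewrite oppr0; exact: l2.
have H : SPb k 0 0
    (fun e w => (enorm (rsubmx w) ^- 2)%:C * (\sum_k rp (iy k) ph e w * rp (iy k) ph e w)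
       + \sum_j rp (ixi j) ph e w * rp (ixi j) ph e w)
    (fun e w => (enorm (rsubmx w) ^- 2)%:C * (\sum_k rp (iy k) ph' e w * rp (iy k) ph' e w)
       + \sum_j rp (ixi j) ph' e w * rp (ixi j) ph' e w).
  apply: (SPD loA GA).
    have S1 : SPb k 0 2 (fun e w => \sum_k rp (iy k) ph e w * rp (iy k) ph e w)
        (fun e w => \sum_k rp (iy k) ph' e w * rp (iy k) ph' e w).
      apply: (SP_sum loA GA) => l.
      have := SPM loA GA om1 (SP_rpderiv_iy l k) (SP_rpderiv_iy l k).
      by rewrite addr0; have -> : 1 + 1 = 2 :> R by [].
    have := SPM loA GA om1 (SP_diag loA GA (S_enorm_inv2 k)) S1.
    by rewrite addr0 addNr.
  apply: (SP_sum loA GA) => l.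
  by have := SPM loA GA om1 (SP_rpderiv_ixi l k) (SP_rpderiv_ixi l k); rewrite !addr0.
have E (q : R -> vec -> R) e w : phase_at (q e) -> A w ->
    (enorm (rsubmx w) ^- 2)%:C * (\sum_k rp (iy k) q e w * rp (iy k) q e w)
       + \sum_j rp (ixi j) q e w * rp (ixi j) q e w = (gradsq (q e) (normalize_xi w))%:C.
  move=> hq Aw; rewrite gradsq_normalize// rmorphD rmorphM !rmorph_sum.
  by congr (_ * _ + _); apply: eq_bigr => l _; rewrite -rmorphM.
apply: (SP_ext loA GA _ _ H) => e w e01 Aw; apply: E => //.
  exact: ph_at.
exact: ph'_at.
Qed.

Let S1chi k : S predT A G omega (shf 1 0) k 0 0 (fun _ w => 1 - chi (rsubmx w)).
Proof.
apply: (SB loA GA om1); first exact: (S_cst loA GA om1).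
by apply: (S_sub _ _ _ (S_cutoff X K 1 0 k 0 hchi)) => // w [].
Qed.

Let loX : line_open predT (@over R (n' + n) p X) := line_open_over oX.
Let KX' : @over R (n' + n) p K `<=` over X. Proof. by move=> w; exact: KX. Qed.
Let om1' (w : vec) : over K w -> 1 <= omega w. Proof. by move=> _; exact: omega_ge1. Qed.

(** Extension across xi = 0: where |xi| < 1/4 both nets vanish and any estimate holds, and this open
    set together with that of xi <> 0 covers everything. *)
Let full mu k F F' : SPb k 0 mu F F' ->
  (forall e w, enorm (rsubmx w) < 4^-1 -> F e w = 0 /\ F' e w = 0) ->
  SP predT (over X) (over K) omega (shf 1 0) k 0 mu F F'.
Proof.
move=> SF F0.
have S0' : SP predT (over_small X) (over_small K) omega (shf 1 0) k 0 mu F F'.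
  have lo : line_open predT (@over_small R (n' + n) p X).
    by apply: open_line_open; exact: open_over_small.
  have sub : @over_small R (n' + n) p K `<=` over_small X.
    by move=> w [Kw w4]; split => //; exact: KX.
  split => [||c].
  - by apply: (S0 lo sub) => e w _ [_ /(F0 e)[]].
  - by apply: (S0 lo sub) => e w _ [_ /(F0 e)[]].
  - by apply: (S0 lo sub) => e w _ [_ /(F0 e)[-> ->]]; exact: subrr.
apply: (SP_sub _ _ _ (SP_union SF S0')) => // w Xw.
  have [w4|w4] := ltP (enorm (rsubmx w)) 4^-1; first by right.
  left; split => //; apply/negP => /eqP w0.
  by move: w4; rewrite w0 enorm0 leNgt invr_gt0 ltr0n.
by have [w4|w4] := ltP (enorm (rsubmx w)) 4^-1; [right|left].
Qed.

Lemma SP_acoef j k : SP predT (over X) (over K) omega (shf 1 0) k 0 0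
  (fun e => acoef chi (ph e) j) (fun e => acoef chi (ph' e) j).
Proof.
apply: full => [|e w w4]; last by rewrite !acoef_small.
have := SPM loA GA om1 (SP_scale loA GA om1 (0 +i* 1) (SP_diag loA GA (S1chi k)))
  (SPM loA GA om1 (SP_varphi k) (SP_rpderiv_ixi j k)).
rewrite !addr0; apply: (SP_ext loA GA) => e w _ _.
  by rewrite /acoef rmorphM.
by rewrite /acoef rmorphM.
Qed.

Lemma SP_bcoef l k : SP predT (over X) (over K) omega (shf 1 0) k 0 (-1)
  (fun e => bcoef chi (ph e) l) (fun e => bcoef chi (ph' e) l).
Proof.
apply: full => [|e w w4]; last by rewrite !bcoef_small.
have := SPM loA GA om1 (SP_scale loA GA om1 (0 +i* 1) (SP_diag loA GA (S1chi k)))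
  (SPM loA GA om1 (SPM loA GA om1 (SP_diag loA GA (S_enorm_inv2 k)) (SP_varphi k))
    (SP_rpderiv_iy l k)).
rewrite !addr0 add0r; have -> : -2 + 1 = -1 :> R by ring.
apply: (SP_ext loA GA) => e w _ _.
  by rewrite /bcoef !rmorphM.
by rewrite /bcoef !rmorphM.
Qed.

(** The cutoff has any order, a xi-derivative lowers the order 0 of [acoef] by one, and a
    y-derivative keeps the order -1 of [bcoef]. *)
Lemma SP_ccoef k : SP predT (over X) (over K) omega (shf 1 0) k 0 (-1)
  (fun e => ccoef chi (ph e)) (fun e => ccoef chi (ph' e)).
Proof.
apply: (SPD loX KX'); first apply: (SPD loX KX').
- by apply: (SP_diag loX KX'); exact: S_cutoff.
- apply: (SP_sum loX KX') => j.
  have := SP_pderiv loX KX' (i := ixi j) erefl (SP_acoef j k.+1).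
  by rewrite shf_ixi add0r.
apply: (SP_sum loX KX') => j.
have := SP_pderiv loX KX' (i := iy j) erefl (SP_bcoef j k.+1).
by rewrite shf_iy addr0.
Qed.

Variables (rho delta : R).
Hypotheses (rho_range : 0 < rho <= 1) (delta_range : 0 <= delta < 1).
Local Notation SPt := (SP predT (over X) (over K) omega (shf rho delta)).

Let sh_le (i : 'I_(n' + n + p)) : shf 1 0 i <= shf rho delta i.
Proof.
case/andP: rho_range => _ r1; case/andP: delta_range => d0 _.
by rewrite /shf; case: fintype.split => // _; rewrite lerN2.
Qed.

(** The three kinds of terms lower the order by [rho], by [1 - delta] and by 1: a xi-derivative with
    a coefficient of order 0, a y-derivative with one of order -1, and multiplication by one of
    order -1. All coefficients have exponent 0 in e, so [b] is kept. *)
Lemma SP_Lop k b mu F F' : SPt k.+1 b mu F F' ->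
  SPt k b (mu - Num.min rho (1 - delta))
    (fun e => Lop chi (ph e) (F e)) (fun e => Lop chi (ph' e) (F' e)).
Proof.
move=> SF; set s := Num.min _ _.
have s_rho : s <= rho by rewrite /s ge_min lexx.
have s_delta : s <= 1 - delta by rewrite /s ge_min lexx orbT.
have s1 : s <= 1 by apply: le_trans s_rho _; case/andP: rho_range.
have conv mu0 (H H' : R -> vec -> R[i]) : SP predT (over X) (over K) omega (shf 1 0) k 0 mu0 H H' -> SPt k 0 mu0 H H'.
  exact: (SP_sh om1' (fun i _ => sh_le i)).
apply: (SPD loX KX'); first apply: (SPD loX KX').
- apply: (SP_sum loX KX') => j.
  have := SPM loX KX' om1' (conv _ _ _ (SP_acoef j k))
    (SP_pderiv loX KX' (i := ixi j) erefl SF).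
  by rewrite !add0r shf_ixi; apply: (SP_le om1') => //; rewrite lerD2l lerN2.
- apply: (SP_sum loX KX') => j.
  have := SPM loX KX' om1' (conv _ _ _ (SP_bcoef j k))
    (SP_pderiv loX KX' (i := iy j) erefl SF).
  rewrite !add0r shf_iy; apply: (SP_le om1') => //.
  by move: s_delta; set t := s; lra.
have SF' := SP_le om1' (leqnSn k) (lexx b) (lexx mu) SF.
have := SPM loX KX' om1' (conv _ _ _ (SP_ccoef k)) SF'.
by rewrite add0r; apply: (SP_le om1') => //; move: s1; set t := s; lra.
Qed.

Lemma SP_iter_Lop h k b mu F F' : SPt (h + k) b mu F F' ->
  SPt k b (mu - h%:R * Num.min rho (1 - delta))
    (fun e => iter h (Lop chi (ph e)) (F e)) (fun e => iter h (Lop chi (ph' e)) (F' e)).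
Proof.
elim: h k => [|h IH] k SF; first by rewrite mul0r subr0.
have := SP_Lop (IH k.+1 _); rewrite addnS => /(_ SF).
by rewrite -addrA -opprD -[X in _ - (_ + X)]mul1r -mulrDl natr1.
Qed.
End coefficients.
End phase_functions.

(** * Integrals depending on a parameter *)

Section complex_integral.
Context {R : realType} {dT : measure_display} {T : measurableType dT}.
Local Notation normc := (@Normc.normc R).
Variables (mu : {measure set T -> \bar R}) (D : set T).
Hypothesis mD : measurable D.
Implicit Types (g : T -> R[i]) (M : T -> R).

Definition cint g : R[i] :=
  Rintegral mu D (fun t => complex.Re (g t)) +i* Rintegral mu D (fun t => complex.Im (g t)).

Definition cmeas g : Prop := measurable_fun D (fun t => complex.Re (g t)) /\
  measurable_fun D (fun t => complex.Im (g t)).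

Definition cdom M g : Prop := cmeas g /\ exists c, forall t, D t -> normc (g t) <= c * M t.

Lemma eq_cint g1 g2 : (forall t, D t -> g1 t = g2 t) -> cint g1 = cint g2.
Proof.
by move=> E; congr (_ +i* _); apply: eq_Rintegral => t /set_mem Dt; rewrite E.
Qed.

Lemma eq_cmeas g1 g2 : (forall t, D t -> g1 t = g2 t) -> cmeas g1 -> cmeas g2.
Proof.
move=> E [h1 h2]; split; [apply: eq_measurable_fun h1|apply: eq_measurable_fun h2] => t /set_mem Dt.
  by rewrite E.
by rewrite E.
Qed.

Lemma cmeasM g1 g2 : cmeas g1 -> cmeas g2 -> cmeas (fun t => g1 t * g2 t).
Proof.
move=> [h1 h2] [k1 k2]; split.
  under eq_fun do rewrite cReM.
  by apply: measurable_funB; exact: measurable_funM.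
under eq_fun do rewrite cImM.
by apply: measurable_funD; exact: measurable_funM.
Qed.

Lemma cmeasD g1 g2 : cmeas g1 -> cmeas g2 -> cmeas (fun t => g1 t + g2 t).
Proof.
move=> [h1 h2] [k1 k2]; split.
  by under eq_fun do rewrite cReD; exact: measurable_funD.
by under eq_fun do rewrite cImD; exact: measurable_funD.
Qed.

Lemma cmeas_cst c : cmeas (fun=> c).
Proof. by split. Qed.

Lemma integrable_scale a (f : T -> R) : mu.-integrable D (EFin \o f) ->
  mu.-integrable D (EFin \o (fun t => a * f t)).
Proof. by move=> i_f; exact: (integrableZl mD a i_f). Qed.

Section dominated.
Variable M : T -> R.
Hypotheses (M0 : forall t, 0 <= M t) (iM : mu.-integrable D (EFin \o M)).

Lemma cdom_integrable g : cdom M g ->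
  mu.-integrable D (EFin \o (fun t => complex.Re (g t))) /\
  mu.-integrable D (EFin \o (fun t => complex.Im (g t))).
Proof.
move=> [[mR mI] [c Hc]].
have iN : mu.-integrable D (fun t => (`|c|)%:E * (EFin \o M) t)%E by exact: integrableZl.
have le t : D t -> normc (g t) <= `| `|c| * M t|.
  move=> Dt; apply: le_trans (Hc t Dt) _; rewrite ger0_norm ?mulr_ge0//.
  by rewrite ler_wpM2r ?ler_norm.
split; apply: (le_integrable mD _ _ iN) => /=.
- exact/measurable_EFinP.
- by move=> t Dt; rewrite lee_fin (le_trans (normc_Re _))// le.
- exact/measurable_EFinP.
- by move=> t Dt; rewrite lee_fin (le_trans (normc_Im _))// le.
Qed.

Lemma cdomD g1 g2 : cdom M g1 -> cdom M g2 -> cdom M (fun t => g1 t + g2 t).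
Proof.
move=> [m1 [c1 H1]] [m2 [c2 H2]]; split; first exact: cmeasD.
exists (c1 + c2) => t Dt; rewrite mulrDl (le_trans (le_normcD _ _))//.
by rewrite lerD ?H1 ?H2.
Qed.

Lemma cdomZ c g : cdom M g -> cdom M (fun t => c * g t).
Proof.
move=> [m1 [c1 H1]]; split; first by apply: cmeasM => //; exact: cmeas_cst.
exists (normc c * c1) => t Dt; rewrite Normc.normcM -mulrA ler_wpM2l ?normc_ge0//.
exact: H1.
Qed.

Lemma cintD g1 g2 : cdom M g1 -> cdom M g2 ->
  cint (fun t => g1 t + g2 t) = cint g1 + cint g2.
Proof.
move=> /cdom_integrable[a1 b1] /cdom_integrable[a2 b2].
apply: complexP; rewrite ?cReD ?cImD /=.
  by under eq_Rintegral do rewrite cReD; rewrite RintegralD.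
by under eq_Rintegral do rewrite cImD; rewrite RintegralD.
Qed.

Lemma cintZ c g : cdom M g -> cint (fun t => c * g t) = c * cint g.
Proof.
move=> /cdom_integrable[a1 b1]; case: c => a b.
have ia : mu.-integrable D (EFin \o (fun t => a * complex.Re (g t))).
  exact: integrable_scale.
have ib : mu.-integrable D (EFin \o (fun t => b * complex.Re (g t))).
  exact: integrable_scale.
have ia' : mu.-integrable D (EFin \o (fun t => a * complex.Im (g t))).
  exact: integrable_scale.
have ib' : mu.-integrable D (EFin \o (fun t => b * complex.Im (g t))).
  exact: integrable_scale.
apply: complexP; rewrite ?cReM ?cImM /=.
  under eq_Rintegral do rewrite cReM /=.
  by rewrite RintegralB// !RintegralZl.
under eq_Rintegral do rewrite cImM /=.
by rewrite RintegralD// !RintegralZl.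
Qed.

Lemma cintB g1 g2 : cdom M g1 -> cdom M g2 ->
  cint (fun t => g1 t - g2 t) = cint g1 - cint g2.
Proof.
move=> h1 h2; have h3 := cdomZ (-1) h2.
rewrite -[RHS]/(cint g1 + - cint g2) -[- cint g2]mulN1r -cintZ// -cintD//.
by apply: eq_cint => t _; rewrite mulN1r.
Qed.

Lemma cdom_sum (I : Type) (r : seq I) (g : I -> T -> R[i]) :
  (forall i, cdom M (g i)) -> cdom M (fun t => \sum_(i <- r) g i t).
Proof.
move=> H; elim: r => [|i r [IHm [c IHc]]].
  split; first by apply: (@eq_cmeas (fun=> 0)); [move=> t _; rewrite big_nil|exact: cmeas_cst].
  by exists 0 => t Dt; rewrite big_nil Normc.normc0 mul0r.
have [hm [c' hc]] := cdomD (H i) (conj IHm (ex_intro _ c IHc)).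
split; first by apply: eq_cmeas hm => t _; rewrite big_cons.
by exists c' => t Dt; rewrite big_cons; exact: hc.
Qed.

Lemma cint_sum (I : Type) (r : seq I) (g : I -> T -> R[i]) :
  (forall i, cdom M (g i)) -> cint (fun t => \sum_(i <- r) g i t) = \sum_(i <- r) cint (g i).
Proof.
move=> H; elim: r => [|i r IH].
  rewrite big_nil (@eq_cint _ (fun=> 0 * 0)); last by move=> t _; rewrite big_nil mul0r.
  rewrite cintZ ?mul0r//; split; first exact: cmeas_cst.
  by exists 0 => t Dt; rewrite Normc.normc0 mul0r.
rewrite big_cons -IH -cintD//; last exact: cdom_sum.
by apply: eq_cint => t _; rewrite big_cons.
Qed.

(** The factor 2 comes from bounding real and imaginary parts separately. *)
Lemma cint_bound g c : 0 <= c -> cmeas g -> (forall t, D t -> normc (g t) <= c * M t) ->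
  normc (cint g) <= c * (2 * Rintegral mu D M).
Proof.
move=> c0 mg Hg; have [iR iI] := cdom_integrable (conj mg (ex_intro _ c Hg)).
have icM : mu.-integrable D (EFin \o (fun t => c * M t)).
  exact: integrable_scale.
have bnd (f : T -> R) : mu.-integrable D (EFin \o f) -> (forall t, D t -> `|f t| <= c * M t) ->
    `|Rintegral mu D f| <= c * Rintegral mu D M.
  move=> i_f Hf; apply: le_trans (le_normr_Rintegral mD i_f) _.
  rewrite -RintegralZl//; apply: le_Rintegral => //.
  by have := integrable_abse i_f; apply: eq_integrable => // t _.
apply: le_trans (normc_le_ReIm _) _ => /=.
rewrite mulrCA mulr_natl mulr2n; apply: lerD; apply: bnd => // t Dt.
  exact: le_trans (normc_Re _) (Hg t Dt).
exact: le_trans (normc_Im _) (Hg t Dt).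
Qed.
End dominated.
End complex_integral.

Section differentiation_under_the_integral.
Context {R : realType} {dT : measure_display} {T : measurableType dT} {d : nat}.
Local Notation normc := (@Normc.normc R).
Variables (mu : {measure set T -> \bar R}) (D : set T).
Hypothesis mD : measurable D.

(** Differentiation under the integral along the line through [x0]. Measurability of the derivative
    is part of the conclusion, so that the step can be iterated. *)
Lemma is_derive_Rintegral (E DE : 'rV[R]_d -> T -> R) (x0 v : 'rV[R]_d) (r : R) (M : T -> R) :
  0 < r -> (forall t, 0 <= M t) -> mu.-integrable D (EFin \o M) ->
  (forall x, `|x - x0| < r -> measurable_fun D (E x) /\ forall t, D t -> `|E x t| <= M t) ->
  (forall x t, `|x - x0| < r -> D t ->
     is_derive x v (fun x => E x t) (DE x t) /\ `|DE x t| <= M t) ->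
  is_derive x0 v (fun x => Rintegral mu D (E x)) (Rintegral mu D (DE x0)) /\
  measurable_fun D (DE x0).
Proof.
move=> r0 M0 iM HE HD.
pose q := r / (`|v| + 1).
have v10 : 0 < `|v| + 1 by rewrite ltr_wpDl.
have q0 : 0 < q by rewrite divr_gt0.
have inr (s : R) : `|s| < q -> `|s *: v + x0 - x0| < r.
  move=> sq; rewrite addrK normrZ; apply: (@le_lt_trans _ _ (`|s| * (`|v| + 1))).
    by rewrite ler_wpM2l// lerDl.
  by rewrite -ltr_pdivlMr.
pose f s t := E (s *: v + x0) t.
have Iq (s : R) : `]- q, q[%classic s -> `|s| < q by rewrite /= in_itv /= ltr_norml.
have Ia : `]- q, q[%classic (0 : R) by rewrite /= in_itv /= oppr_lt0 q0.
have intf s : `]- q, q[%classic s -> mu.-integrable D (EFin \o f s).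
  move=> /Iq/inr/HE[mE bE]; apply: (le_integrable mD _ _ iM) => /=.
    exact/measurable_EFinP.
  by move=> t Dt; rewrite lee_fin (ger0_norm (M0 t)) bE.
have df (s : R) t : `|s| < q -> D t -> is_derive s (1 : R) (f ^~ t) (DE (s *: v + x0) t).
  move=> sq Dt; have [[dE EE] _] := HD _ t (inr s sq) Dt.
  by rewrite -EE; exact: is_derive_on_line.
have derf s t : `]- q, q[%classic s -> D t -> derivable (f ^~ t) s 1.
  by move=> /Iq sq Dt; have [] := df s t sq Dt.
have dfE s t : `|s| < q -> D t -> partial1of2 f s t = DE (s *: v + x0) t.
  by move=> sq Dt; rewrite partial1of2E; have [_ <-] := df s t sq Dt.
have ub s t : `]- q, q[%classic s -> D t -> `|partial1of2 f s t| <= M t.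
  by move=> /Iq sq Dt; rewrite dfE//; exact: (HD _ _ (inr s sq) Dt).2.
have q00 : `|0 : R| < q by rewrite normr0.
have E0 t : D t -> partial1of2 f 0 t = DE x0 t.
  by move=> Dt; rewrite dfE// scale0r add0r.
split.
  apply/is_derive1P; apply: DeriveDef.
    exact: (derivable_under_integral mD Ia intf derf M0 iM ub).
  rewrite -derive1E.
  have := differentiation_under_integral mD Ia intf derf M0 iM ub.
  move=> H; apply: etrans H _.
  by apply: eq_Rintegral => t /set_mem Dt; exact: E0.
(* A null sequence inside the interval: the derivative is the pointwise limit of the difference
   quotients along it, hence measurable. *)
pose u (k : nat) : R := q / k.+2%:R.
have u0 k : 0 < u k by rewrite divr_gt0.
have uq k : `|u k| < q.
  by rewrite gtr0_norm// /u ltr_pdivrMr// ltr_pMr// ltr1n.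
have ucvg : u k @[k --> \oo] --> (0 : R).
  rewrite -[X in _ --> X](mulr0 q); apply: cvgMr.
  have := @cvg_harmonic R; rewrite -(cvg_shiftn 1) /harmonic /=.
  by under eq_fun do rewrite addn1.
have mg k : measurable_fun D (fun t => ((u k)^-1 * (f (u k) t - f 0 t))%:E).
  apply/measurable_EFinP/measurable_funM => //; apply: measurable_funB.
    exact: (HE _ (inr _ (uq k))).1.
  exact: (HE _ (inr _ q00)).1.
apply/measurable_EFinP.
apply: (emeasurable_fun_cvg (fun k t => ((u k)^-1 * (f (u k) t - f 0 t))%:E)) => //.
move=> t Dt; apply: cvg_EFin; first exact: nearW.
have [dfx Edfx] := df 0 t q00 Dt; rewrite scale0r add0r in Edfx.
rewrite /comp -Edfx /=.
have /cvgr_dnbhsP H := dfx.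
have := H u (conj (fun k => lt0r_neq0 (u0 k)) ucvg).
rewrite /derive.
set a := (X in X @ _ --> _ -> _); set b := (X in _ -> X @ _ --> _).
suff -> : a = b by [].
apply/funext => k; rewrite /a /b /= addr0.
by rewrite [(u k)%:A]mulr1.
Qed.

Lemma cder_cint (E DE : 'rV[R]_d -> T -> R[i]) (x0 v : 'rV[R]_d) (r : R) (M : T -> R) :
  0 < r -> (forall t, 0 <= M t) -> mu.-integrable D (EFin \o M) ->
  (forall x, `|x - x0| < r -> cmeas D (E x) /\ forall t, D t -> normc (E x t) <= M t) ->
  (forall x t, `|x - x0| < r -> D t ->
     cder (fun x => E x t) x v (DE x t) /\ normc (DE x t) <= M t) ->
  cder (fun x => cint mu D (E x)) x0 v (cint mu D (DE x0)) /\ cmeas D (DE x0).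
Proof.
move=> r0 M0 iM HE HD.
have [|x t xr Dt|dR mR] := @is_derive_Rintegral (fun x t => complex.Re (E x t))
    (fun x t => complex.Re (DE x t)) x0 v r M r0 M0 iM.
- move=> x /HE[[mR _] bE]; split => // t Dt; exact: le_trans (normc_Re _) (bE t Dt).
- have [[dR _] bD] := HD x t xr Dt; split => //; exact: le_trans (normc_Re _) bD.
have [|x t xr Dt|dI mI] := @is_derive_Rintegral (fun x t => complex.Im (E x t))
    (fun x t => complex.Im (DE x t)) x0 v r M r0 M0 iM.
- move=> x /HE[[_ mI] bE]; split => // t Dt; exact: le_trans (normc_Im _) (bE t Dt).
- have [[_ dI] bD] := HD x t xr Dt; split => //; exact: le_trans (normc_Im _) bD.
by split; split.
Qed.

(** Near every point one integrable function bounds all derivatives up to order [k], uniformly in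
    the parameter, as repeated differentiation under the integral requires. *)
Definition dominated_family (A : set 'rV[R]_d) (k : nat) (E : 'rV[R]_d -> T -> R[i]) : Prop :=
  (forall x, A x -> cmeas D (E x)) /\
  forall x0, A x0 -> exists r M, [/\ 0 < r, forall t, 0 <= M t,
    mu.-integrable D (EFin \o M) & forall x, `|x - x0| < r -> A x /\
      forall s t, (size s <= k)%N -> D t ->
        normc (pderivs s (E ^~ t) x) <= M t /\
        ((size s < k)%N -> forall i, pdiff i (pderivs s (E ^~ t)) x)].

(** The induction on the word carries along the measurability of the differentiated integrand, as
    the next differentiation asks for it. *)
Lemma pderivs_cint A k E s : open A -> dominated_family A k E -> (size s <= k)%N ->
  (forall x, A x -> pderivs s (fun x => cint mu D (E x)) x =
     cint mu D (fun t => pderivs s (E ^~ t) x) /\ cmeas D (fun t => pderivs s (E ^~ t) x)) /\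
  ((size s < k)%N -> forall i x, A x -> pdiff i (pderivs s (fun x => cint mu D (E x))) x).
Proof.
move=> oA [mE HE].
have step s' i x0 : (size s' < k)%N -> A x0 ->
    (forall x, A x -> pderivs s' (fun x => cint mu D (E x)) x =
       cint mu D (fun t => pderivs s' (E ^~ t) x) /\ cmeas D (fun t => pderivs s' (E ^~ t) x)) ->
    cder (pderivs s' (fun x => cint mu D (E x))) x0 (delta_mx 0 i)
      (cint mu D (fun t => pderivs (i :: s') (E ^~ t) x0)) /\
    cmeas D (fun t => pderivs (i :: s') (E ^~ t) x0).
  move=> sk Ax0 IH; have [r [M [r0 M0 iM HM]]] := HE x0 Ax0.
  have [|x t xr Dt|c1 c2] := @cder_cint (fun x t => pderivs s' (E ^~ t) x)
      (fun x t => pderivs (i :: s') (E ^~ t) x) x0 (delta_mx 0 i) r M r0 M0 iM.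
  - move=> x xr; have [Ax HMx] := HM x xr; split; first exact: (IH x Ax).2.
    by move=> t Dt; exact: (HMx s' t (ltnW sk) Dt).1.
  - have [Ax HMx] := HM x xr; split; last exact: (HMx (i :: s') t sk Dt).1.
    exact: ((HMx s' t (ltnW sk) Dt).2 sk i).
  split => //; apply: cder_near c1.
  by apply: filterS (open_nbhs_nbhs (conj oA Ax0)) => x Ax; rewrite (IH x Ax).1.
elim: s => [|i s IH] sk.
  have base x : A x -> pderivs [::] (fun x => cint mu D (E x)) x =
      cint mu D (fun t => pderivs [::] (E ^~ t) x) /\ cmeas D (fun t => pderivs [::] (E ^~ t) x).
    by move=> Ax; split => //; exact: mE.
  split => // k0 i x Ax; exact: cder_pdiff (step [::] i x k0 Ax base).1.
have [IH1 _] := IH (ltnW sk).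
have IH2 x : A x -> pderivs (i :: s) (fun x => cint mu D (E x)) x =
    cint mu D (fun t => pderivs (i :: s) (E ^~ t) x) /\
    cmeas D (fun t => pderivs (i :: s) (E ^~ t) x).
  move=> Ax; have [c1 c2] := step s i x sk Ax IH1; split => //; exact: cder_pderiv c1.
split => // sk' j x Ax; exact: cder_pdiff (step (i :: s) j x sk' Ax IH2).1.
Qed.

(** The integrand may depend on [k]: a fixed power of L makes only finitely many derivatives
    integrable, and different powers give the same integral. *)
Lemma cint_smooth_on A (F : 'rV[R]_d -> R[i]) : open A ->
  (forall k, exists2 E, dominated_family A k E & forall x, A x -> F x = cint mu D (E x)) ->
  smooth_on A F.
Proof.
move=> oA H s; have [E dE FE] := H (size s).+1.
have Fs s' x : A x -> pderivs s' F x = pderivs s' (fun x => cint mu D (E x)) x.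
  exact: pderivs_ext.
have dF s' i x : A x -> (size s' <= size s)%N -> pdiff i (pderivs s' F) x.
  move=> Ax ss; have [_ h] := pderivs_cint oA dE (leqW ss).
  apply: (cder_pdiff (l := pderiv i (pderivs s' (fun x => cint mu D (E x))) x)).
  apply: cder_near (h ss i x Ax).
  by apply: filterS (open_nbhs_nbhs (conj oA Ax)) => y Ay; rewrite Fs.
split; last by move=> i x Ax; apply/pdiffP; exact: dF.
move=> x0 Ax0; have [r [M [r0 M0 iM HM]]] := dE.2 x0 Ax0.
have bd i x : `|x - x0| < r -> normc (pderiv i (pderivs s F) x) <= 1 * (2 * Rintegral mu D M).
  move=> xr; have [Ax HMx] := HM x xr.
  have [h _] := pderivs_cint (s := i :: s) oA dE (leqnn _).
  rewrite -[pderiv i _]/(pderivs (i :: s) F) Fs// (h x Ax).1.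
  apply: cint_bound => //; first exact: (h x Ax).2.
  by move=> t Dt; rewrite mul1r; exact: (HMx (i :: s) t (leqnn _) Dt).1.
split.
  apply: (bounded_partials_continuous (M := 1 * (2 * Rintegral mu D M)) r0) => i x xr.
  have [Ax _] := HM x xr; have /pdiffP[dR _] := dF s i x Ax (leqnn _); split => //.
  exact: le_trans (normc_Re (pderiv i (pderivs s F) x)) (bd i x xr).
apply: (bounded_partials_continuous (M := 1 * (2 * Rintegral mu D M)) r0) => i x xr.
have [Ax _] := HM x xr; have /pdiffP[_ dI] := dF s i x Ax (leqnn _); split => //.
exact: le_trans (normc_Im (pderiv i (pderivs s F) x)) (bd i x xr).
Qed.
End differentiation_under_the_integral.

(** * Integration by parts *)

Section phase_space.
Context {R : realType} {n' n p : nat}.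
Local Notation T := (measurableTypeR R).
Local Notation normc := (@Normc.normc R).
Local Notation vec := 'rV[R]_(n' + n + p).
Implicit Types (x : 'rV[R]_n') (t : n.-tuple T * p.-tuple T).

Definition emb x t : vec := pt x (row_of_tuple t.1) (row_of_tuple t.2).

Definition fiber (Om : set 'rV[R]_n) : set (n.-tuple T * p.-tuple T) :=
  [set t | Om (row_of_tuple t.1)].

Lemma measurable_emb x i : measurable_fun setT (fun t => emb x t 0 i).
Proof.
rewrite /emb /pt; under eq_fun do rewrite mxE.
case: (fintype.split i) => [k|j].
  under eq_fun do rewrite mxE.
  case: (fintype.split k) => [l|l]; first exact: measurable_cst.
  exact: (measurableT_comp (measurable_row_of_tuple l) measurable_fst).
exact: (measurableT_comp (measurable_row_of_tuple j) measurable_snd).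
Qed.

Lemma measurable_fiber Om : open Om -> measurable (fiber Om).
Proof.
move=> oOm; apply: (measurable_preimage_open (tau := fun t => row_of_tuple t.1)) => // i.
exact: (measurableT_comp (measurable_row_of_tuple i) measurable_fst).
Qed.

Lemma row_of_tuple_tshift q (i : 'I_q) (s : R) (t : q.-tuple T) :
  row_of_tuple (tshift i s t) = s *: delta_mx 0 i + row_of_tuple t.
Proof.
apply/rowP => j; rewrite !mxE tnth_mktuple eqxx /= -val_eqE /=.
by case: eqP => _; rewrite ?mulr1 ?mulr0 ?add0r// addrC.
Qed.

Lemma row_of_tuple_inj q : injective (@row_of_tuple R q).
Proof.
move=> s t st; apply: eq_from_tnth => i.
by have := congr1 (fun v : 'rV_q => v 0 i) st; rewrite !mxE.
Qed.

Lemma emb_lsub x t : lsubmx (emb x t) = row_mx x (row_of_tuple t.1).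
Proof. by rewrite /emb /pt row_mxKl. Qed.

Lemma emb_xi x t : rsubmx (emb x t) = row_of_tuple t.2.
Proof. by rewrite /emb /pt row_mxKr. Qed.

Lemma emb_y x t : ypart (emb x t) = row_of_tuple t.1.
Proof. by rewrite /ypart emb_lsub row_mxKr. Qed.

(** Translations along coordinate [i], realized by measure preserving maps of the integration
    variables; they exist for the y and xi coordinates. *)
Definition flow (i : 'I_(n' + n + p)) : Prop :=
  exists psi : R -> n.-tuple T * p.-tuple T -> n.-tuple T * p.-tuple T,
  [/\ forall s, mpres (@phase_measure R n p) (psi s), forall t, psi 0 t = t &
      forall x s t, emb x (psi s t) = s *: delta_mx 0 i + emb x t].

Lemma flow_iy k : flow (iy k).
Proof.
exists (fun s t => (tshift k s t.1, t.2)); split.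
- by move=> s; exact: (mpres_pair1 (lebesgue_tuple R p) (@mpres_tshift R n k s)).
- move=> [t1 t2] /=; congr pair; apply: row_of_tuple_inj.
  by rewrite row_of_tuple_tshift scale0r add0r.
- move=> x s t; rewrite /emb /pt row_of_tuple_tshift /iy delta_lshift delta_rshift.
  by rewrite !row_mx_addZ !scaler0 !add0r.
Qed.

Lemma flow_ixi j : flow (ixi j).
Proof.
exists (fun s t => (t.1, tshift j s t.2)); split.
- by move=> s; exact: (mpres_pair2 (lebesgue_tuple R n) (@mpres_tshift R p j s)).
- move=> [t1 t2] /=; congr pair; apply: row_of_tuple_inj.
  by rewrite row_of_tuple_tshift scale0r add0r.
- move=> x s t; rewrite /emb /pt row_of_tuple_tshift /ixi delta_rshift.
  by rewrite !row_mx_addZ !scaler0 !add0r.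
Qed.

Lemma continuous_ypart : continuous (@ypart R n' n p).
Proof.
move=> w; exact: (continuous_comp (@continuous_lsubmx R (n' + n) p w)
  (@continuous_rsubmx R n' n (lsubmx w))).
Qed.

(** Coordinatewise 2 a^2 + 2 (a - b)^2 - b^2 = (2 a - b)^2 >= 0, and |v' - v| <= 1 turns the sum
    into <v>^2 <= 3 + 2 |v'|^2 <= 4 <v'>^2. *)
Lemma peetre (v v' : 'rV[R]_p) : enorm (v' - v) <= 1 -> japanese v <= 2 * japanese v'.
Proof.
move=> vv; rewrite -ler_sqr ?nnegrE ?mulr_ge0 ?(ltW (japanese_gt0 _))//.
rewrite exprMn !sqr_japanese.
have h : \sum_i v 0 i ^+ 2 <= 2 * \sum_i v' 0 i ^+ 2 + 2 * \sum_i (v' - v) 0 i ^+ 2.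
  rewrite !mulr_sumr -big_split /=; apply: ler_sum => i _; rewrite !mxE.
  have := sqr_ge0 (2 * v' 0 i - v 0 i); nra.
have : enorm (v' - v) ^+ 2 <= 1 by rewrite expr_le1// enorm_ge0.
rewrite sqr_enorm => h2.
have h3 : 0 <= \sum_i v' 0 i ^+ 2 by apply: sumr_ge0 => i _; exact: sqr_ge0.
lra.
Qed.

Lemma japanese_powR_shift (v v' : 'rV[R]_p) mu : mu <= 0 -> enorm (v - v') <= 1 ->
  japanese v' `^ mu <= 2 `^ (- mu) * japanese v `^ mu.
Proof.
move=> mu0 vv; have := peetre (v := v) (v' := v').
have -> : enorm (v' - v) = enorm (v - v').
  by rewrite -[v' - v]opprB -scaleN1r enormZ normrN1 mul1r.
move=> /(_ vv) H; have v0 := japanese_gt0 v; have v'0 := japanese_gt0 v'.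
have h : japanese v `^ (- mu) <= 2 `^ (- mu) * japanese v' `^ (- mu).
  rewrite -powRM ?(ltW v'0)//; apply: ge0_ler_powR => //; rewrite ?nnegrE ?oppr_ge0//.
    exact: ltW.
  by rewrite mulr_ge0// ltW.
have E (u : 'rV[R]_p) : japanese u `^ mu = (japanese u `^ (- mu))^-1 by rewrite powRN invrK.
rewrite !E ler_pdivlMr ?powR_gt0// mulrC ler_pdivrMr ?powR_gt0//.
Qed.

Variables (Om' : set 'rV[R]_n') (Om : set 'rV[R]_n).
Hypotheses (oOm' : open Om') (oOm : open Om).
Local Notation X := (prod_set Om' Om).
Local Notation D := (fiber Om).
Local Notation A := (@over R (n' + n) p X).

Lemma over_pt w : A w = (Om' (lsubmx (lsubmx w)) /\ Om (ypart w)).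
Proof. by []. Qed.

Lemma emb_over x t : Om' x -> D t -> A (emb x t).
Proof. by move=> Ox Dt; split; rewrite emb_lsub ?row_mxKl ?row_mxKr. Qed.

Lemma measurable_on_fiber (g : vec -> R) x : Om' x ->
  (forall w, A w -> {for w, continuous g}) ->
  measurable_fun D (fun t => g (emb x t)).
Proof.
move=> Ox cg; have <- : emb x @^-1` A = D.
  apply/seteqP; split => t; last by move=> Dt; exact: emb_over.
  by move=> [_]; rewrite emb_lsub row_mxKr.
by apply: measurable_continuous_comp => //; [exact: measurable_emb|exact/open_over/open_prod_set].
Qed.

(** By translation invariance the integral of a translate is constant, and its derivative at 0 is
    the integral of the derivative. The support in y is compact in [Om], so there are no boundary
    terms. *)
Lemma integral_rpderiv (i : 'I_(n' + n + p)) (g : vec -> R) K' C mu x : flow i ->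
  Om' x -> mu < - p%:R -> compact_in K' Om ->
  (forall w, A w -> {for w, continuous g} /\ derivable g w (delta_mx 0 i)) ->
  (forall w, A w -> ~ K' (ypart w) -> g w = 0) ->
  (forall w, lsubmx (lsubmx w) = x -> K' (ypart w) ->
     `|g w| <= C * omega w `^ mu /\ `|rpderiv i g w| <= C * omega w `^ mu) ->
  Rintegral (@phase_measure R n p) D (fun t => rpderiv i g (emb x t)) = 0.
Proof.
move=> [psi [mpsi psi0 psiE]] Ox mup [cK' K'Om] gA g0 gb.
have oA : open A by exact/open_over/open_prod_set.
have mu0 : mu <= 0 by rewrite (le_trans (ltW mup))// oppr_le0.
(* Extension by zero, so that translated points may leave the domain. It stays differentiable along
   [i], since [g] already vanishes near points whose y is off [K']. *)
pose ge w := if `[< A w >] then g w else 0.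
have geA w : A w -> ge w = g w by move=> Aw; rewrite /ge asboolT.
have nearA w : A w -> \forall w' \near w, g w' = ge w'.
  move=> Aw; apply: filterS (open_nbhs_nbhs (conj oA Aw)) => w' Aw'.
  by rewrite geA.
have cl : closed K' by exact: compact_closed.
have dg w : lsubmx (lsubmx w) = x ->
    is_derive w (delta_mx 0 i) ge (rpderiv i ge w) /\
    ((K' (ypart w) /\ (`|ge w| <= C * omega w `^ mu /\ `|rpderiv i ge w| <= C * omega w `^ mu))
     \/ (ge w = 0 /\ rpderiv i ge w = 0)).
  move=> wx; have [Kw|nKw] := pselect (K' (ypart w)).
    have Aw : A w by rewrite over_pt wx; split => //; exact: K'Om.
    have d1 : is_derive w (delta_mx 0 i) g (rpderiv i g w).
      by apply: DeriveDef => //; exact: (gA w Aw).2.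
    have d2 : is_derive w (delta_mx 0 i) ge (rpderiv i g w).
      by apply: is_derive_line d1; exact: near_line (nearA w Aw).
    have E : rpderiv i ge w = rpderiv i g w by have [_] := d2.
    by split; [rewrite E|left; split => //; rewrite geA// E; exact: gb].
  have z : \forall w' \near w, 0 = ge w'.
    have oN : open (@ypart R n' n p @^-1` (~` K')).
      by move/continuousP: continuous_ypart; apply; exact: closed_openC.
    apply: filterS (open_nbhs_nbhs (conj oN nKw)) => w' nKw'.
    by rewrite /ge; case: asboolP => // Aw'; rewrite g0.
  have d2 : is_derive w (delta_mx 0 i) ge 0.
    exact: (@is_derive_line R _ (fun=> 0) ge w (delta_mx 0 i) 0 (near_line _ z) (is_derive_cst _ _ _)).
  have E : rpderiv i ge w = 0 by have [_] := d2.
  by split; [rewrite E|right; split => //; rewrite -(nbhs_singleton z)].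
have [r0 Hr] : exists r : R, forall y, K' y -> `|y| <= r.
  have [M [_ HM]] := compact_bounded cK'; exists (M + 1) => y Ky.
  by apply: HM => //; rewrite ltrDl.
(* A translation by |s| < 1 moves y by at most 1 and changes <xi> by a factor of at most 2, whence
   the enlarged radius and the constant 2^(-mu). *)
pose Mt t := `|C| * 2 `^ (- mu) * box_weight (r0 + 1) mu t.
have Mt0 t : 0 <= Mt t by rewrite !mulr_ge0 ?powR_ge0 ?box_weight_ge0.
have embx y t : lsubmx (lsubmx (emb y t)) = y by rewrite emb_lsub row_mxKl.
have bb (s : R) t (v : R) : `|s| < 1 -> K' (ypart (emb x (psi s t))) ->
    `|v| <= C * omega (emb x (psi s t)) `^ mu -> `|v| <= Mt t.
  move=> s1 Ky /le_trans; apply.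
  have Et : emb x t = - s *: delta_mx 0 i + emb x (psi s t).
    by rewrite psiE addrA -scalerDl addNr scale0r add0r.
  apply: (@le_trans _ _ (`|C| * omega (emb x (psi s t)) `^ mu)).
    by rewrite ler_wpM2r ?powR_ge0// ler_norm.
  have ny : `|row_of_tuple t.1| <= r0 + 1.
    have := congr1 (@ypart R n' n p) Et.
    rewrite {1}/ypart emb_lsub row_mxKr /ypart !lsubmx_addZ !rsubmx_addZ => ->.
    apply: le_trans (ler_normD _ _) _; rewrite addrC lerD ?(Hr _ Ky)//.
    rewrite normrZ normrN; apply: mulr_ile1 => //; first exact: ltW.
    apply: norm_le_coord => // j; rewrite !mxE.
    by case: (_ && _); rewrite /= ?normr1 ?normr0.
  rewrite /Mt /box_weight ny mul1r -mulrA ler_wpM2l// /omega.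
  have -> : row_of_tuple t.2 = rsubmx (emb x t) by rewrite emb_xi.
  apply: japanese_powR_shift => //; rewrite Et rsubmx_addZ addrK enormZ normrN.
  apply: (@le_trans _ _ (1 * enorm (rsubmx (delta_mx 0 i : vec)))).
    by rewrite ler_wpM2r ?enorm_ge0// ltW.
  rewrite mul1r -(@expr_le1 R 2%N)// ?enorm_ge0// sqr_enorm.
  under eq_bigr do rewrite !mxE eqxx /=.
  have := fintype.splitK i; case: (fintype.split i) => j /= <-.
    by rewrite big1// => l _; rewrite eq_rlshift expr0n.
  rewrite (bigD1 j)//= eqxx expr1n big1 ?addr0// => l lj.
  by rewrite eq_rshift (negbTE lj) expr0n.
have H : Rintegral (@phase_measure R n p) setT (fun t => rpderiv i ge (emb x t)) = 0.
  apply: (integral_flow_derivative (psi := psi) (G := fun t => ge (emb x t)) (M := Mt)) => //.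
  - have mD : measurable D by exact: measurable_fiber.
    have -> : (fun t => ge (emb x t)) = (fun t => g (emb x t)) \_ D.
      apply/funext => t; rewrite patchE; case: ifPn => [/set_mem Dt|/negP nDt].
        by rewrite geA//; exact: emb_over.
      rewrite /ge asboolF// => -[_]; rewrite emb_lsub row_mxKr => Dt.
      by apply: nDt; exact: mem_set.
    apply/(measurable_restrictT _ mD); apply: measurable_on_fiber => // w Aw.
    exact: (gA w Aw).1.
  - have := integrable_scale (measurableT) (`|C| * 2 `^ (- mu)) (integrable_box_weight (r0 + 1) mup).
    exact.
  - move=> s t s1; have [d1 d2] := dg (emb x (psi s t)) (embx _ _); split.
    + case: d2 => [[Ky [h _]]|[-> _]]; last by rewrite normr0.
      exact: bb h.
    + case: d2 => [[Ky [_ h]]|[_ ->]]; last by rewrite normr0.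
      exact: bb h.
    + have -> : (fun s => ge (emb x (psi s t))) = (fun s => ge (s *: delta_mx 0 i + emb x t)).
        by apply/funext => s'; rewrite psiE.
      rewrite psiE in d1 *; apply: is_derive_on_line; case: d1 => d1 _; exact: d1.
refine (eq_trans _ H); apply: (congr1 fine).
rewrite [LHS]integral_mkcond; apply: eq_integral => t _.
rewrite patchE; case: ifPn => [/set_mem Dt|/negP nDt].
  have Aw : A (emb x t) by exact: emb_over.
  congr EFin; have [_ <-] : is_derive (emb x t) (delta_mx 0 i) ge (rpderiv i g (emb x t)) => //.
  apply: is_derive_line (near_line _ (nearA _ Aw)) _.
  by apply: DeriveDef => //; exact: (gA _ Aw).2.
have [_ [[Ky _]|[_ ->]]] := dg (emb x t) (embx _ _) => //.
by case: nDt; apply: mem_set; rewrite /fiber /= -(emb_y x t); exact: K'Om.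
Qed.
End phase_space.

Section compact_balls.
Context {R : realType} {d : nat}.

Lemma compact_cball (c : 'rV[R]_d) (r : R) : compact [set z : 'rV[R]_d | `|z - c| <= r].
Proof.
apply: bounded_closed_compact.
  exists (r + `|c|); split; first exact: num_real.
  move=> M rM z /= zr; apply: ltW; apply: le_lt_trans rM.
  by rewrite -[z](subrK c) (le_trans (ler_normD _ _))// lerD2r.
have -> : [set z : 'rV[R]_d | `|z - c| <= r] = (fun z => `|z - c|) @^-1` [set x | x <= r] by [].
apply: preimage_closed; last exact: closed_le.
move=> z _; apply: (@cvg_norm _ _ _ (nbhs z) _ (fun z : 'rV[R]_d => z - c) (z - c)).
by apply: cvgB; [exact: cvg_id|exact: cvg_cst].
Qed.

Lemma open_cball (A : set 'rV[R]_d) x : open A -> A x ->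
  exists2 r : R, 0 < r & [set z : 'rV[R]_d | `|z - x| <= r] `<=` A.
Proof.
move=> oA Ax; have /nbhs_normP[r /= r0 rA] := open_nbhs_nbhs (conj oA Ax).
exists (r / 2); first by rewrite divr_gt0.
move=> z /= zr; apply: rA; rewrite /= distrC (le_lt_trans zr)//.
by rewrite ltr_pdivrMr// ltr_pMr// ltr1n.
Qed.
End compact_balls.

Section phase_space_functions.
Context {R : realType} {n' n p : nat}.
Local Notation normc := (@Normc.normc R).
Local Notation vec := 'rV[R]_(n' + n + p).
Variables (Om' : set 'rV[R]_n') (Om : set 'rV[R]_n).
Hypotheses (oOm' : open Om') (oOm : open Om).
Local Notation X := (prod_set Om' Om).
Local Notation A := (@over R (n' + n) p X).
Let oX := open_prod_set oOm' oOm.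
Let oA : open A := open_over oX.
Let loA : line_open predT A := line_open_over oX.
Let om1 G (w : vec) : G w -> 1 <= omega w. Proof. by move=> _; exact: omega_ge1. Qed.
Definition symbol_fun (rho delta mu : R) (F : vec -> R[i]) : Prop :=
  forall K k, compact_in K X ->
    S predT A (over K) omega (shf rho delta) k 0 mu (fun=> F).

Lemma bnd_const (G : set vec) om mu (F : vec -> R[i]) : bnd G om 0 mu (fun=> F) ->
  exists2 C, 0 <= C & forall w, G w -> normc (F w) <= C * om w `^ mu.
Proof.
move=> H; have [|C C0 /near0r_ex[e [/andP[e0 _] He]]] := H (-1); first by rewrite ltrN10.
by exists (C * e `^ (-1)) => //; rewrite mulr_ge0// powR_ge0.
Qed.

Lemma symbol_fun_smooth rho delta mu F : symbol_fun rho delta mu F -> smooth_on A F.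
Proof.
move=> HF; apply: S_smooth => // k x Ax.
have oB : open (A `&` [set w | omega w < omega x + 1]).
  apply: openI => //; have -> : [set w : vec | omega w < omega x + 1] =
      omega @^-1` [set t | t < omega x + 1] by [].
  have /continuousP : continuous (@omega R (n' + n) p).
    move=> w; exact: (continuous_comp (@continuous_rsubmx R (n' + n) p w)
      (@continuous_japanese R p _)).
  by apply; exact: open_lt.
have Bx : (A `&` [set w | omega w < omega x + 1]) x by split => //=; rewrite ltrDl.
have [r r0 rB] := open_cball oB Bx.
pose K := [set z : 'rV[R]_(n' + n) | `|z - lsubmx x| <= r].
have cK : compact_in K X.
  split; first exact: compact_cball.
  move=> z zr; have [] // := rB (row_mx z (rsubmx x)); last by rewrite /over /= row_mxKl.
  apply: norm_le_coord; first exact: ltW.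
  move=> j; rewrite -[x in _ - x]hsubmxK !mxE.
  case: (fintype.split j) => l; last by rewrite subrr normr0 ltW.
  apply: le_trans zr; have := coord_le_norm (z - lsubmx x) l.
  by rewrite !mxE.
exists r, omega, (shf rho delta), mu, (omega x + 1); split => //.
  by move=> w /ltW/rB[Aw /ltW Lw]; rewrite omega_ge1.
apply: S_sub (HF K k cK) => // w /= /ltW wr; rewrite /K /over /=.
apply: le_trans wr; apply: norm_le_coord => // l.
by have := coord_le_norm (w - x) (lshift p l); rewrite !mxE.
Qed.

Lemma symbol_fun_shf rho delta rho1 delta1 mu F : rho1 <= rho -> delta <= delta1 ->
  symbol_fun rho delta mu F -> symbol_fun rho1 delta1 mu F.
Proof.
move=> h1 h2 HF K k cK; apply: S_sh (HF K k cK) => [w _|i _]; first exact: omega_ge1.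
by rewrite /shf; case: (fintype.split i) => _; rewrite ?lerN2.
Qed.

Lemma symbol_fun_le rho delta mu mu1 F : mu <= mu1 ->
  symbol_fun rho delta mu F -> symbol_fun rho delta mu1 F.
Proof. by move=> h HF K k cK; exact: (S_le (@om1 _) (leqnn _) (lexx _) h (HF K k cK)). Qed.

Lemma symbol_fun_pderiv rho delta mu F i : symbol_fun rho delta mu F ->
  symbol_fun rho delta (mu + shf rho delta i) (pderiv i F).
Proof. by move=> HF K k cK; have [_ /(_ i isT)[_]] := HF K k.+1 cK. Qed.

Definition ysupp (K' : set 'rV[R]_n) (F : vec -> R[i]) : Prop :=
  forall w, A w -> ~ K' (ypart w) -> F w = 0.

Lemma ysupp_near K' F w : closed K' -> ysupp K' F -> A w -> ~ K' (ypart w) ->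
  \near w, 0 = F w.
Proof.
move=> cl HF Aw Kw.
have oN : open (@ypart R n' n p @^-1` (~` K')).
  by move/continuousP: (@continuous_ypart R n' n p); apply; exact: closed_openC.
apply: filterS2 (open_nbhs_nbhs (conj oA Aw)) (open_nbhs_nbhs (conj oN Kw)).
by move=> w' Aw' Kw'; rewrite HF.
Qed.

Lemma ysupp_pderiv K' F i : closed K' -> ysupp K' F -> ysupp K' (pderiv i F).
Proof.
move=> cl HF w Aw Kw; apply: cder_pderiv.
exact: cder_near (ysupp_near cl HF Aw Kw) (cder_cst _ _ _).
Qed.

Lemma compact_prod K0 K' : compact K0 -> compact K' ->
  compact (@prod_set R n' n K0 K').
Proof.
move=> c0 c'.
apply: bounded_closed_compact; last first.
  have -> : @prod_set R n' n K0 K' = lsubmx @^-1` K0 `&` rsubmx @^-1` K' by [].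
  apply: closedI; apply: preimage_closed => [z _|].
  - exact: continuous_lsubmx.
  - by apply: compact_closed => //; exact: norm_hausdorff.
  - exact: continuous_rsubmx.
  - by apply: compact_closed => //; exact: norm_hausdorff.
have [M [Mr MK]] := compact_bounded c0; have [N [Nr NK]] := compact_bounded c'.
exists (`|M| + `|N|); split; first exact: num_real.
move=> r rr z [z0 z1].
have Mn := ler_norm M; have Nn := ler_norm N; have M0 := normr_ge0 M; have N0 := normr_ge0 N.
have h0 := MK r ltac:(lra) _ z0; have h1 := NK r ltac:(lra) _ z1.
apply: norm_le_coord; first by lra.
move=> j; rewrite -[z]hsubmxK mxE; case: (fintype.split j) => l.
  exact: le_trans (coord_le_norm _ _) h0.
exact: le_trans (coord_le_norm _ _) h1.
Qed.

Lemma compact_in_prod K0 K' : compact_in K0 Om' -> compact_in K' Om ->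
  compact_in (@prod_set R n' n K0 K') X.
Proof.
move=> [c0 s0] [c' s']; split; first exact: compact_prod.
by move=> z [/s0 ? /s' ?].
Qed.

Lemma compact_in_prod1 x K' : Om' x -> compact_in K' Om ->
  compact_in (@prod_set R n' n [set x] K') X.
Proof.
by move=> Ox; apply: compact_in_prod; split; [exact: compact_set1|move=> _ ->].
Qed.

Definition cint_phase (F : vec -> R[i]) (x : 'rV[R]_n') : R[i] :=
  cint (@phase_measure R n p) (fiber Om) (fun t => F (emb x t)).

Lemma cdom_emb K' r mu C F x : Om' x -> (forall y, K' y -> `|y| <= r) ->
  continuous_on A F -> ysupp K' F ->
  (forall w, lsubmx (lsubmx w) = x -> Om (ypart w) -> K' (ypart w) ->
     normc (F w) <= C * omega w `^ mu) ->
  cmeas (fiber Om) (fun t => F (emb x t)) /\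
  forall t, fiber Om t -> normc (F (emb x t)) <= `|C| * box_weight r mu t.
Proof.
move=> Ox Kr cF sF bF; split.
  by split; [exact: (measurable_on_fiber (g := fun w => complex.Re (F w)) oOm' oOm Ox
      (fun w Aw => (cF w Aw).1))|exact: (measurable_on_fiber (g := fun w => complex.Im (F w))
      oOm' oOm Ox (fun w Aw => (cF w Aw).2))].
move=> t Dt; have Aw : A (emb x t) by exact: emb_over.
have [Ky|nKy] := pselect (K' (ypart (emb x t))).
  have := bF (emb x t); rewrite emb_lsub row_mxKl emb_y => /(_ erefl Dt).
  rewrite emb_y in Ky => /(_ Ky) /le_trans; apply.
  rewrite /box_weight (Kr _ Ky) mul1r /omega emb_xi ler_wpM2r ?powR_ge0//.
  exact: ler_norm.
by rewrite sF// Normc.normc0 mulr_ge0// box_weight_ge0.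
Qed.

Lemma compact_norm_bound (K' : set 'rV[R]_n) : compact K' ->
  exists r : R, forall y, K' y -> `|y| <= r.
Proof.
move=> cK'; have [M [_ HM]] := compact_bounded cK'; exists (M + 1) => y Ky.
by apply: HM => //; rewrite ltrDl.
Qed.

(** Real and imaginary parts are treated separately. The order [mu] bounds those of [F] and of its
    derivative, as both must be integrable. *)
Lemma cint_pderiv K' i rho delta mu0 mu F x : @flow R n' n p i -> Om' x -> compact_in K' Om ->
  symbol_fun rho delta mu0 F -> ysupp K' F -> mu0 <= mu -> mu0 + shf rho delta i <= mu ->
  mu < - p%:R -> cint_phase (pderiv i F) x = 0.
Proof.
move=> fi Ox cK' HF sF mu1 mu2 mup.
have cK := compact_in_prod1 Ox cK'; have smF := symbol_fun_smooth HF.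
have [C1 C10 H1] := bnd_const (bndS (HF _ 0%N cK)).
have [C2 C20 H2] := bnd_const (bndS (symbol_fun_pderiv i HF 0%N cK)).
pose C := C1 + C2.
have Hb w : lsubmx (lsubmx w) = x -> K' (ypart w) ->
    normc (F w) <= C * omega w `^ mu /\ normc (pderiv i F w) <= C * omega w `^ mu.
  move=> wx wK; have kw : over (@prod_set R n' n [set x] K') w by [].
  have o0 := powR_ge0 (omega w) mu.
  split; [apply: le_trans (H1 w kw) _|apply: le_trans (H2 w kw) _];
    apply: ler_pM; rewrite ?powR_ge0 ?ler_powR ?omega_ge1 ?lerDl ?lerDr//.
have dF w : A w -> pdiff i F w by exact: (smooth_on_pdiff [::] i smF).
apply: complexP; rewrite /cint_phase /cint /=.
  apply: (integral_rpderiv (g := fun w => complex.Re (F w)) oOm' oOm fi Ox mup cK') => w.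
  - move=> Aw; split; first by have [] := (smF [::]).1 w Aw.
    exact: (proj1 (proj1 (pdiffP i F w) (dF w Aw))).
  - by move=> Aw Kw; rewrite sF.
  - move=> wx Kw; have [h1 h2] := Hb w wx Kw; split.
      exact: le_trans (normc_Re _) h1.
    exact: le_trans (normc_Re (pderiv i F w)) h2.
apply: (integral_rpderiv (g := fun w => complex.Im (F w)) oOm' oOm fi Ox mup cK') => w.
- move=> Aw; split; first by have [] := (smF [::]).1 w Aw.
  exact: (proj2 (proj1 (pdiffP i F w) (dF w Aw))).
- by move=> Aw Kw; rewrite sF.
- move=> wx Kw; have [h1 h2] := Hb w wx Kw; split.
    exact: le_trans (normc_Im _) h1.
  exact: le_trans (normc_Im (pderiv i F w)) h2.
Qed.

(** At fixed e a phase is a constant net, and homogeneity with compactness of the unit sphere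
    supplies all its bounds. The estimates for nets thus also justify integration by parts and
    differentiation for each e separately. *)
Lemma const_phase_pair K (f : vec -> R) : phase_at Om' Om f -> compact_in K X ->
  phase_pair Om' Om K (fun=> f) (fun=> f).
Proof.
move=> hf cK; have hg := homogeneous_hgbnd oX cK (let: And3 _ s _ := hf in s)
  (phase_homogeneous hf).
have z : (fun w => (f w)%:C - (f w)%:C) = (fun=> 0) :> (vec -> R[i]).
  by apply/funext => w; rewrite subrr.
have dz s : pderivs s (fun=> 0) = (fun=> 0) :> (vec -> R[i]).
  elim: s => // i s IH; rewrite /= IH; apply/funext => w.
  exact: cder_pderiv (cder_cst _ _ _).
split.
- move=> e _; split => //; rewrite z.
  move=> s; rewrite dz; split; first by move=> w _; split; apply: cst_continuous.
  move=> i w _; split; apply: derivable_cst.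
- by [].
- move=> c s b' b'c; exists 0 => //; apply: nearW => e w _ _.
  by rewrite z dz Normc.normc0 mul0r mul0r.
- suff H : bnd (over_big K) omega 0 0 (fun _ w => (varphi f w)%:C) by [].
  have cd i w : over_ne0 X w -> {for w, continuous (rpderiv i f)}.
    move=> Aw; case: hf => _ /(_ [:: i])[c _] _; have [c1 _] := c w Aw.
    exact: c1.
  have cs (I : Type) (r : seq I) (g : I -> vec -> R) w : (forall i, {for w, continuous (g i)}) ->
      {for w, continuous (fun w => \sum_(i <- r) g i w ^+ 2)}.
    move=> cg; elim: r => [|i r IH].
      have -> : (fun w => \sum_(i <- [::]) g i w ^+ 2) = (fun=> 0).
        by apply/funext => w'; rewrite big_nil.
      exact: cst_continuous.
    have -> : (fun w => \sum_(j <- i :: r) g j w ^+ 2) =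
        (fun w => g i w * g i w + \sum_(i <- r) g i w ^+ 2).
      by apply/funext => w'; rewrite big_cons.
    by apply: cvgD IH; exact: (cvgM (cg i) (cg i)).
  have cn w : rsubmx w != 0 -> {for w, continuous (fun w : vec => enorm (rsubmx w) ^- 2)}.
    move=> w0; have e0 : enorm (rsubmx w) ^+ 2 != 0 by rewrite expf_neq0// gt_eqF// enorm_gt0.
    apply: (@cvgV _ _ (nbhs w) _ (fun w : vec => enorm (rsubmx w) ^+ 2)) => //.
    have ce : {for w, continuous (fun w : vec => enorm (rsubmx w))}.
      exact: (continuous_comp (@continuous_rsubmx R (n' + n) p w)
        (@continuous_enorm R p _)).
    exact: (cvgM ce ce).
  have oN : open (@over_ne0 R (n' + n) p X) by exact: open_over_ne0.
  have cv w : over_ne0 X w -> {for w, continuous (varphi f)}.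
    move=> Aw; pose den w := enorm (rsubmx w) ^- 2 * (\sum_k rpderiv (iy k) f w ^+ 2) +
      \sum_j rpderiv (ixi j) f w ^+ 2.
    have vE w' : over_ne0 X w' -> varphi f w' = (den w')^-1 by exact: varphiE.
    have d0 : den w != 0.
      by have := gradsq_normalize_neq0 hf Aw; rewrite (gradsq_normalize oOm' oOm hf Aw).
    apply: (@near_eq_continuous R _ (fun w => (den w)^-1)).
      by apply: filterS (open_nbhs_nbhs (conj oN Aw)) => w' /vE ->.
    apply: (@cvgV _ _ (nbhs w) _ den) => //.
    apply: cvgD; last by apply: cs => j; exact: cd.
    apply: cvgM; first exact: cn Aw.2.
    by apply: cs => j; exact: cd.
  have [C C0 HC] := compact_sphere_bound cK cv.
  move=> b' b'0; exists C => //; apply: filterS near0r01 => e e01 w [Kw w4].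
  have w0 : rsubmx w != 0 by apply: contraTneq w4 => ->; rewrite enorm0 -ltNge invr_gt0.
  have e0 := enorm_gt0 w0.
  pose v := normalize_xi w.
  have v1 : enorm (rsubmx v) = 1.
    rewrite /v /normalize_xi row_mxKr enormZ gtr0_norm ?invr_gt0//.
    by rewrite mulVf// gt_eqF.
  (* [varphi] has degree 0: normalizing twice changes nothing, so its bound on the unit sphere holds
     everywhere. *)
  have vv : normalize_xi v = v.
    by rewrite {1}/normalize_xi /xipart v1 invr1 scale1r hsubmxK.
  have -> : varphi f w = varphi f v by rewrite /varphi vv.
  have Kv : K (lsubmx v) by rewrite /v /normalize_xi row_mxKl.
  rewrite normc_real powRr0 mulr1; apply: le_trans (HC v Kv v1) _.
  by rewrite ler_peMr// powR_ge1// ltW.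
Qed.
End phase_space_functions.

Section lop_adjoint.
Context {R : realType} {n' n p : nat}.
Local Notation normc := (@Normc.normc R).
Local Notation vec := 'rV[R]_(n' + n + p).
Variables (Om' : set 'rV[R]_n') (Om : set 'rV[R]_n).
Hypotheses (oOm' : open Om') (oOm : open Om).
Local Notation X := (prod_set Om' Om).
Local Notation A := (@over R (n' + n) p X).
Let oX := open_prod_set oOm' oOm.
Let oA : open A := open_over oX.
Let loA : line_open predT A := line_open_over oX.
Let om1 G (w : vec) : G w -> 1 <= omega w. Proof. by move=> _; exact: omega_ge1. Qed.
Variable chi : 'rV[R]_p -> R[i].
Hypothesis hchi : cutoff chi.

(** Each derivative of e^(i phi) brings a derivative of phi, of order 1 in z and of order 0 in xi;
    this is type (0, 1). *)
Lemma S_cis_phase K ph ph' k : K `<=` X -> phase_pair Om' Om K ph ph' ->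
  S predT (@over_ne0 R (n' + n) p X) (over_big K) omega (shf 0 1) k 0 0
    (fun e w => cis (ph e w)).
Proof.
move=> KX hp.
have loN : line_open predT (@over_ne0 R (n' + n) p X) by exact: line_open_over_ne0.
have GN : @over_big R (n' + n) p K `<=` over_ne0 X.
  by move=> w /over_big_ne0[h1 h2]; split => //; exact: KX.
apply: (S_le (@om1 _) (leqnSn k) (lexx _) (lexx _)).
apply: S_cis => // [w|i _]; first exact: om1.
have [H _ _] := SP_phase oOm' oOm KX hp k.+1.
have [_ /(_ i isT)[d1 d2]] := H; split => //.
apply: (S_sh (sh := shf 1 0)) => [w _|j _|]; first exact: omega_ge1.
  by rewrite /shf; case: (fintype.split j) => _; rewrite ?lerN2.
apply: S_le d2 => //; first exact: om1.
by rewrite /shf; case: (fintype.split i) => _; rewrite ?addr0 ?subrr ?oppr0.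
Qed.

Lemma continuous_cis_phase f : phase_at Om' Om f -> continuous_on A (fun w : vec => cis (f w)).
Proof.
move=> [cf _ _] w Aw; split => /=.
  exact: (continuous_comp (cf w Aw) (@continuous_cos R _)).
exact: (continuous_comp (cf w Aw) (@continuous_sin R _)).
Qed.

Lemma continuous_onM (f g : vec -> R[i]) : continuous_on A f -> continuous_on A g ->
  continuous_on A (fun w => f w * g w).
Proof.
move=> cf cg w Aw; have [f1 f2] := cf w Aw; have [g1 g2] := cg w Aw; split.
  have -> : (fun y => complex.Re (f y * g y)) = (fun y => complex.Re (f y) * complex.Re (g y)
      - complex.Im (f y) * complex.Im (g y)) by apply/funext => y; rewrite cReM.
  exact: (cvgB (cvgM f1 g1) (cvgM f2 g2)).
have -> : (fun y => complex.Im (f y * g y)) = (fun y => complex.Re (f y) * complex.Im (g y)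
      + complex.Im (f y) * complex.Re (g y)) by apply/funext => y; rewrite cImM.
exact: (cvgD (cvgM f1 g2) (cvgM f2 g1)).
Qed.

Section one_phase.
Variable f : vec -> R.
Hypothesis hf : phase_at Om' Om f.
Let cpp K (cK : compact_in K X) := const_phase_pair oOm' oOm hf cK.

Let point_compact w : A w -> compact_in [set lsubmx w] X.
Proof. by move=> Aw; split; [exact: compact_set1|move=> _ ->]. Qed.

Lemma symbol_fun_acoef j : symbol_fun Om' Om 1 0 0 (acoef chi f j).
Proof.
by move=> K k cK; have [] := SP_acoef oOm' oOm hchi cK.2 (cpp cK) j k.
Qed.

Lemma symbol_fun_bcoef l : symbol_fun Om' Om 1 0 (-1) (bcoef chi f l).
Proof.
by move=> K k cK; have [] := SP_bcoef oOm' oOm hchi cK.2 (cpp cK) l k.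
Qed.

Lemma symbol_fun_Lop rho delta mu F : 0 < rho <= 1 -> 0 <= delta < 1 ->
  symbol_fun Om' Om rho delta mu F ->
  symbol_fun Om' Om rho delta (mu - Num.min rho (1 - delta)) (Lop chi f F).
Proof.
move=> h1 h2 HF K k cK.
have GK : @over R (n' + n) p K `<=` A by move=> w; exact: cK.2.
by have [] := SP_Lop oOm' oOm hchi cK.2 (cpp cK) h1 h2 (SP_diag loA GK (HF K k.+1 cK)).
Qed.

Lemma ysupp_Lop K' F : closed K' -> ysupp Om' Om K' F -> ysupp Om' Om K' (Lop chi f F).
Proof.
move=> cl HF w Aw Kw; rewrite /Lop (HF w)// mulr0 addr0.
rewrite !big1 ?addr0// => i _; rewrite (ysupp_pderiv oOm' oOm _ cl HF)// mulr0//.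
Qed.

Let i1 : (0 +i* 1) * (0 +i* 1) = -1 :> R[i].
Proof. by apply: complexP; rewrite /=; ring. Qed.

(** This identity dictates the coefficients of L: [varphi] is the reciprocal of the weighted sum of
    squares that arises on the left. *)
Lemma sum_grad_coef w : over_ne0 X w ->
  \sum_j (0 +i* 1) * (rpderiv (ixi j) f w)%:C * acoef chi f j w +
  \sum_k (0 +i* 1) * (rpderiv (iy k) f w)%:C * bcoef chi f k w = chi (rsubmx w) - 1.
Proof.
move=> Aw; pose g := varphi f w.
have E1 j : (0 +i* 1) * (rpderiv (ixi j) f w)%:C * acoef chi f j w =
    (chi (rsubmx w) - 1) * (g * rpderiv (ixi j) f w ^+ 2)%:C.
  rewrite /acoef /xipart -/g expr2 !rmorphM /=.
  transitivity ((0 +i* 1) * (0 +i* 1) * (1 - chi (rsubmx w)) *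
    (g%:C * ((rpderiv (ixi j) f w)%:C * (rpderiv (ixi j) f w)%:C))); first by ring.
  by rewrite i1 mulN1r opprB.
have E2 k : (0 +i* 1) * (rpderiv (iy k) f w)%:C * bcoef chi f k w =
    (chi (rsubmx w) - 1) * (g * (enorm (rsubmx w) ^- 2 * rpderiv (iy k) f w ^+ 2))%:C.
  rewrite /bcoef /xipart -/g [rpderiv _ _ _ ^+ 2]expr2 !rmorphM /=.
  transitivity ((0 +i* 1) * (0 +i* 1) * (1 - chi (rsubmx w)) *
    (g%:C * ((enorm (rsubmx w) ^- 2)%:C * ((rpderiv (iy k) f w)%:C * (rpderiv (iy k) f w)%:C)))).
    by ring.
  by rewrite i1 mulN1r opprB.
under eq_bigr do rewrite E1; under [X in _ + X]eq_bigr do rewrite E2.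
rewrite -!mulr_sumr -mulrDr -!rmorph_sum -rmorphD /= -!mulr_sumr -mulrDr.
rewrite /g (varphiE oOm' oOm hf Aw) [_ + _ * _]addrC mulVf ?mulr1//.
by have := gradsq_normalize_neq0 hf Aw; rewrite (gradsq_normalize oOm' oOm hf Aw).
Qed.

(** The product rule gives e^(i phi) times the terms of L F, except that the derivatives of e^(i
    phi) contribute (chi - 1) F by [sum_grad_coef] where L has chi F. The difference is -F. *)
Lemma Lop_divergence F w : A w -> (forall i, pdiff i F w) ->
  \sum_j pderiv (ixi j) (fun w => cis (f w) * (acoef chi f j w * F w)) w +
  \sum_k pderiv (iy k) (fun w => cis (f w) * (bcoef chi f k w * F w)) w =
  cis (f w) * Lop chi f F w - cis (f w) * F w.
Proof.
move=> Aw dF; have cP := point_compact Aw.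
(* Where |xi| < 1/4 the phase need not be differentiable, but the coefficients vanish identically
   and L is the identity. *)
have [w4|w4] := ltP (enorm (rsubmx w)) 4^-1.
  have nz (g : vec -> R[i]) i : (forall w, enorm (rsubmx w) < 4^-1 -> g w = 0) -> pderiv i g w = 0.
    move=> g0; apply: cder_pderiv; apply: cder_near (cder_cst 0 _ _).
    have oS : open [set w : vec | enorm (rsubmx w) < 4^-1].
      have -> : [set w : vec | enorm (rsubmx w) < 4^-1] =
         (fun w => enorm (rsubmx w)) @^-1` [set t | t < 4^-1] by [].
      have /continuousP : continuous (fun w : vec => enorm (rsubmx w)).
        by move=> v; exact: (continuous_comp (@continuous_rsubmx R (n' + n) p v)
          (@continuous_enorm R p _)).
      by apply; exact: open_lt.
    by apply: filterS (open_nbhs_nbhs (conj oS w4)) => v /g0.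
  have a0 j : forall w, enorm (rsubmx w) < 4^-1 -> acoef chi f j w = 0.
    by move=> v; exact: acoef_small.
  have b0 k : forall w, enorm (rsubmx w) < 4^-1 -> bcoef chi f k w = 0.
    by move=> v; exact: bcoef_small.
  rewrite !big1 => [|k _|j _]; last 2 first.
  - by apply: nz => v v4; rewrite b0// mul0r mulr0.
  - by apply: nz => v v4; rewrite a0// mul0r mulr0.
  have -> : Lop chi f F w = F w.
    have z1 : \sum_j acoef chi f j w * pderiv (ixi j) F w = 0.
      by rewrite big1// => j _; rewrite a0// mul0r.
    have z2 : \sum_k bcoef chi f k w * pderiv (iy k) F w = 0.
      by rewrite big1// => k _; rewrite b0// mul0r.
    have z3 : \sum_j pderiv (ixi j) (acoef chi f j) w = 0.
      by rewrite big1// => j _; exact: nz (a0 j).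
    have z4 : \sum_k pderiv (iy k) (bcoef chi f k) w = 0.
      by rewrite big1// => k _; exact: nz (b0 k).
    case: hchi => _ chi1 _.
    by rewrite /Lop /ccoef z1 z2 z3 z4 chi1// !addr0 add0r mul1r.
  by rewrite addr0 subrr.
have w0 : rsubmx w != 0 by apply: contraTneq w4 => ->; rewrite enorm0 -ltNge invr_gt0.
have Nw : over_ne0 X w by split.
have da j i : pdiff i (acoef chi f j) w.
  exact: (smooth_on_pdiff [::] i (symbol_fun_smooth oOm' oOm (symbol_fun_acoef j)) Aw).
have db k i : pdiff i (bcoef chi f k) w.
  exact: (smooth_on_pdiff [::] i (symbol_fun_smooth oOm' oOm (symbol_fun_bcoef k)) Aw).
have dc i : cder (fun w => cis (f w)) w (delta_mx 0 i)
    ((0 +i* 1) * (rpderiv i f w)%:C * cis (f w)).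
  apply: cder_cis; have [d1 _] := phase_pdiff hf i Nw.
  by apply: DeriveDef => //; case: d1.
have pd i (g : vec -> R[i]) : pdiff i g w ->
    pderiv i (fun w => cis (f w) * (g w * F w)) w =
    cis (f w) * (((0 +i* 1) * (rpderiv i f w)%:C * g w) * F w +
      (pderiv i g w * F w + g w * pderiv i F w)).
  move=> dg; rewrite (cder_pderiv (cderM (dc i) (cderM dg (dF i)))); ring.
have -> : \sum_j pderiv (ixi j) (fun w => cis (f w) * (acoef chi f j w * F w)) w =
    cis (f w) * ((\sum_j (0 +i* 1) * (rpderiv (ixi j) f w)%:C * acoef chi f j w) * F w +
      ((\sum_j pderiv (ixi j) (acoef chi f j) w) * F w +
       \sum_j acoef chi f j w * pderiv (ixi j) F w)).
  rewrite !mulr_suml -!big_split /= mulr_sumr; apply: eq_bigr => j _.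
  by rewrite pd.
have -> : \sum_k pderiv (iy k) (fun w => cis (f w) * (bcoef chi f k w * F w)) w =
    cis (f w) * ((\sum_k (0 +i* 1) * (rpderiv (iy k) f w)%:C * bcoef chi f k w) * F w +
      ((\sum_k pderiv (iy k) (bcoef chi f k) w) * F w +
       \sum_k bcoef chi f k w * pderiv (iy k) F w)).
  rewrite !mulr_suml -!big_split /= mulr_sumr; apply: eq_bigr => k _.
  by rewrite pd.
have := sum_grad_coef Nw; rewrite /Lop /ccoef /xipart.
set S1 := \sum_j _; set S2 := \sum_k _ => E.
have -> : S1 = chi (rsubmx w) - 1 - S2 by rewrite -E addrK.
ring.
Qed.

End one_phase.
End lop_adjoint.

Section integration_by_parts.
Context {R : realType} {n' n p : nat}.
Local Notation normc := (@Normc.normc R).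
Local Notation vec := 'rV[R]_(n' + n + p).
Variables (Om' : set 'rV[R]_n') (Om : set 'rV[R]_n).
Hypotheses (oOm' : open Om') (oOm : open Om).
Local Notation X := (prod_set Om' Om).
Local Notation A := (@over R (n' + n) p X).
Let oX := open_prod_set oOm' oOm.
Let loA : line_open predT A := line_open_over oX.
Let om1 G (w : vec) : G w -> 1 <= omega w. Proof. by move=> _; exact: omega_ge1. Qed.
Variables (chi : 'rV[R]_p -> R[i]) (f : vec -> R).
Hypotheses (hchi : cutoff chi) (hf : phase_at Om' Om f).
Variables (rho delta : R).
Hypotheses (rho_range : 0 < rho <= 1) (delta_range : 0 <= delta < 1).

(** The factor [G] vanishes for small xi and removes the singularity of e^(i phi) at xi = 0;
    elsewhere all three factors are symbols of type (0, 1). *)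
Lemma symbol_fun_cisM m1 mu (G F : vec -> R[i]) :
  symbol_fun Om' Om 1 0 m1 G -> (forall w, enorm (rsubmx w) < 4^-1 -> G w = 0) ->
  symbol_fun Om' Om rho delta mu F ->
  symbol_fun Om' Om 0 1 (m1 + mu) (fun w => cis (f w) * (G w * F w)).
Proof.
move=> HG G0 HF K k cK.
have KX := cK.2.
have GN : @over_big R (n' + n) p K `<=` over_ne0 X.
  by move=> w /over_big_ne0[h1 h2]; split => //; exact: KX.
have loN : line_open predT (@over_ne0 R (n' + n) p X) by exact: line_open_over_ne0.
have loS : line_open predT (@over_small R (n' + n) p X).
  by apply: open_line_open; exact: open_over_small.
have GS : @over_small R (n' + n) p K `<=` over_small X.
  by move=> w [h1 h2]; split => //; exact: KX.
have hcis := S_cis_phase oOm' oOm k KX (const_phase_pair oOm' oOm hf cK).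
have sub (H : R -> vec -> R[i]) r d m : 0 <= r -> d <= 1 ->
    S predT A (over K) omega (shf r d) k 0 m H ->
    S predT (@over_ne0 R (n' + n) p X) (over_big K) omega (shf 0 1) k 0 m H.
  move=> r0 d1 HH; apply: (S_sh (sh := shf r d)) => [w _|i _|].
  - exact: omega_ge1.
  - by rewrite /shf; case: (fintype.split i) => _; rewrite ?lerN2.
  - by apply: S_sub HH => // [w []|w []].
have [/ltW rho0 rho1] := andP rho_range; have [delta0 /ltW delta1] := andP delta_range.
have h1 := SM loN GN (@om1 _) (sub _ _ _ _ ler01 ler01 (HG K k cK))
  (sub _ _ _ _ rho0 delta1 (HF K k cK)).
have h2 := SM loN GN (@om1 _) hcis h1.
rewrite !addr0 add0r in h2.
have h3 : S predT (@over_small R (n' + n) p X) (over_small K) omega (shf 0 1) k 0 (m1 + mu)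
    (fun _ w => cis (f w) * (G w * F w)).
  by apply: S0 => // e w _ [_ w4]; rewrite G0// mul0r mulr0.
apply: S_sub (S_union h2 h3) => // w Hw.
  have [w4|w4] := ltP (enorm (rsubmx w)) 4^-1; [by right|left; split => //].
  by apply: contraTneq w4 => ->; rewrite enorm0 -ltNge invr_gt0.
by have [w4|w4] := ltP (enorm (rsubmx w)) 4^-1; [right|left].
Qed.

Lemma cdom_symbol r1 d1 mu (c G : vec -> R[i]) K' r x : Om' x -> compact_in K' Om ->
  (forall y, K' y -> `|y| <= r) -> symbol_fun Om' Om r1 d1 mu G -> ysupp Om' Om K' G ->
  continuous_on A c -> (forall w, normc (c w) <= 1) ->
  cdom (fiber Om) (box_weight r mu) (fun t => c (emb x t) * G (emb x t)).
Proof.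
move=> Ox cK' Kr HG sG cc c1.
have [C C0 HC] := bnd_const (bndS (HG _ 0%N (compact_in_prod1 Ox cK'))).
have cG : continuous_on A G := (symbol_fun_smooth oOm' oOm HG [::]).1.
have [|||m bd] := @cdom_emb R n' n p Om' Om oOm' oOm K' r mu C (fun w => c w * G w) x Ox Kr.
- exact: continuous_onM.
- by move=> w Aw Kw; rewrite sG// mulr0.
- move=> w wx _ Kw; rewrite Normc.normcM.
  have h : normc (G w) <= C * omega w `^ mu by apply: HC; split.
  by apply: le_trans h; rewrite ler_piMl// normc_ge0.
by split => //; exists `|C|.
Qed.

Lemma cint_phase_Lop mu F K' x : symbol_fun Om' Om rho delta mu F -> mu < - p%:R ->
  compact_in K' Om -> ysupp Om' Om K' F -> Om' x ->
  cint_phase Om (fun w => cis (f w) * Lop chi f F w) x =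
  cint_phase Om (fun w => cis (f w) * F w) x.
Proof.
move=> HF mup cK' sF Ox.
have cl : closed K' by apply: compact_closed cK'.1; exact: norm_hausdorff.
have [r Kr] := compact_norm_bound cK'.1.
have mD := measurable_fiber (p := p) oOm.
have smin : 0 <= Num.min rho (1 - delta).
  have [/ltW ? _] := andP rho_range; have [_ /ltW ?] := andP delta_range.
  by rewrite le_min subr_ge0; apply/andP.
have iM := integrableS measurableT mD (@subsetT _ _) (integrable_box_weight r mup).
have M0 := @box_weight_ge0 R n p r mu.
have ccis := continuous_cis_phase hf.
have c1 w : normc (cis (f w)) <= 1 by rewrite normc_cis.
have c2 : continuous_on A (fun=> 1) by move=> w _; split; apply: cst_continuous.
have c3 (w : vec) : normc (1 : R[i]) <= 1 by rewrite Normc.normc1.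
(* The vector field whose divergence is integrated. In type (0, 1) a xi-derivative of the part of
   order [mu] and a y-derivative of the part of order [mu - 1] both have the integrable order
   [mu]. *)
pose Ha j w := cis (f w) * (acoef chi f j w * F w).
pose Hb k w := cis (f w) * (bcoef chi f k w * F w).
have HHa j : symbol_fun Om' Om 0 1 mu (Ha j).
  rewrite -[mu]add0r; apply: symbol_fun_cisM HF; first exact: symbol_fun_acoef.
  by move=> w; exact: acoef_small.
have HHb k : symbol_fun Om' Om 0 1 (-1 + mu) (Hb k).
  apply: symbol_fun_cisM HF; first exact: symbol_fun_bcoef.
  by move=> w; exact: bcoef_small.
have sHa j : ysupp Om' Om K' (Ha j) by move=> w Aw Kw; rewrite /Ha sF// !mulr0.
have sHb k : ysupp Om' Om K' (Hb k) by move=> w Aw Kw; rewrite /Hb sF// !mulr0.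
have Ea j : mu + shf 0 1 (ixi j : 'I_(n' + n + p)) = mu by rewrite shf_ixi oppr0 addr0.
have Eb k : -1 + mu + shf 0 1 (iy k : 'I_(n' + n + p)) = mu.
  by rewrite shf_iy addrAC addNr add0r.
have DL : cdom (fiber Om) (box_weight r mu) (fun t => cis (f (emb x t)) * Lop chi f F (emb x t)).
  apply: (cdom_symbol (G := Lop chi f F) Ox cK' Kr _ _ ccis c1).
    apply: (@symbol_fun_le _ _ _ _ _ _ _ _ _ mu) (symbol_fun_Lop oOm' oOm hchi hf rho_range delta_range HF).
    by rewrite gerDl oppr_le0.
  exact: ysupp_Lop.
have DF : cdom (fiber Om) (box_weight r mu) (fun t => cis (f (emb x t)) * F (emb x t)).
  exact: (cdom_symbol (G := F) Ox cK' Kr HF sF ccis c1).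
have dom1 i m (H : vec -> R[i]) : symbol_fun Om' Om 0 1 m H -> ysupp Om' Om K' H -> m + shf 0 1 i = mu ->
    cdom (fiber Om) (box_weight r mu) (fun t => pderiv i H (emb x t)).
  move=> HH sH Em; have := symbol_fun_pderiv i HH; rewrite Em => HH'.
  have := cdom_symbol Ox cK' Kr HH' (ysupp_pderiv oOm' oOm i cl sH) c2 c3.
  by congr (cdom _ _ _); apply/funext => t; rewrite mul1r.
have Da j : cdom (fiber Om) (box_weight r mu) (fun t => pderiv (ixi j) (Ha j) (emb x t)).
  exact: dom1 (HHa j) (sHa j) (Ea j).
have Db k : cdom (fiber Om) (box_weight r mu) (fun t => pderiv (iy k) (Hb k) (emb x t)).
  exact: dom1 (HHb k) (sHb k) (Eb k).
apply/eqP; rewrite -subr_eq0; apply/eqP.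
rewrite /cint_phase -(cintB mD M0 iM DL DF).
transitivity (cint (@phase_measure R n p) (fiber Om) (fun t =>
    \sum_j pderiv (ixi j) (Ha j) (emb x t) + \sum_k pderiv (iy k) (Hb k) (emb x t))).
  apply: eq_cint => t Dt; rewrite -(Lop_divergence oOm' oOm hchi hf)//.
    exact: emb_over.
  move=> i; apply: (smooth_on_pdiff [::] i (symbol_fun_smooth oOm' oOm HF)).
  exact: emb_over.
rewrite (cintD mD M0 iM (cdom_sum _ Da) (cdom_sum _ Db)).
rewrite (cint_sum mD M0 iM _ Da) (cint_sum mD M0 iM _ Db).
rewrite !big1 ?addr0// => [k _|j _].
  apply: (cint_pderiv oOm' oOm (flow_iy k) Ox cK' (HHb k) (sHb k) _ _ mup).
    by rewrite gerDr lerN10.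
  by rewrite Eb.
by apply: (cint_pderiv oOm' oOm (flow_ixi j) Ox cK' (HHa j) (sHa j) (lexx _) _ mup); rewrite Ea.
Qed.

Lemma symbol_fun_iter_Lop h mu F : symbol_fun Om' Om rho delta mu F ->
  symbol_fun Om' Om rho delta (mu - h%:R * Num.min rho (1 - delta)) (iter h (Lop chi f) F).
Proof.
move=> HF; elim: h => [|h IH]; first by rewrite mul0r subr0.
have := symbol_fun_Lop oOm' oOm hchi hf rho_range delta_range IH.
by congr (symbol_fun _ _ _ _ _ _); rewrite -natr1; ring.
Qed.

Lemma ysupp_iter_Lop h K' F : closed K' -> ysupp Om' Om K' F ->
  ysupp Om' Om K' (iter h (Lop chi f) F).
Proof. by move=> cl sF; elim: h => [//|h IH]; exact: ysupp_Lop. Qed.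

(** Once one power of L reaches an integrable order, every further power stays below it as the gain
    is nonnegative, so the additional powers can be removed one by one. *)
Lemma cint_phase_iter_Lop h h' mu F K' x : symbol_fun Om' Om rho delta mu F ->
  mu - h%:R * Num.min rho (1 - delta) < - p%:R -> compact_in K' Om -> ysupp Om' Om K' F ->
  Om' x ->
  cint_phase Om (fun w => cis (f w) * iter (h' + h) (Lop chi f) F w) x =
  cint_phase Om (fun w => cis (f w) * iter h (Lop chi f) F w) x.
Proof.
move=> HF mup cK' sF Ox.
have cl : closed K' by apply: compact_closed cK'.1; exact: norm_hausdorff.
elim: h' => [//|h' IH]; rewrite -IH addSn /=.
apply: (cint_phase_Lop (symbol_fun_iter_Lop (h' + h) HF) _ cK') => //; last exact: ysupp_iter_Lop.
apply: le_lt_trans mup; rewrite lerD2l lerN2 ler_wpM2r//.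
  have [/ltW ? _] := andP rho_range; have [_ /ltW ?] := andP delta_range.
  by rewrite le_min subr_ge0; apply/andP.
by rewrite ler_nat leq_addl.
Qed.
End integration_by_parts.

(** * Derivatives of the integrals in x *)

Section uniform_over_words.
Context {R : realType} {I : finType}.

(** There are finitely many words of length at most [k], so constants can be summed and
    neighbourhoods of 0 intersected; the induction splits off the first letter. *)
Lemma near_uniform_words k (P : seq I -> R -> R -> Prop) :
  (forall s C C' e, C <= C' -> P s C e -> P s C' e) ->
  (forall s, (size s <= k)%N -> exists C, \forall e \near (0 : R)^'+, P s C e) ->
  exists C, \forall e \near (0 : R)^'+, forall s, (size s <= k)%N -> P s C e.
Proof.
elim: k P => [|k IH] P mono HP.
  by have [C HC] := HP [::] isT; exists C; apply: filterS HC => e He [].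
have [C0 H0] := HP [::] isT.
have /choice[C HC] : forall i, exists C, \forall e \near (0 : R)^'+,
    forall s, (size s <= k)%N -> P (i :: s) C e.
  by move=> i; apply: IH => [s C C' e|s sk]; [exact: mono|exact: HP].
exists (`|C0| + \sum_i `|C i|).
have HC' : \forall e \near (0 : R)^'+, forall i s, (size s <= k)%N -> P (i :: s) (C i) e.
  exact: filter_forall HC.
move: H0 HC'; apply: filterS2 => e He Hi [|i s] sk.
  apply: mono He; rewrite (le_trans (ler_norm _))// lerDl.
  by apply: sumr_ge0 => i _; exact: normr_ge0.
apply: mono (Hi i s sk); rewrite (le_trans (ler_norm _))//.
by rewrite (bigD1 i)//= addrCA lerDl addr_ge0// sumr_ge0.
Qed.

Lemma uniform_words k (P : seq I -> R -> Prop) :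
  (forall s C C', C <= C' -> P s C -> P s C') ->
  (forall s, (size s <= k)%N -> exists C, P s C) ->
  exists C, forall s, (size s <= k)%N -> P s C.
Proof.
move=> mono HP.
have [s C C' _|s sk|C /near0r_ex[e [_ HC]]] :=
  @near_uniform_words k (fun s C _ => P s C); [exact: mono| |by exists C].
by have [C HC] := HP s sk; exists C; exact: nearW.
Qed.
End uniform_over_words.

Section derivatives_in_x.
Context {R : realType} {n' n p : nat}.
Local Notation normc := (@Normc.normc R).
Local Notation vec := 'rV[R]_(n' + n + p).
Local Notation T := (measurableTypeR R).

Definition ix (l : 'I_n') : 'I_(n' + n + p) := lshift p (lshift n l).

Definition xdir (i : 'I_(n' + n + p)) : bool :=
  if fintype.split i is inl k then if fintype.split k is inl _ then true else false else false.

Lemma xdir_ix l : xdir (ix l).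
Proof. by rewrite /xdir /ix (unsplitK (inl _)) (unsplitK (inl _)). Qed.

Lemma xdir_zdir i : xdir i -> zdir i.
Proof. by rewrite /xdir /zdir; case: (fintype.split i). Qed.

Lemma xdirP i : xdir i -> exists l, i = ix l.
Proof.
rewrite /xdir; have := fintype.splitK i; case: (fintype.split i) => //= k <-.
by have := fintype.splitK k; case: (fintype.split k) => //= l <- _; exists l.
Qed.

Lemma emb_addZ l (s : R) x (t : n.-tuple T * p.-tuple T) :
  emb (s *: delta_mx 0 l + x) t = s *: delta_mx 0 (ix l) + emb x t.
Proof.
rewrite /emb /pt /ix !delta_lshift; rewrite !row_mx_addZ !scaler0 !add0r.
by [].
Qed.

Lemma pderiv_emb l (H : vec -> R[i]) (t : n.-tuple T * p.-tuple T) :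
  pderiv l (fun x => H (emb x t)) = fun x => pderiv (ix l) H (emb x t).
Proof.
apply/funext => x; rewrite /pderiv /rpderiv; congr (_ +i* _).
  exact: (@derive_affineE R _ _ (fun w => complex.Re (H w)) (fun x => emb x t) x _ _
    (fun h => emb_addZ l h x t)).
exact: (@derive_affineE R _ _ (fun w => complex.Im (H w)) (fun x => emb x t) x _ _
    (fun h => emb_addZ l h x t)).
Qed.

Lemma pderivs_emb s (H : vec -> R[i]) (t : n.-tuple T * p.-tuple T) :
  pderivs s (fun x => H (emb x t)) = fun x => pderivs (map ix s) H (emb x t).
Proof. by elim: s => //= l s ->; rewrite pderiv_emb. Qed.

Lemma pdiff_emb l (H : vec -> R[i]) (t : n.-tuple T * p.-tuple T) x :
  pdiff (ix l) H (emb x t) -> pdiff l (fun x => H (emb x t)) x.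
Proof.
move=> dH; apply: (cder_pdiff (l := pderiv (ix l) H (emb x t))).
exact: (cder_affine (fun h => emb_addZ l h x t) dH).
Qed.

Variables (Om' : set 'rV[R]_n') (Om : set 'rV[R]_n).
Hypotheses (oOm' : open Om') (oOm : open Om).
Local Notation X := (prod_set Om' Om).
Local Notation A := (@over R (n' + n) p X).
Let oX := open_prod_set oOm' oOm.
Let oA : open A := open_over oX.
Let loA J : line_open J A. Proof. exact: open_line_open. Qed.
Let om1 G (w : vec) : G w -> 1 <= omega w. Proof. by move=> _; exact: omega_ge1. Qed.
Local Notation Sx K := (S xdir A (over K) omega (fun=> 1)).

Lemma S_xdir K rho delta k b mu F : delta <= 1 ->
  S predT A (over K) omega (shf rho delta) k b mu F -> Sx K k b mu F.
Proof.
move=> d1 HF; apply: (S_sh (sh := shf rho delta)) => [w _|i|]; first exact: omega_ge1.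
  by move=> /xdir_zdir; rewrite /zdir /shf; case: (fintype.split i).
by apply: S_sub HF.
Qed.

(** Unlike for derivatives in y and xi, no cutoff removes small xi here; but x-derivatives of phi
    are homogeneous of degree 1 and hence harmless up to xi = 0. *)
Lemma S_xdir_cis K ph ph' k : K `<=` X -> phase_pair Om' Om K ph ph' ->
  Sx K k 0 0 (fun e w => cis (ph e w)).
Proof.
move=> KX hp.
have loN : line_open xdir (@over_ne0 R (n' + n) p X).
  by apply: open_line_open; exact: open_over_ne0.
have GN : @over_ne0 R (n' + n) p K `<=` over_ne0 X by move=> w [h1 h2]; split => //; exact: KX.
have h1 : S xdir (@over_ne0 R (n' + n) p X) (over_ne0 K) omega (fun=> 1) k 0 0
    (fun e w => cis (ph e w)).
  apply: (S_le (@om1 _) (leqnSn k) (lexx _) (lexx _)).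
  apply: S_cis => // [w|i xi]; first exact: om1.
  have [H _ _] := SP_phase_zdir oOm' oOm KX hp k.+1.
  have [_ /(_ i (xdir_zdir xi))[d1 d2]] := H; split => //.
  rewrite addr0 in d2.
  apply: (S_sh (sh := fun=> 0)) => [w _|j _|]; first exact: omega_ge1.
    exact: ler01.
  by apply: S_sub d2 => // j; exact: xdir_zdir.
(* On the slice xi = 0 the phase vanishes for all x, so e^(i phi) is the constant 1 along it. The
   slice is line-open in the directions of x only. *)
pose Z := [set w : vec | A w /\ rsubmx w = 0].
have loZ : line_open xdir Z.
  move=> w i [Aw w0] /xdirP[l ->]; apply: filterS (loA Aw (xdir_ix l)) => s As.
  by split => //; rewrite rsubmx_addZ w0 /ix delta_lshift row_mxKr scaler0 addr0.
have h2 : S xdir Z (Z `&` over K) omega (fun=> 1) k 0 0 (fun e w => cis (ph e w)).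
  apply: (@S_ext _ _ _ _ _ _ _ loZ (@subIsetl _ _ _) _ _ _ (fun _ _ => 1)) => [e w e01 [Aw w0]|].
    have [/(_ e e01)[hf _ _] _ _ _] := hp.
    by rewrite (phase0 hf)// /cis cos0 sin0.
  apply: (S_cst loZ (@subIsetl _ _ _)) => //; exact: om1.
apply: S_sub (S_union h1 h2) => // w Hw; have [w0|w0] := eqVneq (rsubmx w) 0.
- by right.
- by left.
- by right; split => //; split => //; exact: KX.
- by left.
Qed.

Lemma ysupp_pderivs K' s (F : vec -> R[i]) : closed K' -> ysupp Om' Om K' F -> ysupp Om' Om K' (pderivs s F).
Proof. by move=> cl sF; elim: s => //= i s IH; exact: ysupp_pderiv. Qed.

Lemma all_xdir_ix s : all xdir (map ix s).
Proof. by elim: s => //= l s ->; rewrite xdir_ix. Qed.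

Lemma Sx_bound K k b mu F s : Sx K k b mu F -> (size s <= k)%N ->
  bnd (over K) omega b (mu + k%:R) (fun e => pderivs (map ix s) (F e)).
Proof.
move=> HF sk; have [] := S_pderivs HF (all_xdir_ix s); first by rewrite size_map.
move=> H _; apply: (bnd_le (@om1 _) (lexx _) _ H); rewrite lerD2l.
by rewrite big_const_seq count_predT size_map iter_addr_0 ler_nat.
Qed.

(** After [k] derivatives in x the order is at most mu + k, still below -p, and the compact support
    in y makes a multiple of [box_weight] an integrable bound. *)
Lemma cint_phase_family K' k mu (H : vec -> R[i]) : compact_in K' Om -> continuous_on A H ->
  ysupp Om' Om K' H ->
  (forall K0, compact_in K0 Om' -> Sx (@prod_set R n' n K0 K') k 0 mu (fun=> H)) ->
  mu + k%:R < - p%:R ->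
  dominated_family (@phase_measure R n p) (fiber Om) Om' k (fun x t => H (emb x t)).
Proof.
move=> cK' cH sH HS mup; have cl : closed K' by apply: compact_closed cK'.1; exact: norm_hausdorff.
have [r Kr] := compact_norm_bound cK'.1.
split.
  move=> x Ox; split.
    exact: (measurable_on_fiber (g := fun w => complex.Re (H w)) oOm' oOm Ox
      (fun w Aw => (cH w Aw).1)).
  exact: (measurable_on_fiber (g := fun w => complex.Im (H w)) oOm' oOm Ox
      (fun w Aw => (cH w Aw).2)).
move=> x0 Ox0; have [q q0 qO] := open_cball oOm' Ox0.
set K0 := [set _ | _] in qO; have cK0 : compact_in K0 Om' by split => //; exact: compact_cball.
have HK := HS K0 cK0.
have [C HC] := @uniform_words R 'I_n' k (fun s C => forall w, over (@prod_set R n' n K0 K') w ->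
    normc (pderivs (map ix s) H w) <= C * omega w `^ (mu + k%:R))
  (fun s C C' CC h w Kw => le_trans (h w Kw) (ler_wpM2r (powR_ge0 _ _) CC))
  (fun s sk => let: ex_intro2 C _ h := bnd_const (Sx_bound HK sk) in ex_intro _ C h).
have mD := measurable_fiber (p := p) oOm.
exists q, (fun t => `|C| * box_weight r (mu + k%:R) t); split => //.
- by move=> t; rewrite mulr_ge0// box_weight_ge0.
- apply: integrable_scale => //.
  exact: integrableS measurableT mD (@subsetT _ _) (integrable_box_weight r mup).
move=> x /ltW xq; have Ox : Om' x by exact: qO.
split => // s t sk Dt; have Aw : A (emb x t) by exact: emb_over.
split.
  rewrite pderivs_emb; have [Ky|nKy] := pselect (K' (ypart (emb x t))).
    have := HC s sk (emb x t); rewrite /over /= emb_lsub /prod_set /= row_mxKl row_mxKr.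
    rewrite emb_y in Ky => /(_ (conj xq Ky)) /le_trans; apply.
    rewrite /box_weight (Kr _ Ky) mul1r /omega emb_xi ler_wpM2r ?powR_ge0//.
    exact: ler_norm.
  rewrite (ysupp_pderivs _ cl sH)// Normc.normc0 mulr_ge0// box_weight_ge0//.
move=> sk' i; rewrite pderivs_emb; apply: (@pdiff_emb i (pderivs (map ix s) H)).
have [] := S_pderivs HK (all_xdir_ix s); first by rewrite size_map.
by move=> _ /(_ (ix i) (xdir_ix i)); rewrite size_map => /(_ sk' 1 (emb x t)); apply; rewrite ?ltr01 ?lexx.
Qed.

Lemma sup_norm_le d (K : set 'rV[R]_d) f (C : R) : (forall x, K x -> normc (f x) <= C) ->
  (sup_norm K f <= C%:E)%E.
Proof. by move=> H; apply: ge_ereal_sup => _ [x Kx <-]; rewrite lee_fin H. Qed.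

(* The derivatives of order [<= k] in [x] are integrals of symbols of order [mu + k]. *)
Lemma growth_pderivs_cint K0 K' k b mu (F : R -> vec -> R[i]) s : compact_in K0 Om' -> compact_in K' Om ->
  (forall e, 0 < e <= 1 -> [/\ continuous_on A (F e), ysupp Om' Om K' (F e) &
     forall K0, compact_in K0 Om' -> Sx (@prod_set R n' n K0 K') k 0 mu (fun=> F e)]) ->
  Sx (@prod_set R n' n K0 K') k b mu F -> mu + k%:R < - p%:R -> (size s <= k)%N ->
  growth b (fun e => sup_norm K0 (pderivs s (cint_phase Om (F e)))).
Proof.
move=> cK0 cK' HF HS mup sk b' b'b.
have cl : closed K' by apply: compact_closed cK'.1; exact: norm_hausdorff.
have [r Kr] := compact_norm_bound cK'.1.
have mD := measurable_fiber (p := p) oOm.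
have iM := integrableS measurableT mD (@subsetT _ _) (integrable_box_weight r mup).
have M0 := @box_weight_ge0 R n p r (mu + k%:R).
have [C C0 HC] := Sx_bound HS sk b'b.
exists (C * (2 * Rintegral (@phase_measure R n p) (fiber Om) (box_weight r (mu + k%:R)))).
  by rewrite !mulr_ge0//; apply: Rintegral_ge0 => t _; exact: M0.
apply: filterS2 HC near0r01 => e HC e01; have [ce se Se] := HF e e01.
apply: sup_norm_le => x Kx; have Ox := cK0.2 x Kx.
have [h1 _] := pderivs_cint (s := s) mD oOm' (cint_phase_family cK' ce se Se mup) sk.
have [-> cm] := h1 x Ox.
rewrite mulrAC; apply: (cint_bound mD M0 iM) => //.
  by rewrite mulr_ge0// powR_ge0.
move=> t Dt; have Aw : A (emb x t) by exact: emb_over.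
rewrite pderivs_emb; have [Ky|nKy] := pselect (K' (ypart (emb x t))).
  have := HC (emb x t); rewrite /over /= emb_lsub /prod_set /= row_mxKl row_mxKr.
  rewrite emb_y in Ky => /(_ (conj Kx Ky)) /le_trans; apply.
  by rewrite /box_weight (Kr _ Ky) mul1r /omega emb_xi.
rewrite (ysupp_pderivs _ cl se)// Normc.normc0 !mulr_ge0// ?powR_ge0//.
Qed.
End derivatives_in_x.

Section cis_lipschitz.
Context {R : realType}.
Local Notation normc := (@Normc.normc R).

Lemma normc_cisB (a b : R) : normc (cis a - cis b) <= 2 * `|a - b|.
Proof.
have lip (k dk : R -> R) : (forall s, is_derive s (1 : R) k (dk s)) -> (forall s, `|dk s| <= 1) ->
    `|k a - k b| <= `|a - b|.
  move=> hk hd; have := @mvt_line_le R R k b 1 (a - b) 1.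
  rewrite [(a - b) *: 1]mulr1 subrK mul1r; apply => s _.
  by have [h1 ->] := hk (s *: 1 + b).
apply: le_trans (normc_le_ReIm _) _; rewrite cReD cImD cReN cImN /= mulr_natl mulr2n.
apply: lerD.
  apply: (lip cos (fun s => - sin s)) => s.
  by rewrite normrN ler_norml sin_geN1 sin_le1.
by apply: (lip sin cos) => s; rewrite ler_norml cos_geN1 cos_le1.
Qed.
End cis_lipschitz.

Lemma continuous_onB (R : realType) (d : nat) (A : set 'rV[R]_d) (f g : 'rV[R]_d -> R[i]) : continuous_on A f -> continuous_on A g ->
  continuous_on A (fun w => f w - g w).
Proof.
move=> cf cg w Aw; have [p1 p2] := cf w Aw; have [q1 q2] := cg w Aw; split.
  have -> : (fun w => complex.Re (f w - g w)) = (fun w => complex.Re (f w) - complex.Re (g w)).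
    by apply/funext => v; rewrite cReD cReN.
  exact: (cvgB p1 q1).
have -> : (fun w => complex.Im (f w - g w)) = (fun w => complex.Im (f w) - complex.Im (g w)).
  by apply/funext => v; rewrite cImD cImN.
exact: (cvgB p2 q2).
Qed.

(** * Oscillatory integrals *)

Section oscillatory_integral.
Context {R : realType} {n' n p : nat}.
Local Notation normc := (@Normc.normc R).
Local Notation vec := 'rV[R]_(n' + n + p).
Variables (Om' : set 'rV[R]_n') (Om : set 'rV[R]_n).
Hypotheses (oOm' : open Om') (oOm : open Om).
Local Notation X := (prod_set Om' Om).
Local Notation A := (@over R (n' + n) p X).
Let oX := open_prod_set oOm' oOm.
Let oA : open A := open_over oX.
Let loA J : line_open J A. Proof. exact: open_line_open. Qed.
Let om1 G (w : vec) : G w -> 1 <= omega w. Proof. by move=> _; exact: omega_ge1. Qed.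
Local Notation Sx K := (S xdir A (over K) omega (fun=> 1)).
Let GK (K : set 'rV[R]_(n' + n)) : K `<=` X -> @over R (n' + n) p K `<=` A.
Proof. by move=> KX w; exact: KX. Qed.

Section dominated_functions.
Variables (K' : set 'rV[R]_n) (mu : R).
Hypotheses (cK' : compact_in K' Om) (mup : mu < - p%:R).

Definition dom_fun (H : vec -> R[i]) : Prop :=
  [/\ continuous_on A H, ysupp Om' Om K' H & forall K0, compact_in K0 Om' ->
    bnd (over (@prod_set R n' n K0 K')) omega 0 mu (fun=> H)].

Lemma dom_fun_cdom H x r : Om' x -> (forall y, K' y -> `|y| <= r) -> dom_fun H ->
  cdom (fiber Om) (box_weight r mu) (fun t => H (emb x t)).
Proof.
move=> Ox Kr [cH sH bH].
have c1 : compact_in [set x] Om' by split; [exact: compact_set1|move=> _ ->].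
have [C C0 HC] := bnd_const (bH _ c1).
have [|m bd] := @cdom_emb R n' n p Om' Om oOm' oOm K' r mu C H x Ox Kr cH sH.
  by move=> w wx _ Kw; apply: HC; split.
by split => //; exists `|C|.
Qed.

Lemma cint_phaseB H H' x : Om' x -> dom_fun H -> dom_fun H' ->
  cint_phase Om (fun w => H w - H' w) x = cint_phase Om H x - cint_phase Om H' x.
Proof.
move=> Ox dH dH'; have [r Kr] := compact_norm_bound cK'.1.
have mD := measurable_fiber (p := p) oOm.
have iM := integrableS measurableT mD (@subsetT _ _) (integrable_box_weight r mup).
exact: (cintB mD (@box_weight_ge0 R n p r mu) iM (dom_fun_cdom Ox Kr dH) (dom_fun_cdom Ox Kr dH')).
Qed.

Lemma cint_phase_linear c H H' x : Om' x -> dom_fun H -> dom_fun H' ->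
  cint_phase Om (fun w => c * H w + H' w) x = c * cint_phase Om H x + cint_phase Om H' x.
Proof.
move=> Ox dH dH'; have [r Kr] := compact_norm_bound cK'.1.
have mD := measurable_fiber (p := p) oOm.
have iM := integrableS measurableT mD (@subsetT _ _) (integrable_box_weight r mup).
have M0 := @box_weight_ge0 R n p r mu.
have d1 := dom_fun_cdom Ox Kr dH; have d2 := dom_fun_cdom Ox Kr dH'.
rewrite /cint_phase (cintD mD M0 iM (g1 := fun t => c * H (emb x t)) (cdomZ c d1) d2).
by rewrite (cintZ mD M0 iM c d1).
Qed.
End dominated_functions.

Variable chi : 'rV[R]_p -> R[i].
Hypothesis hchi : cutoff chi.
Variables (rho delta : R).
Hypotheses (rho_range : 0 < rho <= 1) (delta_range : 0 <= delta < 1).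
Local Notation gain := (Num.min rho (1 - delta)).
Local Notation St K := (S predT A (over K) omega (shf rho delta)).

Lemma gain_gt0 : 0 < gain.
Proof.
have [? _] := andP rho_range; have [_ ?] := andP delta_range.
by rewrite lt_min subr_gt0; apply/andP.
Qed.

Definition osc_fun h (f : vec -> R) (F : vec -> R[i]) : vec -> R[i] :=
  fun w => cis (f w) * iter h (Lop chi f) F w.

Definition osc_phase h f F : 'rV[R]_n' -> R[i] := cint_phase Om (osc_fun h f F).

Lemma Sx_osc_fun K ph ph' F h k b mu : K `<=` X -> phase_pair Om' Om K ph ph' ->
  St K (h + k) b mu F ->
  Sx K k b (mu - h%:R * gain) (fun e => osc_fun h (ph e) (F e)).
Proof.
move=> KX hp HF.
have [H1 _ _] := SP_iter_Lop oOm' oOm hchi KX hp rho_range delta_range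
  (SP_diag (@loA _) (GK KX) HF).
have H2 := S_xdir_cis oOm' oOm k KX hp.
have d1 : delta <= 1 by have [_ /ltW] := andP delta_range.
have := SM (@loA _) (GK KX) (@om1 _) H2 (S_xdir d1 H1).
by rewrite !add0r.
Qed.

Section one_function.
Variables (f : vec -> R) (F : vec -> R[i]) (K' : set 'rV[R]_n) (mu : R).
Hypotheses (hf : phase_at Om' Om f) (HF : symbol_fun Om' Om rho delta mu F).
Hypotheses (cK' : compact_in K' Om) (sF : ysupp Om' Om K' F).
Let cl : closed K'. Proof. by apply: compact_closed cK'.1; exact: norm_hausdorff. Qed.

Lemma osc_fun_regular h k :
  [/\ continuous_on A (osc_fun h f F), ysupp Om' Om K' (osc_fun h f F) &
    forall K0, compact_in K0 Om' ->
      Sx (@prod_set R n' n K0 K') k 0 (mu - h%:R * gain) (fun=> osc_fun h f F)].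
Proof.
split.
- apply: continuous_onM; first exact: continuous_cis_phase.
  exact: (symbol_fun_smooth oOm' oOm
    (symbol_fun_iter_Lop oOm' oOm hchi hf rho_range delta_range h HF) [::]).1.
- move=> w Aw Kw; rewrite /osc_fun (ysupp_iter_Lop oOm' oOm chi f h cl sF)// mulr0//.
- move=> K0 cK0; have cK := compact_in_prod cK0 cK'.
  exact: (Sx_osc_fun cK.2 (const_phase_pair oOm' oOm hf cK) (HF _ cK)).
Qed.

Lemma osc_fun_dom h mu1 : mu - h%:R * gain <= mu1 -> dom_fun K' mu1 (osc_fun h f F).
Proof.
move=> hm; have [h1 h2 h3] := osc_fun_regular h 0; split => // K0 cK0.
exact: (bnd_le (@om1 _) (lexx _) hm (bndS (h3 K0 cK0))).
Qed.

Lemma osc_phase_raise h h' x : mu - h%:R * gain < - p%:R -> Om' x ->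
  osc_phase (h' + h) f F x = osc_phase h f F x.
Proof.
move=> mup Ox.
exact: (cint_phase_iter_Lop oOm' oOm hchi hf rho_range delta_range h' HF mup cK' sF Ox).
Qed.

(** The positive gain outweighs any prescribed number of x-derivatives. *)
Lemma exists_order (h k : nat) : exists h', mu - (h' + h)%:R * gain + k%:R < - p%:R.
Proof.
have g0 := gain_gt0; pose q := (mu + k%:R + p%:R) / gain.
have [h' hq] : exists h' : nat, q < h'%:R.
  exists (Num.truncn q).+1; exact: truncnS_gt.
exists h'; move: hq; rewrite /q ltr_pdivrMr// natrD mulrDl => hq.
have : 0 <= h%:R * gain by rewrite mulr_ge0// ltW.
lra.
Qed.

(** For [k] derivatives the power of L is raised until the order stays below -p after adding [k];
    the integral does not change. *)
Lemma osc_phase_smooth h : mu - h%:R * gain < - p%:R -> smooth_on Om' (osc_phase h f F).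
Proof.
move=> mup; apply: (cint_smooth_on (mu := @phase_measure R n p) (measurable_fiber oOm) oOm') => k.
have [h' hk] := exists_order h k; exists (fun x t => osc_fun (h' + h) f F (emb x t)).
  have [c s H] := osc_fun_regular (h' + h) k.
  exact: (cint_phase_family oOm' oOm cK' c s H hk).
by move=> x Ox; rewrite -(osc_phase_raise h' mup Ox).
Qed.
End one_function.

Lemma growth_osc K0 K' ph ph' (F : R -> vec -> R[i]) h b mu s :
  compact_in K0 Om' -> compact_in K' Om -> phase_pair Om' Om (prod_set K0 K') ph ph' ->
  (forall e, 0 < e <= 1 -> symbol_fun Om' Om rho delta mu (F e) /\ ysupp Om' Om K' (F e)) ->
  (forall k, St (prod_set K0 K') k b mu F) -> mu - h%:R * gain < - p%:R ->
  growth b (fun e => sup_norm K0 (pderivs s (osc_phase h (ph e) (F e)))).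
Proof.
move=> cK0 cK' hp HF HS mup; have [h' hk] := exists_order mu h (size s).
have cK := compact_in_prod cK0 cK'; have [hph _ _ _] := hp.
have HG := Sx_osc_fun cK.2 hp (HS (h' + h + size s)%N).
have := growth_pderivs_cint oOm' oOm (s := s) cK0 cK' _ HG hk (leqnn _).
move=> H; apply: growth_le (lexx _) _ (H _); last first.
  move=> e e01; have [h1 _ _] := hph e e01; have [h2 h3] := HF e e01.
  exact: osc_fun_regular.
apply: filterS near0r01 => e e01; have [h1 _ _] := hph e e01; have [h2 h3] := HF e e01.
apply: ge_ereal_sup => _ [x Kx <-]; have Ox := cK0.2 x Kx.
apply: ereal_sup_ubound; exists x => //; congr (_%:E); congr (normc _).
apply: (pderivs_ext _ oOm') => // y Oy.
exact: (osc_phase_raise h1 h2 cK' h3 h' mup Oy).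
Qed.

(** The difference of the exponentials costs one order, as |phi - phi'| grows like |xi|; this is the
    origin of the summand 1 in the condition on [h]. *)
Lemma growth_osc_diff K0 K' ph ph' (F F' : R -> vec -> R[i]) h b mu :
  compact_in K0 Om' -> compact_in K' Om -> phase_pair Om' Om (prod_set K0 K') ph ph' ->
  (forall e, 0 < e <= 1 -> symbol_fun Om' Om rho delta mu (F e) /\ ysupp Om' Om K' (F e)) ->
  (forall e, 0 < e <= 1 -> symbol_fun Om' Om rho delta mu (F' e) /\ ysupp Om' Om K' (F' e)) ->
  SP predT A (over (prod_set K0 K')) omega (shf rho delta) h b mu F F' ->
  mu - h%:R * gain + 1 < - p%:R -> forall c,
  growth c (fun e => sup_norm K0 (fun x =>
    osc_phase h (ph e) (F e) x - osc_phase h (ph' e) (F' e) x)).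
Proof.
move=> cK0 cK' hp HF HF' HS mup c; have cK := compact_in_prod cK0 cK'; have [hph _ _ _] := hp.
pose m1 := mu - h%:R * gain; have m1le : m1 <= m1 + 1 by rewrite lerDl.
pose G e := osc_fun h (ph e) (F e); pose G' e := osc_fun h (ph' e) (F' e).
have rG e (e01 : 0 < e <= 1) : dom_fun K' (m1 + 1) (G e).
  have [h1 _ _] := hph e e01; have [h2 h3] := HF e e01.
  exact: osc_fun_dom h1 h2 cK' h3 h _ m1le.
have rG' e (e01 : 0 < e <= 1) : dom_fun K' (m1 + 1) (G' e).
  have [_ h1 _] := hph e e01; have [h2 h3] := HF' e e01.
  exact: osc_fun_dom h1 h2 cK' h3 h _ m1le.
rewrite -[h]addn0 in HS.
have [I1 I2 I3] := SP_iter_Lop oOm' oOm hchi cK.2 hp rho_range delta_range HS.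
rewrite -/m1 in I1 I2 I3.
have cisb b' : bnd (over (prod_set K0 K')) omega b' 1
    (fun e (w : vec) => cis (ph e w) - cis (ph' e w)).
  have [_ _ /(_ b')/bndS Hd] := SP_phase_zdir oOm' oOm cK.2 hp 0.
  move=> b1 b1b; have [C C0 HC] := Hd b1 b1b; exists (2 * C); first by rewrite mulr_ge0.
  apply: filterS2 HC near0r01 => e HC e01 w Kw.
  have [w0|w0] := eqVneq (rsubmx w) 0.
    have [h1 h2 _] := hph e e01.
    rewrite (phase0 h1)//; last exact: cK.2.
    rewrite (phase0 h2)//; last exact: cK.2.
    by rewrite subrr Normc.normc0 !mulr_ge0// ?powR_ge0.
  apply: le_trans (normc_cisB _ _) _; rewrite -!mulrA ler_pM2l// !mulrA.
  have := HC w (conj Kw w0); rewrite /complex_net.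
  have -> : (ph e w)%:C - (ph' e w)%:C = (ph e w - ph' e w)%:C by rewrite rmorphB.
  by rewrite normc_real.
(* Only one factor differs in each term: the first is negligible by the phases, the second by the
   symbols together with the coefficients of L. *)
have B e w : G e w - G' e w = (cis (ph e w) - cis (ph' e w)) * iter h (Lop chi (ph e)) (F e) w
    + cis (ph' e w) * (iter h (Lop chi (ph e)) (F e) w - iter h (Lop chi (ph' e)) (F' e) w).
  by rewrite /G /G' /osc_fun mulrBl mulrBr addrA subrK.
have bD : bnd (over (prod_set K0 K')) omega c (m1 + 1) (fun e w => G e w - G' e w).
  have b1 := bndM (@om1 _) (cisb (c - b)) (bndS I1).
  have c2 : bnd (over (prod_set K0 K')) omega 0 0 (fun e (w : vec) => cis (ph' e w)).
    move=> b' b'0; exists 1 => //; apply: filterS near0r01 => e e01 w _.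
    by rewrite normc_cis powRr0 mulr1 mul1r powR_ge1// ltW.
  have b2 := bndM (@om1 _) c2 (bndS (I3 c)).
  rewrite subrK [1 + m1]addrC in b1; rewrite !add0r in b2.
  have b3 := bndD b1 (bnd_le (@om1 _) (lexx _) m1le b2).
  move=> b' b'c; have [C C0 HC] := b3 b' b'c; exists C => //.
  by apply: filterS HC => e HC w Kw; rewrite B; exact: HC.
have := growth_pderivs_cint oOm' oOm (k := 0) (mu := m1 + 1) (s := [::]) (b := c)
  (F := fun e w => G e w - G' e w) cK0 cK' _ (conj bD I) _ (leqnn _).
rewrite addr0 => /(_ _ mup) H.
apply: growth_le (lexx _) _ (H _).
  apply: filterS near0r01 => e e01.
  apply: ge_ereal_sup => _ [x Kx <-]; have Ox := cK0.2 x Kx.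
  apply: ereal_sup_ubound; exists x => //; apply: (congr1 (fun z => (normc z)%:E)).
  exact: (cint_phaseB cK' mup Ox (rG e e01) (rG' e e01)).
move=> e e01; have [c1 s1 b1] := rG e e01; have [c2 s2 b2] := rG' e e01; split.
- exact: continuous_onB c1 c2.
- move=> w Aw Kw; rewrite (s1 w Aw Kw) (s2 w Aw Kw); exact: subr0.
- move=> K1 cK1; split; last exact: I.
  have n2 : bnd (over (prod_set K1 K')) omega 0 (m1 + 1) (fun _ w => - G' e w).
    move=> b' b'0; have [C C0 HC] := b2 K1 cK1 b' b'0; exists C => //.
    by apply: filterS HC => e' HC w Kw; rewrite -mulN1r Normc.normcM -(rmorphN1 (real_complex R)) normc_real normrN1 mul1r; exact: HC.
  exact: bndD (b1 K1 cK1) n2.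
Qed.

Lemma Lop_ext f (F G : vec -> R[i]) : (forall w, A w -> F w = G w) ->
  forall w, A w -> Lop chi f F w = Lop chi f G w.
Proof.
move=> FG w Aw; have d i : pderiv i F w = pderiv i G w := pderivs_ext [:: i] oA FG Aw.
rewrite /Lop (FG w Aw).
have -> : \sum_j acoef chi f j w * pderiv (ixi j) F w = \sum_j acoef chi f j w * pderiv (ixi j) G w.
  by apply: eq_bigr => j _; rewrite d.
have -> : \sum_k bcoef chi f k w * pderiv (iy k) F w = \sum_k bcoef chi f k w * pderiv (iy k) G w.
  by apply: eq_bigr => k _; rewrite d.
by [].
Qed.

Lemma Lop_linear f c (F G : vec -> R[i]) w : (forall i, pdiff i F w) -> (forall i, pdiff i G w) ->
  Lop chi f (fun w => c * F w + G w) w = c * Lop chi f F w + Lop chi f G w.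
Proof.
move=> dF dG.
have d i : pderiv i (fun w => c * F w + G w) w = c * pderiv i F w + pderiv i G w.
  by rewrite (cder_pderiv (cderD (cderM (cder_cst c _ _) (dF i)) (dG i))) mul0r add0r.
rewrite /Lop.
have -> : \sum_j acoef chi f j w * pderiv (ixi j) (fun w => c * F w + G w) w =
    c * (\sum_j acoef chi f j w * pderiv (ixi j) F w) +
    \sum_j acoef chi f j w * pderiv (ixi j) G w.
  by rewrite mulr_sumr -big_split /=; apply: eq_bigr => j _; rewrite d mulrDr mulrCA.
have -> : \sum_k bcoef chi f k w * pderiv (iy k) (fun w => c * F w + G w) w =
    c * (\sum_k bcoef chi f k w * pderiv (iy k) F w) +
    \sum_k bcoef chi f k w * pderiv (iy k) G w.
  by rewrite mulr_sumr -big_split /=; apply: eq_bigr => k _; rewrite d mulrDr mulrCA.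
have lin (a1 a2 b1 b2 q u v : R[i]) : c * a1 + a2 + (c * b1 + b2) + q * (c * u + v) =
    c * (a1 + b1 + q * u) + (a2 + b2 + q * v) by ring.
exact: lin.
Qed.

Lemma osc_phase_linear f c F G K' h mu x : phase_at Om' Om f -> compact_in K' Om ->
  symbol_fun Om' Om rho delta mu F -> ysupp Om' Om K' F ->
  symbol_fun Om' Om rho delta mu G -> ysupp Om' Om K' G ->
  mu - h%:R * gain < - p%:R -> Om' x ->
  osc_phase h f (fun w => c * F w + G w) x = c * osc_phase h f F x + osc_phase h f G x.
Proof.
move=> hf cK' HF sF HG sG mup Ox.
have E : forall w, A w -> iter h (Lop chi f) (fun w => c * F w + G w) w =
    c * iter h (Lop chi f) F w + iter h (Lop chi f) G w.
  elim: {mup} h => [//|h IH] w Aw.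
  rewrite /= (Lop_ext _ IH Aw) Lop_linear// => i.
    exact: (smooth_on_pdiff [::] i (symbol_fun_smooth oOm' oOm
      (symbol_fun_iter_Lop oOm' oOm hchi hf rho_range delta_range h HF)) Aw).
  exact: (smooth_on_pdiff [::] i (symbol_fun_smooth oOm' oOm
      (symbol_fun_iter_Lop oOm' oOm hchi hf rho_range delta_range h HG)) Aw).
have dF := osc_fun_dom hf HF cK' sF (lexx (mu - h%:R * gain)).
have dG := osc_fun_dom hf HG cK' sG (lexx (mu - h%:R * gain)).
rewrite /osc_phase -(cint_phase_linear cK' mup c Ox dF dG).
apply: eq_cint => t Dt; rewrite /osc_fun E; last exact: emb_over.
by rewrite mulrDr mulrCA.
Qed.
End oscillatory_integral.

(** * Smooth cutoff functions *)

Section smooth_steps.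
Context {R : realType}.
Local Notation normc := (@Normc.normc R).
Implicit Types (q : {poly R}) (t : R).

(** The functions q(1/t) e^(-1/t), extended by 0, are closed under differentiation; bounding them
    all therefore bounds all derivatives of e^(-1/t). *)
Definition theta q t : R := if 0 < t then q.[t^-1] * expR (- t^-1) else 0.

Lemma horner_expR_bound q : exists2 C, 0 <= C & forall x : R, 0 <= x -> `|q.[x]| <= C * expR x.
Proof.
(* The induction on [q] needs every rate [a]: multiplication by x uses up half of it, through x <=
   (2/a) e^(a x / 2). *)
suff H (a : R) : 0 < a -> exists2 C, 0 <= C & forall x : R, 0 <= x -> `|q.[x]| <= C * expR (a * x).
  by have [C C0 HC] := H 1 ltr01; exists C => // x x0; have := HC x x0; rewrite mul1r.
elim/poly_ind: q a => [|q c IH] a a0.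
  by exists 0 => // x _; rewrite horner0 normr0 mul0r.
have a2 : 0 < a / 2 by rewrite divr_gt0.
have [C C0 HC] := IH _ a2; exists (C * (a / 2)^-1 + `|c|).
  by rewrite addr_ge0// mulr_ge0// invr_ge0 ltW.
move=> x x0; rewrite hornerMXaddC; apply: le_trans (ler_normD _ _) _; rewrite mulrDl.
apply: lerD; last first.
  by rewrite ler_peMr// -expR0 ler_expR mulr_ge0// ltW.
rewrite normrM (ger0_norm x0).
have -> : a * x = a / 2 * x + a / 2 * x by field.
rewrite expRD [C * _ * _]mulrACA; apply: ler_pM => //; first exact: HC.
rewrite -(ler_pM2l a2) mulrA mulfV ?gt_eqF// mul1r.
by have := expR_ge1Dx (a / 2 * x); lra.
Qed.

Lemma theta_bounded q : exists2 C, 0 <= C & forall t, `|theta q t| <= C.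
Proof.
have [C C0 HC] := horner_expR_bound q; exists C => // t.
rewrite /theta; case: ifPn => t0; last by rewrite normr0.
rewrite normrM (gtr0_norm (expR_gt0 _)) expRN ler_pdivrMr ?expR_gt0//.
by apply: HC; rewrite invr_ge0 ltW.
Qed.

(** From d/dt (q(1/t) e^(-1/t)) = t^(-2) (q - q')(1/t) e^(-1/t). *)
Definition theta_der q : {poly R} := 'X^2 * (q - q^`()).

Lemma is_derive_theta q t : is_derive t (1 : R) (theta q) (theta (theta_der q) t).
Proof.
have [t0|t0|<-] := ltgtP 0 t.
- have t1 : t != 0 by rewrite gt_eqF.
  have H1 : is_derive t (1 : R) (fun y : R => y^-1) (- t ^- 2 *: 1).
    exact: (@is_deriveV R id t 1 1 t1 (is_derive_id _ _)).
  have H2 : is_derive t (1 : R) (fun y : R => q.[y^-1]) (q^`().[t^-1] * (- t ^- 2 *: 1)).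
    exact: (is_derive_comp1 H1 (is_derive_poly q t^-1)).
  have H3 : is_derive t (1 : R) (fun y : R => expR (- y^-1)) (expR (- t^-1) * - (- t ^- 2 *: 1)).
    exact: (is_derive_comp1 (is_deriveN H1) (is_derive_expR (- t^-1))).
  have H4 := is_deriveM H2 H3.
  have -> : theta (theta_der q) t =
      q.[t^-1] *: (expR (- t^-1) * - (- t ^- 2 *: 1)) + expR (- t^-1) *: (q^`().[t^-1] * (- t ^- 2 *: 1)).
    rewrite /theta t0 /theta_der !hornerE /=.
    have sE (u v : R) : u *: v = u * v by [].
    by rewrite !sE !mulr1 opprK; field.
  have nb : \near t, (fun y : R => q.[y^-1] * expR (- y^-1)) t = theta q t.
    by apply: filterS (open_nbhs_nbhs (conj (@open_gt R 0) t0)) => y /= y0; rewrite /theta y0.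
  apply: is_derive_line H4.
  exact: (@near_line R R t 1 (fun y : R => q.[y^-1] * expR (- y^-1) = theta q y) nb).
- have -> : theta (theta_der q) t = 0 by rewrite /theta ltNge (ltW t0).
  have nb : \near t, (fun=> 0) t = theta q t.
    apply: filterS (open_nbhs_nbhs (conj (@open_lt R 0) t0)) => y /= y0.
    by rewrite /theta ltNge (ltW y0).
  apply: is_derive_line (is_derive_cst 0 _ _).
  exact: (@near_line R R t 1 (fun y : R => 0 = theta q y) nb).
- have -> : theta (theta_der q) 0 = 0 by rewrite /theta ltxx.
  (* The factor x^2 at x = 1/h gives |theta q h| <= C h^2, so the difference quotient at 0 tends to
     0. *)
  have [C C0 HC] := horner_expR_bound ('X^2 * q).
  have bd h : `|theta q h| <= C * h ^+ 2.
    rewrite /theta; case: ifPn => h0; last by rewrite normr0 mulr_ge0// sqr_ge0.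
    have := HC h^-1; rewrite invr_ge0 (ltW h0) => /(_ isT).
    rewrite hornerM hornerXn normrM (ger0_norm (sqr_ge0 h^-1)) => H.
    rewrite normrM (gtr0_norm (expR_gt0 _)) expRN ler_pdivrMr ?expR_gt0//.
    have key : C * expR h^-1 = h^-1 ^+ 2 * (C * h ^+ 2 * expR h^-1).
      by field; rewrite gt_eqF.
    have h2 : 0 < h^-1 ^+ 2 by rewrite exprn_gt0// invr_gt0.
    by rewrite -(ler_pM2l h2) -key.
  have lim : (fun h : R => h^-1 *: ((theta q \o shift 0) (h *: 1) - theta q 0)) @ 0^' --> (0 : R).
    apply/cvgrPdist_le => e e0; near=> h.
    have h0 : h != 0 by near: h; exact: nbhs_dnbhs_neq.
    have th0 : theta q 0 = 0 by rewrite /theta ltxx.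
    rewrite sub0r normrN /= addr0 [h%:A]mulr1 th0 subr0 normrM normfV.
    have hn : 0 < `|h| by rewrite normr_gt0.
    rewrite ler_pdivrMl//; apply: le_trans (bd h) _.
    rewrite -real_normK ?num_real// expr2 mulrCA ler_pM2l//.
    have hC : `|h| <= e / (C + 1).
      near: h; apply: dnbhs0_le; rewrite divr_gt0// ltr_wpDl//.
    have C1 : 0 < C + 1 by rewrite ltr_wpDl.
    move: hC; rewrite ler_pdivlMr// => hC; nra.
  apply: DeriveDef.
    by apply/cvg_ex; exists 0; exact: lim.
  exact: (cvg_lim (@Rhausdorff R) lim).
Unshelve. all: by end_near.
Qed.
End smooth_steps.

Section bounded_smooth_functions.
Context {R : realType} {d : nat}.
Local Notation normc := (@Normc.normc R).
Implicit Types (f g : 'rV[R]_d -> R[i]) (Om K V : set 'rV[R]_d).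

(* Smooth functions all of whose derivatives are bounded. *)
Definition CB f : Prop := forall k, S predT setT setT (fun=> 1) (fun=> 0) k 0 0 (fun=> f).

Let loT : line_open predT [set: 'rV[R]_d]. Proof. by apply: open_line_open; exact: openT. Qed.
Let om1 (w : 'rV[R]_d) : [set: 'rV[R]_d] w -> (1 : R) <= 1. Proof. by []. Qed.

Lemma CB_cst c : CB (fun=> c).
Proof. by move=> k; exact: (S_cst loT (@subset_refl _ _) om1). Qed.

Lemma CBM f g : CB f -> CB g -> CB (fun x => f x * g x).
Proof.
move=> hf hg k; have := SM loT (@subset_refl _ _) om1 (hf k) (hg k).
by rewrite addr0.
Qed.

Lemma CBD f g : CB f -> CB g -> CB (fun x => f x + g x).
Proof. by move=> hf hg k; exact: (SD loT (@subset_refl _ _) (hf k) (hg k)). Qed.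

Lemma CBB f g : CB f -> CB g -> CB (fun x => f x - g x).
Proof. by move=> hf hg k; exact: (SB loT (@subset_refl _ _) om1 (hf k) (hg k)). Qed.

Lemma CB_prod (I : Type) (r : seq I) (f : I -> 'rV[R]_d -> R[i]) :
  (forall i, CB (f i)) -> CB (fun x => \prod_(i <- r) f i x).
Proof.
move=> hf; elim: r => [|i r IH].
  have -> : (fun x => \prod_(i <- [::]) f i x) = (fun=> 1) by apply/funext => x; rewrite big_nil.
  exact: CB_cst.
have -> : (fun x => \prod_(j <- i :: r) f j x) = (fun x => f i x * \prod_(i <- r) f i x).
  by apply/funext => x; rewrite big_cons.
exact: CBM.
Qed.

Lemma CB_smooth f : CB f -> smooth_on setT f.
Proof.
move=> hf; apply: S_smooth; first exact: openT.
move=> k x _; exists 1, (fun=> 1), (fun=> 0), 0, 1; split; first exact: ltr01.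
  by move=> w _; rewrite lexx.
exact: (S_sub (fun i h => h) (@subset_refl _ _) (@subsetT _ _) (hf k)).
Qed.

(** Induction over all [q] at once, since a derivative turns [q] into [theta_der q] up to a constant
    factor. *)
Lemma CB_theta q (a b : R) i : CB (fun x => (theta q (a * x 0 i + b))%:C).
Proof.
move=> k; elim: k q => [|k IH] q; split => //.
- have [C C0 HC] := theta_bounded q; move=> b' b'0; exists C => //.
  apply: filterS near0r01 => e e01 w _; rewrite normc_real powR1 mulr1.
  by apply: le_trans (HC _) _; rewrite ler_peMr// powR_ge1// ltW.
- have [C C0 HC] := theta_bounded q; move=> b' b'0; exists C => //.
  apply: filterS near0r01 => e e01 w _; rewrite normc_real powR1 mulr1.
  by apply: le_trans (HC _) _; rewrite ler_peMr// powR_ge1// ltW.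
move=> j _; pose c : R := a * (i == j)%:R.
have D w : cder (fun x : 'rV[R]_d => (theta q (a * x 0 i + b))%:C) w (delta_mx 0 j)
    (c * theta (theta_der q) (a * w 0 i + b))%:C.
  apply: cder_real.
  apply: (@is_derive_affine R _ R (theta q) (fun x : 'rV[R]_d => a * x 0 i + b) w _ (c *: 1)).
    move=> h; rewrite !mxE /= ?eqxx /= /c.
    have sE (u v : R) : u *: v = u * v by [].
    rewrite !sE mulr1; ring.
  exact: (is_derive_scale c (is_derive_theta q (a * w 0 i + b))).
split; first by move=> e w _ _; exact: cder_pdiff (D w).
rewrite addr0; have H := S_scale loT (@subset_refl _ _) om1 c%:C (IH (theta_der q)).
refine (S_ext loT (@subset_refl _ _) _ H) => e w _ _.
rewrite /net_pderiv (cder_pderiv (D w)); exact: esym (rmorphM (real_complex R) _ _).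
Qed.

(** The usual smooth step in s = a x_i + b, from 0 for s <= 0 to 1 for s >= 1. Its denominator is
    bounded below because s or 1 - s is at least 1/2. *)
Definition step (i : 'I_d) (a b : R) (x : 'rV[R]_d) : R :=
  theta 1 (a * x 0 i + b) * (theta 1 (a * x 0 i + b) + theta 1 (- a * x 0 i + (1 - b)))^-1.

Let theta_ge0 (t : R) : 0 <= theta 1 t.
Proof. by rewrite /theta hornerC mul1r; case: ifP => // _; exact: expR_ge0. Qed.

Let theta_half (t : R) : 2^-1 <= t -> expR (- 2) <= theta 1 t.
Proof.
move=> t2; have t0 : 0 < t by apply: lt_le_trans t2; rewrite invr_gt0.
rewrite /theta t0 hornerC mul1r ler_expR lerN2 -[leRHS]invrK lef_pV2 ?posrE ?invr_gt0//.
Qed.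

Let step_den (t : R) : expR (- 2) <= theta 1 t + theta 1 (1 - t).
Proof.
have [h|h] := leP (2^-1) t.
  by apply: le_trans (theta_half h) _; rewrite lerDl.
have h' : 2^-1 <= 1 - t by lra.
by apply: le_trans (theta_half h') _; rewrite lerDr.
Qed.

Lemma CB_step i a b : CB (fun x => (step i a b x)%:C).
Proof.
pose g (x : 'rV[R]_d) := theta 1 (a * x 0 i + b) + theta 1 (- a * x 0 i + (1 - b)).
have gg x : expR (- 2) <= g x.
  have := step_den (a * x 0 i + b); rewrite /g; congr (_ <= _ + theta 1 _); ring.
have g0 x : 0 < g x by exact: lt_le_trans (expR_gt0 _) (gg x).
have Hg : CB (fun x => (g x)%:C).
  have := CBD (CB_theta 1 a b i) (CB_theta 1 (- a) (1 - b) i).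
  by congr CB; apply/funext => x; rewrite -rmorphD.
have Hi : CB (fun x => (g x)^-1%:C).
  move=> k; have := @S_realV R d predT setT setT (fun=> 1) (fun=> 0) loT (@subset_refl _ _) om1
    k 0 (fun=> g) (fun e w _ _ => lt0r_neq0 (g0 w)) (Hg k).
  rewrite oppr0; apply; move=> b' b'0; exists (expR 2); first by rewrite expR_ge0.
  apply: filterS near0r01 => e e01 w _; rewrite normc_real powR1 mulr1.
  rewrite ger0_norm; last by rewrite invr_ge0 ltW.
  apply: (@le_trans _ _ (expR 2)); last by rewrite ler_peMr ?expR_ge0// powR_ge1// ltW.
  by rewrite -[expR 2]invrK -expRN lef_pV2 ?posrE ?expR_gt0.
have := CBM (CB_theta 1 a b i) Hi.
by congr CB; apply/funext => x; rewrite -rmorphM.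
Qed.

Lemma step_ge1 i a b (x : 'rV[R]_d) : 1 <= a * x 0 i + b -> step i a b x = 1.
Proof.
move=> h; rewrite /step.
have -> : theta 1 (- a * x 0 i + (1 - b)) = 0.
  by rewrite /theta ltNge; have -> : - a * x 0 i + (1 - b) <= 0 by lra.
rewrite addr0 mulfV// gt_eqF// (lt_le_trans (expR_gt0 (- 2)))// theta_half//.
by apply: le_trans h; rewrite invf_le1// ler1n.
Qed.

Lemma step_le0 i a b (x : 'rV[R]_d) : a * x 0 i + b <= 0 -> step i a b x = 0.
Proof. by move=> h; rewrite /step {1}/theta ltNge h mul0r. Qed.

Lemma exists_bump (c : 'rV[R]_d) (r : R) : 0 < r -> exists psi, [/\ CB psi,
  forall x, `|x - c| < r / 2 -> psi x = 1 & forall x, ~ `|x - c| <= r -> psi x = 0].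
Proof.
(* Two steps per coordinate are multiplied, since balls of the maximum norm are cubes. The slope 2/r
   lets s run from 0 to 1 as the distance to the centre falls from r to r/2. *)
move=> r0; pose a := 2 / r; have a0 : 0 < a by rewrite divr_gt0.
have ar : a * r = 2 by rewrite /a divfK// gt_eqF.
exists (fun x => \prod_i ((step i a (2 - a * c 0 i) x)%:C * (step i (- a) (2 + a * c 0 i) x)%:C)).
split.
- by apply: CB_prod => i; apply: CBM; exact: CB_step.
- move=> x xr; rewrite big1// => i _.
  have := le_lt_trans (coord_le_norm (x - c) i) xr; rewrite !mxE ltr_norml => /andP[h1 h2].
  rewrite !step_ge1 ?mulr1//; nra.
- move=> x xr; have [i hi] : exists i, r < `|(x - c) 0 i|.
    apply: contrapT => H; apply: xr; apply: norm_le_coord; first exact: ltW.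
    by move=> i; rewrite leNgt; apply/negP => h; apply: H; exists i.
  rewrite (bigD1 i)//=; move: hi; rewrite !mxE ltr_normr => /orP[h|h].
    by rewrite [step i (- a) _ _]step_le0 ?mulr0 ?mul0r//; nra.
  by rewrite step_le0 ?mulr0 ?mul0r//; nra.
Qed.

Definition cutoff_for Om V K psi : Prop := [/\ CB psi, compact_in K Om, V `<=` K,
  forall x, V x -> psi x = 1 & forall x, ~ K x -> psi x = 0].

(** Finitely many cubes on which a bump equals 1 cover [K], and the bumps are merged one at a
    time. *)
Lemma exists_cutoff Om K : open Om -> compact_in K Om -> exists V K2 psi,
  [/\ open V, K `<=` V & cutoff_for Om V K2 psi].
Proof.
move=> oOm [cK KOm].
have /choice[r Hr] : forall x : 'rV[R]_d, exists r : R, 0 < r /\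
    (K x -> [set z : 'rV[R]_d | `|z - x| <= r] `<=` Om).
  move=> x; have [Kx|nKx] := pselect (K x); last by exists 1.
  by have [r r0 rO] := open_cball oOm (KOm x Kx); exists r.
pose f x := [set z : 'rV[R]_d | `|z - x| < r x / 2].
have of_ x : open (f x).
  have -> : f x = (fun z => `|z - x|) @^-1` [set t | t < r x / 2] by [].
  apply: open_comp; last exact: open_lt.
  move=> z _; apply: (@cvg_norm _ _ _ (nbhs z) _ (fun z : 'rV[R]_d => z - x) (z - x)).
  by apply: cvgB; [exact: cvg_id|exact: cvg_cst].
have cov : K `<=` cover K f.
  by move=> x Kx; exists x => //; rewrite /f /= subrr normr0 divr_gt0//; case: (Hr x).
move: cK; rewrite compact_cover => /(_ _ K f (fun x _ => of_ x) cov)[D DK KD].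
suff H (l : seq 'rV[R]_d) : (forall x, x \in l -> K x) -> exists K2 psi,
    cutoff_for Om [set z | exists2 x, x \in l & f x z] K2 psi.
  have [|K2 [psi Hpsi]] := H (finmap.enum_fset D); first by move=> x /DK; rewrite inE.
  exists [set z | exists2 x, x \in finmap.enum_fset D & f x z], K2, psi.
  split; last exact: Hpsi.
    have -> : [set z | exists2 x, x \in finmap.enum_fset D & f x z] =
        \bigcup_(x in [set x | x \in finmap.enum_fset D]) f x by [].
    by apply: bigcup_open => x _; exact: of_.
  by move=> z /KD[x xD fxz]; exists x.
elim: l => [_|x l IH lK].
  exists set0, (fun=> 0); split => //; first exact: CB_cst.
  - by split; [exact: compact0|exact: sub0set].
  - by move=> z [].
  - by move=> z [].
have [|K2 [psi [h1 [h2 h2'] h3 h4 h5]]] := IH.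
  by move=> y yl; apply: lK; rewrite inE yl orbT.
have Kx : K x by apply: lK; rewrite inE eqxx.
have [rx0 rxO] := Hr x; have [ps [g1 g2 g3]] := exists_bump x rx0.
(* This is 1 - (1 - psi)(1 - ps): equal to 1 where either function is, and 0 off both supports. *)
exists (K2 `|` [set z | `|z - x| <= r x]), (fun z => psi z + (1 - psi z) * ps z); split.
- by apply: CBD => //; apply: CBM => //; apply: CBB => //; exact: CB_cst.
- split; first by apply: compactU => //; exact: compact_cball.
  by rewrite subUset; split => //; exact: rxO.
- move=> z [y]; rewrite inE => /predU1P[->|yl] fz.
    right; apply: ltW; apply: lt_trans fz _.
    by rewrite ltr_pdivrMr// ltr_pMr// ltr1n.
  by left; apply: h3; exists y.
- move=> z [y]; rewrite inE => /predU1P[->|yl] fz.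
    by rewrite g2// mulr1 addrC subrK.
  by rewrite h4 ?subrr ?mul0r ?addr0//; exists y.
- move=> z /not_orP[z1 z2]; by rewrite h5// g3// mulr0 addr0.
Qed.
End bounded_smooth_functions.

(** * Classes of nets of smooth functions *)

Section smooth_nets.
Context {R : realType} {d : nat}.
Local Notation normc := (@Normc.normc R).
Local Notation net := (R -> 'rV[R]_d -> R[i]).
Implicit Types (Om L : set 'rV[R]_d) (u v w : net).

Lemma pderivs_linear A s c (f g : 'rV[R]_d -> R[i]) x : open A -> smooth_on A f ->
  smooth_on A g -> A x ->
  pderivs s (fun x => c * f x + g x) x = c * pderivs s f x + pderivs s g x.
Proof.
move=> oA sf sg; elim: s x => [//|i s IH] x Ax; rewrite /=.
rewrite (@pderiv_near _ _ i _ (fun x => c * pderivs s f x + pderivs s g x)).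
  rewrite (cder_pderiv (cderD (cderM (cder_cst c _ _) (smooth_on_pdiff s i sf Ax))
    (smooth_on_pdiff s i sg Ax))).
  by rewrite mul0r add0r.
by apply: filterS (open_nbhs_nbhs (conj oA Ax)) => y Ay; exact: IH.
Qed.

(** The case of functions without covariable: weight 1 and no shift of order. *)
Definition SL Om L k b u : Prop := S predT Om L (fun=> 1) (fun=> 0) k b 0 u.

Definition smooth_net Om u : Prop := forall e, 0 < e <= 1 -> smooth_on Om (u e).

Section fixed_open_set.
Variable Om : set 'rV[R]_d.
Hypothesis oOm : open Om.
Let loO : line_open predT Om. Proof. by apply: open_line_open. Qed.
Let om1 L (x : 'rV[R]_d) : L x -> (1 : R) <= 1. Proof. by []. Qed.

Lemma smooth_linear c (f g : 'rV[R]_d -> R[i]) : smooth_on Om f -> smooth_on Om g ->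
  smooth_on Om (fun x => c * f x + g x).
Proof.
move=> sf sg s.
have E x : Om x -> pderivs s (fun x => c * f x + g x) x = c * pderivs s f x + pderivs s g x.
  by move=> Ox; exact: (pderivs_linear s c oOm sf sg Ox).
have N x : Om x -> \near x, c * pderivs s f x + pderivs s g x = pderivs s (fun x => c * f x + g x) x.
  by move=> Ox; apply: filterS (open_nbhs_nbhs (conj oOm Ox)) => y Oy; rewrite E.
split; last first.
  move=> i x Ox; apply/pdiffP; apply: cder_pdiff.
  apply: cder_near (N x Ox) _.
  exact: (cderD (cderM (cder_cst c _ _) (smooth_on_pdiff s i sf Ox)) (smooth_on_pdiff s i sg Ox)).
move=> x Ox; have [f1 f2] := (sf s).1 x Ox; have [g1 g2] := (sg s).1 x Ox; split.
  apply: (@near_eq_continuous R d (fun y => complex.Re (c * pderivs s f y + pderivs s g y))).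
    by apply: filterS (N x Ox) => y ->.
  have -> : (fun y => complex.Re (c * pderivs s f y + pderivs s g y)) = (fun y =>
    complex.Re c * complex.Re (pderivs s f y) - complex.Im c * complex.Im (pderivs s f y)
    + complex.Re (pderivs s g y)) by apply/funext => y; rewrite cReD cReM.
  exact: (cvgD (cvgB (cvgM (cvg_cst _) f1) (cvgM (cvg_cst _) f2)) g1).
apply: (@near_eq_continuous R d (fun y => complex.Im (c * pderivs s f y + pderivs s g y))).
  by apply: filterS (N x Ox) => y ->.
have -> : (fun y => complex.Im (c * pderivs s f y + pderivs s g y)) = (fun y =>
    complex.Re c * complex.Im (pderivs s f y) + complex.Im c * complex.Re (pderivs s f y)
    + complex.Im (pderivs s g y)) by apply/funext => y; rewrite cImD cImM.
exact: (cvgD (cvgD (cvgM (cvg_cst _) f2) (cvgM (cvg_cst _) f1)) g2).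
Qed.

Lemma smooth_cst c : smooth_on Om (fun=> c).
Proof. by apply: smooth_onS (CB_smooth (@CB_cst R d c)). Qed.

Lemma SL_compact L k (f : 'rV[R]_d -> R[i]) : compact_in L Om -> smooth_on Om f ->
  SL Om L k 0 (fun=> f).
Proof.
move=> [cL LO] sf; apply: S_of_pderivs => [s _ _|s i _ _ _ e w _ Ow]; last exact: smooth_on_pdiff.
have bdd (g : 'rV[R]_d -> R) : (forall y, Om y -> {for y, continuous g}) ->
    exists C, forall y, L y -> `|g y| <= C.
  move=> cg; have : {within L, continuous g}.
    by apply: continuous_in_subspaceT => y /set_mem yr; apply: cg; exact: LO.
  move=> /(continuous_compact)/(_ cL)/compact_bounded[M [_ HM]]; exists (M + 1) => y yr.
  by apply: (HM (M + 1)); [rewrite ltrDl|exists y].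
have [C1 H1] := bdd _ (fun y Oy => ((sf s).1 y Oy).1).
have [C2 H2] := bdd _ (fun y Oy => ((sf s).1 y Oy).2).
move=> b' b'0; exists (`|C1| + `|C2|); first by rewrite addr_ge0.
apply: filterS near0r01 => e e01 w Lw.
rewrite powR1 mulr1; apply: (@le_trans _ _ (`|C1| + `|C2|)).
  apply: le_trans (normc_le_ReIm _) _; apply: lerD; apply: le_trans (ler_norm _).
    exact: H1.
  exact: H2.
by rewrite ler_peMr ?addr_ge0// powR_ge1// ltW.
Qed.

Lemma smoothM_CB psi f : CB psi -> smooth_on Om f -> smooth_on Om (fun x => psi x * f x).
Proof.
move=> hp sf; apply: S_smooth => // k x Ox; have [r r0 rO] := open_cball oOm Ox.
exists r, (fun=> 1), (fun=> 0), 0, 1; split => //.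
  by move=> w /ltW wr; rewrite lexx; split => //; exact: rO.
have GO : [set w | `|w - x| < r] `<=` Om by move=> w /ltW wr; exact: rO.
rewrite -[0 in X in S _ _ _ _ _ _ X]addr0 -[0 in X in S _ _ _ _ _ _ _ X]addr0.
apply: (SM loO GO (@om1 _)).
  exact: (S_sub (fun i h => h) (@subsetT _ _) (@subsetT _ _) (hp k)).
have cB : compact_in [set z : 'rV[R]_d | `|z - x| <= r] Om by split => //; exact: compact_cball.
by apply: (S_sub (fun i h => h) (@subset_refl _ _) _ (SL_compact k cB sf)) => w /ltW.
Qed.

Lemma SL_of_Ck L k b u : smooth_net Om u -> L `<=` Om ->
  growth b (fun e => Ck_norm L k (u e)) -> SL Om L k b u.
Proof.
move=> su LO Hg; apply: S_of_pderivs => [s _ sk|s i _ _ _ e x e01 Ox]; last first.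
  exact: smooth_on_pdiff (su e e01) Ox.
move=> b' b'b; have [C C0 HC] := Hg b' b'b; exists C => //.
apply: filterS2 HC near0r01 => e HC e01 x Lx.
rewrite powR1 mulr1 -lee_fin; apply: le_trans HC; apply: ereal_sup_ubound.
exists x, (fun i => count_mem i s); split => //; first by rewrite mlen_count.
by rewrite (pderivs_mderiv s oOm (su e e01) (LO x Lx)).
Qed.

Lemma SL_bound L k b b' u s : SL Om L k b u -> (size s <= k)%N -> b' < b ->
  exists2 C, 0 <= C & \forall e \near 0^'+, forall x, L x ->
    normc (pderivs s (u e) x) <= C * e `^ b'.
Proof.
move=> HS sk b'b; have [H _] := S_pderivs HS (all_predT s) sk.
have [C C0 HC] := H b' b'b; exists C => //; apply: filterS HC => e HC x Lx.
by have := HC x Lx; rewrite powR1 mulr1.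
Qed.

(** A supremum over multi-indices needs one constant and one range of e for all of them, hence
    [near_uniform_words]. *)
Lemma Ck_of_SL L k b u : SL Om L k b u -> growth b (fun e => Ck_norm L k (u e)).
Proof.
move=> HS b' b'b.
have [|s sk|C HC] := @near_uniform_words R 'I_d k (fun s C e => 0 < e -> forall x, L x ->
    normc (pderivs s (u e) x) <= C * e `^ b').
- by move=> s C C' e CC H e0 x Lx; apply: le_trans (H e0 x Lx) _; rewrite ler_wpM2r// powR_ge0.
- have [C C0 HC] := SL_bound HS sk b'b; exists C; apply: filterS HC => e HC _ x Lx; exact: HC.
exists `|C| => //; apply: filterS2 HC near0r01 => e HC /andP[e0 e1].
apply: ge_ereal_sup => _ [x [al [Lx alk ->]]]; rewrite lee_fin.
have [s -> ss] := mderiv_pderivs al (u e); apply: (@le_trans _ _ (C * e `^ b')).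
  by apply: HC => //; rewrite ss.
by rewrite ler_wpM2r ?powR_ge0// ler_norm.
Qed.

Lemma sup_norm_SL L k b u (al : 'I_d -> nat) : SL Om L k b u -> (mlen al <= k)%N ->
  growth b (fun e => sup_norm L (mderiv al (u e))).
Proof.
move=> HS sk b' b'b.
have /choice[s Hs] : forall e, exists s, mderiv al (u e) = pderivs s (u e) /\ size s = mlen al.
  by move=> e; have [s] := mderiv_pderivs al (u e); exists s.
have E e : mderiv al (u e) = pderivs (flatten [seq nseq (al i) i | i <- enum 'I_d]) (u e) by [].
have sz : size (flatten [seq nseq (al i) i | i <- enum 'I_d]) = mlen al.
  rewrite size_flatten /shape -map_comp sumnE big_map /mlen -big_enum /=.
  by apply: eq_bigr => i _; rewrite size_nseq.
have [|C C0 HC] := SL_bound HS (s := flatten [seq nseq (al i) i | i <- enum 'I_d]) _ b'b.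
  by rewrite sz.
exists C => //; apply: filterS HC => e HC.
by apply: sup_norm_le => x Lx; rewrite E; exact: HC.
Qed.

Lemma SL_of_sup L k b u : smooth_net Om u -> L `<=` Om ->
  (forall s, growth b (fun e => sup_norm L (pderivs s (u e)))) -> SL Om L k b u.
Proof.
move=> su LO Hg; apply: S_of_pderivs => [s _ sk|s i _ _ _ e x e01 Ox]; last first.
  exact: smooth_on_pdiff (su e e01) Ox.
move=> b' b'b; have [C C0 HC] := Hg s b' b'b; exists C => //.
apply: filterS HC => e HC x Lx; rewrite powR1 mulr1 -lee_fin.
by apply: le_trans HC; apply: ereal_sup_ubound; exists x.
Qed.

Lemma SL_of_mderiv L k b u : smooth_net Om u -> L `<=` Om ->
  (forall al, growth b (fun e => sup_norm L (mderiv al (u e)))) -> SL Om L k b u.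
Proof.
move=> su LO Hg; apply: SL_of_sup => // s.
apply: growth_le (lexx _) _ (Hg (fun i => count_mem i s)).
apply: filterS near0r01 => e e01; apply: ge_ereal_sup => _ [x Lx <-].
apply: ereal_sup_ubound; exists x => //.
by rewrite (pderivs_mderiv s oOm (su e e01) (LO x Lx)).
Qed.

Lemma SL_linear L k b u v (c : R[i]) : L `<=` Om -> SL Om L k b u -> SL Om L k b v ->
  SL Om L k b (fun e x => c * u e x + v e x).
Proof.
by move=> LO hu hv; apply: (SD loO LO) => //; exact: (S_scale loO LO (@om1 _)).
Qed.

Lemma SL_le L k b b1 u : b1 <= b -> SL Om L k b u -> SL Om L k b1 u.
Proof. by move=> bb; exact: (S_le (@om1 _) (leqnn k) bb (lexx _)). Qed.

Lemma SL_subset L L' k b u : L' `<=` L -> SL Om L k b u -> SL Om L' k b u.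
Proof. by move=> LL; exact: (S_sub (fun i h => h) (@subset_refl _ _) LL). Qed.

Lemma SLM_CB L k b psi u : L `<=` Om -> CB psi -> SL Om L k b u ->
  SL Om L k b (fun e x => psi x * u e x).
Proof.
move=> LO hp hu; have := SM loO LO (@om1 _)
  (S_sub (fun i h => h) (@subsetT _ _) (@subsetT _ _) (hp k)) hu.
by rewrite add0r addr0.
Qed.

Lemma SL_ext L k b u v : L `<=` Om -> (forall e x, 0 < e <= 1 -> Om x -> u e x = v e x) ->
  SL Om L k b u -> SL Om L k b v.
Proof. by move=> LO; exact: (S_ext loO LO). Qed.

Lemma negligibleP w : @negligible_net R (Cinf Om) w <->
  smooth_net Om w /\ forall L k c, compact_in L Om -> SL Om L k c w.
Proof.
split=> [[sw Hw]|[sw Hw]]; split => //.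
  move=> L k c cL; apply: SL_of_Ck => //; first exact: cL.2.
  by apply: negligible_growth; apply: Hw; exists L, k.
move=> _ [L [k [cL ->]]]; apply: growth_negligible => b.
by apply: Ck_of_SL; exact: Hw.
Qed.

Lemma moderateP w : @moderate_net R (Cinf Om) w <->
  smooth_net Om w /\ forall L k, compact_in L Om -> exists b, SL Om L k b w.
Proof.
split=> [[sw Hw]|[sw Hw]]; split => //.
  move=> L k cL; have [|N HN] := Hw (Ck_norm L k); first by exists L, k.
  exists (- N%:R); apply: SL_of_Ck => //; first exact: cL.2.
  exact: bigO_expN_growth.
move=> _ [L [k [cL ->]]]; have [b Hb] := Hw L k cL.
exact: growth_moderate_ex (Ck_of_SL Hb).
Qed.

Lemma negligible_C0 w : @negligible_net R (Cinf Om) w -> @negligible_net R (C0 Om) w.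
Proof.
move=> /negligibleP[sw Hw]; split; first by move=> e e01; exact: (sw e e01 [::]).1.
move=> _ [L [cL ->]]; apply: growth_negligible => b.
move=> b' b'b; have [C C0 HC] := SL_bound (s := [::]) (Hw L 0%N b cL) isT b'b.
by exists C => //; apply: filterS HC => e HC; exact: sup_norm_le.
Qed.

Lemma negligible_linear c u v : @negligible_net R (Cinf Om) u -> @negligible_net R (Cinf Om) v ->
  @negligible_net R (Cinf Om) (fun e x => c * u e x + v e x).
Proof.
move=> /negligibleP[su Hu] /negligibleP[sv Hv]; apply/negligibleP; split.
  by move=> e e01; exact: smooth_linear (su e e01) (sv e e01).
by move=> L k b cL; apply: SL_linear; [exact: cL.2|exact: Hu|exact: Hv].
Qed.
End fixed_open_set.
End smooth_nets.

Section net_classes.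
Context {R : realType} {d : nat}.
Local Notation normc := (@Normc.normc R).
Local Notation net := (R -> 'rV[R]_d -> R[i]).
Variable Om : set 'rV[R]_d.
Hypothesis oOm : open Om.
Implicit Types (u v w : net) (U V : set net) (K L : set 'rV[R]_d).
Local Notation negl := (@negligible_net R (Cinf Om)).
Local Notation moder := (@moderate_net R (Cinf Om)).
Let loO : line_open predT Om. Proof. by apply: open_line_open. Qed.
Let om1 L (x : 'rV[R]_d) : L x -> (1 : R) <= 1. Proof. by []. Qed.

Lemma smooth_net_ext u v : (forall e x, 0 < e <= 1 -> Om x -> u e x = v e x) ->
  smooth_net Om u -> smooth_net Om v.
Proof. by move=> E su e e01; apply: smooth_on_ext (su e e01) => // x Ox; exact: E. Qed.

Lemma negl_linear c u v w : negl u -> negl v ->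
  (forall e x, 0 < e <= 1 -> Om x -> w e x = c * u e x + v e x) -> negl w.
Proof.
move=> nu nv E; have /(negligibleP oOm)[s H] := negligible_linear oOm c nu nv.
have E' e x (e01 : 0 < e <= 1) (Ox : Om x) := esym (E e x e01 Ox).
apply/(negligibleP oOm); split; first exact: smooth_net_ext E' s.
by move=> L k b cL; apply: (SL_ext oOm cL.2 E'); exact: H.
Qed.

Lemma negl_ext u w : negl u -> (forall e x, 0 < e <= 1 -> Om x -> w e x = u e x) -> negl w.
Proof.
move=> nu E; have z : negl (fun _ _ => 0).
  apply/(negligibleP oOm); split; first by move=> e _; exact: smooth_cst.
  by move=> L k c cL; apply: (S0 loO cL.2).
by apply: (negl_linear (c := 1) nu z) => e x e01 Ox; rewrite E// mul1r addr0.
Qed.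

Lemma moderate_linear c u v w : moder u -> moder v ->
  (forall e x, 0 < e <= 1 -> Om x -> w e x = c * u e x + v e x) -> moder w.
Proof.
move=> /(moderateP oOm)[su Hu] /(moderateP oOm)[sv Hv] E.
have E' e x (e01 : 0 < e <= 1) (Ox : Om x) := esym (E e x e01 Ox).
apply/(moderateP oOm); split.
  apply: smooth_net_ext E' _ => e e01; exact: smooth_linear (su e e01) (sv e e01).
move=> L k cL; have [b Hb] := Hu L k cL; have [b' Hb'] := Hv L k cL.
exists (Num.min b b'); apply: (SL_ext oOm cL.2 E'); apply: SL_linear => //; first exact: cL.2.
  by apply: SL_le Hb; rewrite ge_min lexx.
by apply: SL_le Hb'; rewrite ge_min lexx orbT.
Qed.

Lemma negl_moderate u : negl u -> moder u.
Proof.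
move=> /(negligibleP oOm)[su Hu]; apply/(moderateP oOm); split => // L k cL.
by exists 0; exact: Hu.
Qed.

Lemma negl0 : negl 0.
Proof.
apply/(negligibleP oOm); split; first by move=> e _; exact: smooth_cst.
by move=> L k c cL; apply: (S0 loO cL.2).
Qed.

Lemma SL_scalar L k b b1 (l : R -> R[i]) u : L `<=` Om ->
  growth b1 (fun e => (normc (l e))%:E) -> SL Om L k b u ->
  SL Om L k (b1 + b) (fun e x => l e * u e x).
Proof.
move=> LO gl hu; have hl : SL Om L k b1 (fun e _ => l e).
  have hb b2 : b2 < b1 -> exists2 C, 0 <= C & \forall e \near 0^'+, forall x, L x ->
      normc (l e) <= C * e `^ b2 * 1 `^ 0.
    move=> bb; have [C C0 HC] := gl b2 bb; exists C => //.
    by apply: filterS HC => e HC x _; rewrite powR1 mulr1 -lee_fin.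
  case: k hu => [|k] hu; first by split.
  split => // i _; split; first by move=> e x _ _; exact: cder_pdiff (cder_cst _ _ _).
  apply: (S0 loO LO) => e x _ _; exact: cder_pderiv (cder_cst _ _ _).
have := SM loO LO (@om1 _) hl hu.
by rewrite add0r.
Qed.

Lemma negl_scalar (l : R -> R[i]) N u w : growth N (fun e => (normc (l e))%:E) -> negl u ->
  (forall e x, 0 < e <= 1 -> Om x -> w e x = l e * u e x) -> negl w.
Proof.
move=> gl /(negligibleP oOm)[su Hu] E.
apply: (negl_ext _ E); apply/(negligibleP oOm); split.
  move=> e e01; have := smooth_linear oOm (l e) (su e e01) (smooth_cst Om 0).
  by apply: smooth_on_ext => // x _; rewrite addr0.
move=> L k c cL; have := SL_scalar cL.2 gl (Hu L k (c - N) cL).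
by rewrite addrC subrK.
Qed.

Lemma moderate_scalar (l : R -> R[i]) N u w : growth N (fun e => (normc (l e))%:E) -> moder u ->
  (forall e x, 0 < e <= 1 -> Om x -> w e x = l e * u e x) -> moder w.
Proof.
move=> gl /(moderateP oOm)[su Hu] E.
have E' e x (e01 : 0 < e <= 1) (Ox : Om x) := esym (E e x e01 Ox).
apply/(moderateP oOm); split.
  apply: smooth_net_ext E' _ => e e01.
  have := smooth_linear oOm (l e) (su e e01) (smooth_cst Om 0).
  by apply: smooth_on_ext => // x _; rewrite addr0.
move=> L k cL; have [b Hb] := Hu L k cL; exists (N + b).
exact: (SL_ext oOm cL.2 E' (SL_scalar cL.2 gl Hb)).
Qed.

Lemma class_moderate U u : G Om U -> U u -> moder u.
Proof. by move=> [u0 mu0 ->] [mu _]. Qed.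

Lemma class_negl U u v : G Om U -> U u -> U v -> negl (u - v).
Proof.
move=> [u0 mu0 ->] [mu nu] [mv nv].
apply: (negl_linear (c := -1) nv nu) => e x _ _.
by rewrite -[LHS]/(u e x - v e x) -[(u - u0) e x]/(u e x - u0 e x) -[(v - u0) e x]/(v e x - u0 e x); ring.
Qed.

Lemma class_mem U u v : G Om U -> U u -> negl (v - u) -> U v.
Proof.
move=> GU Uu nv; have mu := class_moderate GU Uu; case: GU Uu => u0 mu0 -> [_ nu]; split.
  apply: (moderate_linear (c := 1) (negl_moderate nv) mu) => e x _ _.
  by rewrite -[(v - u) e x]/(v e x - u e x); ring.
apply: (negl_linear (c := 1) nv nu) => e x _ _.
by rewrite -[LHS]/(v e x - u0 e x) -[(u - u0) e x]/(u e x - u0 e x) -[(v - u) e x]/(v e x - u e x); ring.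
Qed.

(** Off the closed set [K] the net vanishes on an open set and so do its derivatives; only points of
    [K] matter. *)
Lemma SL_supported L K k b u : L `<=` Om -> closed K -> supported Om K u ->
  SL Om K k b u -> SL Om L k b u.
Proof.
move=> LO cK su Hu; have oN : open (Om `&` ~` K) by apply: openI => //; exact: closed_openC.
have h : S predT (Om `&` ~` K) (L `&` ~` K) (fun=> 1) (fun=> 0) k b 0 u.
  apply: S0; first by apply: open_line_open.
    by move=> x [Lx Kx]; split => //; exact: LO.
  by move=> e x e01 [Ox Kx]; exact: su.
refine (S_sub (fun i h => h) _ _ (S_union Hu h)) => x Hx; first by left.
by have [Kx|Kx] := pselect (K x); [left|right].
Qed.

(** Near a point of [V] the net u - psi u is zero. Near a point outside the support of [U] some
    representative, and hence [u] itself, is negligible. Compactness glues the two cases. *)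
Lemma cutoff_negligible U K (V : set 'rV[R]_d) K2 psi u : G Om U -> gsupp Om U `<=` K -> open V -> K `<=` V ->
  cutoff_for Om V K2 psi -> U u -> negl (fun e x => u e x - psi x * u e x).
Proof.
move=> GU sU oV KV [hpsi cK2 VK2 psi1 psi0] Uu.
have /(moderateP oOm)[su _] := class_moderate GU Uu.
have hq : CB (fun x => 1 - psi x) by apply: CBB => //; exact: CB_cst.
pose y : net := fun e x => (1 - psi x) * u e x.
have yE e x : y e x = u e x - psi x * u e x by rewrite /y mulrBl mul1r.
have sy : smooth_net Om y by move=> e e01; exact: smoothM_CB (su e e01).
(* Stated with constant 1, so that a finite cover needs no choice of constants; the local constants
   are absorbed by one extra power of e. *)
suff H L s c : compact_in L Om -> \forall e \near (0 : R)^'+, forall x, L x ->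
    normc (pderivs s (y e) x) <= e `^ c.
  apply: (@negl_ext y); last by move=> e x _ _; rewrite yE.
  apply/(negligibleP oOm); split => // L k c cL.
  apply: SL_of_sup => //; first exact: cL.2.
  move=> s b' b'c; exists 1 => //; apply: filterS (H L s b' cL) => e He.
  by apply: sup_norm_le => x Lx; rewrite mul1r; exact: He.
move=> [cL LO].
have loc x : L x -> exists W, [/\ open W, W x & exists C, \forall e \near (0 : R)^'+,
    forall x', W x' -> normc (pderivs s (y e) x') <= C * e `^ (c + 1)].
  move=> Lx; have Ox := LO x Lx; have [Vx|nVx] := pselect (V x).
    exists V; split => //; exists 0; apply: nearW => e x' Vx'; rewrite mul0r.
    have -> : pderivs s (y e) x' = 0; last by rewrite Normc.normc0.
    have -> : pderivs s (y e) x' = pderivs s (fun=> 0) x'.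
      by apply: (pderivs_ext s oV) => // z Vz; rewrite yE psi1// mul1r subrr.
    elim: s {Vx'} x' => [//|i s IH] x' /=.
    have -> : pderivs s (fun=> 0 : R[i]) = (fun=> 0) by apply/funext => z; exact: IH.
    exact: cder_pderiv (cder_cst _ _ _).
  have : ~ gsupp Om U x by move=> /sU/KV.
  move=> /not_andP[//|/contrapT[W [oW WO Wx [u' Uu' nu']]]].
  have [r r0 rW] := open_cball oW Wx.
  have cB : compact_in [set z : 'rV[R]_d | `|z - x| <= r] W by split => //; exact: compact_cball.
  have cB' : compact_in [set z : 'rV[R]_d | `|z - x| <= r] Om.
    by split => //; [exact: compact_cball|exact: subset_trans rW WO].
  have /(negligibleP oW)[_ /(_ _ (size s) (c + 2) cB) H1] := nu'.
  have /(negligibleP oOm)[_ /(_ _ (size s) (c + 2) cB') H2] := class_negl GU Uu Uu'.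
  have H2' := S_sub (fun i h => h) WO (@subset_refl _ _) H2.
  have H3 : SL W [set z : 'rV[R]_d | `|z - x| <= r] (size s) (c + 2) u.
    apply: (SL_ext oW rW _ (SL_linear oW 1 rW H2' H1)) => e z _ _.
    by rewrite -[(u - u') e z]/(u e z - u' e z); ring.
  have H4 := SLM_CB oW rW hq H3.
  have [|C C0 HC] := SL_bound H4 (leqnn _) (_ : c + 1 < c + 2); first by rewrite ltrD2l ltr1n.
  exists [set z | `|z - x| < r]; split.
  - have -> : [set z : 'rV[R]_d | `|z - x| < r] = (fun z => `|z - x|) @^-1` [set t | t < r] by [].
    apply: open_comp; last exact: open_lt.
    move=> z _; apply: (@cvg_norm _ _ _ (nbhs z) _ (fun z : 'rV[R]_d => z - x) (z - x)).
    by apply: cvgB; [exact: cvg_id|exact: cvg_cst].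
  - by rewrite /= subrr normr0.
  - by exists C; apply: filterS HC => e HC z /ltW zr; exact: HC.
have := (compact_near_coveringP _).1 cL R (0^'+)
  (fun e x => normc (pderivs s (y e) x) <= e `^ c).
move=> /(_ _); apply=> x Lx.
have [W [oW Wx [C HC]]] := loc x Lx.
exists (W, [set e : R | (0 < e <= 1 /\ e < (`|C| + 1)^-1) /\
    forall x', W x' -> normc (pderivs s (y e) x') <= C * e `^ (c + 1)]).
  split; first exact: open_nbhs_nbhs.
  have c0 : 0 < (`|C| + 1)^-1 by rewrite invr_gt0 ltr_wpDl.
  have h1 := near0r_lt c0; have h2 := @near0r01 R.
  by apply: filterS3 h1 h2 HC => e.
move=> [x' e] /= [Wx' [[/andP[e0 e1] eC] He]].
have C1 : 0 < `|C| + 1 by rewrite ltr_wpDl.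
have CC := ler_norm C; have ec := powR_ge0 e c.
suff h : C * e `^ (c + 1) <= e `^ c by exact: le_trans (He x' Wx') h.
have -> : e `^ (c + 1) = e `^ c * e by rewrite powR_gtD// powRr1// ltW.
have Ce : C * e <= 1.
  move: eC; rewrite -[(_ + 1)^-1]mul1r ltr_pdivlMr// => eC; nra.
by rewrite mulrCA ler_piMr.
Qed.
End net_classes.

Section exp_neg.
Context {R : realType}.

Lemma exp_neg_ge0 (v : \bar R) : (0 <= exp_neg v)%E.
Proof. by rewrite /exp_neg; case: v => [r| |] /=; rewrite ?lee_fin ?expR_ge0. Qed.

Lemma exp_neg_le (v w : \bar R) : (v <= w)%E -> (exp_neg w <= exp_neg v)%E.
Proof.
rewrite /exp_neg; case: v w => [r| |] [q| |] //=; rewrite ?lee_fin ?leey ?expR_ge0// => h.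
by rewrite ler_expR lerN2.
Qed.

Lemma exp_neg_lt (v : \bar R) (c : R) : (exp_neg v < c%:E)%E -> exists b : R,
  (b%:E < v)%E /\ expR (- b) < c.
Proof.
rewrite /exp_neg; case: v => [r| |] //= h.
  rewrite lte_fin in h; have c0 : 0 < c by apply: lt_trans h; exact: expR_gt0.
  have h1 : - r < ln c by rewrite -ltr_expR lnK// posrE.
  exists (r - (r + ln c) / 2); rewrite lte_fin; split; first lra.
  rewrite -[ltRHS](lnK (_ : c \is Num.pos)) ?posrE// ltr_expR; lra.
rewrite lte_fin in h; exists (1 - ln c); rewrite ltey; split => //.
rewrite -[ltRHS](lnK (_ : c \is Num.pos)) ?posrE// ltr_expR; lra.
Qed.

Lemma lt_ereal_real (x : \bar R) (b : R) : (x < b%:E)%E -> exists b', b' < b /\ (x < b'%:E)%E.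
Proof.
case: x => [r| |] //=; last by move=> _; exists (b - 1); rewrite ltrBlDr ltrDl ltr01 ltNye.
rewrite lte_fin => rb; exists ((r + b) / 2); rewrite lte_fin; split; lra.
Qed.

(** In terms of suprema the hypothesis says z >= v + w. Nonemptiness excludes the value -oo, for
    which a product of 0 and +oo would break the inequality. *)
Lemma exp_neg_mul (v w z : \bar R) (S1 S2 : set R) :
  v = ereal_sup [set b%:E | b in S1] -> w = ereal_sup [set b%:E | b in S2] ->
  S1 !=set0 -> S2 !=set0 ->
  (forall b1 b2, S1 b1 -> S2 b2 -> ((b1 + b2)%:E <= z)%E) ->
  (exp_neg z <= exp_neg v * exp_neg w)%E.
Proof.
move=> -> -> [b1 Sb1] [b2 Sb2] H.
set V := ereal_sup _; set W := ereal_sup _.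
have V1 : (b1%:E <= V)%E by apply: ereal_sup_ubound; exists b1.
have W1 : (b2%:E <= W)%E by apply: ereal_sup_ubound; exists b2.
case: z H => [r| |] H; last 2 first.
- by rewrite mule_ge0// exp_neg_ge0.
- by have := H _ _ Sb1 Sb2.
have Wle b : S1 b -> (W <= (r - b)%:E)%E.
  move=> Sb; apply: ge_ereal_sup => _ [c Sc <-]; rewrite lee_fin.
  by have := H _ _ Sb Sc; rewrite lee_fin; lra.
have := Wle _ Sb1; move: W1; case: {-1}W (erefl W) => [w0| |] //= Ew _ _.
have Vle : (V <= (r - w0)%:E)%E.
  apply: ge_ereal_sup => _ [c Sc <-]; have := Wle _ Sc; rewrite Ew !lee_fin; lra.
move: V1 Vle; case: {-1}V (erefl V) => [v0| |] //= Ev _; rewrite lee_fin => h.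
rewrite /exp_neg /= lee_fin -expRD ler_expR; lra.
Qed.
End exp_neg.

(** * Continuity of linear operators on classes *)

Section operator_on_classes.
Context {R : realType} {n' n : nat}.
Local Notation normc := (@Normc.normc R).
Local Notation net := (R -> 'rV[R]_n -> R[i]).
Local Notation net' := (R -> 'rV[R]_n' -> R[i]).
Variables (Om' : set 'rV[R]_n') (Om : set 'rV[R]_n).
Hypotheses (oOm' : open Om') (oOm : open Om).
Local Notation negl := (@negligible_net R (Cinf Om)).
Local Notation negl' := (@negligible_net R (Cinf Om')).
Local Notation moder' := (@moderate_net R (Cinf Om')).
Variables (T : net -> net') (P : pred nat).

Definition good K u : Prop := smooth_net Om u /\ supported Om K u.
(** [P] is the set of orders of derivatives of [u] that the operator depends on: every order for a
    regular symbol, only order 0 for a smoothing one. *)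
Definition PS K b u : Prop := forall k, P k -> SL Om K k b u.

Hypothesis T_smooth : forall K u, compact_in K Om -> good K u -> smooth_net Om' (T u).
Hypothesis T_linear : forall K u v (c : R -> R[i]), compact_in K Om -> good K u -> good K v ->
  forall e x, 0 < e <= 1 -> Om' x ->
  T (fun e x => c e * u e x + v e x) e x = c e * T u e x + T v e x.
Hypothesis T_bound : forall K0 K1, compact_in K0 Om' -> compact_in K1 Om -> exists N : R,
  forall u b, good K1 u -> PS K1 b u -> forall k, SL Om' K0 k (b - N) (T u).

(** Defined by all compactly supported representatives at once, without choosing one; [Bc_negl] and
    [Bc_G] show that the result is a single class. *)
Definition Bc (U : set net) : set net' := [set v | moder' v /\ exists u K,
  [/\ U u, compact_in K Om, supported Om K u & negl' (v - T u)]].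

Definition Dom (U : set net) : Prop := G Om U /\ exists u K,
  [/\ U u, compact_in K Om, supported Om K u & exists b, PS K b u].

Lemma goodU K K' u : good K u -> good (K `|` K') u.
Proof.
move=> [su sp]; split => // e x e01 Ox /not_orP[Kx _]; exact: sp.
Qed.

Lemma goodUr K K' u : good K' u -> good (K `|` K') u.
Proof. by rewrite setUC; exact: goodU. Qed.

Lemma good_linear K (c : R -> R[i]) u v : good K u -> good K v ->
  good K (fun e x => c e * u e x + v e x).
Proof.
move=> [su ku] [sv kv]; split.
  by move=> e e01; exact: smooth_linear (su e e01) (sv e e01).
by move=> e x e01 Ox Kx; rewrite ku// kv// mulr0 addr0.
Qed.

Lemma class_good U K u : G Om U -> U u -> supported Om K u -> good K u.
Proof. by move=> GU Uu su; split => //; have /(moderateP oOm)[] := class_moderate GU Uu. Qed.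

Lemma compact_inU d (K K' A : set 'rV[R]_d) : compact_in K A -> compact_in K' A ->
  compact_in (K `|` K') A.
Proof. by move=> [c s] [c' s']; split; [exact: compactU|rewrite subUset]. Qed.

(** By linearity T u - T v is T of the negligible net u - v, and [T_bound] holds for it with every
    exponent [b]. *)
Lemma T_negl K K' u v : compact_in K Om -> compact_in K' Om -> good K u -> good K' v ->
  negl (u - v) -> negl' (T u - T v).
Proof.
move=> cK cK' gu gv /(negligibleP oOm)[_ H].
have cU := compact_inU cK cK'; have gu' := goodU K' gu; have gv' := goodUr K gv.
pose z : net := fun e x => -1 * v e x + u e x.
have gz : good (K `|` K') z by exact: (good_linear (fun=> -1) gv' gu').
have E e x : 0 < e <= 1 -> Om' x -> T z e x = T u e x - T v e x.
  by move=> e01 Ox; rewrite (T_linear (fun=> -1) cU gv' gu')// mulN1r addrC.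
have zb c k : SL Om (K `|` K') k c z.
  apply: (SL_ext oOm cU.2 _ (H _ k c cU)) => e x _ _.
  by rewrite -[(u - v) e x]/(u e x - v e x) /z mulN1r addrC.
apply/(negligibleP oOm'); split; first exact: smooth_net_ext E (T_smooth cU gz).
move=> L k c cL; have [N HN] := T_bound cL cU.
have h := HN z (c + N) gz (fun k _ => zb _ k) k; rewrite addrK in h.
exact: (SL_ext oOm' cL.2 E h).
Qed.

Lemma T_linear_negl K K1 K2 (c : R -> R[i]) z u v : compact_in K Om -> compact_in K1 Om ->
  compact_in K2 Om -> good K z -> good K1 u -> good K2 v ->
  negl (fun e x => z e x - (c e * u e x + v e x)) ->
  negl' (fun e x => T z e x - (c e * T u e x + T v e x)).
Proof.
move=> cK cK1 cK2 gz gu gv nz; have cU := compact_inU cK1 cK2.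
have gu' := goodU K2 gu; have gv' := goodUr K1 gv.
have gy := good_linear c gu' gv'.
apply: (negl_ext oOm' (T_negl cK cU gz gy nz)) => e x e01 Ox.
by rewrite -[RHS]/(T z e x - T _ e x) (T_linear c cU gu' gv').
Qed.

Lemma T_moderate K b u : compact_in K Om -> good K u -> PS K b u -> moder' (T u).
Proof.
move=> cK gu pu; apply/(moderateP oOm'); split; first exact: T_smooth gu.
by move=> L k cL; have [N HN] := T_bound cL cK; exists (b - N); exact: HN.
Qed.

Lemma Bc_negl U v u K : G Om U -> Bc U v -> U u -> compact_in K Om -> supported Om K u ->
  negl' (v - T u).
Proof.
move=> GU [mv [u1 [K1 [Uu1 cK1 s1 nv]]]] Uu cK su.
have nT := T_negl cK1 cK (class_good GU Uu1 s1) (class_good GU Uu su) (class_negl oOm GU Uu1 Uu).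
apply: (negl_linear oOm' (c := 1) nv nT) => e x _ _.
rewrite -[LHS]/(v e x - T u e x) -[(v - T u1) e x]/(v e x - T u1 e x).
by rewrite -[(T u1 - T u) e x]/(T u1 e x - T u e x); ring.
Qed.

(** One statement for sums, differences and multiples by generalized numbers, [c] being a net of
    scalars: z = c u + v up to a negligible net. *)
Lemma Bc_linear (X : set net) K K1 K2 (c : R -> R[i]) N z u v (w1 w2 y : net') :
  X z -> compact_in K Om -> compact_in K1 Om -> compact_in K2 Om ->
  good K z -> good K1 u -> good K2 v -> growth N (fun e => (normc (c e))%:E) ->
  negl (fun e x => z e x - (c e * u e x + v e x)) ->
  moder' w1 -> moder' w2 -> negl' (w1 - T u) -> negl' (w2 - T v) ->
  (forall e x, 0 < e <= 1 -> Om' x -> y e x = c e * w1 e x + w2 e x) -> Bc X y.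
Proof.
move=> Xz cK cK1 cK2 gz gu gv gc nz m1 m2 n1 n2 yE; split.
  have mc : moder' (fun e x => c e * w1 e x) by apply: (moderate_scalar oOm' gc m1).
  by apply: (moderate_linear oOm' (c := 1) mc m2) => e x e01 Ox; rewrite yE// mul1r.
exists z, K; split => //; first exact: gz.2.
have nT := T_linear_negl cK cK1 cK2 gz gu gv nz.
have nc : negl' (fun e x => c e * (w1 e x - T u e x)).
  by apply: (negl_scalar oOm' gc n1).
have nn := negl_linear oOm' (c := 1) nc n2 (fun e x _ _ => erefl).
apply: (negl_linear oOm' (c := -1) nT nn) => e x e01 Ox.
rewrite -[LHS]/(y e x - T z e x) yE// -[(w2 - T v) e x]/(w2 e x - T v e x); ring.
Qed.

Let growth1 (c : R[i]) : growth 0 (fun _ : R => (normc c)%:E).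
Proof.
move=> b' b'0; exists (normc c); first exact: normc_ge0.
apply: filterS near0r01 => e e01; rewrite lee_fin ler_peMr ?normc_ge0//.
by rewrite powR_ge1// ltW.
Qed.

Lemma Dom_T U : Dom U -> exists u K b, [/\ U u, compact_in K Om, good K u, PS K b u & Bc U (T u)].
Proof.
move=> [GU [u [K [Uu cK su [b pu]]]]]; have gu := class_good GU Uu su.
exists u, K, b; split => //; split; first exact: T_moderate gu pu.
exists u, K; split => //; apply: (negl_ext oOm' (negl0 oOm')) => e x _ _.
by rewrite -[LHS]/(T u e x - T u e x) subrr.
Qed.

Lemma Bc_G U : Dom U -> G Om' (Bc U).
Proof.
move=> DU; have [u [K [b [Uu cK gu pu Bu]]]] := Dom_T DU; have GU := DU.1.
exists (T u); first by case: Bu.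
apply/seteqP; split => [v Bv|v [mv nv]].
  by split; [case: Bv|exact: Bc_negl Bv Uu cK gu.2].
by split => //; exists u, K; split => //; exact: gu.2.
Qed.

Lemma Bc_Ginf U : Dom U -> Ginf Om' (Bc U).
Proof.
move=> DU; split; first exact: Bc_G.
have [u [K [b [Uu cK gu pu Bu]]]] := Dom_T DU; exists (T u) => // K0 cK0.
have [N HN] := T_bound cK0 cK; have [m Hm] : exists m : nat, - (b - N) < m%:R.
  by exists (Num.truncn (- (b - N))).+1; exact: truncnS_gt.
exists m => al; apply: (growth_moderate _ Hm).
exact: (sup_norm_SL (HN u b gu pu (mlen al)) (leqnn _)).
Qed.

Section seminorm.
Variable K0 : set 'rV[R]_n'.
Hypothesis cK0 : compact_in K0 Om'.

Definition regb b (v : net') := forall al : 'I_n' -> nat,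
  bigO_eps (fun e => sup_norm K0 (mderiv al (v e))) (fun e => e `^ b).
Definition val (X : set net') : \bar R := @valuation R (Cinf Om') X regb.

(** [SL] loses an arbitrarily small power of e, which a supremum does not notice. *)
Lemma val_ge X v b : X v -> (forall k, SL Om' K0 k b v) -> (b%:E <= val X)%E.
Proof.
move=> Xv Hv; rewrite leNgt; apply/negP => /lt_ereal_real[b' [b'b]].
rewrite ltNge => /negP; apply; apply: ereal_sup_ubound; exists b' => //; exists v => // al.
exact: growth_bigO (sup_norm_SL (Hv (mlen al)) (leqnn _)) b'b.
Qed.

Lemma regb_SL b v k : smooth_net Om' v -> regb b v -> SL Om' K0 k b v.
Proof.
move=> sv Hv; apply: SL_of_mderiv => //; first exact: cK0.2.
by move=> al; exact: bigO_powR_growth.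
Qed.

Lemma val_gt X (c : \bar R) : (c < val X)%E -> exists v b, [/\ X v, regb b v & (c < b%:E)%E].
Proof.
by move=> /ereal_sup_gt[_ [b [v Xv Hb] <-] cb]; exists v, b.
Qed.

Lemma Bc_smooth U v : Bc U v -> smooth_net Om' v.
Proof. by move=> [/(moderateP oOm')[]]. Qed.

(** By contradiction: representatives with exponents strictly above the valuation of [Bc X] would
    combine to one that forces it to be larger. *)
Lemma val_linear U V X : (forall v w, Bc U v -> Bc V w -> exists2 y, Bc X y &
    exists c : R[i], forall e x, 0 < e <= 1 -> Om' x -> y e x = c * v e x + w e x) ->
  (mine (val (Bc U)) (val (Bc V)) <= val (Bc X))%E.
Proof.
move=> H; rewrite leNgt; apply/negP; rewrite lt_min => /andP[h1 h2].
have [v [b1 [Bv r1 c1]]] := val_gt h1; have [w [b2 [Bw r2 c2]]] := val_gt h2.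
have [y By [c yE]] := H v w Bv Bw.
have yE' e x (e01 : 0 < e <= 1) (Ox : Om' x) := esym (yE e x e01 Ox).
have : ((Num.min b1 b2)%:E <= val (Bc X))%E.
  apply: (val_ge By) => k; apply: (SL_ext oOm' cK0.2 yE'); apply: SL_linear => //; first exact: cK0.2.
    by apply: SL_le (regb_SL k (Bc_smooth Bv) r1); rewrite ge_min lexx.
  by apply: SL_le (regb_SL k (Bc_smooth Bw) r2); rewrite ge_min lexx orbT.
rewrite leNgt => /negP; apply.
by rewrite /Num.min; case: ifP.
Qed.

Lemma Q_linear U V X : (forall v w, Bc U v -> Bc V w -> exists2 y, Bc X y &
    exists c : R[i], forall e x, 0 < e <= 1 -> Om' x -> y e x = c * v e x + w e x) ->
  (Ginf_seminorm Om' K0 (Bc X) <=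
   maxe (Ginf_seminorm Om' K0 (Bc U)) (Ginf_seminorm Om' K0 (Bc V)))%E.
Proof.
move=> /val_linear h; apply: le_trans (exp_neg_le h) _.
rewrite /mine; case: ifP => _; rewrite le_max; apply/orP; [left|right]; exact: lexx.
Qed.
End seminorm.

Lemma Bc_add U V v w : Dom U -> Dom V -> Bc U v -> Bc V w ->
  Bc (gadd (E := Cinf Om) U V) (fun e x => 1 * v e x + w e x).
Proof.
move=> DU DV Bv Bw.
have [u [K [b [Uu cK gu pu _]]]] := Dom_T DU; have [u2 [K2 [b2 [Vu2 cK2 gu2 _ _]]]] := Dom_T DV.
have nv := Bc_negl DU.1 Bv Uu cK gu.2; have nw := Bc_negl DV.1 Bw Vu2 cK2 gu2.2.
have cU := compact_inU cK cK2.
have gz := good_linear (fun=> 1) (goodU K2 gu) (goodUr K gu2).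
have z0 : negl (fun e x => (1 * u e x + u2 e x) - (1 * u e x + u2 e x)).
  by apply: (negl_ext oOm (negl0 oOm)) => e x _ _; rewrite subrr.
apply: (Bc_linear (z := fun e x => 1 * u e x + u2 e x) _ cU cK cK2 gz gu gu2 (growth1 1) z0
  Bv.1 Bw.1 nv nw) => //.
split.
  apply: (moderate_linear oOm (c := 1) (class_moderate DU.1 Uu) (class_moderate DV.1 Vu2)).
  by [].
exists u, u2; split => //; apply: (negl_ext oOm (negl0 oOm)) => e x _ _.
by rewrite -[LHS]/(1 * u e x + u2 e x - (u e x + u2 e x)) mul1r subrr.
Qed.

(** From U + (V - U) = V and V - (V - U) = U come the two strong triangle inequalities used for
    continuity. The third part places the image of the difference in the difference of the
    images. *)
Lemma Bc_sub U V w : Dom U -> Dom V -> Bc (gsub (E := Cinf Om) V U) w ->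
  [/\ forall v, Bc U v -> Bc V (fun e x => 1 * w e x + v e x),
      forall v, Bc V v -> Bc U (fun e x => -1 * w e x + v e x) &
      gsub (E := Cinf Om') (Bc V) (Bc U) w].
Proof.
move=> DU DV Bw.
have [u [K [b [Uu cK gu pu BTu]]]] := Dom_T DU; have [v [K2 [b2 [Vv cK2 gv _ BTv]]]] := Dom_T DV.
have [mw [z [K3 [[mz [v1 [u1 [Vv1 Uu1 nz]]]] cK3 sz nw]]]] := Bw.
have gz : good K3 z by split => //; have /(moderateP oOm)[] := mz.
have nu := class_negl oOm DU.1 Uu Uu1; have nv := class_negl oOm DV.1 Vv Vv1.
have nz1 : negl (fun e x => z e x - (-1 * u e x + v e x)).
  have n1 := negl_linear oOm (c := -1) nv nz (fun e x _ _ => erefl).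
  apply: (negl_linear oOm (c := 1) nu n1) => e x _ _.
  rewrite -[(u - u1) e x]/(u e x - u1 e x) -[(v - v1) e x]/(v e x - v1 e x).
  rewrite -[(z - (v1 - u1)) e x]/(z e x - (v1 e x - u1 e x)); ring.
have nz2 : negl (fun e x => v e x - (1 * z e x + u e x)).
  by apply: (negl_linear oOm (c := -1) nz1 (negl0 oOm)) => e x _ _; rewrite -[0 e x]/0; ring.
have nz3 : negl (fun e x => u e x - (-1 * z e x + v e x)).
  by apply: (negl_linear oOm (c := 1) nz1 (negl0 oOm)) => e x _ _; rewrite -[0 e x]/0; ring.
split.
- move=> y By; have ny := Bc_negl DU.1 By Uu cK gu.2.
  exact: (Bc_linear Vv cK2 cK3 cK gv gz gu (growth1 1) nz2 mw By.1 nw ny).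
- move=> y By; have ny := Bc_negl DV.1 By Vv cK2 gv.2.
  exact: (Bc_linear Uu cK cK3 cK2 gu gz gv (growth1 (-1)) nz3 mw By.1 nw ny).
- split => //; exists (T v), (T u); split => //.
  have nT := T_linear_negl cK3 cK cK2 gz gu gv nz1.
  apply: (negl_linear oOm' (c := 1) nw nT) => e x _ _.
  rewrite -[LHS]/(w e x - (T v e x - T u e x)) -[(w - T z) e x]/(w e x - T z e x); ring.
Qed.

Lemma Bc_scale U (l : R -> R[i]) N L v : Dom U -> growth N (fun e => (normc (l e))%:E) -> L l ->
  Bc U v -> Bc (gscale (E := Cinf Om) L U) (fun e x => l e * v e x).
Proof.
move=> DU gl Ll Bv.
have [u [K [b [Uu cK gu pu _]]]] := Dom_T DU; have nv := Bc_negl DU.1 Bv Uu cK gu.2.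
have g0 : good K (fun _ _ => 0) by split => // e _; exact: smooth_cst.
have gz := good_linear l gu g0.
have z0 : negl (fun e x => (l e * u e x + 0) - (l e * u e x + 0)).
  by apply: (negl_ext oOm (negl0 oOm)) => e x _ _; rewrite subrr.
have p0 : PS K 0 (fun _ _ => 0) by move=> k _; apply: (S0 _ cK.2) => //; apply: open_line_open.
have nT0 : negl' (fun e x => T (fun _ _ => 0) e x - T (fun _ _ => 0) e x).
  by apply: (negl_ext oOm' (negl0 oOm')) => e x _ _; rewrite subrr.
(* T 0 is negligible, because 0 = 0 + 0 and linearity make T 0 and 2 T 0 differ by a negligible
   net. *)
have nT : negl' (0 - T (fun _ _ => 0)).
  have n0 : negl (fun e x => 0 - (1 * (0 : R[i]) + 0)).
    by apply: (negl_ext oOm (negl0 oOm)) => e x _ _; rewrite mulr0 addr0 subr0.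
  have := T_linear_negl (c := fun=> 1) cK cK cK g0 g0 g0 n0.
  move=> h; apply: (negl_ext oOm' h) => e x _ _.
  rewrite -[LHS]/(0 - T (fun _ _ => 0) e x); ring.
apply: (Bc_linear (z := fun e x => l e * u e x + 0) (w2 := 0) _ cK cK cK gz gu g0 gl z0
  Bv.1 (negl_moderate oOm' (negl0 oOm')) nv nT); last first.
  by move=> e x _ _; rewrite -[0 e x]/0 addr0.
split.
  apply: (moderate_scalar oOm gl (class_moderate DU.1 Uu)) => e x _ _; exact: addr0.
exists l, u; split => //; apply: (negl_ext oOm (negl0 oOm)) => e x _ _.
by rewrite -[LHS]/(l e * u e x + 0 - l e * u e x) addr0 subrr.
Qed.
End operator_on_classes.

(** If the two values differ, the larger one is at most ep / 2, and both are nonnegative. *)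
Lemma max_close (R : realFieldType) (q r ep : R) : 0 < ep -> 0 <= q -> 0 <= r ->
  r <= Num.max q (ep / 2) -> q <= Num.max r (ep / 2) -> - ep < q - r < ep.
Proof.
move=> ep0 q0 r0; rewrite !le_max => /orP[k1|k1] /orP[k2|k2]; apply/andP; split; lra.
Qed.

Section topology_of_operator.
Context {R : realType} {n' n : nat}.
Local Notation normc := (@Normc.normc R).
Local Notation net := (R -> 'rV[R]_n -> R[i]).
Local Notation net' := (R -> 'rV[R]_n' -> R[i]).
Variables (Om' : set 'rV[R]_n') (Om : set 'rV[R]_n).
Hypotheses (oOm' : open Om') (oOm : open Om).
Local Notation negl := (@negligible_net R (Cinf Om)).
Local Notation negl' := (@negligible_net R (Cinf Om')).
Local Notation moder' := (@moderate_net R (Cinf Om')).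
Variables (T : net -> net') (P : pred nat).
Local Notation good := (good Om).
Local Notation PS := (PS Om P).
Local Notation Bc := (Bc Om' Om T).
Local Notation Dom := (Dom Om P).

Hypothesis T_smooth : forall K u, compact_in K Om -> good K u -> smooth_net Om' (T u).
Hypothesis T_linear : forall K u v (c : R -> R[i]), compact_in K Om -> good K u -> good K v ->
  forall e x, 0 < e <= 1 -> Om' x ->
  T (fun e x => c e * u e x + v e x) e x = c e * T u e x + T v e x.
Hypothesis T_bound : forall K0 K1, compact_in K0 Om' -> compact_in K1 Om -> exists N : R,
  forall u b, good K1 u -> PS K1 b u -> forall k, SL Om' K0 k (b - N) (T u).

Local Notation Q K0 := (Ginf_seminorm Om' K0).
Local Notation gsubE := (gsub (E := Cinf Om)).

Lemma Q_Bc_lt_pinfty K0 U : compact_in K0 Om' -> Dom U -> (Q K0 (Bc U) < +oo)%E.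
Proof.
move=> cK0 DU; have [u [K [b [Uu cK gu pu BTu]]]] := Dom_T oOm' oOm T_smooth T_bound DU.
have [N HN] := T_bound cK0 cK; have h := val_ge BTu (HN u b gu pu).
by apply: le_lt_trans (exp_neg_le h) _; rewrite /exp_neg /= ltey.
Qed.

Lemma Q_Bc_ultra K0 (D : set (set net)) : compact_in K0 Om' -> (forall U, D U -> Dom U) ->
  @ultra_pseudo_seminorm R (Cinf Om) D (fun U => Q K0 (Bc U)).
Proof.
move=> cK0 DD; split.
- by move=> U /DD DU; rewrite exp_neg_ge0 Q_Bc_lt_pinfty.
- have c0 : compact_in set0 Om by split; [exact: compact0|exact: sub0set].
  have g0 : good set0 0 by split => // e _; exact: smooth_cst.
  have p0 b : PS set0 b 0 by move=> k _; apply: (S0 _ c0.2) => //; apply: open_line_open.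
  have B0 : Bc (gzero (Cinf Om)) (T 0).
    split; first exact: (T_moderate oOm' T_smooth T_bound c0 g0 (p0 0)).
    exists 0, set0; split => //.
      split; first exact: negl_moderate (negl0 oOm).
      by apply: (negl_ext oOm (negl0 oOm)) => e x _ _; rewrite -[LHS]/(0 - 0) subrr.
    apply: (negl_ext oOm' (negl0 oOm')) => e x _ _.
    by rewrite -[LHS]/(T 0 e x - T 0 e x) subrr.
  have [N HN] := T_bound cK0 c0.
  (* The zero net satisfies the estimates with every exponent, so the valuation of its image is +oo
     and the seminorm is 0. *)
  have H b : (b%:E <= val Om' K0 (Bc (gzero (Cinf Om))))%E.
    apply: (val_ge B0) => k; have := HN 0 (b + N) g0 (p0 _) k.
    by rewrite addrK.
  rewrite -[LHS]/(exp_neg (val Om' K0 (Bc (gzero (Cinf Om))))).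
  case E : (val Om' K0 (Bc (gzero (Cinf Om)))) => [r| |].
  + by have := H (r + 1); rewrite E lee_fin gerDl ler10.
  + by [].
  + by have := H 0; rewrite E.
- move=> L U CL /DD DU; have [u [K [b [Uu cK gu pu BTu]]]] := Dom_T oOm' oOm T_smooth T_bound DU.
  apply: (exp_neg_mul (S1 := [set b | exists2 l, L l & bigO_eps (fun e => (normc (l e))%:E)
      (fun e => e `^ b)]) (S2 := [set b | exists2 v, Bc U v & regb K0 b v]) erefl erefl).
  + case: CL => l0 ml0 E; have [_ /(_ (fun z => (normc z)%:E))[//|M HM]] := ml0.
    exists (- M%:R - 1), l0; last first.
      by apply: growth_bigO (bigO_expN_growth HM) _; rewrite ltrBlDr ltrDl.
    rewrite E; split => //; split; first by [].
    move=> _ -> k; exists 0; apply: filterS near0r01 => e e01.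
    by rewrite -[(l0 - l0) e]/(l0 e - l0 e) subrr Normc.normc0 mul0r.
  + have [N HN] := T_bound cK0 cK; exists (b - N - 1), (T u) => // al.
    apply: growth_bigO (sup_norm_SL (HN u b gu pu (mlen al)) (leqnn _)) _.
    by rewrite ltrBlDr ltrDl.
  move=> b1 b2 [l Ll Hl] [v Bv Hv]; have gl := bigO_powR_growth Hl.
  have By := Bc_scale oOm' oOm T_smooth T_linear T_bound DU gl Ll Bv.
  apply: (val_ge By) => k; apply: SL_scalar => //; first exact: cK0.2.
  exact: (regb_SL oOm' cK0 k (Bc_smooth oOm' Bv) Hv).
- move=> U V /DD DU /DD DV; apply: (Q_linear oOm' cK0) => v w Bv Bw.
  exists (fun e x => 1 * v e x + w e x).
    exact: (Bc_add oOm' oOm T_smooth T_linear T_bound DU DV Bv Bw).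
  by exists 1.
Qed.

(** A seminorm of the difference V - U does not fix the compact set [K'] that carries the
    representative [z], while the loss [N] depends on that set. As both supports lie in [K], [z] can
    be cut off to one compact set [K2] at the cost of a negligible net. *)
Lemma val_gsub_ge K K0 : compact_in K Om -> compact_in K0 Om' -> exists N : R,
  forall U V z b K', Dom U -> Dom V -> gsupp Om U `<=` K -> gsupp Om V `<=` K ->
  gsubE V U z -> compact_in K' Om -> supported Om K' z -> PS K' b z ->
  ((b - N)%:E <= val Om' K0 (Bc (gsubE V U)))%E.
Proof.
move=> cK cK0; have [V0 [K2 [psi [oV KV hc]]]] := exists_cutoff oOm cK.
have [hpsi cK2 VK2 psi1 psi0] := hc; have [N HN] := T_bound cK0 cK2.
exists N => U V z b K' DU DV sU sV gz cK' sz pz.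
have [mz [v [u [Vv Uu nz]]]] := gz; have /(moderateP oOm)[smz _] := mz.
pose y : net := fun e x => psi x * z e x.
have gy : good K2 y.
  split; first by move=> e e01; exact: smoothM_CB (smz e e01).
  by move=> e x _ _ Kx; rewrite /y psi0// mul0r.
have py : PS K2 b y.
  move=> k Pk; apply: SLM_CB => //; first exact: cK2.2.
  apply: SL_supported sz (pz k Pk) => //; first exact: cK2.2.
  by apply: compact_closed cK'.1; exact: norm_hausdorff.
have nu := cutoff_negligible oOm DU.1 sU oV KV hc Uu.
have nv := cutoff_negligible oOm DV.1 sV oV KV hc Vv.
have npz : negl (fun e x => psi x * (z - (v - u)) e x).
  apply/(negligibleP oOm); have /(negligibleP oOm)[s0 H0] := nz; split.
    by move=> e e01; exact: smoothM_CB (s0 e e01).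
  by move=> L k c cL; apply: SLM_CB => //; [exact: cL.2|exact: H0].
have n1 := negl_linear oOm (c := -1) nu nv (fun e x _ _ => erefl).
have n2 := negl_linear oOm (c := -1) npz n1 (fun e x _ _ => erefl).
have nyz : negl (fun e x => z e x - y e x).
  apply: (negl_linear oOm (c := 1) nz n2) => e x _ _.
  by rewrite /y -[(z - (v - u)) e x]/(z e x - (v e x - u e x)); ring.
have gsy : gsubE V U y.
  split.
    apply: (moderate_linear oOm (c := -1) (negl_moderate oOm nyz) mz) => e x _ _.
    by ring.
  exists v, u; split => //; apply: (negl_linear oOm (c := -1) nyz nz) => e x _ _.
  rewrite -[LHS]/(y e x - (v e x - u e x)) -[(z - (v - u)) e x]/(z e x - (v e x - u e x)); ring.
have BTy : Bc (gsubE V U) (T y).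
  split; first exact: (T_moderate oOm' T_smooth T_bound cK2 gy py).
  exists y, K2; split => //; first exact: gy.2.
  apply: (negl_ext oOm' (negl0 oOm')) => e x _ _.
  by rewrite -[LHS]/(T y e x - T y e x) subrr.
exact: (val_ge BTy (HN y b gy py)).
Qed.

Variables (D : set (set net)) (DK : set 'rV[R]_n -> set (set net))
  (FK : set 'rV[R]_n -> set (set net -> \bar R)).
Hypothesis D_Dom : forall U, D U -> Dom U.
Hypothesis DK_Dom : forall K U, compact_in K Om -> DK K U -> Dom U /\ gsupp Om U `<=` K.
Hypothesis FK_lt : forall K, compact_in K Om -> exists2 QK, FK K QK &
  forall X (eta : R), (forall z, X z -> smooth_net Om z) -> (QK X < eta%:E)%E -> exists z b K',
    [/\ X z, compact_in K' Om, supported Om K' z, PS K' b z & expR (- b) < eta].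

Lemma Q_Bc_cvg K0 K U : compact_in K0 Om' -> compact_in K Om -> DK K U ->
  (fun U => Q K0 (Bc U)) @ @ups_nbhs R (Cinf Om) (DK K) (FK K) U --> Q K0 (Bc U).
Proof.
move=> cK0 cK DKU; have [DU sU] := DK_Dom cK DKU.
have [QK FQK QKlt] := FK_lt cK; have [N HN] := val_gsub_ge cK cK0.
have fin V : Dom V -> exists2 q : R, Q K0 (Bc V) = q%:E & 0 <= q.
  move=> DV; have := Q_Bc_lt_pinfty cK0 DV; have := exp_neg_ge0 (val Om' K0 (Bc V)).
  rewrite -[exp_neg _]/(Q K0 (Bc V)); case: (Q K0 (Bc V)) => [q| |]// q0 _.
  by exists q => //; rewrite -lee_fin.
have [q Eq q0] := fin U DU; rewrite Eq => A /= nA.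
have : nbhs q (fun r : R => A r%:E) := nA.
move=> /nbhs_ballP[ep /= ep0 Hep].
exists [set QK]; split; [exact: finite_set1|by move=> _ ->|].
(* The operator lowers valuations by at most [N], that is, it multiplies seminorms by at most
   e^N. *)
exists (ep / 2 * expR (- N)); first by rewrite mulr_gt0 ?expR_gt0 ?divr_gt0.
have sgsub V z : gsubE V U z -> smooth_net Om z by move=> [/(moderateP oOm)[]].
move=> V DKV /(_ QK erefl) /(QKlt _ _ (sgsub V))[z [b [K' [gz cK' sz pz bz]]]].
have [DV sV] := DK_Dom cK DKV; have [r Er r0] := fin V DV.
have hv := exp_neg_le (HN U V z b K' DU DV sU sV gz cK' sz pz).
have hd : (Q K0 (Bc (gsubE V U)) < (ep / 2)%:E)%E.
  apply: le_lt_trans hv _; rewrite /exp_neg /= lte_fin opprB addrC expRD.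
  by rewrite -ltr_pdivlMr ?expR_gt0// -expRN.
have sub w (Bw : Bc (gsubE V U) w) := Bc_sub oOm' oOm T_smooth T_linear T_bound DU DV Bw.
have h1 : (Q K0 (Bc V) <= maxe (Q K0 (Bc (gsubE V U))) (Q K0 (Bc U)))%E.
  apply: (Q_linear oOm' cK0) => w v Bw Bv; have [h _ _] := sub w Bw.
  by exists (fun e x => 1 * w e x + v e x); [exact: h|exists 1].
have h2 : (Q K0 (Bc U) <= maxe (Q K0 (Bc (gsubE V U))) (Q K0 (Bc V)))%E.
  apply: (Q_linear oOm' cK0) => w v Bw Bv; have [_ h _] := sub w Bw.
  by exists (fun e x => -1 * w e x + v e x); [exact: h|exists (-1)].
rewrite Eq Er in h1 h2.
have k1 : r <= Num.max q (ep / 2).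
  move: h1; rewrite le_max => /orP[h|h]; rewrite le_max; apply/orP; [right|left].
    by rewrite -lee_fin (le_trans h)// ltW.
  by rewrite -lee_fin.
have k2 : q <= Num.max r (ep / 2).
  move: h2; rewrite le_max => /orP[h|h]; rewrite le_max; apply/orP; [right|left].
    by rewrite -lee_fin (le_trans h)// ltW.
  by rewrite -lee_fin.
by rewrite /preimage /= Er; apply: Hep; rewrite -ball_normE /ball_ /= ltr_norml max_close.
Qed.

Lemma Bc_continuous : @continuous_map R (Cinf Om) (Cinf Om') D
  (@inductive_limit R (Cinf Om) D _ [set K | compact_in K Om] DK FK)
  (Ginf Om') (Ginf_top Om') Bc.
Proof.
move=> U DU W [F [fF FT [eta eta0 HW]]].
(* The composites with the operator belong to the family that defines the limit topology, so the
   same radius [eta] serves. *)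
exists ((fun (Q : set net' -> \bar R) U => Q (Bc U)) @` F); split.
- exact: finite_image.
- move=> _ [Q0 /FT[K0 cK0 ->] <-]; split; first exact: Q_Bc_ultra.
  by move=> K cK V DKV; exact: Q_Bc_cvg.
exists eta => // V DV HV; apply: HW; first exact: (Bc_Ginf oOm' oOm T_smooth T_linear T_bound (D_Dom DV)).
move=> Q0 FQ; have [K0 cK0 EQ] := FT _ FQ.
apply: le_lt_trans (HV (fun U => Q0 (Bc U)) _); last by exists Q0.
rewrite EQ; apply: exp_neg_le; apply: ereal_sup_le => _ [b [v Bv Hb] <-].
exists b => //; exists v => //.
by have [_ _] := Bc_sub oOm' oOm T_smooth T_linear T_bound (D_Dom DU) (D_Dom DV) Bv.
Qed.
End topology_of_operator.

(** * Generalized phases and symbols *)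

Section generalized_phases.
Context {R : realType} {n' n p : nat}.
Local Notation normc := (@Normc.normc R).
Local Notation vec := 'rV[R]_(n' + n + p).
Variables (Om' : set 'rV[R]_n') (Om : set 'rV[R]_n).
Hypotheses (oOm' : open Om') (oOm : open Om).
Local Notation X := (prod_set Om' Om).
Local Notation N := (@over_ne0 R (n' + n) p X).
Let oX := open_prod_set oOm' oOm.
Let oN : open N := open_over_ne0 oX.

Lemma hgbnd_linear K b (c : R[i]) (a a' : R -> vec -> R[i]) : K `<=` X ->
  (forall e, 0 < e <= 1 -> smooth_on N (a e)) -> (forall e, 0 < e <= 1 -> smooth_on N (a' e)) ->
  hgbnd K b a -> hgbnd K b a' -> hgbnd K b (fun e w => c * a e w + a' e w).
Proof.
move=> KX sa sa' Ha Ha' s b' b'b.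
have [C C0 HC] := Ha s b' b'b; have [C' C'0 HC'] := Ha' s b' b'b.
exists (normc c * C + C'); first by rewrite addr_ge0// mulr_ge0// normc_ge0.
apply: filterS3 HC HC' near0r01 => e He He' e01 w Kw w0.
rewrite (pderivs_linear s c oN (sa e e01) (sa' e e01)); last by split => //; exact: KX.
apply: le_trans (le_normcD _ _) _; rewrite Normc.normcM !mulrDl lerD//; last exact: He'.
rewrite -!mulrA ler_wpM2l ?normc_ge0// !mulrA; exact: He.
Qed.

(** From a^2 >= b^2 - |a - b| (|a - b| + 2 |b|), summed over the n + p derivatives. *)
Lemma gradsq_close (f g : vec -> R) v (d M : R) : 0 <= d ->
  (forall i, `|rpderiv i f v - rpderiv i g v| <= d) -> (forall i, `|rpderiv i g v| <= M) ->
  gradsq g v - (n + p)%:R * (d * (d + 2 * M)) <= gradsq f v.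
Proof.
move=> d0 Hd HM; pose q := d * (d + 2 * M).
have H i : rpderiv i g v ^+ 2 - q <= rpderiv i f v ^+ 2.
  have := Hd i; have := HM i; rewrite !ler_norml /q => /andP[m1 m2] /andP[d1 d2]; nra.
rewrite /gradsq natrD mulrDl opprD addrACA.
apply: lerD.
  rewrite -[n in n%:R]card_ord -sum1_card natr_sum mulr_suml -sumrB; apply: ler_sum => k _.
  by rewrite mul1r; exact: H.
rewrite -[p in p%:R]card_ord -sum1_card natr_sum mulr_suml -sumrB; apply: ler_sum => k _.
by rewrite mul1r; exact: H.
Qed.

Variable phi : set (R -> vec -> R).
Hypothesis phi_sc : Phi_sc Om' Om phi.

Lemma phi_at ph e : phi ph -> 0 < e <= 1 -> phase_at Om' Om (ph e).
Proof.
case: phi_sc => -[ph1 M1 ->] _ [[Hph _ _] _] e01.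
by have [h1 h2 h3] := Hph e e01; split.
Qed.

Let phi_smooth ph e : phi ph -> 0 < e <= 1 -> smooth_on N (fun w => (ph e w)%:C).
Proof. by move=> h1 h2; have [] := phi_at h1 h2. Qed.

Let diff_smooth ph ph' e : phi ph -> phi ph' -> 0 < e <= 1 ->
  smooth_on N (fun w => (ph e w)%:C - (ph' e w)%:C).
Proof.
move=> h h' e01; have := smooth_linear oN (-1) (phi_smooth h' e01) (phi_smooth h e01).
by apply: smooth_on_ext => // w _; rewrite mulN1r addrC.
Qed.

Lemma phi_negl ph ph' K c : phi ph -> phi ph' -> compact_in K X ->
  hgbnd K c (fun e w => (ph e w)%:C - (ph' e w)%:C).
Proof.
case: (phi_sc) => -[ph1 M1 E] _ h h' cK.
have H q : phi q -> (forall e, 0 < e <= 1 -> smooth_on N (complex_net (ph1 - q) e)) /\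
    hgbnd K c (complex_net (ph1 - q)).
  rewrite E => -[_ [sm Hn]].
  have sq e (e01 : 0 < e <= 1) := (sm e e01).1; split => //.
  apply: (hg_norm_hgbnd oX cK.2 sq) => al be; apply: negligible_growth; apply: Hn.
  by exists K, al, be.
have [s1 H1] := H ph h; have [s2 H2] := H ph' h'.
have := hgbnd_linear (-1) cK.2 s1 s2 H1 H2; congr (hgbnd _ _ _).
apply/funext => e; apply/funext => w.
by rewrite /complex_net -[(ph1 - ph) e w]/(ph1 e w - ph e w) -[(ph1 - ph') e w]/(ph1 e w - ph' e w)
  !rmorphB /=; ring.
Qed.

(** The slow scale bounds are given for one representative and pass to the others, which differ from
    it by negligible nets. *)
Lemma phi_hgbnd ph K : phi ph -> compact_in K X -> hgbnd K 0 (complex_net ph).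
Proof.
move=> h cK; case: (phi_sc) => _ [ps hps [[sm Hm] _]].
have H : hgbnd K 0 (complex_net ps).
  apply: (hg_norm_hgbnd oX cK.2) => [e e01|al be]; first exact: (sm e e01).1.
  have [|w [sw Hw]] := Hm (hg_norm K al be); first by exists K, al, be.
  exact: slow_scale_growth sw Hw.
have := hgbnd_linear 1 cK.2 (fun e => diff_smooth h hps) (fun e => phi_smooth hps)
  (@phi_negl _ _ _ 0 h hps cK) H.
congr (hgbnd _ _ _); apply/funext => e; apply/funext => w.
by rewrite /complex_net mul1r subrK.
Qed.

Lemma hgbnd_near K b b' (a : R -> vec -> R[i]) : hgbnd K b a -> b' < b ->
  \forall e \near (0 : R)^'+, forall i w, K (lsubmx w) -> enorm (rsubmx w) = 1 ->
    normc (pderiv i (a e) w) <= e `^ b'.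
Proof.
move=> H b'b; suff h i : \forall e \near (0 : R)^'+, forall w, K (lsubmx w) ->
    enorm (rsubmx w) = 1 -> normc (pderiv i (a e) w) <= e `^ b'.
  exact: filter_forall h.
pose b1 := (b + b') / 2; have b1b : b1 < b by rewrite /b1; lra.
have b'b1 : 0 < b1 - b' by rewrite /b1; lra.
have [C C0 HC] := H [:: i] b1 b1b.
(* For e below this number the constant [C] is absorbed by the power e^(b1 - b'). *)
have cc : 0 < (C + 1)^-1 `^ (b1 - b')^-1 by rewrite powR_gt0// invr_gt0 ltr_wpDl.
apply: filterS3 HC near0r01 (near0r_lt cc) => e HC /andP[e0 e1] ec w Kw w1.
have w0 : rsubmx w != 0.
  by apply: contra_eq_neq w1 => ->; rewrite enorm0 eq_sym oner_eq0.
apply: le_trans (HC w Kw w0) _; rewrite w1 powR1 mulr1.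
have -> : e `^ b1 = e `^ b' * e `^ (b1 - b') by rewrite -powR_gtD// addrC subrK.
rewrite mulrCA ler_piMr ?powR_ge0//.
have C1 : 0 < C + 1 by rewrite ltr_wpDl.
have le : e `^ (b1 - b') <= (C + 1)^-1.
  have := @ge0_ler_powR R (b1 - b') (ltW b'b1) e ((C + 1)^-1 `^ (b1 - b')^-1).
  rewrite !nnegrE (ltW e0) (ltW cc) (ltW ec) -powRrM mulVf ?gt_eqF// powRr1.
    by apply.
  by rewrite invr_ge0 ltW.
apply: le_trans (ler_wpM2l C0 le) _.
by rewrite ler_pdivrMr// mul1r lerDl.
Qed.

(** The lower bound is given for one slow scale representative; the gradient of any other differs so
    little that half of the bound survives. *)
Lemma phi_varphi ph K0 K1 : phi ph -> compact_in K0 Om' -> compact_in K1 Om ->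
  bnd (over_big (@prod_set R n' n K0 K1)) omega 0 0 (fun e (w : vec) => (varphi (ph e) w)%:C).
Proof.
move=> h cK0 cK1; have cK := compact_in_prod cK0 cK1; have KX := cK.2.
set K := prod_set K0 K1 in cK KX *.
case: (phi_sc) => _ [ps hps [_ /(_ K0 K1 cK0 cK1)[s [s0 [sl [eta [/andP[eta0 _] Hs]]]]]]].
have gs : growth 0 (fun e => (s e)%:E).
  apply: (slow_scale_growth sl); exists 1; apply: nearW => e.
  by rewrite lee_fin mul1r normc_real ler_norm.
(* The slow scale property with exponent 1 gives e <= c / s. *)
have [c [c0 Hc]] := sl 1 ler01.
have d3 : (3 : R) < 4 by lra.
have m1 : (-1 : R) < 0 by lra.
have nd := hgbnd_near (@phi_negl _ _ _ 4 h hps cK) d3.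
have nm := hgbnd_near (phi_hgbnd hps cK) m1.
(* With differences below e^3 and derivatives below 1/e, the squared gradient changes by at most 3
   (n + p) e^2, which is at most half of 1/s once e < 1/q. *)
pose q : R := (n + p)%:R * 6 * c + 1.
have q0 : 0 < q by rewrite ltr_wpDl// !mulr_ge0// ltW.
have qi : 0 < q^-1 by rewrite invr_gt0.
move=> b' b'0; have [C C0 HC] := gs b' b'0; exists (2 * C); first by rewrite mulr_ge0.
have near1 : \forall e \near (0 : R)^'+, (0 < e <= 1 /\ e < eta) /\ e < q^-1.
  by apply: filterS3 near0r01 (near0r_lt eta0) (near0r_lt qi) => e.
apply: filterS3 near1 HC (filterI nd nm) => e [[e01 eeta] eq] HC [Hd Hm] w [Kw w4].
have /andP[e0 e1] := e01.
have w0 : rsubmx w != 0 by apply: contraTneq w4 => ->; rewrite enorm0 -ltNge invr_gt0.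
pose v := normalize_xi w.
have lv : lsubmx v = lsubmx w by rewrite /v /normalize_xi row_mxKl.
have v1 : enorm (rsubmx v) = 1.
  rewrite /v /normalize_xi row_mxKr enormZ gtr0_norm ?invr_gt0 ?enorm_gt0//.
  by rewrite mulVf// gt_eqF// enorm_gt0.
have v0 : rsubmx v != 0.
  by apply: contra_eq_neq v1 => ->; rewrite enorm0 eq_sym oner_eq0.
have Nv : N v by split; rewrite ?lv//; exact: KX.
have D i : `|rpderiv i (ph e) v - rpderiv i (ps e) v| <= e `^ 3.
  have := Hd i v; rewrite lv v1 => /(_ Kw erefl).
  have -> : pderiv i (fun w => (ph e w)%:C - (ps e w)%:C) v =
      (rpderiv i (ph e) v - rpderiv i (ps e) v)%:C.
    have p1 := phase_pdiff (phi_at h e01) i Nv; have p2 := phase_pdiff (phi_at hps e01) i Nv.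
    by rewrite (cder_pderiv (cderB p1 p2)) !pderiv_real rmorphB.
  by rewrite normc_real.
have M i : `|rpderiv i (ps e) v| <= e `^ (-1).
  by have := Hm i v; rewrite lv v1 /complex_net pderiv_real normc_real => /(_ Kw erefl).
have low : (s e)^-1 <= gradsq (ps e) v.
  have := Hs e; rewrite e0 (ltW eeta) => /(_ isT) hh.
  rewrite -lee_fin; apply: le_trans hh _; apply: ereal_inf_lbound.
  exists (lsubmx (lsubmx w)), (ypart w), (rsubmx w); split; [exact: Kw.1|exact: Kw.2|exact: w0|].
  by rewrite /pt /ypart !hsubmxK.
have low2 := gradsq_close (powR_ge0 e 3) D M.
have se : e <= c * (s e)^-1.
  have := Hc e e01; rewrite normc_real (gtr0_norm (s0 e)) (powRr1 (ltW (s0 e))) => hh.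
  have hse : s e * e <= c by rewrite -ler_pdivlMr.
  by rewrite ler_pdivlMr ?s0// mulrC.
have est : (n + p)%:R * (e `^ 3 * (e `^ 3 + 2 * e `^ (-1))) <= (s e)^-1 / 2.
  have -> : e `^ 3 = e ^+ 3 by rewrite -(powR_mulrn 3 (ltW e0)).
  have -> : e `^ (-1) = e^-1 by rewrite powR_inv1// ltW.
  have h1 : e ^+ 3 * (e ^+ 3 + 2 * e^-1) <= 3 * e ^+ 2.
    have -> : e ^+ 3 * (e ^+ 3 + 2 * e^-1) = e ^+ 2 * (e ^+ 4 + 2) by field; rewrite gt_eqF.
    rewrite [3 * _]mulrC ler_pM2l ?exprn_gt0//.
    have : e ^+ 4 <= 1 by rewrite exprn_ile1// ltW.
    lra.
  have np0 : 0 <= (n + p)%:R :> R by [].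
  apply: le_trans (ler_wpM2l np0 h1) _.
  have h2 : (n + p)%:R * 6 * c * e <= 1.
    move: eq; rewrite -[q^-1]mul1r ltr_pdivlMr// /q mulrC mulrDl mul1r => h2; lra.
  have si0 : 0 <= (s e)^-1 by rewrite invr_ge0 ltW.
  have h3 : (n + p)%:R * 6 * e * e <= (n + p)%:R * 6 * e * (c * (s e)^-1).
    by rewrite ler_wpM2l// !mulr_ge0// ltW.
  have h4 : (n + p)%:R * 6 * c * e * (s e)^-1 <= (s e)^-1 by rewrite ler_piMl.
  rewrite expr2; lra.
have gv : (s e)^-1 / 2 <= gradsq (ph e) v by lra.
have si : 0 < (s e)^-1 / 2 by rewrite divr_gt0// invr_gt0.
rewrite normc_real powRr0 mulr1 /varphi -/v ger0_norm; last first.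
  by rewrite invr_ge0 (le_trans (ltW si)).
apply: (@le_trans _ _ (2 * s e)).
  have -> : 2 * s e = ((s e)^-1 / 2)^-1 by rewrite invf_div invrK.
  by rewrite lef_pV2 ?posrE// (lt_le_trans si).
by rewrite -mulrA ler_pM2l// -lee_fin.
Qed.

Lemma phi_pair ph ph' K0 K1 : phi ph -> phi ph' -> compact_in K0 Om' -> compact_in K1 Om ->
  phase_pair Om' Om (prod_set K0 K1) ph ph'.
Proof.
move=> h h' cK0 cK1; have cK := compact_in_prod cK0 cK1; split.
- by move=> e e01; split; [exact: phi_at|exact: phi_at|exact: diff_smooth].
- by split; exact: phi_hgbnd.
- by move=> c; exact: phi_negl.
- by split; exact: phi_varphi.
Qed.
End generalized_phases.

Section symbols_of_operators.
Context {R : realType} {n' n p : nat}.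
Local Notation normc := (@Normc.normc R).
Local Notation vec := 'rV[R]_(n' + n + p).
Local Notation netw := (R -> vec -> R[i]).
Local Notation net := (R -> 'rV[R]_n -> R[i]).
Variables (Om' : set 'rV[R]_n') (Om : set 'rV[R]_n).
Hypotheses (oOm' : open Om') (oOm : open Om).
Local Notation X := (prod_set Om' Om).
Local Notation A := (@over R (n' + n) p X).
Let oX := open_prod_set oOm' oOm.
Let oA : open A := open_over oX.
Let loA J : line_open J A. Proof. exact: open_line_open. Qed.
Let om1 G (w : vec) : G w -> 1 <= omega w. Proof. by move=> _; exact: omega_ge1. Qed.
Let GK (K : set 'rV[R]_(n' + n)) : K `<=` X -> @over R (n' + n) p K `<=` A.
Proof. by move=> KX w; exact: KX. Qed.
Local Notation Sx K := (S xdir A (over K) omega (fun=> 1)).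

Definition ycoord (i : 'I_(n' + n + p)) : option 'I_n :=
  if fintype.split i is inl l then (if fintype.split l is inr k then Some k else None) else None.

Lemma ypart_addZ i (h : R) (w : vec) : ypart (h *: delta_mx 0 i + w) =
  if ycoord i is Some j then h *: delta_mx 0 j + ypart w else ypart w.
Proof.
rewrite /ypart lsubmx_addZ rsubmx_addZ /ycoord.
have := fintype.splitK i; case: (fintype.split i) => [l|j] /= <-; last first.
  by rewrite delta_rshift row_mxKl linear0 scaler0 add0r.
rewrite delta_lshift row_mxKl; have := fintype.splitK l.
case: (fintype.split l) => [q|k] /= <-; first by rewrite delta_lshift row_mxKr scaler0 add0r.
by rewrite delta_rshift row_mxKr.
Qed.

Let pderivs_y := pderivs_proj ypart_addZ.

Lemma pdiff_pderivs_y s (f : 'rV[R]_n -> R[i]) i (w : vec) : smooth_on Om f -> Om (ypart w) ->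
  pdiff i (pderivs s (fun w => f (ypart w))) w.
Proof.
move=> sf Ow.
have -> : pderivs s (fun w => f (ypart w)) = fun w =>
    if all (fun i => ycoord i != None) s then pderivs (pmap ycoord s) f (ypart w) else 0.
  by apply/funext => v; rewrite pderivs_y.
case: (all _ s); last exact: cder_pdiff (cder_cst _ _ _).
apply: (pdiff_proj ypart_addZ (f := pderivs (pmap ycoord s) f)).
by case: (ycoord i) => // j; exact: smooth_on_pdiff.
Qed.

(** Derivatives of u(y) in x or xi vanish, and those in y have a nonnegative shift, so order 0 holds
    for every such type. *)
Lemma S_ypart K rho delta k b (u : net) : 0 <= delta -> K `<=` X -> smooth_net Om u ->
  SL Om (rsubmx @` K) k b u ->
  S predT A (over K) omega (shf rho delta) k b 0 (fun e w => u e (ypart w)).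
Proof.
move=> d0 KX su Hu; apply: S_of_pderivs => [s _ sk|s i _ _ _ e w e01 Aw]; last first.
  by apply: pdiff_pderivs_y (su e e01) _; exact: Aw.2.
move=> b' b'b; have [|C C0 HC] := SL_bound (s := pmap ycoord s) Hu _ b'b.
  by apply: leq_trans sk; rewrite size_pmap count_size.
exists C => //; apply: filterS2 HC near0r01 => e HC e01 w Kw; rewrite pderivs_y.
case: ifPn => [all_y|_]; last by rewrite Normc.normc0 !mulr_ge0// powR_ge0.
have ge1 : 1 <= omega w `^ (0 + \sum_(i <- s) shf rho delta i).
  rewrite -(powRr0 (omega w)) ler_powR ?omega_ge1// add0r.
  elim: s all_y {sk HC} => [|i s IH]; first by rewrite big_nil.
  rewrite /= big_cons => /andP[yi /IH h]; apply: addr_ge0 => //.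
  by move: yi; rewrite /ycoord /shf; case: (fintype.split i).
have Kyw : (rsubmx @` K) (ypart w) by exists (lsubmx w).
by apply: le_trans (HC _ Kyw) _; rewrite ler_peMr// mulr_ge0// powR_ge0.
Qed.

(** In the directions of x the function u(y) is constant, so control of its values suffices for
    every [k]. *)
Lemma Sx_ypart K k b (u : net) : K `<=` X -> smooth_net Om u ->
  SL Om (rsubmx @` K) 0 b u -> Sx K k b 0 (fun e w => u e (ypart w)).
Proof.
move=> KX su Hu; apply: S_of_pderivs => [s xs sk|s i _ _ _ e w e01 Aw]; last first.
  by apply: pdiff_pderivs_y (su e e01) _; exact: Aw.2.
move=> b' b'b; have [|C C0 HC] := SL_bound (s := [::]) Hu _ b'b => //.
exists C => //; apply: filterS HC => e HC w Kw; rewrite pderivs_y.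
case: s xs sk => [|i s] /= xs sk.
  have Kyw : (rsubmx @` K) (ypart w) by exists (lsubmx w).
  by rewrite big_nil addr0 powRr0 mulr1; exact: HC.
have -> : ycoord i = None.
  case/andP: xs => /xdirP[l ->] _.
  by rewrite /ycoord /ix (unsplitK (inl _)) (unsplitK (inl _)).
by rewrite Normc.normc0 !mulr_ge0// powR_ge0.
Qed.

Lemma compact_ypart K : compact_in K X -> compact_in (rsubmx @` K : set 'rV[R]_n) Om.
Proof.
move=> [cK KX]; split; last by move=> _ [z /KX[_ h] <-].
apply: continuous_compact => //; apply: continuous_subspaceT; exact: continuous_rsubmx.
Qed.

Lemma rsubmx_prod K0 K1 : rsubmx @` (@prod_set R n' n K0 K1) `<=` K1.
Proof. by move=> _ [z [_ h] <-]. Qed.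

Variables (rho delta m : R).
Hypotheses (rho_range : 0 < rho <= 1) (delta_range : 0 <= delta < 1).
Let delta0 : 0 <= delta. Proof. by case/andP: delta_range. Qed.
Local Notation St K := (S predT A (over K) omega (shf rho delta)).

Lemma symbol_funM_ypart mu (a : vec -> R[i]) (u : 'rV[R]_n -> R[i]) :
  symbol_fun Om' Om rho delta mu a -> smooth_on Om u ->
  symbol_fun Om' Om rho delta mu (fun w => a w * u (ypart w)).
Proof.
move=> Ha su K k cK.
have := SM (@loA _) (GK cK.2) (@om1 _) (Ha K k cK)
  (S_ypart rho (k := k) (b := 0) (u := fun=> u) delta0 cK.2 (fun _ _ => su)
    (SL_compact k (compact_ypart cK) su)).
by rewrite !addr0.
Qed.

Lemma growth_const (x : \bar R) : (x < +oo)%E -> growth 0 (fun=> x).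
Proof.
move=> xy b' b'0; exists `|fine x| => //; apply: filterS near0r01 => e e01.
apply: (@le_trans _ _ (`|fine x|)%:E).
  by case: x xy => [r| |] // _; rewrite ?lee_fin ?leNye //= ler_norm.
by rewrite lee_fin ler_peMr// powR_ge1// ltW.
Qed.

Lemma symbol_set_fun mu r d a : 0 <= d -> symbol_set (p := p) X mu r d a ->
  symbol_fun Om' Om r d mu a.
Proof.
move=> d0 [sa na] K k cK; apply: (S_symbol oX cK.2) => //.
exact: growth_const (na K k cK).
Qed.

Lemma S_symbol_negligible r d mu (a : netw) K k c : compact_in K X ->
  negligible_net (E := symbol_space X mu r d) a ->
  S predT A (over K) omega (shf r d) k c mu a.
Proof.
move=> cK [sa na]; apply: (S_symbol oX cK.2); first by move=> e e01; case: (sa e e01).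
by apply: negligible_growth; apply: na; exists K, k.
Qed.

(** What regular and smoothing symbols have in common, so that the operator is treated once: [a] is
    a net of symbols equal to the fixed net [a1] up to a negligible one. *)
Definition near_sym (a1 a : netw) : Prop :=
  (forall e, 0 < e <= 1 -> symbol_fun Om' Om rho delta m (a e)) /\
  (forall K k, compact_in K X -> (exists b, St K k b m a) /\
    forall c, St K k c m (fun e w => a e w - a1 e w)).

Lemma near_symI (a1 a : netw) : moderate_net (E := symbol_space X m rho delta) a ->
  (forall K k c, compact_in K X -> St K k c m (fun e w => a e w - a1 e w)) -> near_sym a1 a.
Proof.
move=> [sa na] H; split; first by move=> e e01; exact: symbol_set_fun (sa e e01).
move=> K k cK; split; last by move=> c; exact: H.
have [|N HN] := na (symb_norm m rho delta K k); first by exists K, k.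
exists (- N%:R); apply: (S_symbol oX cK.2); first by move=> e e01; case: (sa e e01).
exact: bigO_expN_growth.
Qed.

Lemma SP_symbols (a1 a a' : netw) (u u' : net) K0 K1 k : near_sym a1 a -> near_sym a1 a' ->
  compact_in K0 Om' -> compact_in K1 Om ->
  smooth_net Om u -> smooth_net Om u' ->
  (exists b, SL Om K1 k b u) -> (exists b, SL Om K1 k b u') ->
  (forall c, SL Om K1 k c (fun e x => u e x - u' e x)) ->
  exists b, SP predT A (over (prod_set K0 K1)) omega (shf rho delta) k b m
    (fun e w => a e w * u e (ypart w)) (fun e w => a' e w * u' e (ypart w)).
Proof.
move=> [_ Ha] [_ Ha'] cK0 cK1 su su' [b Hb] [b' Hb'] Hd.
have cK := compact_in_prod cK0 cK1; set K := prod_set K0 K1 in cK *.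
have [[q Hq] Hqc] := Ha K k cK; have [[q' Hq'] Hqc'] := Ha' K k cK.
have sub t (v : net) : SL Om K1 k t v -> SL Om (rsubmx @` K) k t v.
  by apply: SL_subset; exact: rsubmx_prod.
have sdiff : smooth_net Om (fun e x => u e x - u' e x).
  move=> e e01; have := smooth_linear oOm (-1) (su' e e01) (su e e01).
  by apply: smooth_on_ext => // x _; rewrite mulN1r addrC.
have P1 : SP predT A (over K) omega (shf rho delta) k (Num.min q q') m a a'.
  split.
  - by apply: (S_le (@om1 _) (leqnn k) _ (lexx m) Hq); rewrite ge_min lexx.
  - by apply: (S_le (@om1 _) (leqnn k) _ (lexx m) Hq'); rewrite ge_min lexx orbT.
  - move=> c; refine (S_ext (@loA _) (GK cK.2) _ (SB (@loA _) (GK cK.2) (@om1 _) (Hqc c) (Hqc' c))).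
    by move=> e w _ _; ring.
have P2 : SP predT A (over K) omega (shf rho delta) k (Num.min b b') 0
    (fun e w => u e (ypart w)) (fun e w => u' e (ypart w)).
  split.
  - apply: (S_ypart _ delta0 cK.2 su); apply: sub; apply: SL_le Hb; by rewrite ge_min lexx.
  - apply: (S_ypart _ delta0 cK.2 su'); apply: sub; apply: SL_le Hb'; by rewrite ge_min lexx orbT.
  - move=> c; exact: (S_ypart rho delta0 cK.2 sdiff (sub _ _ (Hd c))).
exists (Num.min q q' + Num.min b b').
by have := SPM (@loA _) (GK cK.2) (@om1 _) P1 P2; rewrite addr0.
Qed.

Lemma regular_near A0 a1 a : regular_symbol X m rho delta A0 -> A0 a1 -> A0 a -> near_sym a1 a.
Proof.
move=> [[a2 ma2 ->] _] [ma1 na1] [ma na]; apply: near_symI => // K k c cK.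
have h1 := S_symbol_negligible k c cK na1; have h := S_symbol_negligible k c cK na.
refine (S_ext (@loA _) (GK cK.2) _ (SB (@loA _) (GK cK.2) (@om1 _) h h1)) => e w _ _.
by rewrite -[(a - a2) e w]/(a e w - a2 e w) -[(a1 - a2) e w]/(a1 e w - a2 e w); ring.
Qed.

(** The definition gives [N] for a representative that depends on [K]; negligible differences
    transfer it to the given one. *)
Lemma regular_bound A0 a K : regular_symbol X m rho delta A0 -> A0 a -> compact_in K X ->
  exists N, forall k, St K k N m a.
Proof.
move=> HA Aa cK; have [_ /(_ K cK)[aK AaK [N HN]]] := HA.
exists (- N%:R) => k; have [_ /(_ K k cK)[_ H]] := regular_near HA AaK Aa.
have h : St K k (- N%:R) m aK.
  have [[a2 _ E] _] := HA; have [[sK _] _] : gclass (E := symbol_space X m rho delta) a2 aK by rewrite -E.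
  apply: (S_symbol oX cK.2); first by move=> e e01; case: (sK e e01).
  exact: bigO_expN_growth (HN k).
refine (S_ext (@loA _) (GK cK.2) _ (SD (@loA _) (GK cK.2) h (H (- N%:R)))) => e w _ _.
by rewrite addrC subrK.
Qed.

(** As <xi> >= 1, the larger exponent that belongs to rho = 1 and delta = 0 gives the larger
    weight. *)
Lemma symb_norm_le K k (a : vec -> R[i]) mu :
  (symb_norm mu rho delta K k a <= symb_norm mu 1 0 K k a)%E.
Proof.
have [/ltW rho0 rho1] := andP rho_range.
apply: ge_ereal_sup => _ [z [xi [be [al [Kz sz ->]]]]].
apply: (@le_trans _ _ (japanese xi `^ (- mu + 1 * (mlen al)%:R - 0 * (mlen be)%:R)
          * normc (mderiv (mpair be al) a (row_mx z xi)))%:E); last first.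
  by apply: ereal_sup_ubound; exists z, xi, be, al.
rewrite lee_fin ler_wpM2r ?normc_ge0// ler_powR ?japanese_ge1// mul0r subr0 mul1r.
have h1 : rho * (mlen al)%:R <= (mlen al)%:R by rewrite ler_piMl.
have h2 : 0 <= delta * (mlen be)%:R by rewrite mulr_ge0.
lra.
Qed.

Lemma symb_norm0 mu r d K k : (symb_norm mu r d K k (fun _ : vec => 0%R) <= 0)%E.
Proof.
apply: ge_ereal_sup => _ [z [xi [be [al [Kz sz ->]]]]].
have [s -> _] := mderiv_pderivs (mpair be al) (fun _ : vec => 0 : R[i]).
have -> : pderivs s (fun _ : vec => 0 : R[i]) = (fun=> 0).
  elim: s => //= i s ->; apply/funext => w; exact: cder_pderiv (cder_cst _ _ _).
by rewrite Normc.normc0 mulr0.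
Qed.

Section smoothing.
Variable A0 : set netw.
Hypothesis HA : regular_smoothing X A0.
Local Notation A1 := (smoothing_to_symbol X m rho delta A0).

Lemma smoothing_symbol_fun a e mu : A0 a -> 0 < e <= 1 -> symbol_fun Om' Om rho delta mu (a e).
Proof.
case: HA => -[a2 _ ->] _ [[sa _] _] e01.
have /(symbol_set_fun (lexx 0)) := sa e e01 mu; apply: symbol_fun_shf => //.
by case/andP: rho_range.
Qed.

Lemma smoothing_S r mu k b (a : netw) K : r = 1 -> S predT A (over K) omega (shf r 0) k b mu a ->
  St K k b mu a.
Proof.
move=> ->; have [_ rho1] := andP rho_range; apply: S_sh => [w _|i _]; first exact: omega_ge1.
by rewrite /shf; case: (fintype.split i) => _; rewrite ?lerN2.
Qed.

Lemma smoothing_diff a a' mu K k c : A0 a -> A0 a' -> compact_in K X ->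
  St K k c mu (fun e w => a e w - a' e w).
Proof.
case: HA => -[a2 _ ->] _ [ma na] [ma' na'] cK.
have h (q : netw) : negligible_net (E := smoothing_space X) q ->
    St K k c mu q.
  move=> [sq nq]; apply: (smoothing_S erefl); apply: (S_symbol oX cK.2).
    by move=> e e01; have [] := sq e e01 mu.
  by apply: negligible_growth; apply: nq; exists mu, K, k.
refine (S_ext (@loA _) (GK cK.2) _ (SB (@loA _) (GK cK.2) (@om1 _) (h _ na) (h _ na'))) => e w _ _.
by rewrite -[(a - a2) e w]/(a e w - a2 e w) -[(a' - a2) e w]/(a' e w - a2 e w); ring.
Qed.

Lemma smoothing_near a1 a : A0 a1 -> A1 a -> near_sym a1 a.
Proof.
move=> Aa1 [ma [a' Aa' na]]; apply: near_symI => // K k c cK.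
have h1 := S_symbol_negligible k c cK na.
have h2 := smoothing_diff m k c Aa' Aa1 cK.
refine (S_ext (@loA _) (GK cK.2) _ (SD (@loA _) (GK cK.2) h1 h2)) => e w _ _.
by rewrite -[(a - a') e w]/(a e w - a' e w) addrA subrK.
Qed.

Lemma smoothing_mem a1 : A0 a1 -> A1 a1.
Proof.
move=> Aa1; split.
  case: HA => -[a2 _ E] _; move: Aa1; rewrite E => -[[sa na] _]; split.
    move=> e e01; have [s1 s2] := sa e e01 m; split => // K j cK.
    exact: le_lt_trans (symb_norm_le _ _ _ _) (s2 K j cK).
  move=> _ [K [j [cK ->]]]; have [|N [C HC]] := na (symb_norm m 1 0 K j); first by exists m, K, j.
  by exists N, C; apply: filterS HC => e; apply: le_trans; exact: symb_norm_le.
have z e : (a1 - a1) e = (fun=> 0).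
  by apply/funext => w; rewrite -[LHS]/(a1 e w - a1 e w) subrr.
exists a1 => //; split.
  move=> e e01; rewrite z; split; first exact: smooth_cst.
  by move=> K j _; apply: le_lt_trans (symb_norm0 _ _ _ _ _) _; rewrite ltey.
move=> _ [K [j [cK ->]]] N; exists 0; apply: nearW => e.
by rewrite z mul0r; exact: symb_norm0.
Qed.

Lemma smoothing_bound a K : A0 a -> compact_in K X -> exists N, forall mu k, St K k N mu a.
Proof.
move=> Aa cK; have [_ /(_ K cK)[aK AaK [N HN]]] := HA.
exists (- N%:R) => mu k.
have h : St K k (- N%:R) mu aK.
  apply: (smoothing_S erefl); apply: (S_symbol oX cK.2); last exact: bigO_expN_growth (HN mu k).
  have [[a2 _ E] _] := HA; have [[sK _] _] : gclass (E := smoothing_space X) a2 aK by rewrite -E.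
  by move=> e e01; have [] := sK e e01 mu.
refine (S_ext (@loA _) (GK cK.2) _ (SD (@loA _) (GK cK.2) h (smoothing_diff mu k (- N%:R) Aa AaK cK))) => e w _ _.
by rewrite addrC subrK.
Qed.
End smoothing.
End symbols_of_operators.

(** * The operator on representatives and on classes *)

Section uniform_norm_nets.
Context {R : realType} {d : nat}.
Local Notation normc := (@Normc.normc R).
Local Notation net := (R -> 'rV[R]_d -> R[i]).
Variable Om : set 'rV[R]_d.

Lemma C0_negl_trans (v w z : net) :
  (forall e, 0 < e <= 1 -> continuous_on Om (v e)) ->
  (forall e, 0 < e <= 1 -> continuous_on Om (z e)) ->
  @negligible_net R (C0 Om) (v - w) ->
  (forall K c, compact_in K Om -> growth c (fun e => sup_norm K (fun x => w e x - z e x))) ->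
  @negligible_net R (C0 Om) (v - z).
Proof.
move=> cv cz [_ nvw] g; split; first by move=> e e01; exact: continuous_onB (cv e e01) (cz e e01).
move=> _ [K [cK ->]]; apply: growth_negligible => b.
have g1 : growth b (fun e => sup_norm K ((v - w) e)).
  by apply: negligible_growth; apply: nvw; exists K.
apply: growthD g1 (g K b cK) => e.
apply: ge_ereal_sup => _ [x Kx <-].
apply: (@le_trans _ _ ((normc ((v - w) e x))%:E + (normc (w e x - z e x))%:E)%E).
  rewrite -EFinD lee_fin; apply: le_trans (le_normcD _ _).
  by rewrite -[(v - w) e x]/(v e x - w e x) -[(v - z) e x]/(v e x - z e x) addrA subrK.
by apply: leeD; apply: ereal_sup_ubound; exists x.
Qed.
End uniform_norm_nets.

Section fourier_integral_operator.
Context {R : realType} {n' n p : nat}.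
Local Notation normc := (@Normc.normc R).
Local Notation vec := 'rV[R]_(n' + n + p).
Local Notation netw := (R -> vec -> R[i]).
Local Notation net := (R -> 'rV[R]_n -> R[i]).
Variables (Om' : set 'rV[R]_n') (Om : set 'rV[R]_n).
Hypotheses (oOm' : open Om') (oOm : open Om).
Local Notation X := (prod_set Om' Om).
Local Notation A := (@over R (n' + n) p X).
Let oX := open_prod_set oOm' oOm.
Let oA : open A := open_over oX.
Let loA J : line_open J A. Proof. exact: open_line_open. Qed.
Let om1 G (w : vec) : G w -> 1 <= omega w. Proof. by move=> _; exact: omega_ge1. Qed.
Let GK (K : set 'rV[R]_(n' + n)) : K `<=` X -> @over R (n' + n) p K `<=` A.
Proof. by move=> KX w; exact: KX. Qed.
Variables (chi : 'rV[R]_p -> R[i]) (rho delta m : R) (phi : set (R -> vec -> R)).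
Hypotheses (hchi : cutoff chi) (rho_range : 0 < rho <= 1) (delta_range : 0 <= delta < 1).
Hypothesis phi_sc : Phi_sc Om' Om phi.
Local Notation gain := (Num.min rho (1 - delta)).
Local Notation St K := (S predT A (over K) omega (shf rho delta)).
Local Notation near := (near_sym Om' Om rho delta m).

Variables (A1 : set netw) (a1 : netw) (h0 : nat) (ph0 : R -> vec -> R).
Hypotheses (A1near : forall a, A1 a -> near a1 a) (A1a1 : A1 a1) (phi_ph0 : phi ph0).
Hypothesis h0m : m - h0%:R * gain + 1 < - p%:R.
Let h0m' : m - h0%:R * gain < - p%:R. Proof. by have := h0m; lra. Qed.

Definition au (a : netw) (u : net) : netw := fun e w => a e w * u e (ypart w).

Let cst : R[i] := ((2 * pi) ^- p)%:C.

Lemma oscillatory_netE h ph a u e x : oscillatory_net Om chi h ph a u e x =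
  cst * osc_phase Om chi h (ph e) (au a u e) x.
Proof. by []. Qed.

(** The operator on nets for one fixed choice of phase, symbol and power of L; all other choices are
    compared with it. *)
Let T (u : net) := oscillatory_net Om chi h0 ph0 a1 u.

Lemma au_regular K a u e : near a1 a -> good Om K u -> 0 < e <= 1 ->
  symbol_fun Om' Om rho delta m (au a u e) /\ ysupp Om' Om K (au a u e).
Proof.
move=> [ha _] [su sK] e01; split; first exact: symbol_funM_ypart (ha e e01) (su e e01).
by move=> w [_ Ow] Kw; rewrite /au sK// mulr0.
Qed.

Lemma osc_smooth_net K u : compact_in K Om -> good Om K u ->
  smooth_net Om' (fun e => osc_phase Om chi h0 (ph0 e) (au a1 u e)).
Proof.
move=> cK gu e e01; have [h1 h2] := au_regular (A1near A1a1) gu e01.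
exact: (osc_phase_smooth oOm' oOm hchi rho_range delta_range (phi_at phi_sc phi_ph0 e01) h1 cK h2 h0m').
Qed.

Lemma T_smooth K u : compact_in K Om -> good Om K u -> smooth_net Om' (T u).
Proof.
move=> cK gu e e01; have h := smooth_linear oOm' cst (osc_smooth_net cK gu e01) (smooth_cst Om' 0).
by apply: smooth_on_ext h => // x _; rewrite addr0.
Qed.

Lemma T_linear K u v (c : R -> R[i]) : compact_in K Om -> good Om K u -> good Om K v ->
  forall e x, 0 < e <= 1 -> Om' x ->
  T (fun e x => c e * u e x + v e x) e x = c e * T u e x + T v e x.
Proof.
move=> cK gu gv e x e01 Ox; rewrite /T !oscillatory_netE.
have [h1 h2] := au_regular (A1near A1a1) gu e01; have [h3 h4] := au_regular (A1near A1a1) gv e01.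
have -> : au a1 (fun e x => c e * u e x + v e x) e = (fun w => c e * au a1 u e w + au a1 v e w).
  by apply/funext => w; rewrite /au mulrDr mulrCA.
rewrite (osc_phase_linear oOm' oOm hchi rho_range delta_range (c e) (phi_at phi_sc phi_ph0 e01)
  cK h1 h2 h3 h4 h0m' Ox).
by rewrite mulrDr mulrCA.
Qed.

Lemma SL_T K K0 k b u : compact_in K Om -> good Om K u -> compact_in K0 Om' ->
  (forall s, growth b (fun e => sup_norm K0 (pderivs s
    (osc_phase Om chi h0 (ph0 e) (au a1 u e))))) -> SL Om' K0 k b (T u).
Proof.
move=> cK gu cK0 H; have h := SL_of_sup k (osc_smooth_net cK gu) cK0.2 H.
have z : SL Om' K0 k b (fun _ _ => 0) by apply: (S0 _ cK0.2) => //; apply: open_line_open.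
apply: (SL_ext oOm' cK0.2 _ (SL_linear oOm' cst cK0.2 h z)) => e x _ _; exact: addr0.
Qed.

(** The powers [h] and [h0] of L are both raised to [h0 + h], which leaves the integrals unchanged;
    phases and symbols are then compared at this common power. *)
Lemma growth_osc_reps h ph a u u' K K' U K0 c : phi ph -> A1 a -> G Om U -> U u -> U u' ->
  compact_in K Om -> supported Om K u -> compact_in K' Om -> supported Om K' u' ->
  m - h%:R * gain + 1 < - p%:R -> compact_in K0 Om' ->
  growth c (fun e => sup_norm K0 (fun x => oscillatory_net Om chi h ph a u e x - T u' e x)).
Proof.
move=> hph Aa GU Uu Uu' cK su cK' su' hm cK0.
have gu : good Om (K `|` K') u by apply: goodU; exact: class_good GU Uu su.
have gu' : good Om (K `|` K') u' by apply: goodUr; exact: class_good GU Uu' su'.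
have cU := compact_inU cK cK'.
have mod v : U v -> forall k, exists b, SL Om (K `|` K') k b v.
  by move=> Uv k; have /(moderateP oOm)[_ /(_ _ k cU)] := class_moderate GU Uv.
have dif k t : SL Om (K `|` K') k t (fun e x => u e x - u' e x).
  by have /(negligibleP oOm)[_ /(_ _ k t cU)] := class_negl oOm GU Uu Uu'.
have [b HSP] := SP_symbols oOm' oOm delta_range (k := h0 + h) (A1near Aa) (A1near A1a1) cK0 cU gu.1 gu'.1
  (mod u Uu _) (mod u' Uu' _) (dif _).
have g0 : 0 < gain := gain_gt0 rho_range delta_range.
have hh : m - (h0 + h)%:R * gain + 1 < - p%:R.
  have : 0 <= h0%:R * gain by rewrite mulr_ge0// ltW.
  by rewrite natrD mulrDl; lra.
have H : growth c (fun e => sup_norm K0 (fun x => osc_phase Om chi (h0 + h) (ph e) (au a u e) x -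
    osc_phase Om chi (h0 + h) (ph0 e) (au a1 u' e) x)).
  exact: (growth_osc_diff oOm' oOm hchi rho_range delta_range cK0 cU
    (phi_pair oOm' oOm phi_sc hph phi_ph0 cK0 cU)
    (fun e => au_regular (A1near Aa) gu) (fun e => au_regular (A1near A1a1) gu') HSP hh).
move=> b' b'c; have [C C0 HC] := H b' b'c; exists (normc cst * C).
  by rewrite mulr_ge0// normc_ge0.
apply: filterS2 HC near0r01 => e HC e01; apply: sup_norm_le => x Kx; have Ox := cK0.2 x Kx.
rewrite /T !oscillatory_netE -mulrBr Normc.normcM -mulrA ler_wpM2l ?normc_ge0//.
have [f1 f2] := au_regular (A1near Aa) gu e01; have [f3 f4] := au_regular (A1near A1a1) gu' e01.
have hm' : m - h%:R * gain < - p%:R by lra.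
rewrite -(osc_phase_raise oOm' oOm hchi rho_range delta_range (phi_at phi_sc hph e01) f1 cU f2 h0 hm' Ox).
rewrite -(osc_phase_raise oOm' oOm hchi rho_range delta_range (phi_at phi_sc phi_ph0 e01) f3 cU f4 h h0m' Ox).
rewrite [(h + h0)%N]addnC -lee_fin; apply: le_trans HC.
by apply: ereal_sup_ubound; exists x.
Qed.

Section classes.
Variable P : pred nat.
Hypothesis T_bound : forall K0 K1, compact_in K0 Om' -> compact_in K1 Om -> exists N : R,
  forall u b, good Om K1 u -> PS Om P K1 b u -> forall k, SL Om' K0 k (b - N) (T u).

(** Both sides consist of the moderate nets that differ negligibly, in the uniform norms on compact
    sets, from T u for one compactly supported representative [u]. *)
Lemma FIO_Bc U : Dom Om P U ->
  FIO Om' Om chi m rho delta phi A1 U = G_to_C0 Om' (Bc Om' Om T U).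
Proof.
move=> DU; have [u [K [b [Uu cK gu pu BTu]]]] := Dom_T oOm' oOm T_smooth T_bound DU.
have cT e (e01 : 0 < e <= 1) : continuous_on Om' (T u e) := (T_smooth cK gu e01 [::]).1.
apply/seteqP; split=> v [mv].
  move=> [ph [a [u' [h [hph Aa [Uu' [K' cK' su']] hm nv]]]]]; split; [exact: mv|exists (T u); first exact: BTu].
  apply: (C0_negl_trans mv.1 cT nv).
  move=> K0 c cK0; exact: (growth_osc_reps hph Aa DU.1 Uu' Uu cK' su' cK gu.2 hm cK0).
move=> [w Bw nvw]; split; first exact: mv.
exists ph0, a1, u, h0; split; [exact: phi_ph0|exact: A1a1| |exact: h0m|].
  by split; [exact: Uu|exists K; [exact: cK|exact: gu.2]].
apply: (C0_negl_trans mv.1 cT nvw).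
move=> K0 c cK0; have [_ nn] := negligible_C0 oOm' (Bc_negl oOm' oOm T_smooth T_linear T_bound DU.1 Bw Uu cK gu.2).
by apply: negligible_growth; apply: nn; exists K0.
Qed.

Lemma FIO_maps_continuously D DK FK : (forall U, D U -> Dom Om P U) ->
  (forall K U, compact_in K Om -> DK K U -> Dom Om P U /\ gsupp Om U `<=` K) ->
  (forall K, compact_in K Om -> exists2 QK, FK K QK &
    forall X (eta : R), (forall z, X z -> smooth_net Om z) -> (QK X < eta%:E)%E ->
    exists z b K', [/\ X z, compact_in K' Om, supported Om K' z, PS Om P K' b z & expR (- b) < eta]) ->
  maps_continuously_into_Ginf Om' Om D
    (@inductive_limit R (Cinf Om) D _ [set K | compact_in K Om] DK FK)
    (FIO Om' Om chi m rho delta phi A1).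
Proof.
move=> DD DKD FKl; exists (Bc Om' Om T); split.
  move=> U /DD DU; split; last exact: FIO_Bc.
  exact: (Bc_Ginf oOm' oOm T_smooth T_linear T_bound DU).
exact: (Bc_continuous oOm' oOm T_smooth T_linear T_bound DD DKD FKl).
Qed.
End classes.

(** The exponent of the product a u is the sum of those of [a] and [u], and neither L nor the
    x-derivatives change it. *)
Lemma T_bound_regular K0 K1 : compact_in K0 Om' -> compact_in K1 Om ->
  (exists N, forall k, St (prod_set K0 K1) k N m a1) -> exists N : R,
  forall u b, good Om K1 u -> PS Om predT K1 b u -> forall k, SL Om' K0 k (b - N) (T u).
Proof.
move=> cK0 cK1 [N HN]; exists (- N) => u b gu pu k; rewrite opprK addrC.
have cK := compact_in_prod cK0 cK1; have [d0 _] := andP delta_range.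
apply: (SL_T k cK1 gu cK0) => s.
apply: (growth_osc oOm' oOm hchi rho_range delta_range s cK0 cK1
  (phi_pair oOm' oOm phi_sc phi_ph0 phi_ph0 cK0 cK1) (fun e => au_regular (A1near A1a1) gu) _ h0m').
move=> j; have h := SL_subset (@rsubmx_prod R n' n K0 K1) (pu j isT).
have := SM (@loA _) (GK cK.2) (@om1 _) (HN j) (S_ypart rho d0 cK.2 gu.1 h).
by rewrite addr0.
Qed.

Lemma T_bound_smoothing K0 K1 : compact_in K0 Om' -> compact_in K1 Om ->
  (forall e mu, 0 < e <= 1 -> symbol_fun Om' Om rho delta mu (a1 e)) ->
  (exists N, forall mu k, St (prod_set K0 K1) k N mu a1) -> exists N : R,
  forall u b, good Om K1 u -> PS Om (pred1 0%N) K1 b u -> forall k, SL Om' K0 k (b - N) (T u).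
Proof.
move=> cK0 cK1 sa [N HN]; exists (- N) => u b gu pu k; rewrite opprK addrC.
have cK := compact_in_prod cK0 cK1; have [_ /ltW d1] := andP delta_range.
have hp := phi_pair oOm' oOm phi_sc phi_ph0 phi_ph0 cK0 cK1.
have sau mu e : 0 < e <= 1 -> symbol_fun Om' Om rho delta mu (au a1 u e).
  by move=> e01; exact: symbol_funM_ypart (sa e mu e01) (gu.1 e e01).
have yau e : 0 < e <= 1 -> ysupp Om' Om K1 (au a1 u e).
  by move=> e01; have [] := au_regular (A1near A1a1) gu e01.
apply: (SL_T k cK1 gu cK0) => s.
(* A smoothing symbol has every order; this one leaves -p - 1 after the x-derivatives in [s],
   without any power of L. *)
pose mu : R := - p%:R - 1 - (size s)%:R.
have mu1 : mu - 0%:R * gain = mu by rewrite mul0r subr0.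
have h := SL_subset (@rsubmx_prod R n' n K0 K1) (pu 0%N erefl).
have HS : S xdir A (over (prod_set K0 K1)) omega (fun=> 1) (size s) (N + b) mu
    (fun e => osc_fun chi 0 (ph0 e) (au a1 u e)).
  have := SM (@loA _) (GK cK.2) (@om1 _) (S_xdir_cis oOm' oOm (size s) cK.2 hp)
    (SM (@loA _) (GK cK.2) (@om1 _) (S_xdir d1 (HN mu (size s))) (Sx_ypart (size s) cK.2 gu.1 h)).
  by rewrite !add0r addr0.
have mup : mu + (size s)%:R < - p%:R by rewrite /mu subrK; lra.
have reg e : 0 < e <= 1 -> [/\ continuous_on A (osc_fun chi 0 (ph0 e) (au a1 u e)),
    ysupp Om' Om K1 (osc_fun chi 0 (ph0 e) (au a1 u e)) &
    forall K0, compact_in K0 Om' -> S xdir A (over (prod_set K0 K1)) omega (fun=> 1) (size s) 0 mu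
      (fun=> osc_fun chi 0 (ph0 e) (au a1 u e))].
  move=> e01; rewrite -mu1.
  exact: (osc_fun_regular oOm' oOm hchi rho_range delta_range (phi_at phi_sc phi_ph0 e01)
    (sau mu e e01) cK1 (yau e e01) 0 (size s)).
have H := growth_pderivs_cint oOm' oOm cK0 cK1 reg HS mup (leqnn _).
apply: growth_le (lexx _) _ H; apply: filterS near0r01 => e e01.
apply: ge_ereal_sup => _ [x Kx <-]; have Ox := cK0.2 x Kx.
apply: ereal_sup_ubound; exists x => //; congr (_%:E); congr (normc _).
apply: (pderivs_ext _ oOm') => // y Oy.
(* The operator is defined with the power [h0], the estimate uses the power 0; both give the same
   integral. *)
have q : - p%:R - 1 - 0%:R * gain < - p%:R :> R by rewrite mul0r subr0; lra.
have := osc_phase_raise oOm' oOm hchi rho_range delta_range (phi_at phi_sc phi_ph0 e01)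
  (sau (- p%:R - 1) e e01) cK1 (yau e e01) h0 q Oy.
by rewrite addn0.
Qed.
End fourier_integral_operator.

Section domains.
Context {R : realType} {n : nat}.
Local Notation normc := (@Normc.normc R).
Local Notation net := (R -> 'rV[R]_n -> R[i]).
Variable Om : set 'rV[R]_n.
Hypothesis oOm : open Om.

(** Multiplication by a cutoff equal to 1 near the support keeps the class and every estimate,
    whichever orders of derivatives it concerns. *)
Lemma cutoff_rep (U : set net) K u : G Om U -> U u -> compact_in K Om -> gsupp Om U `<=` K ->
  exists v K2, [/\ U v, compact_in K2 Om, supported Om K2 v &
    forall k b, SL Om K2 k b u -> SL Om K2 k b v].
Proof.
move=> GU Uu cK sU; have [V0 [K2 [psi [oV KV hc]]]] := exists_cutoff oOm cK.
have [hpsi cK2 VK2 psi1 psi0] := hc.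
exists (fun e x => psi x * u e x), K2; split => //.
- apply: (class_mem oOm GU Uu).
  have nu := cutoff_negligible oOm GU sU oV KV hc Uu.
  apply: (negl_linear oOm (c := -1) nu (negl0 oOm)) => e x _ _.
  by rewrite -[LHS]/(psi x * u e x - u e x) -[0 e x]/0; ring.
- by move=> e x _ _ Kx; rewrite psi0// mul0r.
- by move=> k b; apply: SLM_CB => //; exact: cK2.2.
Qed.

Lemma Dom_Ginf (U : set net) K : Ginf Om U -> compact_in K Om -> gsupp Om U `<=` K ->
  Dom Om predT U.
Proof.
move=> [GU [u Uu Hu]] cK sU; split => //.
have [v [K2 [Uv cK2 sv Hv]]] := cutoff_rep GU Uu cK sU.
exists v, K2; split => //; have [N HN] := Hu K2 cK2; exists (- N%:R) => k _; apply: Hv.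
have /(moderateP oOm)[su _] := class_moderate GU Uu.
apply: SL_of_mderiv => //; first exact: cK2.2.
by move=> al; exact: bigO_expN_growth.
Qed.

Lemma Dom_G (U : set net) K : G Om U -> compact_in K Om -> gsupp Om U `<=` K ->
  Dom Om (pred1 0%N) U.
Proof.
move=> GU cK sU; split => //; have [u0 mu0 E] := GU.
have Uu : U u0.
  rewrite E; split => //; apply: (negl_ext oOm (negl0 oOm)) => e x _ _.
  by rewrite -[LHS]/(u0 e x - u0 e x) subrr.
have [v [K2 [Uv cK2 sv Hv]]] := cutoff_rep GU Uu cK sU.
exists v, K2; split => //; have /(moderateP oOm)[_ /(_ K2 0%N cK2)[b Hb]] := mu0.
by exists b => k /eqP ->; exact: Hv.
Qed.

Lemma Gc_compact (U : set net) : Gc Om U -> compact_in (gsupp Om U) Om.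
Proof. by move=> [_ cU]; split => // x []. Qed.

Lemma valuation_lt (X : set net) Pr (eta : R) :
  (exp_neg (@valuation R (Cinf Om) X Pr) < eta%:E)%E ->
  exists z b, [/\ X z, Pr b z & expR (- b) < eta].
Proof.
move=> /exp_neg_lt[b [/ereal_sup_gt[_ [b' [z Xz Pz] <-]]]]; rewrite lte_fin => bb eb.
exists z, b'; split => //; apply: lt_trans eb; by rewrite ltr_expR ltrN2.
Qed.
End domains.

Theorem theorem3p10 (R : realType) (n' n p : nat)
    (Om' : set 'rV[R]_n') (Om : set 'rV[R]_n) (m rho delta : R)
    (chi : 'rV[R]_p -> R[i]) (phi : set (R -> 'rV[R]_(n' + n + p) -> R))
    (open_Om' : open Om') (open_Om : open Om)
    (rho_range : 0 < rho <= 1) (delta_range : 0 <= delta < 1)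
    (chi_cutoff : cutoff chi) (phi_sc : Phi_sc Om' Om phi) :
  (forall A : set (R -> 'rV[R]_(n' + n + p) -> R[i]),
     regular_symbol (prod_set Om' Om) m rho delta A ->
     maps_continuously_into_Ginf Om' Om (Gcinf Om) (Gcinf_top Om)
       (FIO Om' Om chi m rho delta phi A)) /\
  (forall A : set (R -> 'rV[R]_(n' + n + p) -> R[i]),
     regular_smoothing (prod_set Om' Om) A ->
     maps_continuously_into_Ginf Om' Om (Gc Om) (Gc_top Om)
       (FIO Om' Om chi m rho delta phi
          (smoothing_to_symbol (prod_set Om' Om) m rho delta A))).
Proof.
have [ph0 phi_ph0 _] := phi_sc.2.
have g0 := gain_gt0 rho_range delta_range.
(* Any integer above (m + 1 + p) divided by the positive gain will do. *)
have [h0 h0m] : exists h : nat, m - h%:R * Num.min rho (1 - delta) + 1 < - p%:R.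
  exists (Num.truncn ((m + 1 + p%:R) / Num.min rho (1 - delta))).+1.
  have := truncnS_gt ((m + 1 + p%:R) / Num.min rho (1 - delta)).
  by rewrite ltr_pdivrMr//; lra.
split=> A HA.
  (* Regularity over the empty compact set serves to produce a representative. *)
  have [a1 Aa1] : exists a1, A a1.
    have c0 : compact_in set0 (prod_set Om' Om) by split; [exact: compact0|exact: sub0set].
    by have [_ /(_ set0 c0)[a1 ? _]] := HA; exists a1.
  apply: (FIO_maps_continuously open_Om' open_Om chi_cutoff rho_range delta_range phi_sc
    (fun a => regular_near open_Om' open_Om delta_range HA Aa1) Aa1 phi_ph0 h0m (P := predT)).
  - move=> K0 K1 cK0 cK1.
    apply: (T_bound_regular open_Om' open_Om chi_cutoff rho_range delta_range phi_sc
      (fun a => regular_near open_Om' open_Om delta_range HA Aa1) Aa1 phi_ph0 h0m cK0 cK1).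
    exact: (regular_bound open_Om' open_Om delta_range HA Aa1 (compact_in_prod cK0 cK1)).
  - by move=> U [GU /Gc_compact cU]; exact: (Dom_Ginf open_Om GU cU).
  - by move=> K U cK [GU sU]; split => //; exact: (Dom_Ginf open_Om GU cK sU).
  (* This norm controls all derivatives with one exponent, as [predT] demands. *)
  - move=> K cK; exists (GKinf_norm Om K) => // X eta sX /valuation_lt[z [b [Xz [K' [cK' _ sz Hz]] eb]]].
    exists z, b, K'; split => // k _.
    by apply: SL_of_Ck => //; [exact: sX|exact: cK'.2|exact: bigO_powR_growth].
have [a1 Aa1] : exists a1, A a1.
  have c0 : compact_in set0 (prod_set Om' Om) by split; [exact: compact0|exact: sub0set].
  by have [_ /(_ set0 c0)[a1 ? _]] := HA; exists a1.
have near1 a (Aa : smoothing_to_symbol (prod_set Om' Om) m rho delta A a) :=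
  smoothing_near open_Om' open_Om rho_range delta_range HA Aa1 Aa.
have mem1 := smoothing_mem m rho_range delta_range HA Aa1.
apply: (FIO_maps_continuously open_Om' open_Om chi_cutoff rho_range delta_range phi_sc
  near1 mem1 phi_ph0 h0m (P := pred1 0%N)).
- move=> K0 K1 cK0 cK1.
  apply: (T_bound_smoothing open_Om' open_Om chi_cutoff rho_range delta_range phi_sc
    near1 mem1 phi_ph0 h0m cK0 cK1).
    move=> e mu e01; exact: (smoothing_symbol_fun open_Om' open_Om rho_range delta_range HA mu Aa1 e01).
  exact: (smoothing_bound open_Om' open_Om rho_range delta_range HA Aa1 (compact_in_prod cK0 cK1)).
- by move=> U GU; exact: (Dom_G open_Om GU.1 (Gc_compact GU)).
- by move=> K U cK [GU sU]; split => //; exact: (Dom_G open_Om GU.1 cK sU).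
(* A smoothing operator depends only on the values of [u], so the seminorm with n = 0 suffices. *)
- move=> K cK; exists (GK_seminorm Om K 0) => [|X eta sX]; first by exists 0%N.
  move=> /valuation_lt[z [b [Xz [K' [cK' _ sz Hz]] eb]]].
  exists z, b, K'; split => // k /eqP ->.
  by apply: SL_of_Ck => //; [exact: sX|exact: cK'.2|exact: bigO_powR_growth].
Qed.
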